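(* Let $\mathcal K$ be a compact subset of $\{(\beta,h):\beta>0,\ h>0,\ \alpha(\beta,h)<1\}$. For every fixed $(\beta,h)\in\mathcal K$, with respect to $\nu_1$, $$\sqrt N\,(R_{12}-q)\xrightarrow[N\to\infty]{\mathrm d}\mathcal N(0,\sigma^2),$$ where $$\sigma^2=\frac{3(1-2q+r)}{1-\alpha}-\frac{2\kappa}{1-\beta^2\kappa}-\frac{\zeta}{(1-\beta^2\kappa)^2}>0,\qquad \kappa=1-4q+3r,\quad \zeta=2q+q^2-3r.$$
   Context: Let $Z\sim N(0,1)$. For $\beta>0$, $h>0$, let $q=q(\beta,h)$ be the unique solution in $[0,1]$ of $q=\mathbb E\tanh^2(h+\beta\sqrt q\,Z)$. Set $r=\mathbb E\tanh^4(h+\beta\sqrt q\,Z)$ and $\alpha=\alpha(\beta,h)=\beta^2(1-2q+r)=\beta^2\,\mathbb E\,\mathrm{sech}^4(h+\beta\sqrt q\,Z)$. For $N\in\mathbb N$ let $\Sigma_N=\{-1,1\}^N$, let $(g_{ij})_{1\le i,j\le N}$ be independent standard Gaussian random variables, and $$H_N(\sigma)=\frac{\beta}{\sqrt{2N}}\sum_{i,j=1}^N g_{ij}\sigma_i\sigma_j+h\sum_{i=1}^N\sigma_i .$$ Let $\langle\cdot\rangle_1$ denote the Gibbs expectation with weights proportional to $e^{H_N(\sigma)}$, applied to i.i.d. replicas $\sigma^1,\sigma^2,\dots$ for fixed disorder, and $\nu_1[f]=\mathbb E\langle f\rangle_1$ the disorder-averaged Gibbs expectation. The overlap is $R_{12}=\frac1N\sum_{i=1}^N\sigma_i^1\sigma_i^2$.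 Convergence in distribution ''with respect to $\nu_1$'' means weak convergence of the law of $\sqrt N(R_{12}-q)$ under the averaged measure $\nu_1$ (which depends on $N$). *)

(* Defs.v *)
From HB Require Import structures.
From mathcomp Require Export all_boot all_order all_algebra.
From mathcomp Require Export all_classical all_reals all_analysis.
Export numFieldNormedType.Exports.

Set Implicit Arguments.
Unset Strict Implicit.
Unset Printing Implicit Defensive.

Import Order.TTheory GRing.Theory Num.Theory.

Local Open Scope classical_set_scope.
Local Open Scope ring_scope.

Definition tanh (R : realType) (x : R) : R :=
  (expR x - expR (- x)) / (expR x + expR (- x)).

Definition gauss_mean (R : realType) (f : R -> R) : R :=
  \int[normal_prob (0 : R) 1]_z f z.

Definition is_q (R : realType) (beta h x : R) : Prop :=
  0 <= x <= 1 /\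
  x = gauss_mean (fun z => tanh (h + beta * Num.sqrt x * z) ^+ 2).

(* For beta, h > 0 exactly one x satisfies [is_q beta h x], and [q beta h] is
   that x.  The default value 0 only concerns parameters with no solution. *)
Definition q (R : realType) (beta h : R) : R :=
  xget 0 [set x | is_q beta h x].

Definition r (R : realType) (beta h : R) : R :=
  gauss_mean (fun z => tanh (h + beta * Num.sqrt (q beta h) * z) ^+ 4).

Definition alpha (R : realType) (beta h : R) : R :=
  beta ^+ 2 * (1 - 2 * q beta h + r beta h).

Definition kappa (R : realType) (beta h : R) : R :=
  1 - 4 * q beta h + 3 * r beta h.

Definition zeta (R : realType) (beta h : R) : R :=
  2 * q beta h + q beta h ^+ 2 - 3 * r beta h.

Definition sigma2 (R : realType) (beta h : R) : R :=
  3 * (1 - 2 * q beta h + r beta h) / (1 - alpha beta h)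
  - 2 * kappa beta h / (1 - beta ^+ 2 * kappa beta h)
  - zeta beta h / (1 - beta ^+ 2 * kappa beta h) ^+ 2.

(* The two laws are compared on Borel sets only: on other sets the values of a
   measure of the library are junk. *)
Definition standard_normal (d : measure_display) (T : measurableType d)
    (R : realType) (P : probability T R) (X : {RV P >-> R}) : Prop :=
  forall B : set R, measurable B -> distribution P X B = normal_prob 0 1 B.

Definition mutually_independent (d : measure_display) (T : measurableType d)
    (R : realType) (P : probability T R) (I : finType)
    (X : I -> {RV P >-> R}) : Prop :=
  forall (J : {set I}) (B : I -> set R), (forall i, measurable (B i)) ->
    P (\bigcap_(i in [set i | i \in J]) (X i @^-1` B i)) =
    (\prod_(i in J) P (X i @^-1` B i))%E.

Definition iid_standard_normal (d : measure_display) (T : measurableType d)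
    (R : realType) (P : probability T R) (I : finType)
    (X : I -> {RV P >-> R}) : Prop :=
  (forall i, standard_normal (X i)) /\ mutually_independent X.

(* The cube {-1,1}^N is encoded by boolean vectors, read through [spin]. *)
Definition config (N : nat) := {ffun 'I_N -> bool}.

Definition spin (R : realType) (N : nat) (s : config N) (i : 'I_N) : R :=
  if s i then 1 else -1.
Arguments spin R {N} s i.

Definition overlap (R : realType) (N : nat) (s t : config N) : R :=
  N%:R^-1 * \sum_(i < N) spin R s i * spin R t i.
Arguments overlap R {N} s t.

Definition hamiltonian (R : realType) (beta h : R) (N : nat)
    (g : 'I_N * 'I_N -> R) (s : config N) : R :=
  beta / Num.sqrt (2 * N%:R) *
    (\sum_(i < N) \sum_(j < N) g (i, j) * spin R s i * spin R s j)
  + h * \sum_(i < N) spin R s i.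

Definition gibbs_weight (R : realType) (beta h : R) (N : nat)
    (g : 'I_N * 'I_N -> R) (s : config N) : R :=
  expR (hamiltonian beta h g s) /
  \sum_(t : config N) expR (hamiltonian beta h g t).

Definition gibbs_mean (R : realType) (beta h : R) (N : nat)
    (g : 'I_N * 'I_N -> R) (n : nat)
    (f : {ffun 'I_n -> config N} -> R) : R :=
  \sum_(s : {ffun 'I_n -> config N})
    (\prod_(l < n) gibbs_weight beta h g (s l)) * f s.

Definition nu1 (R : realType) (beta h : R) (N : nat)
    (d : measure_display) (T : measurableType d) (P : probability T R)
    (g : 'I_N * 'I_N -> {RV P >-> R}) (n : nat)
    (f : {ffun 'I_n -> config N} -> R) : R :=
  \int[P]_w gibbs_mean beta h (fun ij => g ij w) f.

Definition R12 (R : realType) (N : nat) (s : {ffun 'I_2 -> config N}) : R :=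
  overlap R (s ord0) (s ord_max).
Arguments R12 R {N} s.

(* Weak convergence to [mu] of the law of [X N] under the averaged Gibbs
   measure of size N, the disorder living on a space depending on N: an
   expectation against that law is an instance of [nu1]. *)
Definition nu1_cvg_in_law (R : realType) (beta h : R)
    (d : nat -> measure_display) (T : forall N, measurableType (d N))
    (P : forall N, probability (T N) R)
    (g : forall N, 'I_N * 'I_N -> {RV (P N) >-> R}) (n : nat)
    (X : forall N, {ffun 'I_n -> config N} -> R)
    (mu : probability (measurableTypeR R) R) : Prop :=
  forall f : R -> R, continuous f -> bounded_fun f ->
    nu1 beta h (g N) (fun s => f (X N s)) @[N --> \oo] --> \int[mu]_x f x.

(* Main.v *)
(** Guerra's and Talagrand's interpolations bound the free energy of two replicas
    with prescribed overlap [u] by a replica symmetric functional with a Lagrange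
    multiplier when [|u| <= q], and by one step of replica symmetry breaking when
    [|u| > q]; when [alpha < 1] both bounds lie below twice the free energy by a
    multiple of [(u - q)^2].  With Gaussian concentration of the free energy, the
    overlap concentrates at [q].  Decoupling one site then closes a linear system
    for the moments of [R12 - q], [R13 - q], [R34 - q] tested against functions of
    [R12]: at order [1 / N], [Y = sqrt N (R12 - q)] satisfies Stein's identity
    [E (Y f Y) = sigma2 E (f' Y)].  The heat flow [s |-> E g (sin s Y + cos s sigma Z)]
    turns it into convergence in law. *)
Require Import Defs.
From mathcomp Require Import measurable_realfun ring lra.

Set Implicit Arguments.
Unset Strict Implicit.
Unset Printing Implicit Defensive.

Import Order.TTheory GRing.Theory Num.Theory.

Local Open Scope classical_set_scope.
Local Open Scope ring_scope.

Local Notation gm := gauss_mean.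
Local Notation sqr := Num.sqrt.
Local Notation cont_meas := continuous_measurable_fun.
Local Notation mfun := (measurable_fun setT).
Ltac eqgm := congr gauss_mean; apply/funext.
Ltac eqgn := apply: (congr1 (@gauss_mean _)); apply/funext.
Ltac cvg_scale := apply: cvgM; [exact: cvg_cst|exact: cvg_id].

(** The condition [alpha < 1] is local: it bounds the mean of [sech ^ 4], which governs the coupled
    free energy near [u = q]. Two facts make it global. For [|u| <= q], the correlation of two
    fields of fixed variance grows at most at rate [alpha]. For [|u| > q], the one-step functional
    at inner variance [y] has a slope to be compared with its value at [y = 0]: it decreases when
    [h <= beta ^+ 2 * q], and for larger [h] a cruder bound suffices. These bounds are relative to
    the replica symmetric value, not to the free energy, whose limit is not known beforehand. The
    difference of the two vanishes for independent sites, and its derivative along the path is a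
    multiple of the second moment of [R12 - q], which the bounds control by the difference itself:
    Gronwall's inequality closes the loop. All disorder lives in one space of environments, where
    each Gaussian coordinate has its value and its standard deviation as variables. A derivative in
    a standard deviation is a second derivative in the value, so every interpolation is the same
    chain rule. *)

Lemma le_of_eq (R : realType) (x y : R) : x = y -> x <= y.
by move=> ->.
Qed.

(** * Calculus under the standard Gaussian measure *)

Section Gauss1.
Context {R : realType}.
Notation gamma := (@normal_prob R 0 1).
Notation mu := (@lebesgue_measure R).

(** The Radon-Nikodym derivative and the explicit density have the same integral over every
    measurable set, hence agree almost everywhere. *)
Lemma ge0_integral_normal (m s : R) (f : R -> R) : (forall x, 0 <= f x) ->
 mfun f ->
 (\int[normal_prob m s]_x (f x)%:E = \int[mu]_x (f x * normal_pdf m s x)%:E)%E.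
move=> f0 mf.
have dom : (normal_prob m s) `<< mu by exact: normal_prob_dominates.
have f0' x : (0 <= (EFin \o f) x)%E by rewrite lee_fin.
have mf' : mfun (EFin \o f) by exact/measurable_EFinP.
rewrite -(Radon_Nikodym_SigmaFinite.change_of_variables dom f0' measurableT mf').
under [in RHS]eq_integral do rewrite EFinM.
have mn : mfun (EFin \o normal_pdf m s).
 by apply/measurable_EFinP; exact: measurable_normal_pdf.
have iR := Radon_Nikodym_SigmaFinite.f_integrable dom.
apply: ae_eq_integral => //.
- by apply: emeasurable_funM => //; exact: measurable_int iR.
- exact: emeasurable_funM.
- apply: ae_eqe_mul2l.
 apply: integral_ae_eq => //.
 by move=> A _ mA; rewrite -Radon_Nikodym_SigmaFinite.f_integral.
Qed.

Lemma ge0_integral_gauss (f : R -> R) : (forall x, 0 <= f x) -> mfun f ->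
 (\int[gamma]_x (f x)%:E = \int[mu]_x (f x * normal_pdf 0 1 x)%:E)%E.
exact: ge0_integral_normal. Qed.
Lemma integral_gauss (g : R -> R) : mfun g ->
 (\int[gamma]_x (g x)%:E = \int[mu]_x (g x * normal_pdf 0 1 x)%:E)%E.
move=> mg; rewrite integralE [RHS]integralE.
have n0 x : 0 <= normal_pdf (0:R) 1 x by exact: normal_pdf_ge0.
have mp : mfun (fun x => Num.max (g x) 0).
 exact: measurable_maxr.
have mn : mfun (fun x => Num.max (- g x) 0).
 by apply: measurable_maxr => //; exact: measurableT_comp.
congr (_ - _)%E.
- transitivity (\int[gamma]_x (Num.max (g x) 0)%:E)%E.
 by apply: eq_integral => x _; rewrite funeposE EFin_max.
 rewrite ge0_integral_gauss//; last by move=> x; rewrite le_max lexx orbT.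
 apply: eq_integral => x _; rewrite funeposE -EFin_max; congr EFin.
 by rewrite maxr_pMl// mul0r.
- transitivity (\int[gamma]_x (Num.max (- g x) 0)%:E)%E.
 by apply: eq_integral => x _; rewrite funenegE EFin_max.
 rewrite ge0_integral_gauss//; last by move=> x; rewrite le_max lexx orbT.
 apply: eq_integral => x _; rewrite funenegE -EFinN -EFin_max; congr EFin.
 by rewrite maxr_pMl// mul0r mulNr.
Qed.

(** A class closed under sums and products and integrable against the Gaussian measure. One constant
    serves as factor and as rate, which keeps the witnesses short. *)
Definition egrowth (f : R -> R) :=
 exists C, 0 <= C /\ forall x, `|f x| <= C * expR (C * `|x|).

Lemma egrowth_le f g : (forall x, `|f x| <= `|g x|) -> egrowth g -> egrowth f.
by move=> fg [C [C0 h]]; exists C; split=> // x; exact: le_trans (fg x) (h x).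
Qed.
Lemma egrowthD f g : egrowth f -> egrowth g -> egrowth (fun x => f x + g x).
move=> [C [C0 hC]] [D [D0 hD]]; exists (C + D); split=> [|x]; first exact: addr_ge0.
rewrite (le_trans (ler_normD _ _))// mulrDl lerD//.
 rewrite (le_trans (hC x))// ler_wpM2l// ler_expR ler_wpM2r//; lra.
rewrite (le_trans (hD x))// ler_wpM2l// ler_expR ler_wpM2r//; lra.
Qed.

Lemma egrowthM f g : egrowth f -> egrowth g -> egrowth (fun x => f x * g x).
move=> [C [C0 hC]] [D [D0 hD]]; exists (C + D + C * D); split=> [|x].
 by rewrite !addr_ge0// mulr_ge0.
rewrite normrM (le_trans (ler_pM _ _ (hC x) (hD x)))// mulrACA -expRD -mulrDl.
apply: ler_pM; rewrite ?expR_ge0 ?mulr_ge0//; first nra.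
by rewrite ler_expR ler_wpM2r//; nra.
Qed.

Lemma egrowth_cst c : egrowth (fun=> c).
exists `|c|; split=> // x; rewrite ler_peMr//.
by rewrite -[leLHS]expR0 ler_expR mulr_ge0.
Qed.
Lemma egrowth_id : egrowth (fun x => x).
exists 1; split=> // x; rewrite !mul1r.
by have := expR_ge1Dx `|x|; lra.
Qed.
Lemma egrowth_integrable (f : R -> R) : mfun f -> egrowth f ->
 gamma.-integrable setT (EFin \o f).
move=> mf [C [C0 Cf]]; apply/integrableP; split; first exact/measurable_EFinP.
(* From [C * |x| <= C ^+ 2 + x ^+ 2 / 4], the integrand lies below a multiple of the normal density
   of variance 2. *)
pose K : R := C * normal_peak 1 * expR (C ^+ 2) / normal_peak (sqr 2 : R).
have s2 : (sqr 2 : R) != 0 by rewrite gt_eqF// sqrtr_gt0.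
rewrite (ge0_integral_gauss (f := fun x => `|f x|))//; last first.
 exact: measurableT_comp.
apply: (@le_lt_trans _ _ (\int[mu]_x (K * normal_pdf 0 (sqr 2) x)%:E)%E).
 apply: ge0_le_integral => //.
 - by move=> x _; rewrite lee_fin mulr_ge0// normal_pdf_ge0.
 - apply/measurable_EFinP/measurable_funM; first exact: measurableT_comp.
 exact: measurable_normal_pdf.
 - by apply/measurable_EFinP/measurable_funM => //; exact: measurable_normal_pdf.
 - move=> x _ /=; rewrite lee_fin.
 rewrite normal_pdfE ?oner_neq0// normal_pdfE//.
 have k2 : normal_peak (sqr 2 : R) != 0 by rewrite gt_eqF// normal_peak_gt0.
 rewrite [leRHS](_ : _ = normal_peak 1 *
 (C * (expR (C ^+ 2) * normal_fun 0 (sqr 2) x))); last by rewrite /K; field.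
 rewrite mulrCA ler_wpM2l ?normal_peak_ge0//.
 apply: (@le_trans _ _ (C * expR (C * `|x|) * normal_fun 0 1 x)).
 apply: ler_wpM2r; first exact: normal_fun_ge0.
 exact: Cf.
 rewrite -mulrA ler_wpM2l// /normal_fun -!expRD ler_expR subr0 sqr_sqrtr// expr1n.
 have := sqr_ge0 (C - `|x|/2); rewrite -(real_normK (num_real x)); lra.
under eq_integral do rewrite EFinM.
rewrite integralZl//; last exact: integrable_normal_pdf.
by rewrite integral_normal_pdf mule1 ltry.
Qed.

Lemma egrowth_pdf_integrable (f : R -> R) : mfun f -> egrowth f ->
 mu.-integrable setT (fun x => (f x * normal_pdf 0 1 x)%:E).
move=> mf ef; apply/integrableP; split.
 by apply/measurable_EFinP/measurable_funM => //; exact: measurable_normal_pdf.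
have /integrableP[_] := egrowth_integrable mf ef.
rewrite (integral_gauss (g := fun x => `|f x|)); last exact: measurableT_comp.
congr (_ < _)%E; apply: eq_integral => x _ /=.
by rewrite normrM (ger0_norm (normal_pdf_ge0 _ _ _)).
Qed.

Lemma gm_fine (f : R -> R) : mfun f ->
 gm f = fine (\int[mu]_x (f x * normal_pdf 0 1 x)%:E)%E.
by move=> mf; rewrite /gm /Rintegral integral_gauss. Qed.
Lemma is_derive_mul_pdf (f f' : R -> R) (x : R) : is_derive x 1 f (f' x) ->
 is_derive x 1 (fun x => f x * normal_pdf 0 1 x)
 ((f' x - x * f x) * normal_pdf 0 1 x).
move=> df.
have -> : normal_pdf (0:R) 1 = fun x => normal_peak 1 * expR (- (x * x) / 2).
 apply/funext => y; rewrite normal_pdfE ?oner_neq0// /normal_fun subr0 expr2.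
 by rewrite expr1n.
apply: is_derive_eq.
by rewrite -![_ *: _]/(_ * _); field.
Qed.

Lemma derive_cont (f f' : R -> R) :
 (forall x : R, is_derive x 1 f (f' x)) -> continuous f.
by move=> df x; apply/differentiable_continuous/derivable1_diffP; by case: (df x).
Qed.
(** [f' x - x * f x] times the density is the derivative of [f] times the density; over
    [[- n.+1, n.+1]] it integrates to boundary terms, which vanish as [n] grows. *)
Lemma gm_ibp (f f' : R -> R) : (forall x : R, is_derive x 1 f (f' x)) ->
 continuous f' -> egrowth f -> egrowth f' ->
 gm (fun x => x * f x) = gm f'.
move=> df cf' ef ef'.
have cf := derive_cont df.
have dphi (x : R) := is_derive_mul_pdf (df x).
have cfphi := derive_cont dphi.
pose g x := f' x - x * f x.
pose phi := normal_pdf (0:R) 1.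
have cphi : continuous phi by exact: continuous_normal_pdf (oner_neq0 _).
have cg : continuous g.
 by move=> x; apply: cvgB; [exact: cf'|apply: cvgM; [exact: cvg_id|exact: cf]].
have mg : mfun g by exact: cont_meas.
have eg : egrowth g.
 apply: egrowthD => //.
 apply: (egrowth_le (g := fun x => x * f x)) => [x|]; first by rewrite normrN.
 by apply: egrowthM => //; exact: egrowth_id.
have ig : mu.-integrable setT (EFin \o (fun x => g x * phi x)).
 exact: egrowth_pdf_integrable.
suff : (\int[mu]_x (g x * phi x)%:E)%E = 0%E.
 move=> g0.
 have : gm g = 0 by rewrite gm_fine// g0.
 rewrite /gm RintegralB//.
 - by move/eqP; rewrite subr_eq0 => /eqP ->.
 - by apply: egrowth_integrable => //; exact: cont_meas.
 - apply: egrowth_integrable; last by apply: egrowthM => //; exact: egrowth_id.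
 by apply: cont_meas => x; apply: cvgM; [exact: cvg_id|exact: cf].
pose F n : R -> R := (fun x => g x * phi x) \_ `[- n.+1%:R, n.+1%:R].
have FE n : (\int[mu]_x (F n x)%:E)%E =
 (\int[mu]_(x in `[(- n.+1%:R)%R, n.+1%:R]) (g x * phi x)%:E)%E.
 rewrite [RHS]integral_mkcond; apply: eq_integral => x _.
 by rewrite /F !patchE; case: ifP.
have cF : (\int[mu]_x (F n x)%:E)%E @[n --> \oo] --> (\int[mu]_x (g x * phi x)%:E)%E.
 apply: (@dominated_cvg _ _ _ mu setT measurableT (fun n x => (F n x)%:E)
 _ (fun x => `|(g x * phi x)%:E|)%E) => //.
 - move=> n; apply/measurable_EFinP.
 apply/(measurable_restrictT _ _).1 => //; apply: measurable_funTS.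
 by apply: measurable_funM => //; exact: measurable_normal_pdf.
 - move=> x _; apply: cvg_near_cst; near=> n.
 rewrite /F patchE mem_set ?mulr1//= in_itv/= -ler_norml.
 rewrite (@le_trans _ _ n%:R) ?ler_nat//.
 near: n; exact: nbhs_infty_ger.
 - exact: integrable_abse.
 - move=> n x _; rewrite lee_fin /F patchE; case: ifP => // _.
 by rewrite normr0.
suff c0 : (\int[mu]_x (F n x)%:E)%E @[n --> \oo] --> 0%E.
 by apply: cvg_unique cF c0; exact: ereal_hausdorff.
have [C [C0 hC]] := ef.
(* At a boundary point of modulus [N], [C * N - N ^+ 2 / 2 <= C ^+ 2 - N ^+ 2 / 4]; then
   [1 + N ^+ 2 / 4 >= N] turns the remaining exponential into the rate [1 / N]. *)
pose K : R := C * normal_peak 1 * expR (C ^+ 2).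
have fphi (x : R) n : `|x| = n.+1%:R -> `|f x * phi x| <= K * harmonic n.
 move=> xn; rewrite normrM (ger0_norm (normal_pdf_ge0 _ _ _)).
 rewrite /phi normal_pdfE ?oner_neq0//.
 apply: (@le_trans _ _ (C * expR (C * `|x|) * (normal_peak 1 * normal_fun 0 1 x))).
 by rewrite ler_wpM2r ?mulr_ge0 ?normal_peak_ge0 ?normal_fun_ge0.
 rewrite mulrACA -[K * _]mulrA ler_wpM2l ?mulr_ge0 ?normal_peak_ge0//.
 rewrite /normal_fun -expRD subr0 expr1n -(real_normK (num_real x)) xn.
 set N : R := n.+1%:R.
 have N1 : 1 <= N by rewrite ler1n.
 apply: (@le_trans _ _ (expR (C ^+ 2) * expR (- (N ^+ 2 / 4)))).
 rewrite -expRD ler_expR; have := sqr_ge0 (C - N / 2); lra.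
 rewrite ler_wpM2l ?expR_ge0// expRN lef_pV2 ?posrE ?expR_gt0//.
 have := expR_ge1Dx (N ^+ 2 / 4); have := sqr_ge0 (N / 2 - 1).
 rewrite -/N; nra.
apply/fine_cvgP.
have FTC n : (\int[mu]_x (F n x)%:E)%E =
 (f n.+1%:R * phi n.+1%:R - f (- n.+1%:R) * phi (- n.+1%:R))%:E.
 rewrite FE EFinB.
 apply: (continuous_FTC2 (F := fun x => f x * phi x)).
 - have : (0:R) < n.+1%:R by rewrite ltr0n.
 lra.
 - apply: continuous_subspaceT => x; apply: cvgM; [exact: cg|exact: cphi].
 - split=> [x _||]; first by case: (dphi x).
 by apply: cvg_at_right_filter; exact: cfphi.
 by apply: cvg_at_left_filter; exact: cfphi.
 - by move=> x _; rewrite derive1E; by case: (dphi x).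
split; first by apply: nearW => n; rewrite FTC.
rewrite (_ : _ \o _ = fun n => f n.+1%:R * phi n.+1%:R - f (- n.+1%:R) * phi (- n.+1%:R)); last first.
 by apply/funext => n; rewrite /= FTC.
apply: norm_cvg0.
apply: (@squeeze_cvgr _ _ _ _ (cst 0) (fun n => (K + K) * harmonic n)).
- apply: nearW => n; rewrite normr_ge0/= mulrDl (le_trans (ler_normB _ _))// lerD//; apply: fphi.
 by rewrite ger0_norm.
 by rewrite normrN ger0_norm.
- exact: cvg_cst.
- rewrite -(mulr0 (K + K)); apply: cvgM; [exact: cvg_cst|exact: cvg_harmonic].
Unshelve. all: end_near.
Qed.

Lemma gm_cst (c : R) : gm (fun=> c) = c.

rewrite /gm Rintegral_cst//.
by rewrite [X in fine X](probability_setT (normal_prob (0:R) 1)) mulr1.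
 Qed.

Lemma gmD (f g : R -> R) : mfun f -> mfun g ->
 egrowth f -> egrowth g ->
 gm (fun x => f x + g x) = gm f + gm g.
by move=> mf mg ef eg; rewrite /gm RintegralD//; exact: egrowth_integrable. Qed.
Lemma gmZ (f : R -> R) c : mfun f -> egrowth f ->
 gm (fun x => c * f x) = c * gm f.
by move=> mf ef; rewrite /gm RintegralZl//; exact: egrowth_integrable. Qed.
Lemma ler_gauss_mean (f g : R -> R) : mfun f -> mfun g ->
 egrowth f -> egrowth g -> (forall x, f x <= g x) -> gm f <= gm g.
by move=> mf mg ef eg fg; apply: le_Rintegral => //; exact: egrowth_integrable.
Qed.
Lemma gm_derive (f f' : R -> R -> R) (G : R -> R) (a e : R) : 0 < e ->
 (forall x, `|x - a| < e -> mfun (f x) /\ egrowth (f x)) ->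
 (forall x y : R, `|x - a| < e -> is_derive x 1 (f ^~ y) (f' x y)) ->
 mfun G -> egrowth G ->
 (forall x y, `|x - a| < e -> `|f' x y| <= G y) ->
 is_derive a 1 (fun x => gm (f x)) (gm (f' a)).
move=> e0 hf df mG eG hG.
have near_a x : `]a - e, a + e[%classic x -> `|x - a| < e.
 by rewrite /= in_itv/= => /andP[? ?]; rewrite ltr_distl; apply/andP.
have Ia : `]a - e, a + e[%classic a by rewrite /= in_itv/=; lra.
have d1 x y : `]a - e, a + e[%classic x -> partial1of2 f x y = f' x y.
 by move=> /near_a xa; rewrite partial1of2E; by case: (df x y xa).
have H1 x : `]a - e, a + e[%classic x -> gamma.-integrable setT (EFin \o f x).
 by move=> /near_a xa; have [? ?] := hf _ xa; exact: egrowth_integrable.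
have H2 (x y : R) : `]a - e, a + e[%classic x -> setT y -> derivable (f ^~ y) x 1.
 by move=> /near_a xa _; by case: (df x y xa).
have H3 y : 0 <= G y by apply: le_trans (hG a y _); rewrite ?subrr ?normr0.
have H4 := egrowth_integrable mG eG.
have H5 x y : `]a - e, a + e[%classic x -> setT y -> `|partial1of2 f x y| <= G y.
 by move=> xa _; rewrite d1//; apply: hG; exact: near_a.
apply: DeriveDef; first exact: (derivable_under_integral measurableT Ia H1 H2 H3 H4 H5).
rewrite -derive1E (differentiation_under_integral measurableT Ia H1 H2 H3 H4 H5).
by apply: eq_Rintegral => y _; rewrite d1.
Qed.

Lemma gm_abs (f : R -> R) : mfun f -> egrowth f ->
 `|gm f| <= gm (fun x => `|f x|).
by move=> mf ef; apply: le_normr_Rintegral => //; exact: egrowth_integrable. Qed.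
(** A zero mean would make [f] vanish almost everywhere, so that the origin alone would carry full
    mass; but the normal law has no atom. *)
Lemma gm_gt0 (f : R -> R) : mfun f -> egrowth f ->
 (forall x, 0 <= f x) -> (forall x, x != 0 -> 0 < f x) -> 0 < gm f.
move=> mf ef f0 fp; rewrite lt_neqAle Rintegral_ge0// andbT eq_sym; apply/eqP => E0.
have i := egrowth_integrable mf ef.
have I0 : (\int[gamma]_x `|(EFin \o f) x| = 0)%E.
 transitivity (\int[gamma]_x (f x)%:E)%E.
 by apply: eq_integral => x _ /=; rewrite ger0_norm.
 by rewrite -(fineK (integrable_fin_num measurableT i)) -[fine _]/(gm f) E0.
have mf' : mfun (EFin \o f) by exact/measurable_EFinP.
have [A [mA A0 sA]] := (ae_eq_integral_abs gamma measurableT mf').1 I0.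
have : (gamma (A `|` [set 0%R]) <= gamma A + gamma [set 0%R])%E.
 exact: measureU2.
have -> : gamma [set (0:R)] = 0%E.
 exact: integral_set1.
rewrite A0 adde0 (_ : A `|` _ = setT); first by rewrite probability_setT lee_fin ler10.
apply/seteqP; split=> // x _; have [->|x0] := eqVneq x 0; [by right|left].
apply: sA => /= H; have := fp x x0.
by have /(_ Logic.I)[->] := H; rewrite ltxx.
Qed.
End Gauss1.

(** * Gaussian averages as functions of the coordinates and their standard deviations *)

Section Env.
Context {R : realType} {I : finType}.
Notation V := (I + I -> R).
Implicit Types (F G : V -> R) (x v : V) (k : I + I).

Definition push x k t : V := fun j => x j + t *+ (j == k).
Definition nrm x : R := \sum_i `|x (inl i)|.
(** Exponential growth is measured in the values only, locally uniformly in the standard deviations: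
    this is the form that survives averaging over a coordinate. *)
Definition growth F := forall B, exists C, 0 <= C /\
 forall x, (forall i, `|x (inr i)| <= B) -> `|F x| <= C * expR (C * nrm x).
Definition pd k F F' := forall x, is_derive (0:R) 1 (fun t : R => F (push x k t)) (F' x).
Definition D k F : V -> R := fun x => 'D_1 (fun t : R => F (push x k t)) (0:R).
(** Differentiability in all coordinates, standard deviations included, with the growth of every
    derivative under control. The derivatives are existentially quantified so that closure
    properties are plain inductions on the order. *)
Fixpoint sm n F := growth F /\
 (if n is n'.+1 then forall k, exists2 F', pd k F F' & sm n' F' else True).
Definition smooth F := forall n, sm n F.

Lemma push0 x k : push x k 0 = x.
by apply/funext => j; rewrite /push mul0rn addr0. Qed.
Lemma push_add x k s t : push (push x k s) k t = push x k (s + t).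
by apply/funext => j; rewrite /push -addrA mulrnDl. Qed.
Lemma pushC x k l s t : push (push x k s) l t = push (push x l t) k s.
by apply/funext => j; rewrite /push addrAC. Qed.
Lemma pushE x k t : push x k t k = x k + t.
by rewrite /push eqxx. Qed.
Lemma pushNE x k t j : j != k -> push x k t j = x j.
by rewrite /push => /negbTE ->; rewrite addr0. Qed.
Lemma pd_D k F F' : pd k F F' -> D k F = F'.
by move=> h; apply/funext => x; case: (h x). Qed.
Lemma smooth_ex k F : smooth F -> pd k F (D k F) /\ smooth (D k F).
move=> h; have [_ /(_ k)[F' hF _]] := h 1%N; rewrite (pd_D hF); split=> // n.
by have [_ /(_ k)[F'' hF'' +]] := h n.+1; rewrite -(pd_D hF) (pd_D hF'').
Qed.
Lemma smooth_pd k F F' : smooth F -> pd k F F' -> smooth F'.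
by move=> h hF; have [_] := smooth_ex k h; rewrite (pd_D hF). Qed.
Lemma smooth_growth F : smooth F -> growth F.
by move=> /(_ 0%N)[]. Qed.
Lemma pd_at k F F' x (s : R) : pd k F F' ->
 is_derive s 1 (fun t : R => F (push x k t)) (F' (push x k s)).
move=> h; have Fx : is_derive (s - s) 1 (fun t : R => F (push (push x k s) k t))
 (F' (push x k s)) by rewrite subrr; exact: h.
have d1 : is_derive s 1 (fun t : R => t - s) 1 by apply: is_derive_eq; rewrite subr0.
have := @is_derive1_comp _ (fun t : R => F (push (push x k s) k t))
 (fun t => t - s) s _ _ Fx d1; rewrite mulr1; congr (is_derive _ _ _ _).
by apply/funext => t /=; rewrite push_add addrC subrK.
Qed.

Lemma growth_le F G : (forall x, `|F x| <= `|G x|) -> growth G -> growth F.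
by move=> fg h B; have [C [C0 hC]] := h B; exists C; split=> // x hx; exact: le_trans (fg x) (hC x hx).
Qed.
Lemma nrm_ge0 x : 0 <= nrm x. Proof. exact: sumr_ge0. Qed.
Lemma growthD F G : growth F -> growth G -> growth (fun x => F x + G x).
move=> hF hG B; have [C [C0 hC]] := hF B; have [E [E0 hE]] := hG B.
exists (C + E); split=> [|x hx]; first exact: addr_ge0.
have n0 := nrm_ge0 x.
rewrite (le_trans (ler_normD _ _))// mulrDl lerD//.
 rewrite (le_trans (hC x hx))// ler_wpM2l// ler_expR ler_wpM2r//; lra.
rewrite (le_trans (hE x hx))// ler_wpM2l// ler_expR ler_wpM2r//; lra.
Qed.

Lemma growthM F G : growth F -> growth G -> growth (fun x => F x * G x).
move=> hF hG B; have [C [C0 hC]] := hF B; have [E [E0 hE]] := hG B.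
exists (C + E + C * E); split=> [|x hx]; first by rewrite !addr_ge0// mulr_ge0.
have n0 := nrm_ge0 x.
rewrite normrM (le_trans (ler_pM _ _ (hC x hx) (hE x hx)))// mulrACA -expRD -mulrDl.
apply: ler_pM; rewrite ?expR_ge0 ?mulr_ge0//; first nra.
by rewrite ler_expR ler_wpM2r//; nra.
Qed.

Lemma growth_cst (c : R) : growth (fun=> c).
move=> B; exists `|c|; split=> // x _; rewrite ler_peMr//.
by rewrite -[leLHS]expR0 ler_expR mulr_ge0// nrm_ge0.
Qed.
Lemma growth_coord k : growth (fun x => x k).
move=> B; case: k => i.
 exists 1; split=> // x _; rewrite !mul1r.
 have : `|x (inl i)| <= nrm x by rewrite /nrm (bigD1 i)//= lerDl sumr_ge0.
 by have := expR_ge1Dx (nrm x); lra.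
exists `|B|; split=> // x hx; rewrite (le_trans (hx i))// (le_trans (ler_norm _))//.
by rewrite ler_peMr// -[leLHS]expR0 ler_expR mulr_ge0// nrm_ge0.
Qed.

Lemma pdD k F G F' G' : pd k F F' -> pd k G G' ->
 pd k (fun x => F x + G x) (fun x => F' x + G' x).
by move=> hF hG x; have := hF x; have := hG x => ? ?; apply: is_derive_eq. Qed.
Lemma pdM k F G F' G' : pd k F F' -> pd k G G' ->
 pd k (fun x => F x * G x) (fun x => F' x * G x + F x * G' x).
move=> hF hG x; have := hF x; have := hG x => ? ?; apply: is_derive_eq.
by rewrite !push0 addrC; congr (_ + _); rewrite mulrC.
Qed.
Lemma pd_cst k (c : R) : pd k (fun=> c) (fun=> 0).
by move=> x; exact: is_derive_cst. Qed.
Lemma pd_ext k F F' G G' : F =1 G -> F' =1 G' -> pd k F F' -> pd k G G'.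
by move=> /funext -> /funext ->. Qed.
Lemma smooth_ext F G : F =1 G -> smooth F -> smooth G.
by move=> /funext ->. Qed.
Lemma pd_coord k j : pd k (fun x => x j) (fun=> (j == k)%:R).
move=> x; rewrite /push; case: eqP => _ /=; last by under eq_fun do rewrite mulr0n addr0; exact: is_derive_cst.
have : is_derive (0:R) 1 (cst (x j) + id : R -> R) (0 + 1) by exact: is_deriveD.
by rewrite add0r.
Qed.

Lemma pd_comp k F F' (f f' : R -> R) : (forall x, is_derive (F x) 1 f (f' (F x))) ->
 pd k F F' -> pd k (fun x => f (F x)) (fun x => f' (F x) * F' x).
move=> hf hF x; apply: (@is_derive1_comp _ f (fun t : R => F (push x k t))) => //.
by rewrite push0.
Qed.
Lemma pd_exp k F F' : pd k F F' ->
 pd k (fun x => expR (F x)) (fun x => expR (F x) * F' x).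
by move=> hF; apply: (@pd_comp k F F' expR expR) => // x; exact: is_derive_expR. Qed.
Lemma pd_inv k F F' : (forall x, F x != 0) -> pd k F F' ->
 pd k (fun x => (F x)^-1) (fun x => - ((F x)^-1 * (F x)^-1) * F' x).
move=> F0 hF; apply: (@pd_comp k F F' (fun y => y^-1) (fun y => - (y^-1 * y^-1))) => // x.
have := @is_deriveV R id (F x) 1 1 (F0 x) (is_derive_id _ _).
by rewrite -exprVn expr2 -[_ *: _]/(_ * _) mulr1.
Qed.

Lemma pd_ln k F F' : (forall x, 0 < F x) -> pd k F F' ->
 pd k (fun x => ln (F x)) (fun x => (F x)^-1 * F' x).
move=> F0 hF; apply: (@pd_comp k F F' (@ln R) (fun y => y^-1)) => // x.
exact: is_derive1_ln.
Qed.
Lemma smW n F : sm n.+1 F -> sm n F.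
elim: n F => [|n IH] F [gF h]; split=> // k.
by have [F' hF /IH] := h k; exists F'.
Qed.
Lemma smD n F G : sm n F -> sm n G -> sm n (fun x => F x + G x).
elim: n F G => [|n IH] F G [gF hF] [gG hG]; split=> //; try exact: growthD.
move=> k; have [F' dF sF] := hF k; have [G' dG sG] := hG k.
by exists (fun x => F' x + G' x); [exact: pdD|exact: IH].
Qed.
Lemma smM n F G : sm n F -> sm n G -> sm n (fun x => F x * G x).
elim: n F G => [|n IH] F G sF sG; (split; first by apply: growthM; [case: sF|case: sG]) => //.
have [gF hF] := sF; have [gG hG] := sG.
move=> k; have [F' dF sF'] := hF k; have [G' dG sG'] := hG k.
exists (fun x => F' x * G x + F x * G' x); first exact: pdM.
by apply: smD; apply: IH => //; exact: smW.
Qed.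

Lemma sm_cst n c : sm n (fun=> c).
elim: n c => [|n IH] c; (split; first exact: growth_cst) => // k.
by exists (fun=> 0) => //; exact: pd_cst.
Qed.
Lemma sm_exp n F : sm n F -> growth (fun x => expR (F x)) -> sm n (fun x => expR (F x)).
elim: n F => [|n IH] F sF g; split=> // k; have [_ /(_ k)[F' dF sF']] := sF.
exists (fun x => expR (F x) * F' x); first exact: pd_exp.
by apply: smM => //; apply: IH => //; exact: smW.
Qed.

Lemma sm_inv n F : (forall x, F x != 0) -> sm n F -> growth (fun x => (F x)^-1) ->
 sm n (fun x => (F x)^-1).
move=> F0; elim: n => [|n IH] sF g; split=> // k; have [_ /(_ k)[F' dF sF']] := sF.
exists (fun x => - ((F x)^-1 * (F x)^-1) * F' x); first exact: pd_inv.
have sV := IH (smW sF) g.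
apply: smM => //; under eq_fun do rewrite -mulN1r.
by apply: smM; [exact: sm_cst|exact: smM].
Qed.

Lemma smoothD F G : smooth F -> smooth G -> smooth (fun x => F x + G x).
by move=> sF sG n; exact: smD. Qed.
Lemma smoothM F G : smooth F -> smooth G -> smooth (fun x => F x * G x).
by move=> sF sG n; exact: smM. Qed.
Lemma smooth_cst c : smooth (fun=> c).
by move=> n; exact: sm_cst. Qed.
Lemma smooth_coord k : smooth (fun x => x k).
case=> [|n]; (split; first exact: growth_coord) => // j.
by exists (fun=> (k == j)%:R); [exact: pd_coord|exact: sm_cst].
Qed.
Lemma smooth_exp F : smooth F -> growth (fun x => expR (F x)) -> smooth (fun x => expR (F x)).
by move=> sF g n; exact: sm_exp. Qed.
Lemma smooth_inv F : (forall x, F x != 0) -> smooth F -> growth (fun x => (F x)^-1) ->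
 smooth (fun x => (F x)^-1).
by move=> F0 sF g n; exact: sm_inv. Qed.
Lemma smooth_ln F : (forall x, 0 < F x) -> smooth F -> growth (fun x => (F x)^-1) ->
 smooth (fun x => ln (F x)).
move=> F0 sF g.
have gl : growth (fun x => ln (F x)).
 apply: (growth_le (G := fun x => F x + (F x)^-1)); last by apply: growthD => //; exact: smooth_growth.
 move=> x; have Fx := F0 x; have iF : 0 < (F x)^-1 by rewrite invr_gt0.
 rewrite (ger0_norm (ltW (addr_gt0 Fx iF))) ler_norml.
 have := ln_sublinear Fx; have := ln_sublinear iF; rewrite lnV ?posrE//; lra.
case=> [|n]; split=> // k; have [dF sF'] := smooth_ex k sF.
exists (fun x => (F x)^-1 * D k F x); first exact: pd_ln.
by apply: smM => //; apply: sm_inv => // x; rewrite gt_eqF.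
Qed.

Lemma smooth_sum (J : Type) (s : seq J) (P : pred J) (f : J -> V -> R) :
 (forall j, smooth (f j)) -> smooth (fun x => \sum_(j <- s | P j) f j x).
move=> h; elim: s => [|j s IH].
 by under eq_fun do rewrite big_nil; exact: smooth_cst.
under eq_fun do rewrite big_cons; case: (P j) => //; exact: smoothD.
Qed.

Lemma smooth_prod (J : Type) (s : seq J) (P : pred J) (f : J -> V -> R) :
 (forall j, smooth (f j)) -> smooth (fun x => \prod_(j <- s | P j) f j x).
move=> h; elim: s => [|j s IH].
 by under eq_fun do rewrite big_nil; exact: smooth_cst.
under eq_fun do rewrite big_cons; case: (P j) => //; exact: smoothM.
Qed.

Lemma pd_sum k (J : Type) (s : seq J) (P : pred J) (f f' : J -> V -> R) :
 (forall j, pd k (f j) (f' j)) ->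
 pd k (fun x => \sum_(j <- s | P j) f j x) (fun x => \sum_(j <- s | P j) f' j x).
move=> h; elim: s => [|j s IH].
 by apply: pd_ext (pd_cst k 0) => x; rewrite big_nil.
case Pj: (P j); last by apply: pd_ext IH => x; rewrite big_cons Pj.
by apply: pd_ext (pdD (h j) IH) => x; rewrite big_cons Pj.
Qed.

Lemma smoothZ c F : smooth F -> smooth (fun x => c * F x).
by move=> h; apply: smoothM => //; exact: smooth_cst. Qed.
Lemma smoothN F : smooth F -> smooth (fun x => - F x).
by move=> h; under eq_fun do rewrite -mulN1r; exact: smoothZ. Qed.
Lemma smoothB F G : smooth F -> smooth G -> smooth (fun x => F x - G x).
by move=> sF sG; apply: smoothD => //; exact: smoothN. Qed.
Lemma pdZ k c F F' : pd k F F' -> pd k (fun x => c * F x) (fun x => c * F' x).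
move=> h; apply: pd_ext (pdM (pd_cst k c) h) => x //.
by rewrite mul0r add0r.
Qed.

Definition nrmV v : R := \sum_k `|v k|.

Lemma nrmV_coord v k : `|v k| <= nrmV v.
by rewrite /nrmV (bigD1 k)//= lerDl sumr_ge0. Qed.

Definition mask (s : seq (I + I)) v : V := fun k => if k \in s then v k else 0.

Lemma mask_cons k s x v : k \notin s ->
 (fun j => x j + mask (k :: s) v j) = push (fun j => x j + mask s v j) k (v k).
move=> ks; apply/funext => j; rewrite /push /mask in_cons; have [->|jk] /= := eqVneq j k.
 by rewrite (negbTE ks) addr0.
by rewrite addr0.
Qed.
Lemma sm_bounded F x : growth F ->
 exists2 C, 0 <= C & forall v, nrmV v <= 1 -> `|F (fun k => x k + v k)| <= C.
move=> gF; have [C [C0 hC]] := gF (nrmV x + 1).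
have h1 v : nrmV v <= 1 -> forall k, `|x k + v k| <= `|x k| + `|v k|.
 by move=> _ k; exact: ler_normD.
exists (C * expR (C * (nrm x + 1))); first by rewrite mulr_ge0// expR_ge0.
move=> v v1; apply: le_trans (hC _ _) _.
 move=> i; rewrite (le_trans (ler_normD _ _))// lerD ?nrmV_coord//.
 exact: le_trans (nrmV_coord _ _) v1.
rewrite ler_wpM2l// ler_expR ler_wpM2l//.
apply: (@le_trans _ _ (nrm x + nrm v)).
 by rewrite /nrm -big_split/=; apply: ler_sum => i _; exact: ler_normD.
rewrite lerD2l; apply: le_trans v1; rewrite /nrmV big_sumType/= /nrm lerDl.
exact: sumr_ge0.
Qed.

Lemma MVT_pd k F F' x (a : R) : pd k F F' ->
 exists2 b, `|b| <= `|a| & F (push x k a) - F x = a * F' (push x k b).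
move=> h; have der (s : R) := pd_at x s h.
have cF := derive_cont der.
have [a0|a0|->] := ltrgt0P a.
- have [c] := MVT a0 (fun t _ => der t) (continuous_subspaceT cF).
 rewrite in_itv/= => /andP[? ?]; rewrite push0 subr0 => ->.
 by exists c; [rewrite !ger0_norm//; lra|rewrite mulrC].
- have [c] := MVT a0 (fun t _ => der t) (continuous_subspaceT cF).
 rewrite in_itv/= => /andP[? ?]; rewrite push0 sub0r => e.
 exists c; first by rewrite !ler0_norm//; lra.
 by rewrite -opprB e mulrN opprK mulrC.
- by exists 0; rewrite ?normr0// push0 subrr mul0r.
Qed.

(** The increment is switched on one coordinate at a time, and the one-variable mean value theorem
    is applied to each switch. *)
Lemma telescope F x v (s : seq (I + I)) : smooth F -> uniq s ->
 exists Phi : V,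
 F (fun j => x j + mask s v j) - F x = \sum_(k <- s) v k * Phi k /\
 forall k, exists2 w, nrmV w <= nrmV v & Phi k = D k F (fun j => x j + w j).
move=> sF; elim: s => [_|k s IH /= /andP[ks us]].
 exists (fun k => D k F x); split=> [|k].
 rewrite big_nil (_ : (fun j => _) = x) ?subrr//.
 by apply/funext => j; rewrite /mask in_nil addr0.
 exists (fun=> 0); first by rewrite /nrmV big1 ?sumr_ge0// => i _; rewrite normr0.
 by congr (D k F _); apply/funext => j; rewrite addr0.
have [Phi [e hPhi]] := IH us.
have [b bv eb] := MVT_pd (fun j => x j + mask s v j) (v k) (smooth_ex k sF).1.
exists (fun j => if j == k then D k F (push (fun j => x j + mask s v j) k b) else Phi j).
split.
 rewrite mask_cons// big_cons eqxx -eb.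
 rewrite (eq_big_seq (fun k => v k * Phi k)) -?e; first by rewrite addrA subrK.
 by move=> j js; rewrite ifF//; apply/negbTE; apply: contraNneq ks => <-.
move=> j; case: eqP => [->|_]; last exact: hPhi.
exists (fun i => mask s v i + b *+ (i == k)).
 apply: ler_sum => i _; rewrite /mask; have [->|ik] := eqVneq i k.
 by rewrite (negbTE ks) add0r.
 by rewrite addr0; case: ifP => // _; rewrite normr0.
by congr (D k F _); apply/funext => i; rewrite /push addrA.
Qed.

Lemma mask_all v : mask (enum {: I + I}) v = v.
by apply/funext => k; rewrite /mask mem_enum. Qed.
Lemma smooth_lip F x : smooth F ->
 exists2 C, 0 <= C & forall v, nrmV v <= 1 ->
 `|F (fun j => x j + v j) - F x| <= C * nrmV v.
move=> sF.
have hM k : exists2 C, 0 <= C & forall v, nrmV v <= 1 -> `|D k F (fun k => x k + v k)| <= C.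
 by apply: sm_bounded; apply/smooth_growth; case: (smooth_ex k sF).
pose M k := projT1 (cid2 (hM k)).
have [M0 MP] : (forall k, 0 <= M k) /\ forall k v, nrmV v <= 1 -> `|D k F (fun k => x k + v k)| <= M k.
 by split=> k; rewrite /M; case: cid2.
exists (\sum_k M k) => [|v v1]; first exact: sumr_ge0.
have [Phi [e hPhi]] := telescope x v sF (enum_uniq {: I + I}).
move: e; rewrite mask_all big_enum/= => ->.
rewrite (le_trans (ler_norm_sum _ _ _))// mulr_suml; apply: ler_sum => k _.
rewrite normrM mulrC; have [w wv ->] := hPhi k.
by apply: ler_pM => //; [apply: MP; exact: le_trans v1|exact: nrmV_coord].
Qed.

(** Total differentiability in quantitative form: the slopes are partial derivatives at nearby
    points, and these are locally Lipschitz. *)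
Lemma smooth_slope F x : smooth F ->
 exists2 C, 0 <= C & forall v, nrmV v <= 1 -> exists Phi : V,
 F (fun j => x j + v j) - F x = \sum_k v k * Phi k /\
 forall k, `|Phi k - D k F x| <= C * nrmV v.
move=> sF.
have hM k := @smooth_lip (D k F) x (smooth_ex k sF).2.
pose M k := projT1 (cid2 (hM k)).
have [M0 MP] : (forall k, 0 <= M k) /\ forall k v, nrmV v <= 1 ->
 `|D k F (fun k => x k + v k) - D k F x| <= M k * nrmV v.
 by split=> k; rewrite /M; case: cid2.
exists (\sum_k M k) => [|v v1]; first exact: sumr_ge0.
have [Phi [e hPhi]] := telescope x v sF (enum_uniq {: I + I}).
exists Phi; split=> [|k]; first by move: e; rewrite mask_all big_enum.
have [w wv ->] := hPhi k; rewrite (le_trans (MP k w _)) ?(le_trans wv)//.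
apply: ler_pM => //; first exact: sumr_ge0.
by rewrite (bigD1 k)//= lerDl sumr_ge0.
Qed.

Lemma is_derive1P (f : R -> R) (s l : R) :
 is_derive s 1 f l <-> h^-1 * (f (s + h) - f s) @[h --> (0:R)^'] --> l.
have E : (fun h : R => h^-1 * (f (s + h) - f s)) = fun h => h^-1 *: (f (h *: 1 + s) - f s).
 by apply/funext => h; rewrite [s + h]addrC -[h%:A]/(h * 1) mulr1.
rewrite E; split=> [[df <-]|h]; first exact: df.
by apply: DeriveDef; [apply/cvg_ex; exists l|exact: cvg_lim].
Qed.

Lemma cvg_finsum (T : Type) (J : finType) (Fl : set_system T) {FF : Filter Fl}
 (f : J -> T -> R) (l : J -> R) :
 (forall j, f j t @[t --> Fl] --> l j) ->
 (\sum_j f j t) @[t --> Fl] --> \sum_j l j.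
move=> h; elim: (index_enum J) => [|j s IH].
 by rewrite big_nil; under eq_fun do rewrite big_nil; exact: cvg_cst.
by rewrite big_cons; under eq_fun do rewrite big_cons; apply: cvgD; [exact: h|exact: IH].
Qed.

Lemma smooth_chain F (gam : R -> V) (gam' : V) (s : R) : smooth F ->
 (forall k, is_derive s 1 (gam ^~ k) (gam' k)) ->
 is_derive s 1 (fun t => F (gam t)) (\sum_k gam' k * D k F (gam s)).
move=> sF dg; apply/is_derive1P.
have [C C0 hC] := smooth_slope (gam s) sF.
pose v h : V := fun k => gam (s + h) k - gam s k.
have ve h : gam (s + h) = fun j => gam s j + v h j.
 by apply/funext => j; rewrite /v [RHS]addrC subrK.
have vk k : h^-1 * v h k @[h --> (0:R)^'] --> gam' k by exact/is_derive1P.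
have vk0 k : `|v h k| @[h --> (0:R)^'] --> (0:R).
 have h0 : v h k @[h --> (0:R)^'] --> 0 * gam' k.
 apply: (@cvg_trans _ ((h * (h^-1 * v h k)) @[h --> (0:R)^'])).
 apply: near_eq_cvg; near=> h.
 by rewrite mulrA divff ?mul1r//; near: h; exact: nbhs_dnbhs_neq.
 apply: cvgM; last exact: vk.
 exact: nbhs_dnbhs.
 suff : `|v h k| @[h --> (0:R)^'] --> `|0 * gam' k| by rewrite mul0r normr0.
 exact: cvg_norm.
have nv : nrmV (v h) @[h --> (0:R)^'] --> (0:R).
 suff : nrmV (v h) @[h --> (0:R)^'] --> \sum_(k : I + I) (0:R) by rewrite big1.
 exact: cvg_finsum.
(* Stated as an implication so that a slope can be chosen for every [h], even where the increment is
   too large for [hC]. *)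
have Phi_ex h : exists Phi : V, nrmV (v h) <= 1 ->
 F (gam (s + h)) - F (gam s) = \sum_k v h k * Phi k /\
 forall k, `|Phi k - D k F (gam s)| <= C * nrmV (v h).
 have [v1|_] := boolP (nrmV (v h) <= 1); last by exists (fun=> 0).
 by have [Phi] := hC _ v1; rewrite -ve; exists Phi.
pose Phi h := projT1 (cid (Phi_ex h)).
have PhiP h : nrmV (v h) <= 1 ->
 F (gam (s + h)) - F (gam s) = \sum_k v h k * Phi h k /\
 forall k, `|Phi h k - D k F (gam s)| <= C * nrmV (v h).
 by rewrite /Phi; case: cid.
have v1 : \forall h \near (0:R)^', nrmV (v h) <= 1.
 by apply: (cvgr_le (0:R) nv); exact: ltr01.
apply: (@cvg_trans _ ((\sum_k (h^-1 * v h k) * Phi h k) @[h --> (0:R)^'])).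
 apply: near_eq_cvg; near=> h.
 have [|-> _] := PhiP h; first by near: h.
 by rewrite mulr_sumr; apply: eq_bigr => k _; rewrite mulrA.
apply: cvg_finsum => k; apply: cvgM; first exact: vk.
apply: cvg_zero; apply: norm_cvg0.
apply: (@squeeze_cvgr _ _ _ _ (cst 0) (fun h => C * nrmV (v h))).
- by near=> h; rewrite normr_ge0/=; have [|_ ->] := PhiP h; first by near: h.
- exact: cvg_cst.
- suff : C * nrmV (v h) @[h --> (0:R)^'] --> C * 0 by rewrite mulr0.
 by apply: cvgM; [exact: cvg_cst|exact: nv].
Unshelve. all: end_near. Qed.

Lemma smooth_continuous F (T : topologicalType) (gam : T -> V) (s : T) : smooth F ->
 (forall k, {for s, continuous (gam ^~ k)}) -> {for s, continuous (F \o gam)}.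
move=> sF cg; have [C C0 hC] := smooth_lip (gam s) sF.
pose v t : V := fun k => gam t k - gam s k.
have ve t : gam t = fun j => gam s j + v t j.
 by apply/funext => j; rewrite /v [RHS]addrC subrK.
have vk0 k : `|v t k| @[t --> s] --> (0:R).
 have h0 : v t k @[t --> s] --> gam s k - gam s k.
 by apply: cvgB; [exact: cg|exact: cvg_cst].
 suff : `|v t k| @[t --> s] --> `|gam s k - gam s k| by rewrite subrr normr0.
 exact: cvg_norm.
have nv : nrmV (v t) @[t --> s] --> (0:R).
 suff : nrmV (v t) @[t --> s] --> \sum_(k : I + I) (0:R) by rewrite big1.
 exact: cvg_finsum.
have v1 : \forall t \near s, nrmV (v t) <= 1.
 by apply: (cvgr_le (0:R) nv); exact: ltr01.
apply: cvg_zero; apply: norm_cvg0.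
apply: (@squeeze_cvgr _ _ _ _ (cst 0) (fun t => C * nrmV (v t))).
- near=> t; rewrite normr_ge0/= !fctE [in X in F X]ve; apply: hC.
 by near: t.
- exact: cvg_cst.
- suff : C * nrmV (v t) @[t --> s] --> C * 0 by rewrite mulr0.
 by apply: cvgM; [exact: cvg_cst|exact: nv].
Unshelve. all: end_near. Qed.

Lemma pd_continuous k F F' x : pd k F F' -> continuous (fun t : R => F (push x k t)).
by move=> h; apply: derive_cont => s; exact: pd_at. Qed.

(* [x (inl i)] is the value of the [i]-th Gaussian coordinate and [x (inr i)] its
 standard deviation: [T i] averages over an added centred Gaussian. *)
Definition T i F : V -> R :=
 fun x => gm (fun z => F (push x (inl i) (x (inr i) * z))).

Lemma nrm_push x i t : nrm (push x (inl i) t) <= nrm x + `|t|.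
rewrite /nrm (bigD1 i)//= [X in _ <= X + _](bigD1 i)//= /push eqxx mulr1n.
rewrite addrAC lerD ?ler_normD//; apply: ler_sum => j ji.
by rewrite (_ : (inl j == inl i) = false) ?addr0//; apply/negbTE; apply: contraNneq ji => -[->].
Qed.

Lemma growth_push F : growth F -> forall B, exists2 C, 0 <= C & forall x i t,
 (forall i, `|x (inr i)| <= B) ->
 `|F (push x (inl i) t)| <= C * expR (C * nrm x) * expR (C * `|t|).
move=> gF B; have [C [C0 hC]] := gF B; exists C => // x i t hx.
apply: le_trans (hC _ _) _ => [j|]; first by rewrite /push addr0.
by rewrite -mulrA -expRD -mulrDr ler_wpM2l// ler_expR ler_wpM2l// nrm_push.
Qed.

Lemma scale_bound x : forall i : I, `|x (inr i)| <= \sum_k `|x k|.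
by move=> i; rewrite (bigD1 (inr i))//= lerDl sumr_ge0. Qed.
Lemma egrowth_push F x i (c : R) : growth F -> egrowth (fun z => F (push x (inl i) (c * z))).
move=> gF; have [C C0 hC] := growth_push gF (\sum_k `|x k|).
have nx := nrm_ge0 x.
exists (C * expR (C * nrm x) + C * `|c|); split=> [|z].
 by rewrite addr_ge0// mulr_ge0// expR_ge0.
apply: le_trans (hC _ _ _ (scale_bound x)) _; apply: ler_pM; rewrite ?expR_ge0//.
- by rewrite mulr_ge0// expR_ge0.
- by rewrite lerDl mulr_ge0.
- rewrite ler_expR normrM mulrA ler_wpM2r// lerDr mulr_ge0// expR_ge0//.
Qed.

Lemma measurable_push F x i (c : R) : smooth F ->
 mfun (fun z : R => F (push x (inl i) (c * z))).
move=> sF; apply: cont_meas => z.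
apply: (@continuous_comp _ _ _ (fun z => c * z) (fun t => F (push x (inl i) t))).
 by cvg_scale.
have cF := pd_continuous (x := x) (smooth_ex (inl i) sF).1; exact: cF.
Qed.

Lemma growth_T i F : smooth F -> growth (T i F).
move=> sF B; have gF := smooth_growth sF; have [C C0 hC] := growth_push gF `|B|.
pose M := gm (fun z => expR ((C * `|B|) * `|z|)).
have eM : egrowth (fun z => expR ((C * `|B|) * `|z|)).
 exists (1 + C * `|B|); split=> [|z]; first by rewrite addr_ge0// mulr_ge0.
 rewrite ger0_norm ?expR_ge0// -[leLHS]mul1r ler_pM ?expR_ge0//.
 by rewrite lerDl mulr_ge0.
 by rewrite ler_expR ler_wpM2r// lerDr.
have mM : mfun (fun z : R => expR ((C * `|B|) * `|z|)).
 apply: cont_meas => z; apply: continuous_comp; last exact: continuous_expR.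
 by apply: cvgM; [exact: cvg_cst|exact: norm_continuous].
have M0 : 0 <= M by apply: Rintegral_ge0 => z _; exact: expR_ge0.
exists (C * M + C); split=> [|x hx]; first by rewrite addr_ge0// mulr_ge0.
have nx := nrm_ge0 x.
apply: le_trans (gm_abs (measurable_push _ _ _ sF) (egrowth_push _ _ _ gF)) _.
apply: (@le_trans _ _ (gm (fun z => (C * expR (C * nrm x)) * expR ((C * `|B|) * `|z|)))).
 apply: ler_gauss_mean.
 - exact: (measurableT_comp _ (measurable_push _ _ _ sF)).
 - exact: measurable_funM.
 - by apply: egrowth_le (egrowth_push x i (x (inr i)) gF) => z; rewrite normr_id.
 - by apply: egrowthM => //; exact: egrowth_cst.
 - move=> z; apply: le_trans (hC x i _ _) _; first by move=> j; exact: le_trans (hx j) (ler_norm _).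
 rewrite ler_wpM2l ?mulr_ge0 ?expR_ge0// ler_expR normrM -mulrA ler_wpM2l// ler_wpM2r//.
 exact: le_trans (hx i) (ler_norm _).
rewrite gmZ// -/M mulrAC ler_pM ?expR_ge0 ?mulr_ge0// ?lerDl//.
by rewrite ler_expR ler_wpM2r// lerDr mulr_ge0.
Qed.

Lemma egrowth_push_id F x i (c : R) : growth F ->
 egrowth (fun z => z * F (push x (inl i) (c * z))).
by move=> gF; apply: egrowthM; [exact: egrowth_id|exact: egrowth_push]. Qed.
Lemma measurable_push_id F x i (c : R) : smooth F ->
 mfun (fun z : R => z * F (push x (inl i) (c * z))).
by move=> sF; apply: measurable_funM => //; exact: measurable_push. Qed.
Lemma T_ibp F i x (c : R) : smooth F ->
 gm (fun z => z * F (push x (inl i) (c * z))) =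
 c * gm (fun z => D (inl i) F (push x (inl i) (c * z))).
move=> sF; have [dF sF'] := smooth_ex (inl i) sF.
rewrite -gmZ; first last.
- exact/egrowth_push/smooth_growth.
- exact: measurable_push.
apply: (gm_ibp (f := fun z => F (push x (inl i) (c * z)))).
- move=> z; rewrite [X in is_derive _ _ _ X]mulrC.
 apply: (@is_derive1_comp _ (fun t : R => F (push x (inl i) t)) (fun z => c * z)).
 exact: pd_at.
 have := is_deriveZ c (is_derive_id z (1:R)); rewrite -[_ *: _]/(c * 1) mulr1; exact.
- move=> z; apply: cvgM; first exact: cvg_cst.
 apply: (@continuous_comp _ _ _ (fun z => c * z) (fun t => D (inl i) F (push x (inl i) t))).
 by cvg_scale.
 have cF := pd_continuous (x := x) (smooth_ex (inl i) sF').1; exact: cF.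
- exact/egrowth_push/smooth_growth.
- by apply: egrowthM; [exact: egrowth_cst|exact/egrowth_push/smooth_growth].
Qed.

(** Differentiating the average in its standard deviation brings down the factor [z], which Gaussian
    integration by parts trades for the standard deviation times a second derivative in the value.
    This is the heat equation behind all interpolations. *)
Definition DT k i F : V -> R := fun x =>
 T i (D k F) x + (k == inr i)%:R * (x (inr i) * T i (D (inl i) (D (inl i) F)) x).

Lemma push_curve F x i k (z s : R) : smooth F ->
 is_derive s 1 (fun t : R => F (push (push x k t) (inl i) (push x k t (inr i) * z)))
 (D k F (push (push x k s) (inl i) (push x k s (inr i) * z)) +
 (k == inr i)%:R * (z * D (inl i) F (push (push x k s) (inl i) (push x k s (inr i) * z)))).
move=> sF.
pose gam (t : R) : V := push (push x k t) (inl i) (push x k t (inr i) * z).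
have dg j : is_derive s 1 (gam ^~ j) ((j == k)%:R + (inr i == k)%:R * z * (j == inl i)%:R).
 rewrite /gam /push.
 have d1 l : is_derive s 1 (fun t : R => x l + t *+ (l == k)) ((l == k)%:R).
 have : is_derive s 1 (cst (x l) + (l == k)%:R *: id : R -> R) (0 + (l == k)%:R *: 1).
 exact: is_deriveD.
 rewrite add0r -[_ *: 1]/(_ * 1) mulr1; congr is_derive.
 by apply/funext => t; rewrite !fctE -[_ *: _]/(_ * _) mulr_natl.
 have d2 : is_derive s 1 (fun t : R => (x (inr i) + t *+ (inr i == k)) * z) ((inr i == k)%:R * z).
 have : is_derive s 1 (z *: (fun t : R => x (inr i) + t *+ (inr i == k))) (z *: (inr i == k)%:R).
 exact: is_deriveZ.
 rewrite -[_ *: _%:R]/(_ * _) mulrC; congr is_derive.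
 by apply/funext => t; rewrite !fctE -[_ *: _]/(_ * _) mulrC.
 case: (j == inl i); last first.
 by rewrite mulr0 addr0; under eq_fun do rewrite mulr0n addr0; exact: d1.
 by rewrite mulr1; under eq_fun do rewrite mulr1n; exact: is_deriveD.
have := smooth_chain sF dg; congr is_derive.
have e1 : (true%:R : R) = 1 by [].
have e0 : (false%:R : R) = 0 by [].
rewrite (bigD1 k)//= eqxx.
have [ek|ki] := eqVneq k (inr i).
 subst k; transitivity (D (inr i) F (gam s) + z * D (inl i) F (gam s)); last by rewrite e1 mul1r.
 rewrite !e1 !mul1r (_ : (inr i == inl i) = false)// e0 mulr0 addr0 mul1r; congr (_ + _).
 rewrite (bigD1 (inl i))//= eqxx e1 e0 mulr1 add0r.
 rewrite big1 ?addr0// => j /andP[/negbTE -> /negbTE ->].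
 by rewrite e0 mulr0 addr0 mul0r.
rewrite e0 e1 !mul0r addr0 mul1r addr0 big1 ?addr0// => j /negbTE ->.
by rewrite e0 add0r !mul0r.
Qed.

Lemma pd_T k i F : smooth F -> pd k (T i F) (DT k i F).
move=> sF x.
have [dk sk] := smooth_ex k sF; have [di si] := smooth_ex (inl i) sF.
have -> : DT k i F x = gm (fun z =>
 D k F (push (push x k 0) (inl i) (push x k 0 (inr i) * z)) +
 (k == inr i)%:R * (z * D (inl i) F (push (push x k 0) (inl i) (push x k 0 (inr i) * z)))).
 rewrite push0 gmD.
 - by rewrite gmZ ?T_ibp//; [exact: measurable_push_id|exact/egrowth_push_id/smooth_growth].
 - exact: measurable_push.
 - by apply: measurable_funM => //; exact: measurable_push_id.
 - exact/egrowth_push/smooth_growth.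
 - by apply: egrowthM; [exact: egrowth_cst|exact/egrowth_push_id/smooth_growth].
(* For [|t| < 1] this bounds all standard deviations, so that the single function [G] dominates the
   derivative near [t = 0]. *)
pose B := \sum_k `|x k| + 1.
have [C C0 hC] := growth_push (smooth_growth sk) B.
have [E E0 hE] := growth_push (smooth_growth si) B.
have nx := nrm_ge0 x.
have B0 : 0 <= B by rewrite addr_ge0// sumr_ge0.
pose G (z : R) := C * expR (C * (nrm x + 1)) * expR (C * (B * `|z|)) +
 `|z| * (E * expR (E * (nrm x + 1)) * expR (E * (B * `|z|))).
have mexp (a : R) : mfun (fun z : R => expR (a * (B * `|z|))).
 apply: cont_meas => z; apply: continuous_comp; last exact: continuous_expR.
 apply: cvgM; first exact: cvg_cst.
 by apply: cvgM; [exact: cvg_cst|exact: norm_continuous].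
have eexp (a : R) : 0 <= a -> egrowth (fun z => expR (a * (B * `|z|))).
 move=> a0; exists (1 + a * B); split=> [|z]; first by rewrite addr_ge0// mulr_ge0.
 rewrite ger0_norm ?expR_ge0// -[leLHS]mul1r ler_pM ?expR_ge0//.
 by rewrite lerDl mulr_ge0.
 by rewrite ler_expR mulrA ler_wpM2r// lerDr.
apply: (@gm_derive _ (fun t z => F (push (push x k t) (inl i) (push x k t (inr i) * z)))
 (fun t z => D k F (push (push x k t) (inl i) (push x k t (inr i) * z)) +
 (k == inr i)%:R * (z * D (inl i) F (push (push x k t) (inl i) (push x k t (inr i) * z)))) G _ 1) => //.
- move=> t _; split; first exact: measurable_push.
 exact/egrowth_push/smooth_growth.
- by move=> t z _; exact: push_curve.
- apply: measurable_funD; first exact: measurable_funM.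
 apply: measurable_funM; last exact: measurable_funM.
 by apply: cont_meas => z; exact: norm_continuous.
- apply: egrowthD; first by apply: egrowthM; [exact: egrowth_cst|exact: eexp].
 apply: egrowthM; last by apply: egrowthM; [exact: egrowth_cst|exact: eexp].
 by apply: (egrowth_le (g := id)) => [z|]; [rewrite normr_id|exact: egrowth_id].
- move=> t z; rewrite subr0 => t1.
 have hB j : `|push x k t (inr j)| <= B.
 rewrite /push (le_trans (ler_normD _ _))// lerD ?scale_bound//.
 by case: (_ == _); rewrite ?normr0// ltW.
 have hn : nrm (push x k t) <= nrm x + 1.
 case: k {dk sk hC hB} => j; first by rewrite (le_trans (nrm_push _ _ _))// lerD2l ltW.
 by rewrite /nrm /push (eq_bigr (fun i => `|x (inl i)|)) ?lerDl// => l _; rewrite addr0.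
 have hz : `|push x k t (inr i) * z| <= B * `|z| by rewrite normrM ler_wpM2r.
 rewrite (le_trans (ler_normD _ _))// lerD//.
 apply: le_trans (hC _ _ _ hB) _; apply: ler_pM; rewrite ?mulr_ge0 ?expR_ge0//.
 by rewrite ler_wpM2l// ler_expR ler_wpM2l.
 by rewrite ler_expR ler_wpM2l.
 rewrite !normrM -[leRHS]mul1r; apply: ler_pM; rewrite ?mulr_ge0//.
 by case: (_ == _); rewrite ?normr0 ?normr1.
 apply: ler_wpM2l => //; apply: le_trans (hE _ _ _ hB) _.
 apply: ler_pM; rewrite ?mulr_ge0 ?expR_ge0//.
 by rewrite ler_wpM2l// ler_expR ler_wpM2l.
 by rewrite ler_expR ler_wpM2l.
Qed.

Lemma smooth_T i F : smooth F -> smooth (T i F).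
move=> sF n; elim: n F sF => [|n IH] F sF; split=> //; try exact: growth_T.
move=> k; exists (DT k i F); first exact: pd_T.
have [_ sk] := smooth_ex k sF; have [_ si] := smooth_ex (inl i) sF.
have [_ sii] := smooth_ex (inl i) si.
apply: smD; first exact: IH.
by apply: smM; [exact: sm_cst|apply: smM; [exact: smooth_coord|exact: IH]].
Qed.

Lemma smooth_mD F i x (c : R) : smooth F ->
 mfun (fun z : R => F (push x (inl i) (c * z))) /\
 egrowth (fun z => F (push x (inl i) (c * z))).
by move=> sF; split; [exact: measurable_push|exact/egrowth_push/smooth_growth]. Qed.
Lemma T_D i F G : smooth F -> smooth G ->
 T i (fun x => F x + G x) = fun x => T i F x + T i G x.
move=> sF sG; apply/funext => x; rewrite /T gmD//.
all: by have [? ?] := smooth_mD i x (x (inr i)) sF; have [? ?] := smooth_mD i x (x (inr i)) sG.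
Qed.
Lemma T_indepM i A G : smooth G -> forall x, (forall t, A (push x (inl i) t) = A x) ->
 T i (fun x => A x * G x) x = A x * T i G x.
move=> sG x hA; rewrite /T -gmZ.
- by eqgm => z; rewrite hA.
- exact: (smooth_mD i x _ sG).1.
- exact: (smooth_mD i x _ sG).2.
Qed.
Lemma T_Z i c G : smooth G -> T i (fun x => c * G x) = fun x => c * T i G x.
by move=> sG; apply/funext => x; rewrite (T_indepM (A := fun=> c)). Qed.
Lemma T_indep i F x : (forall t, F (push x (inl i) t) = F x) -> T i F x = F x.
by move=> h; rewrite /T (_ : (fun z => _) = fun=> F x) ?gm_cst//; apply/funext.
Qed.
Lemma T_scale0 i F x : x (inr i) = 0 -> T i F x = F x.
move=> h; rewrite /T (_ : (fun z => _) = fun=> F x) ?gm_cst//.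
by apply/funext => z; rewrite h mul0r push0.
Qed.
Lemma T_le i F G x : smooth F -> smooth G ->
 (forall z, F (push x (inl i) (x (inr i) * z)) <= G (push x (inl i) (x (inr i) * z))) ->
 T i F x <= T i G x.
move=> sF sG h; apply: ler_gauss_mean => //.
all: by have [? ?] := smooth_mD i x (x (inr i)) sF; have [? ?] := smooth_mD i x (x (inr i)) sG.
Qed.

Definition P (s : seq I) F : V -> R := foldr T F s.

Lemma smooth_P s F : smooth F -> smooth (P s F).
by move=> sF; elim: s => //= i s; exact: smooth_T. Qed.
Lemma P_D s F G : smooth F -> smooth G ->
 P s (fun x => F x + G x) = fun x => P s F x + P s G x.
by move=> sF sG; elim: s => //= i s ->; rewrite T_D//; exact: smooth_P. Qed.
Lemma P_Z s c G : smooth G -> P s (fun x => c * G x) = fun x => c * P s G x.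
by move=> sG; elim: s => //= i s ->; rewrite T_Z//; exact: smooth_P. Qed.
Lemma P_B s F G : smooth F -> smooth G ->
 P s (fun x => F x - G x) = fun x => P s F x - P s G x.
move=> sF sG; rewrite (_ : (fun x => F x - G x) = fun x => F x + (-1) * G x); last first.
 by apply/funext => x; rewrite mulN1r.
by rewrite P_D ?P_Z//; [apply/funext => x; rewrite mulN1r|exact: smoothZ].
Qed.

Lemma P_cst s c : P s (fun=> c) = fun=> c.
by elim: s => //= i s ->; apply/funext => x; exact: T_indep. Qed.
Lemma P_sum s (J : Type) (r : seq J) (Q : pred J) (f : J -> V -> R) : (forall j, smooth (f j)) ->
 P s (fun x => \sum_(j <- r | Q j) f j x) = fun x => \sum_(j <- r | Q j) P s (f j) x.
move=> h; elim: r => [|j r IH].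
 under eq_fun do rewrite big_nil; rewrite P_cst.
 by apply/funext => x; rewrite big_nil.
case Qj: (Q j); last first.
 rewrite (_ : (fun x => _) = fun x => \sum_(j <- r | Q j) f j x) ?IH.
 by apply/funext => x; rewrite big_cons Qj.
 by apply/funext => x; rewrite big_cons Qj.
rewrite (_ : (fun x => _) = fun x => f j x + \sum_(j <- r | Q j) f j x); last first.
 by apply/funext => x; rewrite big_cons Qj.
rewrite P_D//; last exact: smooth_sum.
by rewrite IH; apply/funext => x; rewrite big_cons Qj.
Qed.

Lemma P_le_on s (Q : V -> Prop) F G x : smooth F -> smooth G ->
 (forall x i z, i \in s -> Q x -> Q (push x (inl i) (x (inr i) * z))) ->
 (forall x, Q x -> F x <= G x) -> Q x -> P s F x <= P s G x.
move=> sF sG; elim: s x => [|i s IH] x hQ h Qx /=; first exact: h.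
apply: T_le; [exact: smooth_P|exact: smooth_P|] => z; apply: IH => //.
 by move=> y j w js; apply: hQ; rewrite in_cons js orbT.
by apply: hQ => //; rewrite in_cons eqxx.
Qed.

Lemma P_le s F G x : smooth F -> smooth G -> (forall x, F x <= G x) -> P s F x <= P s G x.
by move=> sF sG h; apply: (@P_le_on s (fun=> True)). Qed.
Lemma P_ge0 s F x : smooth F -> (forall x, 0 <= F x) -> 0 <= P s F x.
move=> sF h; rewrite -[leLHS](_ : P s (fun=> 0) x = 0); last by rewrite P_cst.
by apply: P_le => //; exact: smooth_cst.
Qed.
Lemma P_eq_on s (Q : V -> Prop) F G x :
 (forall x i z, i \in s -> Q x -> Q (push x (inl i) (x (inr i) * z))) ->
 (forall x, Q x -> F x = G x) -> Q x -> P s F x = P s G x.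
elim: s x => [|i s IH] x hQ h Qx /=; first exact: h.
eqgm => z; apply: IH => //.
 by move=> y j w js; apply: hQ; rewrite in_cons js orbT.
by apply: hQ => //; rewrite in_cons eqxx.
Qed.

Lemma D_T k i F : smooth F -> D k (T i F) = DT k i F.
by move=> sF; apply: pd_D; exact: pd_T. Qed.
Lemma D_P_inl j s F : smooth F -> D (inl j) (P s F) = P s (D (inl j) F).
move=> sF; elim: s => //= i s IH; rewrite D_T; last exact: smooth_P.
by rewrite /DT IH; apply/funext => x; rewrite mul0r addr0.
Qed.
Lemma D_P_notin j s F : j \notin s -> smooth F -> D (inr j) (P s F) = P s (D (inr j) F).
move=> + sF; elim: s => //= i s IH; rewrite in_cons negb_or => /andP[ji /IH e].
rewrite D_T; last exact: smooth_P.
rewrite /DT e; apply/funext => x.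
by rewrite (_ : (inr j == inr i) = false) ?mul0r ?addr0//; apply/negbTE; apply: contraNneq ji => -[->].
Qed.

(** [F] does not see the standard deviation of [j], so the only contribution is the heat term of the
    average over [j], which occurs exactly once in [s]. *)
Lemma D_P_in j s F : uniq s -> j \in s -> smooth F -> D (inr j) F = (fun=> 0) ->
 D (inr j) (P s F) = fun x => x (inr j) * P s (D (inl j) (D (inl j) F)) x.
move=> + + sF F0; have [_ s1] := smooth_ex (inl j) sF; have [_ s2] := smooth_ex (inl j) s1.
elim: s => //= i s IH /andP[is_ us]; rewrite in_cons D_T; last exact: smooth_P.
case: (eqVneq j i) is_ => [<-|ji] is_ /= js; rewrite /DT.
 rewrite D_P_notin// F0 P_cst D_P_inl// D_P_inl// eqxx; apply/funext => x.
 by rewrite (_ : true%:R = 1 :> R)// mul1r T_indep ?add0r.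
rewrite IH//; apply/funext => x.
rewrite (_ : (inr j == inr i) = false) ?mul0r ?addr0; last first.
 by apply/negbTE; apply: contraNneq ji => -[->].
rewrite (T_indepM (A := fun x => x (inr j)))//; first exact: smooth_P.
by move=> t; rewrite /push addr0.
Qed.

Lemma P_push s (Q : V -> Prop) A i :
 (forall x j z, j \in s -> Q x -> Q (push x (inl j) (x (inr j) * z))) ->
 (forall x z, Q x -> A (push x (inl i) (x (inr i) * z)) = A x) ->
 forall x z, Q x -> P s A (push x (inl i) (x (inr i) * z)) = P s A x.
move=> + hA; elim: s => [|j s IH] hQ x z Qx /=; first exact: hA.
eqgm => w.
have e (l : I) : push x (inl i) (x (inr i) * z) (inr l) = x (inr l) by rewrite /push addr0.
rewrite e pushC.
have -> : x (inr i) * z = push x (inl j) (x (inr j) * w) (inr i) * z by rewrite /push addr0.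
apply: IH; last by apply: hQ; rewrite ?in_cons ?eqxx.
by move=> y k t ks; apply: hQ; rewrite in_cons ks orbT.
Qed.

(* Independence: [A] and [B] share no active coordinate. *)
Lemma P_indepM s A B x (Q : V -> Prop) : smooth A -> smooth B ->
 (forall x i z, i \in s -> Q x -> Q (push x (inl i) (x (inr i) * z))) ->
 (forall i, i \in s ->
 (forall x z, Q x -> A (push x (inl i) (x (inr i) * z)) = A x) \/
 (forall x z, Q x -> B (push x (inl i) (x (inr i) * z)) = B x)) ->
 Q x -> P s (fun x => A x * B x) x = P s A x * P s B x.
move=> sA sB; elim: s x => //= i s IH x hQ h Qx.
have Qi z : Q (push x (inl i) (x (inr i) * z)) by apply: hQ; rewrite ?in_cons ?eqxx.
have hQs y j w : j \in s -> Q y -> Q (push y (inl j) (y (inr j) * w)).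
 by move=> js; apply: hQ; rewrite in_cons js orbT.
have hs j : j \in s -> (forall x z, Q x -> A (push x (inl j) (x (inr j) * z)) = A x) \/
 (forall x z, Q x -> B (push x (inl j) (x (inr j) * z)) = B x).
 by move=> js; apply: h; rewrite in_cons js orbT.
rewrite /T (_ : (fun z => _) = fun z => P s A (push x (inl i) (x (inr i) * z)) *
 P s B (push x (inl i) (x (inr i) * z))); last by apply/funext => z; exact: IH.
have [hA|hB] := h i (mem_head _ _).
- under eq_fun do rewrite (P_push hQs hA)//.
 rewrite gmZ; [|exact: (smooth_mD i x _ (smooth_P s sB)).1|exact: (smooth_mD i x _ (smooth_P s sB)).2].
 congr (_ * _); rewrite -[LHS]gm_cst; congr gm.
 by apply/funext => z; rewrite (P_push hQs hA).
- under eq_fun do rewrite (P_push hQs hB)// mulrC.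
 rewrite gmZ; [|exact: (smooth_mD i x _ (smooth_P s sA)).1|exact: (smooth_mD i x _ (smooth_P s sA)).2].
 rewrite mulrC; congr (_ * _); rewrite -[LHS]gm_cst; congr gm.
 by apply/funext => z; rewrite (P_push hQs hB).
Qed.

(** Interpolations are linear in variances whereas environments store standard deviations; every
    Gaussian coordinate starts from the value 0. *)
Definition vec (A : I -> R) : V := fun k => if k is inr i then sqr (A i) else 0.
Definition mix (A B : I -> R) s : I -> R := fun i => (1 - s) * A i + s * B i.

Section Interp.
Variables (F : V -> R) (h : I -> V -> R) (A B : I -> R).
Hypotheses (sF : smooth F) (A0 : forall i, 0 <= A i) (B0 : forall i, 0 <= B i).
Hypothesis Fh : forall i, D (inr i) F = fun x => x (inr i) * h i x.

(** The factor [1 / (2 * sqr v)] from differentiating a standard deviation cancels the factor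
    [x (inr i)] of [Fh], so nothing blows up near variance 0. *)
Lemma interp_der (s : R) : 0 < s < 1 ->
 is_derive s 1 (fun s => F (vec (mix A B s)))
 (2^-1 * \sum_i (B i - A i) * h i (vec (mix A B s))).
move=> /andP[s0 s1].
pose gam' : V := fun k => if k is inr i then (2 * sqr (mix A B s i))^-1 * (B i - A i) else 0.
(* A variance that vanishes at an interior time vanishes at both ends; the coordinate is then
   constant along the path. *)
have AB i : mix A B s i = 0 -> B i = A i.
 rewrite /mix => e; have a0 := A0 i; have b0 := B0 i; nra.
have m0 i : 0 <= mix A B s i by have := A0 i; have := B0 i; rewrite /mix; nra.
have dm i : is_derive s 1 (fun t : R => mix A B t i) (B i - A i).
 have -> : (fun t : R => mix A B t i) = cst (A i) + (B i - A i) *: id.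
 by apply/funext => t; rewrite !fctE -[_ *: _]/(_ * _) /mix; ring.
 have : is_derive s 1 (cst (A i) + (B i - A i) *: id : R -> R) (0 + (B i - A i) *: 1).
 exact: is_deriveD.
 by rewrite add0r -[_ *: 1]/(_ * 1) mulr1.
have dg k : is_derive s 1 ((fun t => vec (mix A B t)) ^~ k) (gam' k).
 case: k => i /=; first exact: is_derive_cst.
 have [mi0|mi0] := eqVneq (mix A B s i) 0.
 have e := AB i mi0; have a0 : A i = 0 by move: mi0; rewrite /mix e; lra.
 rewrite e subrr mulr0 (_ : (fun t => _) = cst 0); first exact: is_derive_cst.
 by apply/funext => t; rewrite /mix e a0 !mulr0 addr0 sqrtr0.
 have mpos : 0 < mix A B s i by rewrite lt_neqAle eq_sym mi0 m0.
 have sq := is_derive1_sqrt mpos.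
 have dmi : is_derive s 1 (fun t : R => mix A B t i) (B i - A i) := dm i.
 by have := @is_derive1_comp R _ (fun t : R => mix A B t i) s _ _ sq dmi.
have := smooth_chain sF dg; congr is_derive.
rewrite big_sumType/= big1 ?add0r => [|i _]; last by rewrite mul0r.
rewrite mulr_sumr; apply: eq_bigr => i _; rewrite Fh /gam' /=.
have [mi0|mi0] := eqVneq (mix A B s i) 0.
 by rewrite (AB i mi0) subrr !mul0r !mulr0 mul0r.
have : sqr (mix A B s i) != 0 by rewrite sqrtr_eq0 -ltNge lt_neqAle eq_sym mi0 m0.
by move=> ?; field.
Qed.

Lemma interp_cont : continuous (fun s : R => F (vec (mix A B s))).
move=> s; apply: (@smooth_continuous F _ (fun s => vec (mix A B s))) => // -[i|i] /=.
 exact: cvg_cst.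
apply: (@continuous_comp _ _ _ (fun t : R => mix A B t i) (@sqr R)); last exact: sqrt_continuous.
apply: cvgD; (apply: cvgM; last exact: cvg_cst); last exact: cvg_id.
by apply: cvgB; [exact: cvg_cst|exact: cvg_id].
Qed.

Lemma vec_mix0 : vec (mix A B 0) = vec A.
by congr vec; apply/funext => i; rewrite /mix subr0 mul1r mul0r addr0. Qed.
Lemma vec_mix1 : vec (mix A B 1) = vec B.
by congr vec; apply/funext => i; rewrite /mix subrr mul0r mul1r add0r. Qed.
(** The bound on the derivative may be affine in [s]; its slope integrates to [K1 / 2], which keeps
    track of second-order terms. *)
Lemma interp_le (K0 K1 : R) :
 (forall s : R, 0 < s < 1 ->
 2^-1 * \sum_i (B i - A i) * h i (vec (mix A B s)) <= K0 + K1 * s) ->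
 F (vec B) - F (vec A) <= K0 + K1 / 2.
move=> hK; pose g (s : R) := F (vec (mix A B s)).
pose p (s : R) : R := K0 * s + K1 / 2 * (s * s).
have dp (s : R) : is_derive s 1 p (K0 + K1 * s).
 have -> : p = K0 *: id + (K1 / 2) *: (id * id : R -> R).
 by apply/funext => t; rewrite !fctE -![_ *: _]/(_ * _).
 have d1 : is_derive s 1 (K0 *: id : R -> R) (K0 *: 1) by exact: is_deriveZ.
 have d2 : is_derive s 1 (id * id : R -> R) (s *: 1 + s *: 1) by exact: is_deriveM.
 have d3 : is_derive s 1 ((K1 / 2) *: (id * id) : R -> R) ((K1 / 2) *: (s *: 1 + s *: 1)).
 exact: is_deriveZ.
 have := is_deriveD d1 d3; congr is_derive.
 by rewrite -![_ *: _]/(_ * _); field.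
pose df s := 2^-1 * (\sum_i (B i - A i) * h i (vec (mix A B s))) - (K0 + K1 * s).
have dgp (s : R) : s \in `](0:R), 1[ -> is_derive s 1 (g - p) (df s).
 by rewrite in_itv/= => s01; apply: is_deriveB; exact: interp_der.
have cgp : {within `[(0:R), 1], continuous (g - p)}.
 apply: continuous_subspaceT => s; apply: cvgB; first exact: interp_cont.
 exact: (derive_cont dp).
have [c c01 e] := MVT ltr01 dgp cgp.
have : df c <= 0 by rewrite subr_le0; apply: hK; rewrite in_itv/= in c01.
move: e; rewrite !fctE /g vec_mix0 vec_mix1 /p; nra.
Qed.
End Interp.
End Env.

(** * Product averages over replicas *)

Section Replicas.
Context {R : realType} {S J : finType} (W : S -> R).
Hypothesis W1 : \sum_s W s = 1.
Implicit Types (f : {ffun J -> S} -> R) (sg : {ffun J -> S}).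

Definition upd sg m a : {ffun J -> S} := [ffun l => if l == m then a else sg l].
Definition gav f := \sum_(sg : {ffun J -> S}) (\prod_l W (sg l)) * f sg.
Definition indep f m := forall sg a, f (upd sg m a) = f sg.

Lemma upd_upd sg m a c : upd (upd sg m a) m c = upd sg m c.
by apply/ffunP => l; rewrite !ffunE; case: eqP. Qed.
Lemma upd_id sg m : upd sg m (sg m) = sg.
by apply/ffunP => l; rewrite ffunE; case: eqP => [->|]. Qed.
Lemma updE sg m a : upd sg m a m = a.
by rewrite ffunE eqxx. Qed.
Lemma prod_upd sg m a : (\prod_l W (upd sg m a l)) * W (sg m) = (\prod_l W (sg l)) * W a.
rewrite (bigD1 m)//= [in RHS](bigD1 m)//= updE.
rewrite (eq_bigr (fun l => W (sg l))) => [|l /negbTE lm]; last by rewrite ffunE lm.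
by rewrite mulrAC [RHS]mulrAC [W a * _]mulrC.
Qed.

(** Exchanging replica [m] with an independent copy is an injection of the finite set of pairs into
    itself that preserves the product weights. *)
Lemma gav_resample m f : gav f = gav (fun sg => \sum_a W a * f (upd sg m a)).
rewrite /gav; under [RHS]eq_bigr do rewrite mulr_sumr.
rewrite pair_big/= (reindex_inj (h := fun p : {ffun J -> S} * S => (upd p.1 m p.2, p.1 m)))/=.
 transitivity (\sum_(p : {ffun J -> S} * S) (\prod_l W (p.1 l)) * f p.1 * W p.2).
 rewrite -(pair_big xpredT xpredT (fun (sg : {ffun J -> S}) a => (\prod_l W (sg l)) * f sg * W a))/=.
 by apply: eq_bigr => sg _; rewrite -mulr_sumr W1 mulr1.
 by apply: eq_bigr => -[sg a] _ /=; rewrite upd_upd upd_id mulrA prod_upd mulrAC.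
move=> [s1 a1] [s2 a2] /= [e1 e2].
have e3 : a1 = a2 by move/ffunP: e1 => /(_ m); rewrite !updE.
congr pair => //; apply/ffunP => l; have [->//|lm] := eqVneq l m.
by move/ffunP: e1 => /(_ l); rewrite !ffunE (negbTE lm).
Qed.

Lemma gavZ c f : gav (fun sg => c * f sg) = c * gav f.
by rewrite /gav mulr_sumr; apply: eq_bigr => sg _; rewrite mulrCA. Qed.
Lemma gavD f g : gav (fun sg => f sg + g sg) = gav f + gav g.
by rewrite /gav -big_split/=; apply: eq_bigr => sg _; rewrite mulrDr. Qed.
Lemma gav_sum (L : Type) (s : seq L) (Q : pred L) (f : L -> {ffun J -> S} -> R) :
 gav (fun sg => \sum_(l <- s | Q l) f l sg) = \sum_(l <- s | Q l) gav (f l).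
rewrite /gav exchange_big/=; apply: eq_bigr => sg _; rewrite mulr_sumr//.
Qed.
Lemma eq_gav f g : f =1 g -> gav f = gav g.
by move=> /funext ->. Qed.
Lemma gav_mul f (g : S -> R) m : indep f m ->
 gav (fun sg => f sg * g (sg m)) = gav f * \sum_a W a * g a.
move=> fm; rewrite (gav_resample m) mulrC -gavZ; apply: eq_gav => sg.
by rewrite mulr_suml; apply: eq_bigr => a _; rewrite fm updE mulrA mulrAC.
Qed.
Lemma gav_cst c : gav (fun=> c) = c.
rewrite /gav -mulr_suml -(bigA_distr_bigA (fun _ : J => W)) /=.
by rewrite big1 ?mul1r.
Qed.
Hypothesis W0 : forall s, 0 <= W s.

Lemma prodW_ge0 sg : 0 <= \prod_l W (sg l).
by apply: prodr_ge0 => l _; exact: W0. Qed.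
Lemma gav_le f g : (forall sg, f sg <= g sg) -> gav f <= gav g.
by move=> h; apply: ler_sum => sg _; rewrite ler_wpM2l ?prodW_ge0. Qed.
Lemma gav_perm f (pi : J -> J) (pi_inj : injective pi) : gav (fun sg => f [ffun l => sg (pi l)]) = gav f.
rewrite /gav [RHS](reindex_inj (h := fun sg : {ffun J -> S} => [ffun l => sg (pi l)]))/=.
 apply: eq_bigr => sg _; congr (_ * _).
 rewrite (reindex_inj pi_inj)/=; apply: eq_bigr => l _; rewrite ffunE//.
move=> s1 s2 /ffunP e; apply/ffunP => l; have := e (invF pi_inj l).
by rewrite !ffunE f_invF.
Qed.

Lemma gav_two (g : S -> S -> R) m m' : m != m' ->
 gav (fun sg : {ffun J -> S} => g (sg m) (sg m')) = \sum_a W a * \sum_c W c * g a c.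
move=> mm; rewrite (gav_resample m) -[RHS](gav_cst) [LHS](gav_resample m'); apply: eq_gav => sg.
under eq_bigr do rewrite mulr_sumr; rewrite exchange_big/=; apply: eq_bigr => a _.
rewrite mulr_sumr; apply: eq_bigr => c _.
by rewrite updE ffunE eq_sym (negbTE mm) updE mulrCA.
Qed.
End Replicas.

(** * Gibbs measures with Gaussian energies and their derivatives *)

Section Gibbs.
Context {R : realType} {I S : finType}.
Notation V := (I + I -> R).
Variables (a b : S -> R) (v : I -> S -> R) (s0 : S).
Hypotheses (a0 : forall s, 0 <= a s) (as0 : 0 < a s0).

(** [a] is an a priori weight, which may vanish to impose a constraint; [b] is the deterministic
    energy and [v] gives the coefficients of the Gaussian coordinates. Only values, not standard
    deviations, enter the energy. *)
Definition En s (x : V) : R := b s + \sum_k v k s * x (inl k).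
Definition Zf (x : V) : R := \sum_s a s * expR (En s x).
Definition wt s (x : V) : R := a s * expR (En s x) / Zf x.
Definition wav (g : S -> R) (x : V) : R := \sum_s wt s x * g s.

Lemma smooth_En s : smooth (En s).
apply: smoothD; first exact: smooth_cst.
by apply: smooth_sum => k; apply: smoothZ; exact: smooth_coord.
Qed.
Lemma En_bound s : exists2 C, 0 <= C & forall x, `|En s x| <= C + C * nrm x.
exists (`|b s| + \sum_k `|v k s|) => [|x]; first by rewrite addr_ge0// sumr_ge0.
rewrite (le_trans (ler_normD _ _))// lerD//; first by rewrite lerDl sumr_ge0.
rewrite (le_trans (ler_norm_sum _ _ _))// mulrDl (@le_trans _ _ (\sum_k `|v k s| * nrm x))//.
 by apply: ler_sum => k _; rewrite normrM ler_wpM2l// /nrm (bigD1 k)//= lerDl sumr_ge0.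
by rewrite -mulr_suml lerDr mulr_ge0// nrm_ge0.
Qed.

Lemma growth_expEn s (e : R) : `|e| <= 1 -> growth (fun x => expR (e * En s x)).
move=> e1 B; have [C C0 hC] := En_bound s; exists (expR C + C); split=> [|x _].
 by rewrite addr_ge0 ?expR_ge0.
have nx := nrm_ge0 x.
rewrite ger0_norm ?expR_ge0// (@le_trans _ _ (expR C * expR (C * nrm x)))//.
 rewrite -expRD ler_expR (le_trans (ler_norm _))// normrM (le_trans _ (hC x))//.
 by rewrite ler_piMl.
by apply: ler_pM; rewrite ?expR_ge0// ?lerDl// ler_expR ler_wpM2r// lerDr expR_ge0.
Qed.

Lemma smooth_expEn s : smooth (fun x => expR (En s x)).
apply: smooth_exp; first exact: smooth_En.
have := @growth_expEn s 1; rewrite normr1 => /(_ (lexx _)).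
by under eq_fun do rewrite mul1r.
Qed.
Lemma Zf_gt0 x : 0 < Zf x.
rewrite /Zf (bigD1 s0)//= ltr_wpDr ?mulr_gt0 ?expR_gt0//.
by apply: sumr_ge0 => s _; rewrite mulr_ge0// expR_ge0.
Qed.
Lemma smooth_Zf : smooth Zf.
by apply: smooth_sum => s; apply: smoothZ; exact: smooth_expEn. Qed.
(** The single configuration [s0] bounds [Zf] from below by the exponential of an affine form. *)
Lemma growth_iZ : growth (fun x => (Zf x)^-1).
apply: (growth_le (G := fun x => (a s0)^-1 * expR ((-1) * En s0 x))); last first.
 by apply: growthM; [exact: growth_cst|apply: growth_expEn; rewrite normrN1].
move=> x; have Z0 := Zf_gt0 x.
rewrite !ger0_norm ?mulr_ge0 ?expR_ge0 ?invr_ge0 ?(ltW Z0)//.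
rewrite mulN1r expRN -invfM lef_pV2 ?posrE ?mulr_gt0 ?expR_gt0//.
rewrite /Zf (bigD1 s0)//= lerDl; apply: sumr_ge0 => s _.
by rewrite mulr_ge0// expR_ge0.
Qed.

Lemma smooth_iZ : smooth (fun x => (Zf x)^-1).
apply: smooth_inv; [|exact: smooth_Zf|exact: growth_iZ].
by move=> x; rewrite gt_eqF// Zf_gt0.
Qed.
Lemma smooth_lnZ : smooth (fun x => ln (Zf x)).
by apply: smooth_ln; [exact: Zf_gt0|exact: smooth_Zf|exact: growth_iZ]. Qed.
Lemma smooth_wt s : smooth (wt s).
by apply: smoothM; [apply: smoothZ; exact: smooth_expEn|exact: smooth_iZ]. Qed.
Lemma smooth_wav g : smooth (wav g).
by apply: smooth_sum => s; apply: smoothM; [exact: smooth_wt|exact: smooth_cst].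
Qed.
Lemma wt_sum x : \sum_s wt s x = 1.
by rewrite -mulr_suml divff// gt_eqF// Zf_gt0. Qed.
Lemma wt_ge0 s x : 0 <= wt s x.
by rewrite divr_ge0// ?mulr_ge0 ?expR_ge0// ltW// Zf_gt0. Qed.

Definition dE (k : I + I) s : R := if k is inl i then v i s else 0.

Lemma pd_En k s : pd k (En s) (fun=> dE k s).
apply: pd_ext (pdD (pd_cst k (b s)) (@pd_sum _ _ k _ (index_enum I) xpredT
 (fun i x => v i s * x (inl i)) _ (fun i => pdZ (v i s) (pd_coord k (inl i))))) => x //.
rewrite add0r /dE; case: k => i; last by rewrite big1// => j _; rewrite mulr0.
rewrite (bigD1 i)//= eqxx mulr1 big1 ?addr0// => j ji.
rewrite (_ : (inl j == inl i) = false) ?mulr0//.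
by apply/negbTE; apply: contraNneq ji => -[->].
Qed.

Lemma pd_Zf k : pd k Zf (fun x => Zf x * wav (dE k) x).
apply: pd_ext (@pd_sum _ _ k _ (index_enum S) xpredT (fun s x => a s * expR (En s x)) _
 (fun s => pdZ (a s) (pd_exp (pd_En k s)))) => x //.
rewrite /wav mulr_sumr; apply: eq_bigr => s _.
by rewrite /wt mulrA mulrA [Zf x * _]mulrC mulfVK ?mulrA// gt_eqF// Zf_gt0.
Qed.

Lemma pd_lnZ k : pd k (fun x => ln (Zf x)) (wav (dE k)).
apply: pd_ext (pd_ln Zf_gt0 (pd_Zf k)) => x //.
by rewrite mulKf// gt_eqF// Zf_gt0.
Qed.
Lemma pd_wt k s : pd k (wt s) (fun x => wt s x * (dE k s - wav (dE k) x)).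
have Z0 x : Zf x != 0 by rewrite gt_eqF// Zf_gt0.
apply: pd_ext (pdM (pdZ (a s) (pd_exp (pd_En k s))) (pd_inv Z0 (pd_Zf k))) => x //.
by have ? := Z0 x; rewrite /wt -/(dE k s); field.
Qed.
Lemma pd_wav k g : pd k (wav g) (fun x => wav (fun s => g s * dE k s) x - wav g x * wav (dE k) x).
apply: pd_ext (@pd_sum _ _ k _ (index_enum S) xpredT (fun s x => wt s x * g s) _
 (fun s => pdM (pd_wt k s) (pd_cst k (g s)))) => x //.
rewrite /wav mulr_suml -sumrB; apply: eq_bigr => s _; rewrite mulr0 addr0 -/(wav _ _).
by ring.
Qed.

Definition gibbs (J : finType) (f : {ffun J -> S} -> R) (x : V) : R :=
 gav (fun s => wt s x) f.

Lemma smooth_gibbs (J : finType) (f : {ffun J -> S} -> R) : smooth (gibbs f).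
apply: smooth_sum => sg; apply: smoothM; last exact: smooth_cst.
by apply: smooth_prod => l; exact: smooth_wt.
Qed.
Lemma pd_prod_wt k (J : finType) (sg : {ffun J -> S}) :
 pd k (fun x => \prod_l wt (sg l) x)
 (fun x => (\prod_l wt (sg l) x) * (\sum_l dE k (sg l) - #|J|%:R * wav (dE k) x)).
rewrite (_ : #|J|%:R = \sum_(l : J) 1); last by rewrite sumr_const.
elim: (index_enum J) => [|j s IH].
 apply: pd_ext (pd_cst k 1) => x; rewrite !big_nil//.
 by rewrite mul0r subr0 mulr0.
apply: pd_ext (pdM (pd_wt k (sg j)) IH) => x; rewrite !big_cons//.
ring.
Qed.

Lemma pd_gibbs0 k (J : finType) (f : {ffun J -> S} -> R) :
 pd k (gibbs f) (fun x => gibbs (fun sg => f sg * \sum_l dE k (sg l)) x -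
 #|J|%:R * (gibbs f x * wav (dE k) x)).
apply: pd_ext (@pd_sum _ _ k _ (index_enum {ffun J -> S}) xpredT
 (fun sg x => (\prod_l wt (sg l) x) * f sg) _
 (fun sg => pdM (pd_prod_wt k sg) (pd_cst k (f sg)))) => x //.
rewrite /gibbs /gav mulr_suml mulr_sumr -sumrB; apply: eq_bigr => sg _.
ring.
Qed.

Section PdGibbs.
Variables (M : nat) (f : {ffun 'I_M -> S} -> R) (n : nat).
Hypotheses (nM : (n < M)%N) (fi : forall l : 'I_M, (n <= l)%N -> indep f l).

(* differentiating a function of the first [n] replicas brings in replica number [n] *)
Definition gam (l : 'I_M) : R := (l < n)%N%:R - n%:R * (l == n :> nat)%:R.

Lemma sum_gam : \sum_l gam l = 0.
rewrite /gam sumrB -mulr_sumr -natr_sum -big_mkcond/=.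
rewrite -(big_ord_widen _ (fun=> 1%N))//; last exact: ltnW.
rewrite sum1_card card_ord (bigD1 (Ordinal nM))//= eqxx big1 ?addr0 ?mulr1 ?subrr//.
by move=> l; rewrite -val_eqE/= => /negbTE ->.
Qed.

(** All [M] replicas are differentiated, but each replica [l >= n] is independent of [f] and
    contributes the same product, which cancels against the normalisation except for the
    multiplicity recorded on replica [n]. *)
Lemma pd_gibbs k : pd k (gibbs f) (gibbs (fun sg => f sg * \sum_l gam l * dE k (sg l))).
apply: pd_ext (pd_gibbs0 k f) => x //.
have wm (l : 'I_M) : (n <= l)%N -> gibbs (fun sg => f sg * dE k (sg l)) x = gibbs f x * wav (dE k) x.
 by move=> nl; rewrite /gibbs (gav_mul (wt_sum x) _ (fi nl)).
have e (g : 'I_M -> R) : gibbs (fun sg => f sg * \sum_l g l * dE k (sg l)) x =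
 \sum_l g l * gibbs (fun sg => f sg * dE k (sg l)) x.
 rewrite /gibbs (_ : (fun sg => _) = fun sg => \sum_l g l * (f sg * dE k (sg l))).
 by rewrite gav_sum; apply: eq_bigr => l _; rewrite gavZ.
 by apply/funext => sg; rewrite mulr_sumr; apply: eq_bigr => l _; rewrite mulrCA.
rewrite e (_ : (fun sg => _) = fun sg : {ffun 'I_M -> S} => f sg * \sum_l 1 * dE k (sg l)); last first.
 by apply/funext => sg; under [in RHS]eq_bigr do rewrite mul1r.
rewrite e card_ord.
set c := gibbs f x * _.
have h l : 1 * gibbs (fun sg => f sg * dE k (sg l)) x =
 gam l * gibbs (fun sg => f sg * dE k (sg l)) x + (1 - gam l) * c.
 case: (ltnP l n) => [ln|nl]; last by rewrite wm// -/c; ring.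
 by rewrite /gam ln (ltn_eqF ln)/= mulr0 subr0 subrr mul0r addr0 mul1r.
rewrite (eq_bigr _ (fun l _ => h l)) big_split/= -mulr_suml sumrB sumr_const card_ord.
by rewrite sum_gam subr0 addrK.
Qed.
End PdGibbs.

Lemma gibbs_inr i (J : finType) (f : {ffun J -> S} -> R) : D (inr i) (gibbs f) = fun=> 0.
apply: pd_D; apply: pd_ext (pd_gibbs0 (inr i) f) => x //.
rewrite (_ : (fun sg => _) = fun=> 0); last by apply/funext => sg; rewrite big1 ?mulr0.
rewrite /gibbs (gav_cst (wt_sum x)) /wav big1 ?mulr0 ?subrr// => s _.
by rewrite mulr0.
Qed.
Variable cs : seq I.
Hypotheses (csU : uniq cs) (csA : forall i, i \in cs).

Definition nu (A : I -> R) (J : finType) (f : {ffun J -> S} -> R) : R :=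
 P cs (gibbs f) (vec A).

Lemma eq_nu A (J : finType) (f g : {ffun J -> S} -> R) : f =1 g -> nu A f = nu A g.
by move=> /funext ->. Qed.
Lemma nuD A (J : finType) (f g : {ffun J -> S} -> R) :
 nu A (fun sg => f sg + g sg) = nu A f + nu A g.
rewrite /nu (_ : gibbs _ = fun x => gibbs f x + gibbs g x).
 by rewrite P_D//; exact: smooth_gibbs.
by apply/funext => x; rewrite /gibbs gavD.
Qed.
Lemma nuZ A (J : finType) c (f : {ffun J -> S} -> R) :
 nu A (fun sg => c * f sg) = c * nu A f.
rewrite /nu (_ : gibbs _ = fun x => c * gibbs f x).
 by rewrite P_Z//; exact: smooth_gibbs.
by apply/funext => x; rewrite /gibbs gavZ.
Qed.
Lemma nuB A (J : finType) (f g : {ffun J -> S} -> R) :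
 nu A (fun sg => f sg - g sg) = nu A f - nu A g.
rewrite (@eq_nu _ _ _ (fun sg => f sg + (-1) * g sg)).
 by rewrite nuD nuZ mulN1r.
by move=> sg; rewrite mulN1r.
Qed.
Lemma nu_sum A (J : finType) (L : Type) (s : seq L) (Q : pred L) (f : L -> {ffun J -> S} -> R) :
 nu A (fun sg => \sum_(l <- s | Q l) f l sg) = \sum_(l <- s | Q l) nu A (f l).
rewrite /nu (_ : gibbs _ = fun x => \sum_(l <- s | Q l) gibbs (f l) x).
 by rewrite P_sum// => l; exact: smooth_gibbs.
by apply/funext => x; rewrite /gibbs gav_sum.
Qed.

Lemma nu_cst A (J : finType) c : nu A (fun _ : {ffun J -> S} => c) = c.
rewrite /nu (_ : gibbs _ = fun=> c); first by rewrite P_cst.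
by apply/funext => x; rewrite /gibbs (gav_cst (wt_sum x)).
Qed.
Lemma nu_le A (J : finType) (f g : {ffun J -> S} -> R) : (forall sg, f sg <= g sg) ->
 nu A f <= nu A g.
move=> fg; apply: P_le; [exact: smooth_gibbs..|move=> x].
by apply: gav_le => // s; exact: wt_ge0.
Qed.
Lemma nu_norm A (J : finType) (f : {ffun J -> S} -> R) : `|nu A f| <= nu A (fun sg => `|f sg|).
rewrite ler_norml -mulN1r -nuZ; apply/andP; split; apply: nu_le => sg; last exact: ler_norm.
by rewrite mulN1r lerNl -normrN ler_norm.
Qed.
Lemma nu_perm A (J : finType) (f : {ffun J -> S} -> R) (pi : J -> J) : injective pi ->
 nu A (fun sg => f [ffun l => sg (pi l)]) = nu A f.
by move=> pi_inj; congr P; apply/funext => x; rewrite /gibbs gav_perm.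
Qed.

Definition Cov (w : I -> R) s t : R := \sum_i w i * v i s * v i t.

Section NuDer.
Variables (M : nat) (f : {ffun 'I_M -> S} -> R) (n : nat).
Hypotheses (nM : (n.+1 < M)%N) (fi : forall l : 'I_M, (n <= l)%N -> indep f l).

(** Two differentiations at the same coordinate bring in replicas [n] and [n.+1] in turn: their
    weights meet in the covariance of the energies. The factor 1/2 is that of the heat equation. *)
Definition kern (w : I -> R) (sg : {ffun 'I_M -> S}) : R :=
 2^-1 * \sum_l \sum_l' gam n l * gam n.+1 l' * Cov w (sg l) (sg l').

Let ff i (sg : {ffun 'I_M -> S}) : R :=
 f sg * (\sum_l gam n l * v i (sg l)) * (\sum_l gam n.+1 l * v i (sg l)).

Lemma DD_gibbs i : D (inl i) (D (inl i) (gibbs f)) = gibbs (ff i).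
rewrite (pd_D (pd_gibbs (ltnW nM) fi (inl i))).
apply: pd_D; apply: (pd_gibbs nM) => l nl sg c.
rewrite fi ?(ltnW nl)//; congr (_ * _); apply: eq_bigr => l' _.
rewrite ffunE; case: eqP => // ->; rewrite /gam ltnNge (ltnW nl)/= (gtn_eqF nl).
by rewrite mulr0 subr0 !mul0r.
Qed.

Lemma nu_der A B (s : R) : (forall i, 0 <= A i) -> (forall i, 0 <= B i) -> 0 < s < 1 ->
 is_derive s 1 (fun s => nu (mix A B s) f)
 (nu (mix A B s) (fun sg => f sg * kern (fun i => B i - A i) sg)).
move=> A0 B0 s01.
have h i : D (inr i) (P cs (gibbs f)) =
 fun x => x (inr i) * P cs (gibbs (ff i)) x.
 rewrite D_P_in //; [by rewrite DD_gibbs|exact: smooth_gibbs|exact: gibbs_inr].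
have := interp_der (smooth_P _ (smooth_gibbs f)) A0 B0 h s01.
suff -> : nu (mix A B s) (fun sg => f sg * kern (fun i => B i - A i) sg) =
 2^-1 * \sum_i (B i - A i) * P cs (gibbs (ff i)) (vec (mix A B s)) by [].
under [in RHS]eq_bigr do rewrite -[P _ _ _]/(nu (mix A B s) (ff _)) -nuZ.
rewrite -nu_sum -nuZ; apply: eq_nu => sg; rewrite /kern mulrCA; congr (_ * _).
transitivity (f sg * \sum_i (B i - A i) *
 ((\sum_l gam n l * v i (sg l)) * (\sum_l gam n.+1 l * v i (sg l)))); last first.
 by rewrite mulr_sumr; apply: eq_bigr => i _; rewrite /ff; ring.
congr (_ * _); under [in RHS]eq_bigr do rewrite big_distrlr/= mulr_sumr.
rewrite [in RHS]exchange_big/=; apply: eq_bigr => l _.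
under [in RHS]eq_bigr do rewrite mulr_sumr.
rewrite [in RHS]exchange_big/=; apply: eq_bigr => l' _.
by rewrite /Cov mulr_sumr; apply: eq_bigr => i _; ring.
Qed.
End NuDer.

Lemma nu_cont (M : nat) (f : {ffun 'I_M -> S} -> R) A B :
 continuous (fun s : R => nu (mix A B s) f).
by apply: interp_cont; apply: smooth_P; exact: smooth_gibbs. Qed.

(* The derivative of the free energy only involves the covariances of two replicas. *)
Definition kern2 (w : I -> R) x : R :=
 2^-1 * \sum_s wt s x * (Cov w s s - \sum_t wt t x * Cov w s t).

Definition free A : R := P cs (fun x => ln (Zf x)) (vec A).

Lemma free_interp A B : (forall i, 0 <= A i) -> (forall i, 0 <= B i) ->
 (forall s : R, 0 < s < 1 -> is_derive s 1 (fun s => free (mix A B s))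
 (P cs (kern2 (fun i => B i - A i)) (vec (mix A B s)))) /\
 continuous (fun s : R => free (mix A B s)).
move=> A0 B0.
have sm2 i : smooth (D (inl i) (D (inl i) (fun x => ln (Zf x)))).
 by apply: (smooth_ex (inl i) (smooth_ex (inl i) smooth_lnZ).2).2.
split; last by apply: interp_cont; apply: smooth_P; exact: smooth_lnZ.
move=> s s01.
have h i : D (inr i) (P cs (fun x => ln (Zf x))) =
 fun x => x (inr i) * P cs (D (inl i) (D (inl i) (fun x => ln (Zf x)))) x.
 rewrite D_P_in //; first exact: smooth_lnZ.
 rewrite (pd_D (pd_lnZ (inr i))); apply/funext => x.
 by rewrite /wav big1// => t _; rewrite mulr0.
have := interp_der (smooth_P _ smooth_lnZ) A0 B0 h s01.
rewrite (_ : 2^-1 * _ = P cs (kern2 (fun i => B i - A i)) (vec (mix A B s)))//.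
have -> : kern2 (fun i => B i - A i) = fun x => 2^-1 * \sum_i (B i - A i) *
 D (inl i) (D (inl i) (fun x => ln (Zf x))) x.
 apply/funext => x; rewrite /kern2; congr (_ * _).
 transitivity (\sum_i (B i - A i) * (wav (fun s => v i s * v i s) x - wav (v i) x * wav (v i) x)).
 under [in RHS]eq_bigr do rewrite mulrBr; rewrite sumrB.
 under eq_bigr do rewrite mulrBr; rewrite sumrB; congr (_ - _).
 under eq_bigr do rewrite mulr_sumr; rewrite exchange_big/=; apply: eq_bigr => i _.
 by rewrite mulr_sumr; apply: eq_bigr => t _; ring.
 under eq_bigr do rewrite mulr_sumr; under eq_bigr do under eq_bigr do rewrite !mulr_sumr.
 under eq_bigr do rewrite exchange_big/=.
 rewrite exchange_big/=; apply: eq_bigr => i _.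
 rewrite mulr_suml mulr_sumr; apply: eq_bigr => t _.
 by rewrite !mulr_sumr; apply: eq_bigr => u _; ring.
 apply: eq_bigr => i _; rewrite (pd_D (pd_lnZ (inl i))) (pd_D (pd_wav (inl i) _))//.
rewrite P_Z ?P_sum; last 2 first.
- by move=> i; apply: smoothZ; exact: sm2.
- by apply: smooth_sum => i; apply: smoothZ; exact: sm2.
congr (_ * _); apply: eq_bigr => i _; rewrite P_Z//.
Qed.
End Gibbs.

(** * Hyperbolic functions, alone and of affine forms in the Gaussian coordinates *)

Section Hyperbolic.
Context {R : realType}.

Definition cosh (t : R) := (expR t + expR (- t)) / 2.
Definition sinh (t : R) := (expR t - expR (- t)) / 2.

Lemma cosh_ge1 t : 1 <= cosh t.
have := expR_ge1Dx t; have := expR_ge1Dx (- t); rewrite /cosh; lra.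
Qed.
Lemma cosh_gt0 t : 0 < cosh t.
exact: lt_le_trans (cosh_ge1 t). Qed.
Lemma cosh_neq0 t : cosh t != 0.
by rewrite gt_eqF// cosh_gt0. Qed.
Lemma cosh2_sinh2 t : cosh t ^+ 2 - sinh t ^+ 2 = 1.
have := expRxMexpNx_1 t; rewrite /cosh /sinh; set u := expR t; set w := expR (- t) => uw.
by rewrite -[RHS]uw; field.
Qed.
Lemma tanhE (t : R) : tanh t = sinh t / cosh t.
have c0 := cosh_gt0 t.
have e0 : expR t + expR (- t) != 0 by rewrite gt_eqF// addr_gt0 ?expR_gt0.
rewrite /tanh /sinh /cosh; field.
by rewrite e0.
Qed.
Lemma sech2E t : 1 - tanh t ^+ 2 = (cosh t)^-1 ^+ 2.
have c0 := cosh_neq0 t; have e := cosh2_sinh2 t.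
rewrite tanhE (_ : 1 - _ = (cosh t ^+ 2 - sinh t ^+ 2) / cosh t ^+ 2); last by field.
by rewrite e mul1r exprVn.
Qed.
Lemma tanhN (t : R) : tanh (- t) = - tanh t.
by rewrite /tanh opprK [X in _ / X]addrC -mulNr opprB. Qed.
Lemma coshN t : cosh (- t) = cosh t.
by rewrite /cosh opprK addrC. Qed.
Lemma sinhN t : sinh (- t) = - sinh t.
by rewrite /sinh opprK -mulNr opprB. Qed.
Lemma tanh2_le1 (t : R) : tanh t ^+ 2 <= 1.
by rewrite -subr_ge0 sech2E sqr_ge0. Qed.
Lemma tanh_norm (t : R) : `|tanh t| <= 1.
by rewrite -(@expr_le1 _ 2)// real_normK ?num_real ?tanh2_le1. Qed.
Lemma sinh_ge0 t : 0 <= t -> 0 <= sinh t.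
by move=> t0; rewrite divr_ge0// subr_ge0 ler_expR; lra.
Qed.
Lemma tanh_ge0 (t : R) : 0 <= t -> 0 <= tanh t.
by move=> t0; rewrite tanhE divr_ge0 ?sinh_ge0// ltW// cosh_gt0. Qed.
Lemma sinh_gt0 t : 0 < t -> 0 < sinh t.
by move=> t0; rewrite divr_gt0// subr_gt0 ltr_expR; lra. Qed.
Lemma tanh_gt0 (t : R) : 0 < t -> 0 < tanh t.
by move=> t0; rewrite tanhE divr_gt0 ?sinh_gt0 ?cosh_gt0. Qed.
Lemma sech_le1 t : (cosh t)^-1 <= 1.
by rewrite invf_le1 ?cosh_gt0// cosh_ge1. Qed.
Lemma sech_gt0 t : 0 < (cosh t)^-1.
by rewrite invr_gt0 cosh_gt0. Qed.
Lemma is_derive_cosh (t : R) : is_derive t 1 cosh (sinh t).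
have dN : is_derive t 1 (fun t => expR (- t)) (expR (- t) * - 1).
 exact: (@is_derive1_comp _ expR (fun t => - t)).
have := is_deriveZ (2^-1 : R) (is_deriveD (is_derive_expR t) dN).
rewrite -[_ *: (expR t + _)]/(2^-1 * (expR t + expR (- t) * - 1)) mulrN1 mulrC.
congr is_derive; apply/funext => s; by rewrite /cosh [RHS]mulrC.
Qed.

Lemma is_derive_sinh (t : R) : is_derive t 1 sinh (cosh t).
have dN : is_derive t 1 (fun t => expR (- t)) (expR (- t) * - 1).
 exact: (@is_derive1_comp _ expR (fun t => - t)).
have := is_deriveZ (2^-1 : R) (is_deriveB (is_derive_expR t) dN).
rewrite -[_ *: (expR t - _)]/(2^-1 * (expR t - expR (- t) * - 1)) mulrN1 opprK mulrC.
congr is_derive; apply/funext => s; by rewrite /sinh [RHS]mulrC.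
Qed.

Lemma cosh_le_exp t : cosh t <= expR `|t|.
have h (s : R) : 0 <= s -> cosh s <= expR s.
 by move=> s0; have : expR (- s) <= expR s; [rewrite ler_expR; lra|rewrite /cosh; lra].
have [t0|t0] := leP 0 t; first by rewrite (ger0_norm t0) h.
by rewrite (ltr0_norm t0) -coshN h// oppr_ge0 ltW.
Qed.
End Hyperbolic.

Section EnvHyp.
Context {R : realType} {I : finType}.
Notation V := (I + I -> R).
Variables (c0 : R) (w : I -> R).

Definition L (x : V) : R := c0 + \sum_k w k * x (inl k).

Definition wk (k : I + I) : R := if k is inl i then w i else 0.

Lemma pd_L k : pd k L (fun=> wk k).
exact: (pd_En (fun _ : unit => c0) (fun k _ => w k) k tt). Qed.
Lemma smooth_L : smooth L.
exact: (smooth_En (fun _ : unit => c0) (fun k _ => w k) tt). Qed.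
Lemma growth_expL (e : R) : `|e| <= 1 -> growth (fun x => expR (e * L x)).
exact: (growth_expEn (fun _ : unit => c0) (fun k _ => w k) tt). Qed.
Lemma smooth_expL (e : R) : `|e| <= 1 -> smooth (fun x => expR (e * L x)).
by move=> e1; apply: smooth_exp; [apply: smoothZ; exact: smooth_L|exact: growth_expL].
Qed.
Lemma smooth_ch : smooth (fun x => cosh (L x)).
apply: (@smooth_ext _ _ (fun x => 2^-1 * (expR (1 * L x) + expR ((-1) * L x)))).
 by move=> x; rewrite /cosh mul1r mulN1r mulrC.
by apply/smoothZ/smoothD; apply: smooth_expL; rewrite ?normr1 ?normrN1.
Qed.
Lemma smooth_sh : smooth (fun x => sinh (L x)).
apply: (@smooth_ext _ _ (fun x => 2^-1 * (expR (1 * L x) - expR ((-1) * L x)))).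
 by move=> x; rewrite /sinh mul1r mulN1r mulrC.
by apply/smoothZ/smoothB; apply: smooth_expL; rewrite ?normr1 ?normrN1.
Qed.
Lemma smooth_sc : smooth (fun x => (cosh (L x))^-1).
apply: smooth_inv; [by move=> x; exact: cosh_neq0|exact: smooth_ch|].
apply: (growth_le (G := fun=> 1)); last exact: growth_cst.
by move=> x; rewrite normr1 ger0_norm ?sech_le1// ltW// sech_gt0.
Qed.
Lemma smooth_th : smooth (fun x => tanh (L x)).
apply: (@smooth_ext _ _ (fun x => sinh (L x) * (cosh (L x))^-1)).
 by move=> x; rewrite tanhE.
exact: smoothM smooth_sh smooth_sc.
Qed.
Lemma smooth_lnch : smooth (fun x => ln (cosh (L x))).
by apply: smooth_ln; [move=> x; exact: cosh_gt0|exact: smooth_ch|exact/smooth_growth/smooth_sc].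
Qed.
Lemma pd_ch k : pd k (fun x => cosh (L x)) (fun x => sinh (L x) * wk k).
by apply: (pd_comp (f' := sinh)) (pd_L k) => x; exact: is_derive_cosh. Qed.
Lemma pd_sh k : pd k (fun x => sinh (L x)) (fun x => cosh (L x) * wk k).
by apply: (pd_comp (f' := cosh)) (pd_L k) => x; exact: is_derive_sinh. Qed.
Lemma pd_sc k : pd k (fun x => (cosh (L x))^-1) (fun x => - (cosh (L x))^-1 * tanh (L x) * wk k).
apply: pd_ext (pd_inv (fun x => cosh_neq0 (L x)) (pd_ch k)) => x //.
by have := cosh_neq0 (L x) => ?; rewrite tanhE; field.
Qed.
Lemma pd_th k : pd k (fun x => tanh (L x)) (fun x => (1 - tanh (L x) ^+ 2) * wk k).
apply: (pd_ext (F := fun x => sinh (L x) * (cosh (L x))^-1)) (pdM (pd_sh k) (pd_sc k)) => x.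
 by rewrite tanhE.
by have := cosh_neq0 (L x) => ?; rewrite tanhE; field.
Qed.

Definition chm m x := expR (m * ln (cosh (L x))).

Lemma smooth_chm m : smooth (chm m).
apply: smooth_exp; first by apply: smoothZ; exact: smooth_lnch.
move=> B; have [C C0 hC] := En_bound (fun _ : unit => c0) (fun k _ => w k) tt.
exists (expR (`|m| * C) + `|m| * C); split=> [|x _].
 by rewrite addr_ge0 ?expR_ge0 ?mulr_ge0.
have nx := nrm_ge0 x.
rewrite ger0_norm ?expR_ge0// (@le_trans _ _ (expR (`|m| * C) * expR (`|m| * C * nrm x)))//.
 rewrite -expRD ler_expR (le_trans (ler_norm _))// normrM -mulrA -mulrDr ler_wpM2l//.
 apply: le_trans (hC x); rewrite ger0_norm ?ln_ge0 ?cosh_ge1//.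
 rewrite -[leRHS]expRK ler_ln ?posrE ?cosh_gt0 ?expR_gt0//; exact: cosh_le_exp.
apply: ler_pM; rewrite ?expR_ge0// ?lerDl ?mulr_ge0// ler_expR ler_wpM2r// lerDr expR_ge0//.
Qed.
End EnvHyp.

(** * Shifting the Gaussian measure *)

Section CameronMartin.
Context {R : realType}.
Notation gamma := (@normal_prob R 0 1).
Notation mu := (@lebesgue_measure R).

Lemma egrowth_exp (a : R) : egrowth (fun z => expR (a * z)).
exists (`|a| + 1); split=> [|z]; first exact: addr_ge0.
rewrite ger0_norm ?expR_ge0// -[leLHS]mul1r ler_pM ?expR_ge0// ?lerDr// ler_expR.
by rewrite (le_trans (ler_norm _))// normrM ler_wpM2r// lerDl.
Qed.
Lemma measurable_exp (a : R) : mfun (fun z : R => expR (a * z)).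
apply: cont_meas => z; apply: continuous_comp; last exact: continuous_expR.
by cvg_scale.
Qed.
Lemma egrowth_addl (f : R -> R) a : egrowth f -> egrowth (fun z => f (a + z)).
move=> [C [C0 h]]; exists (C * expR (C * `|a|) + C); split=> [|z].
 by rewrite addr_ge0// mulr_ge0// expR_ge0.
apply: le_trans (h _) _.
apply: (@le_trans _ _ (C * expR (C * `|a|) * expR (C * `|z|))).
 by rewrite -mulrA -expRD -mulrDr ler_wpM2l// ler_expR ler_wpM2l// ler_normD.
by apply: ler_pM; rewrite ?mulr_ge0 ?expR_ge0 ?lerDl// ler_expR ler_wpM2r// lerDr mulr_ge0// expR_ge0.
Qed.

Lemma pdf_shift (a y : R) : normal_pdf 0 1 (y - a) = normal_pdf 0 1 y * expR (a * y - a ^+ 2 / 2).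
rewrite normal_pdfE ?oner_neq0// /normal_fun -mulrA -expRD; congr (_ * expR _).
by rewrite !subr0 expr1n; field.
Qed.
Let ge0_shift (f : R -> R) a : continuous f -> egrowth f -> (forall z, 0 <= f z) ->
 gm (fun z => f (a + z)) = gm (fun z => f z * expR (a * z - a ^+ 2 / 2)).
move=> cf ef f0.
have cs : continuous (fun z : R => f (a + z)).
 move=> z; apply: (@continuous_comp _ _ _ (fun z => a + z) f); last exact: cf.
 by apply: cvgD; [exact: cvg_cst|exact: cvg_id].
have ce : continuous (fun z : R => expR (a * z - a ^+ 2 / 2)).
 move=> z; apply: continuous_comp; last exact: continuous_expR.
 by apply: cvgB; [cvg_scale|exact: cvg_cst].
have mfe : mfun (fun z => f z * expR (a * z - a ^+ 2 / 2)).
 by apply: cont_meas => z; apply: cvgM; [exact: cf|exact: ce].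
rewrite !gm_fine//; last exact: cont_meas.
congr fine.
pose G (y : R) := f y * normal_pdf 0 1 (y - a).
have dF (x : R) : is_derive x 1 (fun x : R => a + x) 1.
 have : is_derive x 1 (cst a + id : R -> R) (0 + 1) by exact: is_deriveD.
 by rewrite add0r.
have dFE : (fun x : R => a + x)^`()%classic = cst 1.
 by apply/funext => x; rewrite derive1E; case: (dF x).
transitivity (\int[mu]_x (G x)%:E)%E; last first.
 by apply: eq_integral => x _; rewrite /G pdf_shift mulrA mulrAC.
rewrite [RHS](@increasing_ge0_integration_by_substitutionT _ (fun x => a + x) G).
- apply: eq_integral => x _; rewrite dFE /G /= !fctE mulr1.
 by rewrite [(a + x)%R]addrC addrK.
- by move=> x y; rewrite ltrD2l.
- by rewrite dFE => x; exact: cvg_cst.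
- by rewrite dFE; exact: is_cvg_cst.
- by rewrite dFE; exact: is_cvg_cst.
- by move=> x; case: (dF x).
- exact: cvg_addrl_Ny.
- exact: cvg_addrl.
- move=> x; apply: cvgM; first exact: cf.
 have cp : continuous (normal_pdf (0:R) 1) by exact: continuous_normal_pdf (oner_neq0 _).
 apply: (@continuous_comp _ _ _ (fun y => y - a) (normal_pdf (0:R) 1)); last exact: cp.
 by apply: cvgB; [exact: cvg_id|exact: cvg_cst].
- by move=> x; rewrite mulr_ge0// normal_pdf_ge0.
Qed.

(** The nonnegative case is a change of variables; in general it is applied to [f + |f|] and to
    [|f|], and the results are subtracted. *)
Lemma gm_shift (f : R -> R) a : continuous f -> egrowth f ->
 gm (fun z => f (a + z)) = gm (fun z => f z * expR (a * z - a ^+ 2 / 2)).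
move=> cf ef.
pose g z := `|f z|.
have cg : continuous g by move=> z; apply: cvg_norm; exact: cf.
have eg : egrowth g by apply: egrowth_le ef => z; rewrite normr_id.
have cD : continuous (fun z => f z + g z) by move=> z; apply: cvgD; [exact: cf|exact: cg].
have eD := egrowthD ef eg.
have D0 z : 0 <= f z + g z by have := ler_norm (- f z); rewrite normrN -/(g z); lra.
have ce : continuous (fun z : R => expR (a * z - a ^+ 2 / 2)).
 move=> z; apply: continuous_comp; last exact: continuous_expR.
 by apply: cvgB; [cvg_scale|exact: cvg_cst].
have ee : egrowth (fun z : R => expR (a * z - a ^+ 2 / 2)).
 under eq_fun do rewrite expRD mulrC; apply: egrowthM; [exact: egrowth_cst|exact: egrowth_exp].
have cs (h : R -> R) : continuous h -> continuous (fun z : R => h (a + z)).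
 move=> ch z; apply: (@continuous_comp _ _ _ (fun z => a + z) h); last exact: ch.
 by apply: cvgD; [exact: cvg_cst|exact: cvg_id].
have cM (h : R -> R) : continuous h -> continuous (fun z : R => h z * expR (a * z - a ^+ 2 / 2)).
 by move=> ch z; apply: cvgM; [exact: ch|exact: ce].
have := ge0_shift a cD eD D0; have := ge0_shift a cg eg (fun z => normr_ge0 _).
rewrite gmD; try exact: egrowth_addl; try by apply: cont_meas; exact: cs.
move=> ->; under [in X in _ = X -> _]eq_fun do rewrite mulrDl.
rewrite gmD; try exact: egrowthM; try by apply: cont_meas; exact: cM.
exact: addIr.
Qed.
End CameronMartin.

(** * Smooth functions of one Gaussian variable *)

Section OneD.
Context {R : realType}.
Notation gamma := (@normal_prob R 0 1).
Notation mu := (@lebesgue_measure R).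
Notation U := (unit + unit -> R)%type.

Let ge0_sym (f : R -> R) : continuous f -> (forall z, 0 <= f z) ->
 gm (fun z => f (- z)) = gm f.
move=> cf f0.
have cs : continuous (fun z : R => f (- z)).
 move=> z; apply: (@continuous_comp _ _ _ (fun z => - z) f); last exact: cf.
 by apply: (@cvgN _ R); exact: cvg_id.
have cp : continuous (normal_pdf (0:R) 1) by exact: continuous_normal_pdf (oner_neq0 _).
have ev (x : R) : normal_pdf 0 1 (- x) = normal_pdf 0 1 x.
 by rewrite normal_pdfE ?oner_neq0// /normal_fun !subr0 sqrrN.
rewrite !gm_fine; try exact: cont_meas.
congr fine.
have split_int (G : R -> R) : continuous G -> (forall x, 0 <= G x) ->
 (\int[mu]_x (G x)%:E = \int[mu]_(x in `[0%R, +oo[) (G (- x))%:E +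
 \int[mu]_(x in `[0%R, +oo[) (G x)%:E)%E.
 move=> cG G0; have mG : mfun G by exact: cont_meas.
 have -> : [set: R] = `]-oo, (- 0)%R] `|` `]0%R, +oo[.
 rewrite oppr0; apply/seteqP; split=> // x _ /=; rewrite !in_itv/= andbT.
 by have [?|?] := leP x 0; [left|right].
 rewrite ge0_integral_setU//=; first last.
 - rewrite oppr0; apply/disj_setPS => x [] /=; rewrite !in_itv/= andbT => x1 x2.
 by move: (lt_le_trans x2 x1); rewrite ltxx.
 - by move=> x _; rewrite lee_fin.
 - by apply: (measurable_funS measurableT) => //; exact/measurable_EFinP.
 congr (_ + _)%E.
 rewrite ge0_integration_by_substitutionNy//; first exact: continuous_subspaceT.
 rewrite integral_itv_obnd_cbnd//.
 by apply: (measurable_funS measurableT) => //; exact/measurable_EFinP.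
rewrite (split_int (fun x => f (- x) * normal_pdf 0 1 x)); last 2 first.
- by move=> x; apply: cvgM; [exact: cs|exact: cp].
- by move=> x; rewrite mulr_ge0// normal_pdf_ge0.
rewrite (split_int (fun x => f x * normal_pdf 0 1 x)); last 2 first.
- by move=> x; apply: cvgM; [exact: cf|exact: cp].
- by move=> x; rewrite mulr_ge0// normal_pdf_ge0.
rewrite [LHS]addeC; apply: (congr2 (fun a b => (a + b)%E)).
 by apply: eq_integral => x _; rewrite ev.
by apply: eq_integral => x _; rewrite opprK ev.
Qed.

(** A function of one variable is seen as a function of one Gaussian coordinate, so that smoothness
    and growth come from the general theory. *)
Definition sm1 (f : R -> R) := smooth (fun x : U => f (x (inl tt))).

Definition u1 (t : R) : U := fun k => if k is inl _ then t else 0.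

Lemma push_u1 t s : push (u1 t) (inl tt) s = u1 (t + s).
by apply/funext => -[[]|[]]; rewrite /push/= ?mulr1n ?addr0. Qed.
Lemma sm1_der f : sm1 f -> exists2 f', (forall t : R, is_derive t 1 f (f' t)) & sm1 f'.
move=> sf; have [df sf'] := smooth_ex (inl tt) sf.
set F' := D _ _ in df sf'.
have e x : F' x = F' (u1 (x (inl tt))).
 by congr ('D_1 _ (0:R)); apply/funext => t; rewrite !pushE.
have d (t : R) : is_derive t 1 f (F' (u1 t)).
 have := pd_at (u1 0) t df; rewrite push_u1 add0r; congr is_derive.
 by apply/funext => s /=; rewrite push_u1/= add0r.
exists (fun t => F' (u1 t)) => //; apply: smooth_ext sf' => x; exact: e.
Qed.

Lemma sm1_cont f : sm1 f -> continuous f.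
by move=> /sm1_der[f' df _]; exact: derive_cont df. Qed.
Lemma sm1_meas f : sm1 f -> mfun f.
by move=> /sm1_cont; exact: cont_meas. Qed.
Lemma sm1_eg f : sm1 f -> egrowth f.
move=> sf; have [C [C0 hC]] := smooth_growth sf 0; exists C; split=> // t.
have := hC (u1 t); rewrite /nrm (bigD1 tt)//= [X in `|t| + X]big1 ?addr0.
 by apply=> i; rewrite normr0.
by case.
Qed.
Lemma sm1_push (I : finType) (F : (I + I -> R) -> R) x i (d : R) : smooth F ->
 sm1 (fun t => F (push x (inl i) (d * t))).
move=> sF n; elim: n F sF => [|n IH] F sF; split=> //.
1,2: have [C [C0 hC]] := egrowth_push x i d (smooth_growth sF).
1,2: move=> B; exists C; split=> // y _; apply: le_trans (hC _) _.
1,2: by rewrite ler_wpM2l// ler_expR ler_wpM2l// /nrm (bigD1 tt)//= lerDl sumr_ge0.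
have [di si] := smooth_ex (inl i) sF.
case=> -[].
 exists (fun y => d * D (inl i) F (push x (inl i) (d * y (inl tt)))).
 move=> y; under eq_fun do rewrite pushE.
 rewrite mulrC; set c := y (inl tt).
 have h : is_derive (d * (c + 0)) 1 (fun t : R => F (push x (inl i) t))
 (D (inl i) F (push x (inl i) (d * c))) by rewrite addr0; exact: pd_at.
 apply: (@is_derive1_comp _ (fun t : R => F (push x (inl i) t)) (fun t => d * (c + t)) 0 _ d h).
 have := is_deriveZ d (is_deriveD (is_derive_cst c (0:R) 1) (is_derive_id (0:R) 1)).
 by rewrite add0r -[_ *: 1]/(d * 1) mulr1.
 by apply: smM; [exact: sm_cst|exact: IH].
exists (fun=> 0); last exact: sm_cst.
move=> y; have -> : (fun t : R => F (push x (inl i) (d * push y (inr tt) t (inl tt)))) =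
 fun=> F (push x (inl i) (d * y (inl tt))) by apply/funext => t; rewrite pushNE.
exact: is_derive_cst.
Qed.

Lemma sm1M f g : sm1 f -> sm1 g -> sm1 (fun t => f t * g t).
exact: smoothM. Qed.
Lemma sm1D f g : sm1 f -> sm1 g -> sm1 (fun t => f t + g t).
exact: smoothD. Qed.
Lemma sm1Z c f : sm1 f -> sm1 (fun t => c * f t).
exact: smoothZ. Qed.
Lemma sm1_id : sm1 id.
exact: smooth_coord. Qed.
Lemma L_unit (c d : R) (x : U) : L c (fun=> d) x = c + d * x (inl tt).
by rewrite /L (bigD1 tt)//= big1 ?addr0//; case. Qed.
Lemma sm1_ext f g : f =1 g -> sm1 f -> sm1 g.
by move=> /funext ->. Qed.
Lemma sm1_cosh (c d : R) : sm1 (fun t => cosh (c + d * t)).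
by apply: smooth_ext (smooth_ch c (fun=> d)) => x; rewrite L_unit. Qed.
Lemma sm1_sinh (c d : R) : sm1 (fun t => sinh (c + d * t)).
by apply: smooth_ext (smooth_sh c (fun=> d)) => x; rewrite L_unit. Qed.
Lemma sm1_sech (c d : R) : sm1 (fun t => (cosh (c + d * t))^-1).
by apply: smooth_ext (smooth_sc c (fun=> d)) => x; rewrite L_unit. Qed.
Lemma sm1_tanh (c d : R) : sm1 (fun t => tanh (c + d * t)).
by apply: smooth_ext (smooth_th c (fun=> d)) => x; rewrite L_unit. Qed.
Lemma sm1_lncosh (c d : R) : sm1 (fun t => ln (cosh (c + d * t))).
by apply: smooth_ext (smooth_lnch c (fun=> d)) => x; rewrite L_unit. Qed.
Lemma gmeanD f g : sm1 f -> sm1 g ->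
 gm (fun t => f t + g t) = gm f + gm g.
by move=> sf sg; rewrite gmD//; (exact: sm1_meas || exact: sm1_eg). Qed.
Lemma gmeanZ c f : sm1 f -> gm (fun t => c * f t) = c * gm f.
by move=> sf; rewrite gmZ//; (exact: sm1_meas || exact: sm1_eg). Qed.
Lemma gmean_le f g : sm1 f -> sm1 g -> (forall t, f t <= g t) -> gm f <= gm g.
by move=> sf sg; apply: ler_gauss_mean; (exact: sm1_meas || exact: sm1_eg). Qed.
Lemma gmean_ge0 (f : R -> R) : (forall t, 0 <= f t) -> 0 <= gm f.
by move=> f0; apply: Rintegral_ge0. Qed.
Lemma gmean_ibp f f' : sm1 f -> (forall t : R, is_derive t 1 f (f' t)) ->
 gm (fun t => t * f t) = gm f' /\ sm1 f'.
move=> sf df; have [f1 df1 sf1] := sm1_der sf.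
have e : f1 = f'.
 by apply/funext => t; have := df t => -[_ <-]; have := df1 t => -[_ <-].
rewrite -e; split=> //; apply: gm_ibp => //.
- exact: sm1_cont.
- exact: sm1_eg.
- exact: sm1_eg.
Qed.

Lemma gmean_sym f : sm1 f -> gm (fun t => f (- t)) = gm f.
move=> sf; have cf := sm1_cont sf; have ef := sm1_eg sf.
have cs (h : R -> R) : continuous h -> continuous (fun z : R => h (- z)).
 move=> ch z; apply: (@continuous_comp _ _ _ (fun z => - z) h); last exact: ch.
 by apply: (@cvgN _ R); exact: cvg_id.
have es (h : R -> R) : egrowth h -> egrowth (fun z : R => h (- z)).
 by move=> [C [C0 hC]]; exists C; split=> // z; have := hC (- z); rewrite normrN.
pose g z := `|f z|.
have cg : continuous g by move=> z; apply: cvg_norm; exact: cf.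
have eg : egrowth g by apply: egrowth_le ef => z; rewrite normr_id.
have cD : continuous (fun z => f z + g z) by move=> z; apply: cvgD; [exact: cf|exact: cg].
have D0 z : 0 <= f z + g z by have := ler_norm (- f z); rewrite normrN -/(g z); lra.
have := ge0_sym cD D0; have := ge0_sym cg (fun z => normr_ge0 _).
rewrite gmD; try exact: es; try by apply: cont_meas; exact: cs.
move=> ->; rewrite gmD//; try by apply: cont_meas.
exact: addIr.
Qed.

Lemma gmean_shift f a : sm1 f ->
 gm (fun z => f (a + z)) = expR (- (a ^+ 2 / 2)) * gm (fun z => f z * expR (a * z)).
move=> sf; rewrite gm_shift; [|exact: sm1_cont|exact: sm1_eg].
rewrite -gmZ; first by eqgm => z; rewrite expRD; ring.
 by apply: measurable_funM; [exact: sm1_meas|exact: measurable_exp].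
by apply: egrowthM; [exact: sm1_eg|exact: egrowth_exp].
Qed.

Lemma sm1_exp (a : R) : sm1 (fun z => expR (a * z)).
apply: (sm1_ext (f := fun z => cosh (0 + a * z) + sinh (0 + a * z))).
 by move=> z; rewrite add0r /cosh /sinh; field.
exact: sm1D (sm1_cosh _ _) (sm1_sinh _ _).
Qed.
(** Averaging the weight of the shift over the two signs of [z] leaves its even part [cosh]; the odd
    companion leaves [sinh]. *)
Lemma gmean_even_shift f a : sm1 f -> (forall z, f (- z) = f z) ->
 gm (fun z => f (a + z)) = expR (- (a ^+ 2 / 2)) * gm (fun z => f z * cosh (a * z)).
move=> sf ef; rewrite gmean_shift//; congr (_ * _).
have s1 (c : R) : sm1 (fun z => f z * expR (c * z)) by apply: sm1M => //; exact: sm1_exp.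
have h : gm (fun z => f z * expR ((- a) * z)) = gm (fun z => f z * expR (a * z)).
 by rewrite -[RHS](gmean_sym (s1 a)); eqgm => z; rewrite ef mulNr mulrN.
have -> : (fun z => f z * cosh (a * z)) =
 fun z => 2^-1 * (f z * expR (a * z) + f z * expR ((- a) * z)).
 by apply/funext => z; rewrite /cosh mulNr; field.
rewrite gmeanZ; last exact: sm1D.
rewrite gmeanD// h; set X := gm _.
by field.
Qed.

Lemma gmean_odd_shift f a : sm1 f -> (forall z, f (- z) = - f z) ->
 gm (fun z => f (a + z)) = expR (- (a ^+ 2 / 2)) * gm (fun z => f z * sinh (a * z)).
move=> sf ef; rewrite gmean_shift//; congr (_ * _).
have s1 (c : R) : sm1 (fun z => f z * expR (c * z)) by apply: sm1M => //; exact: sm1_exp.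
have h : gm (fun z => f z * expR ((- a) * z)) = - gm (fun z => f z * expR (a * z)).
 rewrite -(gmean_sym (s1 a)) -[RHS]mulN1r -gmeanZ.
 by eqgm => z; rewrite ef mulNr mulrN; ring.
 apply: (sm1_ext (f := fun z => (-1) * (f z * expR ((- a) * z)))).
 by move=> z /=; rewrite ef !mulNr !mulrN mul1r.
 exact: sm1Z.
have -> : (fun z => f z * sinh (a * z)) =
 fun z => 2^-1 * (f z * expR (a * z) + (-1) * (f z * expR ((- a) * z))).
 by apply/funext => z; rewrite /sinh [- a * z]mulNr; field.
rewrite gmeanZ; last by apply: sm1D => //; exact: sm1Z.
rewrite gmeanD//; last exact: sm1Z.
rewrite gmeanZ// h; set X := gm _.
by field.
Qed.
End OneD.

(** * Differential inequalities along paths of variances *)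

Section Paths.
Context {R : realType}.

(* An integrating factor turns a linear differential inequality into monotonicity. *)
Lemma exp_interp_le (f f' : R -> R) (c K a0 a1 : R) : f 0 = a0 -> f 1 = a1 -> continuous f ->
 (forall s : R, 0 < s < 1 -> is_derive s 1 f (f' s)) ->
 (forall s : R, 0 < s < 1 -> expR (- (c * s)) * (f' s - c * f s) <= K) ->
 expR (- c) * a1 <= a0 + K.
move=> <- <- cf df hK.
have dl (s : R) : is_derive s 1 (fun s => - (c * s)) (- c).
 have := is_deriveN (is_deriveZ c (is_derive_id s (1:R))); rewrite -[_ *: 1]/(c * 1) mulr1; exact.
have de (s : R) : is_derive s 1 (fun s => expR (- (c * s))) (expR (- (c * s)) * - c).
 exact: (@is_derive1_comp _ expR (fun s => - (c * s)) s _ _ (is_derive_expR _) (dl s)).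
pose g (s : R) := expR (- (c * s)) * f s - K * s.
have dg (s : R) : s \in `](0:R), 1[ ->
 is_derive s 1 g (expR (- (c * s)) * (f' s - c * f s) - K).
 rewrite in_itv/= => s01; have := is_deriveB (is_deriveM (de s) (df s s01)) (is_deriveZ K (is_derive_id s (1:R))).
 rewrite -![_ *: _]/(_ * _); congr is_derive; ring.
have cg : {within `[(0:R), 1], continuous g}.
 apply: continuous_subspaceT => s; apply: cvgB; last by cvg_scale.
 by apply: cvgM; [exact: (derive_cont de)|exact: cf].
have [s s01 e] := MVT ltr01 dg cg.
have : expR (- (c * s)) * (f' s - c * f s) - K <= 0.
 by rewrite subr_le0; apply: hK; rewrite in_itv/= in s01.
have e0 : g 0 = f 0 by rewrite /g !mulr0 oppr0 expR0 mul1r addr0.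
have e1 : g 1 = expR (- c) * f 1 - K by rewrite /g !mulr1.
by move: e; rewrite e0 e1 subr0 mulr1 => <-; lra.
Qed.

Context {I : finType}.
Notation V := (I + I -> R).
Variables (cs : seq I) (csU : uniq cs) (csA : forall i, i \in cs).

Lemma P_der (F : V -> R) (A B : I -> R) (s : R) : smooth F ->
 (forall i, D (inr i) F = fun=> 0) -> (forall i, 0 <= A i) -> (forall i, 0 <= B i) ->
 0 < s < 1 ->
 is_derive s 1 (fun s => P cs F (vec (mix A B s)))
 (2^-1 * \sum_i (B i - A i) * P cs (D (inl i) (D (inl i) F)) (vec (mix A B s))).
move=> sF F0 A0 B0 s01; apply: (interp_der (F := P cs F)
 (h := fun i => P cs (D (inl i) (D (inl i) F)))) => //; first exact: smooth_P.
by move=> i; rewrite D_P_in.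
Qed.

Lemma P_der1 n (F F1 F2 : V -> R) (A B : I -> R) (s : R) : smooth F ->
 (forall i, D (inr i) F = fun=> 0) -> pd (inl n) F F1 -> pd (inl n) F1 F2 ->
 (forall i, 0 <= A i) -> (forall i, 0 <= B i) -> (forall i, i != n -> A i = B i) ->
 0 < s < 1 ->
 is_derive s 1 (fun s => P cs F (vec (mix A B s)))
 ((B n - A n) / 2 * P cs F2 (vec (mix A B s))).
move=> sF F0 d1 d2 A0 B0 AB s01; have := P_der sF F0 A0 B0 s01.
rewrite (bigD1 n)//= [X in _ + X]big1 ?addr0 => [|i ni]; last by rewrite AB// subrr mul0r.
by rewrite (pd_D d1) (pd_D d2) mulrA [2^-1 * _]mulrC.
Qed.

Lemma P_cont (F : V -> R) A B : smooth F -> continuous (fun s : R => P cs F (vec (mix A B s))).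
by move=> sF; apply: interp_cont; exact: smooth_P. Qed.
End Paths.

(** * One-dimensional heat flow and parity *)

Section Sm1.
Context {R : realType}.
Implicit Types f g : R -> R.

Lemma sm1_growth_L (I : finType) c (w : I -> R) f : egrowth f -> growth (fun x => f (L c w x)).
move=> [C [C0 hC]] B; have [C' C'0 hC'] := En_bound (fun _ : unit => c) (fun k _ => w k) tt.
exists (C * expR (C * C') + C * C'); split=> [|x _]; first by rewrite addr_ge0 ?mulr_ge0 ?expR_ge0.
have nx := nrm_ge0 x; rewrite (le_trans (hC _))//.
apply: (@le_trans _ _ (C * expR (C * C') * expR (C * C' * nrm x))).
 rewrite -mulrA ler_wpM2l// -expRD ler_expR -mulrA -mulrDr ler_wpM2l//; exact: hC'.
by apply: ler_pM; rewrite ?mulr_ge0 ?expR_ge0// ?lerDl ?mulr_ge0// ler_expR ler_wpM2r// lerDr mulr_ge0// expR_ge0.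
Qed.

Lemma smooth_sm1L (I : finType) c (w : I -> R) f : sm1 f -> smooth (fun x => f (L c w x)).
move=> sf n; elim: n f sf => [|n IH] f sf; split=> //.
1,2: by apply: sm1_growth_L; exact: sm1_eg.
move=> k; have [f' df sf'] := sm1_der sf.
exists (fun x => f' (L c w x) * wk w k).
 by apply: pd_comp (pd_L c w k) => x; exact: df.
by apply: smM; [exact: IH|exact: sm_cst].
Qed.

Lemma sm1_affine f c d : sm1 f -> sm1 (fun t => f (c + d * t)).
by move=> sf; apply: smooth_ext (smooth_sm1L c (fun=> d) sf) => x; rewrite L_unit. Qed.
Lemma sm1X f n : sm1 f -> sm1 (fun t => f t ^+ n).
move=> sf; elim: n => [|n IH]; first exact: (smooth_cst 1).
by apply: sm1_ext (sm1M sf IH) => t; rewrite exprS.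
Qed.
Lemma sm1_cst c : sm1 (fun _ : R => c). Proof. exact: smooth_cst. Qed.
Lemma sm1B f g : sm1 f -> sm1 g -> sm1 (fun t => f t - g t).
exact: smoothB. Qed.
Lemma sm1_sc : sm1 (fun t : R => (cosh t)^-1).
by apply: sm1_ext (sm1_sech 0 1) => t; rewrite add0r mul1r. Qed.
Lemma sm1_th : sm1 (@tanh R).
by apply: sm1_ext (sm1_tanh 0 1) => t; rewrite add0r mul1r. Qed.
Lemma sm1_ch : sm1 (@cosh R).
by apply: sm1_ext (sm1_cosh 0 1) => t; rewrite add0r mul1r. Qed.

Definition emf m (t : R) := expR (m * ln (cosh t)).

Lemma sm1_chm m : sm1 (emf m).
by apply: smooth_ext (smooth_chm 0 (fun=> 1) m) => x; rewrite /chm L_unit add0r mul1r.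
Qed.
Lemma is_derive_sech (t : R) : is_derive t 1 (fun t => (cosh t)^-1) (- ((cosh t)^-1 * tanh t)).
have := @is_deriveV R cosh t _ 1 (cosh_neq0 t) (is_derive_cosh t).
congr is_derive; rewrite -[_ *: _]/(_ * _) tanhE; have := cosh_neq0 t => C0; by field.
Qed.
Lemma is_derive_tanh (t : R) : is_derive t 1 (@tanh R) ((cosh t)^-1 ^+ 2).
have := is_deriveM (is_derive_sinh t) (is_derive_sech t).
rewrite (_ : (sinh * _) = @tanh R); last by apply/funext => s; rewrite tanhE.
by congr is_derive; rewrite -![_ *: _]/(_ * _) -sech2E tanhE; have := cosh_neq0 t => C0; field.
Qed.

Lemma dM f g (t f' g' : R) : is_derive t 1 f f' -> is_derive t 1 g g' ->
 is_derive t 1 (fun t => f t * g t) (f' * g t + f t * g').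
by move=> df dg; have := is_deriveM df dg; rewrite -![_ *: _]/(_ * _) addrC [g t * _]mulrC.
Qed.
Lemma dZ c f (t f' : R) : is_derive t 1 f f' -> is_derive t 1 (fun t => c * f t) (c * f').
exact: is_deriveZ. Qed.
Lemma dD f g (t f' g' : R) : is_derive t 1 f f' -> is_derive t 1 g g' ->
 is_derive t 1 (fun t => f t + g t) (f' + g').
exact: is_deriveD. Qed.
Lemma d_ext f g (t f' g' : R) : f =1 g -> f' = g' -> is_derive t 1 f f' -> is_derive t 1 g g'.
by move=> /funext -> ->. Qed.
Lemma mvt_ex (f f' : R -> R) (x y : R) : (forall t : R, is_derive t 1 f (f' t)) ->
 exists t, f y - f x = f' t * (y - x).
move=> df; wlog xy : x y / x <= y => [H|].
 have [/H//|/ltW /H[t e]] := leP x y.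
 by exists t; rewrite -opprB e -mulrN opprB.
move: xy; rewrite le_eqVlt => /predU1P[->|xy]; first by exists 0; rewrite !subrr mulr0.
have [t _ e] := MVT xy (fun t _ => df t) (continuous_subspaceT (derive_cont df)).
by exists t.
Qed.

Lemma lip_derive (f f' : R -> R) K (x y : R) : (forall t : R, is_derive t 1 f (f' t)) ->
 (forall t, `|f' t| <= K) -> `|f y - f x| <= K * `|y - x|.
by move=> df hK; have [t ->] := mvt_ex x y df; rewrite normrM ler_wpM2r. Qed.
Lemma tanh_le (x y : R) : x <= y -> tanh x <= tanh y.
move=> xy; rewrite -subr_ge0; have [t ->] := mvt_ex x y is_derive_tanh.
by rewrite mulr_ge0 ?sqr_ge0// subr_ge0.
Qed.
Lemma sm1V f : sm1 f -> (forall t, 1 <= f t) -> sm1 (fun t => (f t)^-1).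
move=> sf f1; apply: smooth_inv => //; first by move=> x; rewrite gt_eqF// (lt_le_trans _ (f1 _)).
apply: growth_le (growth_cst 1) => x; rewrite normr1 ger0_norm ?invr_ge0 ?invf_le1//.
 exact: lt_le_trans (f1 _).
exact: le_trans (f1 _).
Qed.

Section Heat.
Variables (s : R).
Definition heat f t := gm (fun z => f (t + s * z)).
Notation w := (fun k : bool => if k then s else 1).

(** Of the two coordinates, [false] carries the starting point and [true] the Gaussian increment, so
    that the calculus of environments covers both. *)
Lemma heatE f t : heat f t = T true (fun x : bool + bool -> R => f (L 0 (fun=> 1) x))
 (push (fun k => if k is inr _ then s else 0) (inl false) t).
eqgm => z.
by rewrite /L big_bool /push/= !(mulr1n, mulr0n, addr0, add0r, mul1r) [_ + t]addrC.
Qed.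
Lemma sm1_heat f : sm1 f -> sm1 (heat f).
move=> sf; have sF := smooth_T true (smooth_sm1L 0 (fun _ : bool => 1) sf).
by apply: sm1_ext (sm1_push (fun k => if k is inr _ then s else 0) false 1 sF) => t; rewrite mul1r -heatE.
Qed.
Lemma sm1_unique f f' : sm1 f -> (forall t : R, is_derive t 1 f (f' t)) -> sm1 f'.
by move=> sf df; have [] := gmean_ibp sf df. Qed.
Lemma is_derive_heat f f' (t : R) : sm1 f -> (forall t : R, is_derive t 1 f (f' t)) ->
 is_derive t 1 (heat f) (heat f' t).
move=> sf df; have sF := smooth_sm1L 0 (fun _ : bool => 1) sf.
have := pd_at (fun k => if k is inr _ then s else 0) t (pd_T (inl false) true sF).
congr is_derive; first by apply/funext => r; rewrite -heatE.
have e := pd_D (pd_comp (fun x => df (L 0 (fun _ : bool => 1) x)) (pd_L 0 (fun _ : bool => 1) (inl false))).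
rewrite /DT e mul0r addr0 heatE; congr T; apply/funext => x; by rewrite /wk mulr1.
Qed.

Lemma heat_cosh t : heat (@cosh R) t = expR (s ^+ 2 / 2) * cosh t.
have h (a : R) : gm (fun z => expR (a * z)) = expR (a ^+ 2 / 2).
 have := @gmean_shift R (fun=> 1) a (sm1_cst 1); rewrite gm_cst.
 rewrite (_ : (fun z => 1 * expR (a * z)) = fun z => expR (a * z)); last by apply/funext => z; rewrite mul1r.
 by move=> e; rewrite -[LHS]mul1r -[X in X * _]expR0 -(subrr (a ^+ 2 / 2)) expRD -mulrA -e mulr1.
rewrite /heat (_ : (fun z => _) = fun z => (expR t / 2) * expR (s * z) + (expR (- t) / 2) * expR ((- s) * z)).
 rewrite gmeanD; [|by apply: sm1Z; exact: sm1_exp|by apply: sm1Z; exact: sm1_exp].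
 by rewrite !gmeanZ ?h ?sqrrN; [rewrite /cosh; field|exact: sm1_exp|exact: sm1_exp].
by apply/funext => z; rewrite /cosh opprD mulNr !expRD; field.
Qed.

Lemma heat_odd f t : sm1 f -> (forall t, f (- t) = - f t) -> heat f (- t) = - heat f t.
move=> sf of_; rewrite -[RHS]mulN1r -gmeanZ; last exact: sm1_affine.
rewrite -[LHS](gmean_sym (sm1_affine (- t) s sf)).
by eqgm => z; rewrite mulrN -opprD of_ mulN1r.
Qed.

(* Gaussian averaging preserves odd functions of constant sign on the half line. *)
Lemma heat_odd_le0 f t : 0 <= s -> sm1 f -> (forall t, f (- t) = - f t) ->
 (forall t, 0 <= t -> f t <= 0) -> 0 <= t -> heat f t <= 0.
move=> s_ge0 sf of_ f0 t0.
have [s00|sn0] := eqVneq s 0.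
 by rewrite /heat s00; under eq_fun do rewrite mul0r addr0; rewrite gm_cst f0.
have s0 : 0 < s by rewrite lt_neqAle eq_sym sn0.
pose g z := f (s * z).
have sg : sm1 g by apply: sm1_ext (sm1_affine 0 s sf) => z; rewrite add0r.
have -> : heat f t = gm (fun z => g (t / s + z)).
 by eqgm => z; rewrite /g mulrDr mulrCA mulfV// mulr1.
rewrite gmean_odd_shift//; last by move=> z; rewrite /g mulrN of_.
rewrite mulr_ge0_le0 ?expR_ge0//.
have := @gmean_ge0 R (fun z => (-1) * (g z * sinh (t / s * z))).
have sm : sm1 (fun z => g z * sinh (t / s * z)).
 by apply: sm1M => //; apply: sm1_ext (sm1_sinh 0 (t / s)) => z; rewrite add0r.
rewrite gmeanZ// mulN1r oppr_ge0; apply => z.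
have ts : 0 <= t / s by rewrite divr_ge0// ltW.
have key r : 0 <= r -> g r * sinh (t / s * r) <= 0.
 by move=> w0; apply: mulr_le0_ge0; [apply: f0; rewrite mulr_ge0// ltW|apply: sinh_ge0; rewrite mulr_ge0].
rewrite mulN1r oppr_ge0; have [z0|z0] := leP 0 z; first exact: key.
have := key (- z); rewrite /g !mulrN of_ sinhN mulrNN; apply; lra.
Qed.
End Heat.

(* When the Gaussian measure is multiplied by a density that is even and
 decreasing in [|z|], derivatives of odd functions that are negative on the
 half line have negative mean. *)
Lemma gmean_weight_le0 (g g' w w' : R -> R) (c : R) : 0 < c -> sm1 g -> sm1 w ->
 (forall t : R, is_derive t 1 g (g' t)) -> (forall t : R, is_derive t 1 w (w' t)) ->
 (forall t, 0 <= w t) -> (forall t, w' t * g (c * t) >= 0) ->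
 (forall t, g (- t) = - g t) -> (forall t, 0 <= t -> g t <= 0) ->
 gm (fun z => w z * g' (c * z)) <= 0.
move=> c0 sg sw dg dw w0 wg og g0.
have sgc : sm1 (fun z => g (c * z)) by apply: sm1_ext (sm1_affine 0 c sg) => z; rewrite add0r.
have sg'c : sm1 (fun z => g' (c * z)).
 by apply: sm1_ext (sm1_affine 0 c (sm1_unique sg dg)) => z; rewrite add0r.
have dgc (t : R) : is_derive t 1 (fun z => g (c * z)) (g' (c * t) * c).
 have dc : is_derive t 1 (fun z => c * z) c.
 by have := is_deriveZ c (is_derive_id t (1:R)); rewrite -[_ *: 1]/(c * 1) mulr1.
 exact: (@is_derive1_comp _ g (fun z => c * z) t _ _ (dg _) dc).
have dwg (t : R) : is_derive t 1 (fun z => w z * g (c * z)) (c * (w t * g' (c * t)) + w' t * g (c * t)).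
 by have := is_deriveM (dw t) (dgc t); rewrite -![_ *: _]/(_ * _); congr is_derive; ring.
have [e _] := gmean_ibp (sm1M sw sgc) dwg.
have sw' := sm1_unique sw dw.
rewrite gmeanD in e; [|by apply: sm1Z; exact: sm1M|exact: sm1M].
rewrite gmeanZ in e; last exact: sm1M.
have h1 : gm (fun t => t * (w t * g (c * t))) <= 0.
 rewrite -[leRHS](gm_cst 0); apply: gmean_le; [|exact: sm1_cst|].
 by apply: sm1M; [exact: sm1_id|exact: sm1M].
 move=> t; rewrite mulrCA mulr_ge0_le0//.
 have key r : 0 <= r -> r * g (c * r) <= 0.
 by move=> r0; rewrite mulr_ge0_le0// g0// mulr_ge0// ltW.
 have [t0|t0] := leP 0 t; first exact: key.
 by have := key (- t); rewrite mulrN og mulrNN; apply; lra.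
have h2 : 0 <= gm (fun t => w' t * g (c * t)) by exact: gmean_ge0.
move: e h1 h2; set A := gm _; set B := gm _; set C := gm _; nra.
Qed.
End Sm1.

(** * Dependence of tilted averages on the exponent *)

Section Tilt.
Context {R : realType}.
Notation em m := (fun t : R => expR (m * ln (cosh t))).
Notation sc x := ((cosh x)^-1).
(* Averages of [cosh^m]-tilted Gaussians depend on [m] at first order in the variance. *)
Lemma tilt_le (C0 : R) : 0 <= C0 -> exists2 K, 0 <= K & forall t c m, 0 <= c <= C0 -> 1 <= m <= 2 ->
 heat c (fun t => emf m t * tanh t ^+ 2) t / heat c (emf m) t <=
 heat c (fun t => cosh t * tanh t ^+ 2) t / heat c (@cosh R) t + K * (m - 1) * c ^+ 2.
(* A common majorant of the integrands: two factors [1 + |z|] for at most two Lipschitz bounds, and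
   an exponential for powers of [cosh] with exponent at most 2. *)
rewrite /emf => C00; pose om (z : R) := (1 + `|z|) * (1 + `|z|) * expR (2 * C0 * `|z|).
have mom : mfun om.
 apply: cont_meas => z.
 have c1 : {for z, continuous (fun z : R => 1 + `|z|)}.
 by apply: cvgD; [exact: cvg_cst|apply: cvg_norm; exact: cvg_id].
 apply: cvgM; first by apply: cvgM; exact: c1.
 apply: (@continuous_comp _ _ _ (fun z : R => 2 * C0 * `|z|) (@expR R)); last exact: continuous_expR.
 by apply: cvgM; [exact: cvg_cst|apply: cvg_norm; exact: cvg_id].
have eom : egrowth om.
 have e1 : egrowth (fun z : R => 1 + `|z|).
 by apply: egrowthD; [exact: egrowth_cst|apply: egrowth_le egrowth_id => z; rewrite normr_id].
 apply: egrowthM; first by apply: egrowthM; exact: e1.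
 exists (1 + 2 * C0); split=> [|z]; first lra.
 rewrite ger0_norm ?expR_ge0//; have := normr_ge0 z => z0.
 apply: (@le_trans _ _ (1 * expR ((1 + 2 * C0) * `|z|))); last by rewrite ler_wpM2r ?expR_ge0//; lra.
 by rewrite mul1r ler_expR ler_wpM2r//; lra.
pose M := gm om.
have M0 : 0 <= M by apply: gmean_ge0 => z; rewrite !mulr_ge0 ?expR_ge0 ?addr_ge0.
have gmean_leM f c : sm1 f -> 0 <= c -> (forall z, `|f z| <= c * om z) -> `|gm f| <= c * M.
 move=> sf c0 hf; rewrite /M -gmZ//.
 have mc : mfun (fun z => c * om z) by apply: measurable_funM => //; exact: measurable_cst.
 have ec : egrowth (fun z => c * om z) by apply: egrowthM => //; exact: egrowth_cst.
 rewrite ler_norml; apply/andP; split; last first.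
 apply: ler_gauss_mean => //; [exact: sm1_meas|exact: sm1_eg|].
 by move=> z; exact: le_trans (ler_norm _) (hf z).
 rewrite lerNl -mulN1r -gmeanZ//; apply: ler_gauss_mean => //; [exact: sm1_meas (sm1Z _ sf)|exact: sm1_eg (sm1Z _ sf)|].
 by move=> z; rewrite mulN1r; apply: le_trans (hf z); rewrite -normrN ler_norm.
exists (2 * M + 2 * (M * M)); first by rewrite addr_ge0// ?mulr_ge0.
move=> t c m /andP[c0 cC] /andP[m1 m2].
(* Centring [ln cosh] and [tanh ^ 2] at [t] makes each of order [c]; two such factors multiply to
   the [c ^+ 2] of the error. *)
pose l z := ln (cosh (t + c * z)) - ln (cosh t).
pose f z := tanh (t + c * z) ^+ 2 - tanh t ^+ 2.
pose k m z := expR (m * l z).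
have sl : sm1 l by apply: sm1B; [exact: sm1_lncosh|exact: sm1_cst].
have sf : sm1 f by apply: sm1B; [exact: sm1_affine (sm1X 2 sm1_th)|exact: sm1_cst].
have kE m' z : k m' z = expR (- (m' * ln (cosh t))) * expR (m' * ln (cosh (t + c * z))).
 by rewrite -expRD /k /l; congr expR; ring.
have kE2 m' z : expR (m' * ln (cosh t)) * k m' z = expR (m' * ln (cosh (t + c * z))).
 by rewrite -expRD /k /l; congr expR; ring.
have sk m' : sm1 (k m').
 by apply: sm1_ext (sm1Z _ (sm1_affine t c (sm1_chm m'))) => z; rewrite kE.
have cz (z : R) : `|t + c * z - t| = c * `|z| by rewrite addrAC subrr add0r normrM ger0_norm.
have lb (z : R) : `|l z| <= c * `|z|.
 rewrite -cz /l -[leRHS]mul1r; apply: (lip_derive (f := fun u => ln (cosh u)) (f' := @tanh R)) => [u|u]; last exact: tanh_norm.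
 have := @is_derive1_ln _ _ (cosh_gt0 u) => dl.
 by have := @is_derive1_comp _ (@ln R) cosh u _ _ dl (is_derive_cosh u); rewrite tanhE mulrC.
have fb (z : R) : `|f z| <= 2 * (c * `|z|).
 rewrite -cz; apply: (lip_derive (f := fun u => tanh u ^+ 2) (f' := fun u => 2 * (tanh u * sc u ^+ 2))) => u.
 have dt := is_derive_tanh u; apply: d_ext (dM dt dt) => [r|]; [by rewrite expr2|ring].
 rewrite normrM ger0_norm// ler_piMr// normrM mulr_ile1// ?tanh_norm// ger0_norm ?sqr_ge0//.
 by rewrite exprn_ile1 ?(ltW (sech_gt0 _))// sech_le1.
have sg2 : sm1 (fun z => tanh (t + c * z) ^+ 2) by exact: sm1_affine (sm1X 2 sm1_th).
have heatK m' : heat c (em m') t = expR (m' * ln (cosh t)) * gm (k m').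
 rewrite -gmeanZ//; eqgm => z.
 by rewrite kE2.
have heatKf m' : heat c (fun u => expR (m' * ln (cosh u)) * tanh u ^+ 2) t =
 expR (m' * ln (cosh t)) * (gm (fun z => k m' z * f z) + tanh t ^+ 2 * gm (k m')).
 have skf := sm1M (sk m') sf.
 rewrite -gmeanZ// -gmeanD//; last exact: sm1Z.
 have skd := sm1D skf (sm1Z (tanh t ^+ 2) (sk m')).
 apply: (etrans _ (gmeanZ (expR (m' * ln (cosh t))) skd)).
 eqgm => z; rewrite /f.
 rewrite (_ : k m' z * _ + _ = k m' z * tanh (t + c * z) ^+ 2); last by ring.
 by rewrite -[LHS](congr1 (fun u => u * tanh (t + c * z) ^+ 2) (kE2 m' z)) mulrA.
have k1 z : k 1 z = expR (l z) by rewrite /k mul1r.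
have Dk1 : 1 <= gm (k 1).
 have := heatK 1; rewrite mul1r lnK ?posrE ?cosh_gt0//.
 rewrite (_ : heat c (em 1) t = expR (c ^+ 2 / 2) * cosh t); last first.
 rewrite -heat_cosh; eqgm => z.
 by rewrite mul1r lnK ?posrE ?cosh_gt0.
 rewrite mulrC => /(mulfI (cosh_neq0 t)) <-.
 by rewrite -[leLHS]expR0 ler_expR divr_ge0 ?sqr_ge0.
(* Bernoulli's inequality, which carries the lower bound 1 on the denominator from exponent 1 to
   exponent [m]. *)
have km_ge z : 1 + m * (k 1 z - 1) <= k m z.
 have h1 : k m z = k 1 z * expR ((m - 1) * l z) by rewrite k1 /k -expRD; congr expR; ring.
 have h2 := expR_ge1Dx ((m - 1) * l z); have h3 := expR_ge1Dx (- l z).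
 have h4 : expR (- l z) * k 1 z = 1 by rewrite k1 -expRD addrC subrr expR0.
 have k0 : 0 < k 1 z by rewrite k1 expR_gt0.
 rewrite h1; apply: (@le_trans _ _ (k 1 z * (1 + (m - 1) * l z))); last by rewrite ler_wpM2l// ltW.
 have : (1 - l z) * k 1 z <= 1 by rewrite -[leRHS]h4 ler_wpM2r// ltW.
 nra.
have Dkm : 1 <= gm (k m).
 have h1 z : (1 - m) + m * k 1 z <= k m z by have := km_ge z; lra.
 have := gmean_le (sm1D (sm1_cst (1 - m)) (sm1Z m (sk 1))) (sk m) h1.
 rewrite (gmeanD (sm1_cst (1 - m)) (sm1Z m (sk 1))) (gmeanZ m (sk 1)) gm_cst.
 move: (gm (k m)) (gm (k 1)) Dk1 => u v; nra.
have ce (z : R) : c * `|z| <= C0 * `|z| by rewrite ler_wpM2r.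
have kdiff (z : R) : `|k m z - k 1 z| <= (m - 1) * (c * `|z|) * expR (2 * C0 * `|z|).
 have dk (u : R) : is_derive u 1 (fun u => expR (u * l z)) (expR (u * l z) * l z).
 have dl : is_derive u 1 (fun u => u * l z) (l z).
 by apply: d_ext (dZ (l z) (is_derive_id u (1:R))) => [r|]; [exact: mulrC|rewrite mulr1].
 exact: (@is_derive1_comp _ expR (fun u => u * l z) u _ _ (is_derive_expR _) dl).
 have [->|m1'] := eqVneq m 1; first by rewrite !subrr normr0 !mul0r.
 have lt1 : 1 < m by rewrite lt_neqAle eq_sym m1'.
 have [u] := MVT lt1 (fun t _ => dk t) (continuous_subspaceT (derive_cont dk)).
 rewrite in_itv/= => /andP[u1 u2] e; rewrite /k e mulrC normrM ger0_norm ?subr_ge0// -mulrA.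
 rewrite ler_wpM2l ?subr_ge0// normrM ger0_norm ?expR_ge0// mulrC ler_pM ?expR_ge0//.
 rewrite ler_expR (le_trans (ler_norm _))// normrM -mulrA ler_pM//.
 by rewrite ger0_norm; lra.
 exact: le_trans (lb z) (ce z).
have k1b (z : R) : `|k 1 z| <= expR (2 * C0 * `|z|).
 rewrite k1 ger0_norm ?expR_ge0// ler_expR (le_trans (ler_norm _))// (le_trans (lb z))//.
 by rewrite (le_trans (ce z))// -mulrA ler_peMl ?mulr_ge0//; lra.
have omz (z a b' : R) : 0 <= a -> 0 <= b' -> a <= 1 + `|z| -> b' <= 1 + `|z| -> a * b' * expR (2 * C0 * `|z|) <= om z.
 by move=> a0 b0' ha hb'; rewrite ler_wpM2r ?expR_ge0// ler_pM.
have z1 (z : R) : `|z| <= 1 + `|z| by rewrite lerDr.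
have o1 (z : R) : 1 <= 1 + `|z| by rewrite lerDl.
have m10 : 0 <= m - 1 by rewrite subr_ge0.
pose Nm := gm (fun z => k m z * f z); pose N1 := gm (fun z => k 1 z * f z).
have dN : `|Nm - N1| <= 2 * (m - 1) * c ^+ 2 * M.
 have -> : Nm - N1 = gm (fun z => (k m z - k 1 z) * f z).
 rewrite /Nm /N1 -[- gm _]mulN1r -gmeanZ; last exact: sm1M.
 rewrite -gmeanD; [eqgm => z; ring|exact: sm1M|].
 by apply: sm1Z; exact: sm1M.
 apply: gmean_leM; [by apply: sm1M => //; exact: sm1B|by rewrite !mulr_ge0 ?sqr_ge0|].
 move=> z; rewrite normrM; apply: le_trans (ler_pM _ _ (kdiff z) (fb z)) _ => //.
 rewrite (_ : _ * _ = 2 * (m - 1) * c ^+ 2 * (`|z| * `|z| * expR (2 * C0 * `|z|))); last by ring.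
 by rewrite ler_wpM2l ?omz// !mulr_ge0 ?sqr_ge0.
have dD' : `|gm (k m) - gm (k 1)| <= (m - 1) * c * M.
 have -> : gm (k m) - gm (k 1) = gm (fun z => k m z - k 1 z).
 rewrite -[- gm _]mulN1r -gmeanZ// -gmeanD//; last exact: sm1Z.
 by eqgm => z; ring.
 apply: gmean_leM; [exact: sm1B|by rewrite !mulr_ge0|] => z.
 rewrite (le_trans (kdiff z))//.
 rewrite (_ : _ * _ = (m - 1) * c * (`|z| * 1 * expR (2 * C0 * `|z|))); last by ring.
 by rewrite ler_wpM2l ?omz// !mulr_ge0.
have bN : `|N1| <= 2 * c * M.
 apply: gmean_leM; [exact: sm1M|by rewrite !mulr_ge0|] => z.
 rewrite normrM; apply: le_trans (ler_pM _ _ (k1b z) (fb z)) _ => //.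
 rewrite (_ : expR _ * _ = 2 * c * (1 * `|z| * expR (2 * C0 * `|z|))); last by ring.
 by rewrite ler_wpM2l ?omz// !mulr_ge0.
have -> : heat c (fun u => cosh u * tanh u ^+ 2) t = heat c (fun u => expR (1 * ln (cosh u)) * tanh u ^+ 2) t.
 by eqgm => z; rewrite mul1r lnK ?posrE ?cosh_gt0.
have -> : heat c cosh t = heat c (em 1) t.
 by eqgm => z; rewrite mul1r lnK ?posrE ?cosh_gt0.
rewrite !heatK !heatKf -/Nm -/N1.
move: dN dD' bN Dkm Dk1; set Dm := gm (k m); set D1 := gm (k 1) => dN dD' bN Dm1 D11.
have quo m' (A : R) : 0 < A -> expR (m' * ln (cosh t)) * (0 + A) != 0.
 by move=> A0; rewrite add0r mulf_neq0 ?gt_eqF// expR_gt0.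
have e m' (N A : R) : 1 <= A -> expR (m' * ln (cosh t)) * (N + tanh t ^+ 2 * A) / (expR (m' * ln (cosh t)) * A) = N / A + tanh t ^+ 2.
 move=> A1; have A0 : A != 0 by rewrite gt_eqF// (lt_le_trans _ A1).
 by have := gt_eqF (expR_gt0 (m' * ln (cosh t))) => e0; field; rewrite e0 A0.
rewrite !e// addrAC lerD2r -lerBlDl.
have -> : Nm / Dm - N1 / D1 = (Nm - N1) / Dm + N1 * (D1 - Dm) / (D1 * Dm).
 by have := lt_le_trans ltr01 Dm1; have := lt_le_trans ltr01 D11 => ? ?; field; rewrite !gt_eqF.
have D0 : 0 < D1 * Dm by rewrite mulr_gt0// (lt_le_trans ltr01).
apply: (@le_trans _ _ (2 * (m - 1) * c ^+ 2 * M + 2 * c * M * ((m - 1) * c * M))).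
 apply: lerD.
 rewrite ler_pdivrMr ?(lt_le_trans ltr01)// (le_trans (ler_norm _))// (le_trans dN)//.
 by rewrite ler_peMr// !mulr_ge0 ?sqr_ge0.
 rewrite ler_pdivrMr// (le_trans (ler_norm _))// normrM.
 apply: (@le_trans _ _ (2 * c * M * ((m - 1) * c * M))); first by rewrite ler_pM// distrC.
 by rewrite ler_peMr ?mulr_ge0// -[leLHS]mulr1 ler_pM//; lra.
by apply: le_of_eq; ring.
Qed.
End Tilt.

(** * From the condition on the mean of [sech ^ 4] to a strict one-step bound *)

Section AT.
Context {R : realType}.
Notation V := (bool + bool -> R).
Variables (h b q : R).
Hypotheses (h0 : 0 < h) (b0 : 0 < b) (q0 : 0 < q).
Notation X := (fun z : R => h + sqr b * z).
Hypothesis Eth2 : gm (fun z => tanh (X z) ^+ 2) = q.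
Notation Lo := (L h (fun k : bool => (~~ k)%:R)).
Notation Li := (L h (fun=> 1)).
Notation cs := [:: false; true].
(** Coordinate [false] is the outer field, of variance [b]; coordinate [true], of variance [y], is
    the inner field created by a symmetry breaking step. [Lo] sees the outer field only, [Li] sees
    both. *)
Definition av (y : R) (k : bool) := if k then y else b.

Lemma LiE x : Li x = h + x (inl false) + x (inl true).
by rewrite /L big_bool/= !mul1r -addrA [_ + x (inl false)]addrC. Qed.
Lemma LoE (x : V) : Lo x = h + x (inl false).
by rewrite /L big_bool/= mul0r mul1r add0r. Qed.
Lemma csA k : k \in cs. Proof. by case: k. Qed.
Lemma av_ge0 (y : R) k : 0 <= y -> 0 <= av y k. Proof. by case: k => //= _; exact: ltW. Qed.
Lemma mix_av y (s : R) : mix (av 0) (av y) s = av (s * y).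
by apply/funext => -[]; rewrite /mix/=; ring. Qed.
Lemma P_diag (f : R -> R -> R) : P cs (fun x => f (Lo x) (Li x)) (vec (av 0)) = gm (fun z => f (X z) (X z)).
rewrite /= /T; eqgm => z.
rewrite -[RHS]gm_cst; eqgm => w.
by rewrite LoE LiE /push /= sqrtr0 !(addr0, add0r, mulr1n, mul0r).
Qed.
Notation sc x := ((cosh x)^-1).
(** Its mean determines the one-step functional at exponent 1, by [tilted1]; [psi0] and [psi2] arise
    from differentiating in the inner variance. *)
Definition chi0 (x : V) : R := sc (Lo x) * sc (Li x).
Definition psi0 (x : V) : R := sc (Lo x) * sc (Li x) ^+ 3.
Definition psi2 (x : V) : R := sc (Lo x) * (9 * sc (Li x) ^+ 3 - 12 * sc (Li x) ^+ 5).

Lemma smooth_scL (w : bool -> R) n : smooth (fun x => sc (L h w x) ^+ n).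
elim: n => [|n IH]; first exact: (smooth_cst 1).
apply: smooth_ext (smoothM (smooth_sc h w) IH) => x; by rewrite exprS.
Qed.
Lemma smooth_chi0 : smooth chi0. Proof. by apply: smoothM; exact: smooth_sc. Qed.
Lemma smooth_psi0 : smooth psi0.
by apply: smoothM; [exact: smooth_sc|exact: smooth_scL]. Qed.
Lemma inr0 (f : R -> R -> R) i : D (inr i) (fun x : V => f (Lo x) (Li x)) = fun=> 0.
apply: pd_D => x; rewrite (_ : (fun t : R => _) = fun=> f (Lo x) (Li x)); first exact: is_derive_cst.
by apply/funext => t; rewrite !LoE !LiE !pushNE.
Qed.
Lemma chi0_inr i : D (inr i) chi0 = fun=> 0.
exact: (inr0 (fun x y => sc x * sc y)). Qed.
Lemma psi0_inr i : D (inr i) psi0 = fun=> 0.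
exact: (inr0 (fun x y => sc x * sc y ^+ 3)). Qed.
Lemma chi_pd : exists2 F1, pd (inl true) chi0 F1 & pd (inl true) F1 (fun x => chi0 x - 2 * psi0 x).
have := pd_sc h (fun k : bool => (~~ k)%:R) (inl true); set d0 := (fun x => _ * wk _ _) => p0.
have p1 := pd_sc h (fun k : bool => 1) (inl true).
have p2 := pd_th h (fun k : bool => 1) (inl true).
exists (fun x => sc (Lo x) * (- (sc (Li x) * tanh (Li x)))).
 apply: pd_ext (pdM p0 p1) => x //; rewrite /d0 /wk/=; ring.
apply: pd_ext (pdM p0 (pdZ (-1) (pdM p1 p2))) => x; first by rewrite mulN1r.
rewrite /d0 /wk/= /chi0 /psi0; have := sech2E (Li x); set t := tanh (Li x); set s := sc (Li x) => e.
have -> : s ^+ 3 = s * (1 - t ^+ 2) by rewrite e exprS.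
ring.
Qed.

Lemma psi_pd : exists2 F1, pd (inl true) psi0 F1 & pd (inl true) F1 psi2.
have := pd_sc h (fun k : bool => (~~ k)%:R) (inl true); set d0 := (fun x => _ * wk _ _) => p0.
have p1 := pd_sc h (fun k : bool => 1) (inl true).
have p2 := pd_th h (fun k : bool => 1) (inl true).
have p3 := pdM p1 (pdM p1 p1).
exists (fun x => sc (Lo x) * (-3 * (sc (Li x) ^+ 3 * tanh (Li x)))).
 apply: pd_ext (pdM p0 p3) => x; first by rewrite /psi0; ring.
 by rewrite /d0 /wk/=; ring.
apply: pd_ext (pdM p0 (pdZ (-3) (pdM p3 p2))) => x; first by ring.
rewrite /d0 /wk/= /psi2; have := sech2E (Li x); set t := tanh _; set s := sc (Li x) => e.
rewrite [in RHS](_ : s ^+ 5 = s ^+ 3 * (1 - t ^+ 2)); last by rewrite e; ring.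
ring.
Qed.

Definition Ev (F : V -> R) (y : R) := P cs F (vec (av y)).
Notation E F y := (Ev F y).

Lemma Ev_le F G y : smooth F -> smooth G -> (forall x, F x <= G x) -> E F y <= E G y.
exact: P_le. Qed.
Lemma Ev_ge0 F y : smooth F -> (forall x, 0 <= F x) -> 0 <= E F y.
exact: P_ge0. Qed.
Lemma csU : uniq cs. Proof. by []. Qed.
Lemma E_der (F F1 F2 : V -> R) (y s : R) : smooth F -> (forall i, D (inr i) F = fun=> 0) ->
 pd (inl true) F F1 -> pd (inl true) F1 F2 -> 0 <= y -> 0 < s < 1 ->
 is_derive s 1 (fun s : R => E F (s * y)) (y / 2 * E F2 (s * y)).
move=> sF F0 d1 d2 y0 s01; rewrite /Ev.
have -> : (fun s : R => E F (s * y)) = fun s => P cs F (vec (mix (av 0) (av y) s)).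
 by apply/funext => t; rewrite mix_av.
have := P_der1 csU csA sF F0 d1 d2 (fun k => av_ge0 k (lexx 0)) (fun k => av_ge0 k y0) _ s01.
by rewrite [av y true]/= [av 0 true]/= subr0 mix_av; apply; case.
Qed.

Lemma chi_der (y s : R) : 0 <= y -> 0 < s < 1 ->
 is_derive s 1 (fun s : R => E chi0 (s * y)) (y / 2 * (E chi0 (s * y) - 2 * E psi0 (s * y))).
move=> y0 s01; have [F1 d1 d2] := chi_pd.
have e : P cs (fun x => chi0 x - 2 * psi0 x) = fun x => P cs chi0 x - 2 * P cs psi0 x.
 rewrite P_B; [|exact: smooth_chi0|by apply: smoothZ; exact: smooth_psi0].
 by rewrite P_Z//; exact: smooth_psi0.
by have := E_der smooth_chi0 chi0_inr d1 d2 y0 s01; rewrite {2}/Ev e.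
Qed.

Lemma psi_der (y s : R) : 0 <= y -> 0 < s < 1 ->
 is_derive s 1 (fun s : R => E psi0 (s * y)) (y / 2 * E psi2 (s * y)).
move=> y0 s01; have [F1 d1 d2] := psi_pd.
exact: E_der smooth_psi0 psi0_inr d1 d2 y0 s01.
Qed.
Lemma E_cont (F : V -> R) (y : R) : smooth F -> continuous (fun s : R => E F (s * y)).
move=> sF; have -> : (fun s : R => E F (s * y)) = fun s => P cs F (vec (mix (av 0) (av y) s)).
 by apply/funext => t; rewrite mix_av.
exact: P_cont.
Qed.
Lemma Ev1 F y : E F (1 * y) = E F y. Proof. by rewrite mul1r. Qed.
Lemma Ev0 F y : E F (0 * y) = E F 0. Proof. by rewrite mul0r. Qed.
Lemma EvE F y : E F y = P cs F (vec (av y)). Proof. by []. Qed.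
Opaque Ev.

Lemma psi0_ge0 x : 0 <= psi0 x.
by rewrite /psi0 mulr_ge0 ?exprn_ge0// ltW// sech_gt0. Qed.

(* [1 - e^(-y/2) E chi0] has derivative [e^(-y/2) E psi0] in [y]. *)
Lemma chi_bound (y k : R) : 0 <= y ->
 (forall u : R, 0 <= u <= y -> expR (- (u / 2)) * E psi0 u <= k) ->
 E chi0 0 - k * y <= expR (- (y / 2)) * E chi0 y.
move=> y0 hk.
have h1 (s : R) : 0 < s < 1 -> is_derive s 1 (fun s : R => - E chi0 (s * y))
 (- (y / 2 * (E chi0 (s * y) - 2 * E psi0 (s * y)))).
 by move=> s01; exact: is_deriveN (chi_der y0 s01).
have c1 : continuous (fun s : R => - E chi0 (s * y)).
 by move=> s; apply: (@cvgN _ R); exact: (E_cont smooth_chi0).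
have H := @exp_interp_le _ _ _ (y / 2) (k * y) (- E chi0 0) (- E chi0 y) (congr1 -%R (Ev0 _ _)) (congr1 -%R (Ev1 _ _)) c1 h1.
suff : expR (- (y / 2)) * - E chi0 y <= - E chi0 0 + k * y 
 by clear H c1 h1 hk; move: (E chi0 0) (E chi0 y) => u v; lra.
apply: H => s /andP[s0 s1].
have := hk (s * y); rewrite (_ : y / 2 * s = s * y / 2); last by field.
set e := expR _; set p := E psi0 _ => hp.
rewrite (_ : e * _ = y * (e * p)); last by field.
by rewrite [k * y]mulrC ler_wpM2l// hp//; apply/andP; split; [rewrite mulr_ge0// ltW|rewrite ler_piMl// ltW].
Qed.

(** Pointwise [psi0 <= chi0], and [expR (- (y / 2)) * E chi0 y] decreases because its derivative is
    minus a mean of [psi0]. *)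
Lemma psi_case_large (y : R) : 0 <= y -> expR (- (y / 2)) * E psi0 y <= E chi0 0.
move=> y0.
rewrite -[E chi0 0]addr0.
have H := @exp_interp_le _ _ _ (y / 2) 0 _ _ (Ev0 _ _) (Ev1 _ _) (E_cont smooth_chi0) (fun s s01 => chi_der y0 s01).
apply: (@le_trans _ _ (expR (- (y / 2)) * E chi0 y)).
 rewrite ler_wpM2l ?expR_ge0//; apply: Ev_le; [exact: smooth_psi0|exact: smooth_chi0|].
 move=> x; rewrite /psi0 /chi0 ler_wpM2l ?(ltW (sech_gt0 _))// exprS ler_piMr ?(ltW (sech_gt0 _))//.
 by rewrite exprn_ile1 ?(ltW (sech_gt0 _))// sech_le1.
apply: H => s /andP[s0 s1].
have -> : y / 2 * (E chi0 (s * y) - 2 * E psi0 (s * y)) - y / 2 * E chi0 (s * y) = - (y * E psi0 (s * y)).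
 by move: (E chi0 _) (E psi0 _) => u v; field.
by rewrite mulrN oppr_le0 mulr_ge0 ?expR_ge0// mulr_ge0// Ev_ge0//; [exact: smooth_psi0|exact: psi0_ge0].
Qed.

(** If the means of [psi2] are nonpositive then [E psi0] itself decreases, so the extreme value is
    the one at 0, the mean of [sech ^ 4]. *)
Lemma psi_case_small (y : R) : (forall u, 0 <= u -> E psi2 u <= 0) -> 0 <= y ->
 expR (- (y / 2)) * E psi0 y <= E psi0 0.
move=> neg y0.
rewrite -[E psi0 0]addr0.
apply: (exp_interp_le (Ev0 _ _) (Ev1 _ _) (E_cont smooth_psi0) (fun s s01 => psi_der y0 s01)) => s /andP[s0 s1].
rewrite -mulrBr mulr_ge0_le0 ?expR_ge0// mulr_ge0_le0//; first lra.
rewrite subr_le0 (le_trans (neg _ _)) ?mulr_ge0 ?(ltW s0)//.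
by rewrite Ev_ge0//; [exact: smooth_psi0|exact: psi0_ge0].
Qed.

Lemma sqb_gt0 : 0 < sqr b. Proof. by rewrite sqrtr_gt0. Qed.
Lemma sqb2 : sqr b * sqr b = b. Proof. by rewrite -expr2 sqr_sqrtr ?ltW. Qed.

(* For [h <= b] the law of [X] has an even density times [exp (h x / b)], so
 that [E sech(X) g'(X)] is a mean with the even weight
 [sech (sqrt b z) cosh (h z / sqrt b)], which decreases in [|z|]. *)
Lemma psi2_le0 u : h <= b -> 0 <= u -> E psi2 u <= 0.
move=> hb u0.
pose f (t : R) := -3 * (sc t ^+ 3 * tanh t).
pose f' (t : R) := 9 * sc t ^+ 3 - 12 * sc t ^+ 5.
have sf : sm1 f by apply: sm1Z; apply: sm1M; [apply: sm1X; exact: sm1_sc|exact: sm1_th].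
have sf' : sm1 f' by apply: sm1B; apply: sm1Z; apply: sm1X; exact: sm1_sc.
have df (t : R) : is_derive t 1 f (f' t).
 have ds := is_derive_sech t; have dt := is_derive_tanh t.
 apply: d_ext (dZ (-3) (dM (dM ds (dM ds ds)) dt)) => [r|]; first by rewrite /f; ring.
 rewrite /f'; have := sech2E t; set a := sc t; set c := tanh t => e.
 rewrite [in RHS](_ : a ^+ 5 = a ^+ 3 * (1 - c ^+ 2)); last by rewrite e; ring.
 by rewrite -e; ring.
have of_ t : f (- t) = - f t by rewrite /f coshN tanhN; ring.
have f0 t : 0 <= t -> f t <= 0.
 by move=> t0; rewrite /f mulNr oppr_le0 mulr_ge0// mulr_ge0 ?tanh_ge0// exprn_ge0// ltW// sech_gt0.
pose su := sqr u; pose a := h / sqr b; pose sb := sqr b.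
have sb0 : 0 < sb by exact: sqb_gt0.
have asb : a <= sb by rewrite /a ler_pdivrMr ?sqb_gt0// sqb2.
have a0 : 0 < a by rewrite divr_gt0.
pose w z := sc (sb * z) * cosh (a * z).
pose w' z := w z * (a * tanh (a * z) - sb * tanh (sb * z)).
have sw : sm1 w.
 by apply: (sm1_ext _ (sm1M (sm1_sech 0 sb) (sm1_cosh 0 a))) => z; rewrite !add0r.
have dl (c z : R) : is_derive z 1 (fun z => c * z) c.
 by have := is_deriveZ c (is_derive_id z (1:R)); rewrite -[_ *: 1]/(c * 1) mulr1.
have dw (z : R) : is_derive z 1 w (w' z).
 have dc := @is_derive1_comp _ cosh (fun z => a * z) z _ _ (is_derive_cosh _) (dl a z).
 have dc2 := @is_derive1_comp _ (fun t => sc t) (fun z => sb * z) z _ _ (is_derive_sech _) (dl sb z).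
 have := is_deriveM dc2 dc; congr is_derive.
 rewrite -![_ *: _]/(_ * _) /= /w' /w !(tanhE (a * z)); have := cosh_neq0 (a * z).
 have C1 := cosh_neq0 (sb * z); move=> C0; by field; rewrite ?C0 ?C1.
have -> : E psi2 u = expR (- (a ^+ 2 / 2)) * gm (fun z => w z * heat su f' (sb * z)).
 have eo t : heat su f' (- t) = heat su f' t.
 rewrite /heat -[LHS](gmean_sym (sm1_affine (- t) su sf')).
 by eqgm => z; rewrite mulrN -opprD /f' coshN.
 transitivity (gm (fun z => sc (sb * (a + z)) * heat su f' (sb * (a + z)))).
 rewrite EvE /= /T; eqgm => z.
 have -> : sb * (a + z) = X z by rewrite mulrDr /a mulrCA mulfV ?mulr1// gt_eqF.
 rewrite /heat -gmeanZ; last exact: sm1_affine.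
 eqgm => z'; rewrite /psi2 LoE LiE /push/=.
 by rewrite !(mulr1n, mulr0n, addr0, add0r).
 apply: (etrans (gmean_even_shift (f := fun z => sc (sb * z) * heat su f' (sb * z)) a _ _)).
 - apply: (sm1_ext _ (sm1M (sm1_sech 0 sb) (sm1_affine 0 sb (sm1_heat su sf')))) => z.
 by rewrite !add0r.
 - by move=> z; rewrite !mulrN eo coshN.
 - by congr (_ * gm _); apply/funext => z; rewrite /w mulrAC.
rewrite mulr_ge0_le0 ?expR_ge0//.
apply: (gmean_weight_le0 sb0 (sm1_heat su sf) sw _ dw).
- by move=> t; exact: is_derive_heat.
- by move=> t; rewrite mulr_ge0// ltW ?sech_gt0 ?cosh_gt0.
- have key t : 0 <= t -> w' t * heat su f (sb * t) >= 0.
 move=> t0; rewrite mulr_le0// ?heat_odd_le0 ?sqrtr_ge0// ?mulr_ge0 ?(ltW sb0)//.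
 rewrite mulr_ge0_le0 ?mulr_ge0 ?(ltW (sech_gt0 _)) ?(ltW (cosh_gt0 _))// subr_le0.
 rewrite ler_pM ?(ltW a0)//; first by rewrite tanh_ge0// mulr_ge0// ltW.
 by rewrite tanh_le// ler_wpM2r.
 move=> t; have [t0|t0] := leP 0 t; first exact: key.
 have := key (- t); rewrite /w' /w !mulrN heat_odd// coshN coshN !tanhN.
 rewrite (_ : _ * _ = sc (sb * t) * cosh (a * t) *
 (a * tanh (a * t) - sb * tanh (sb * t)) * heat su f (sb * t)); last ring.
 apply; lra.
- by move=> t; exact: heat_odd.
- by move=> t; apply: heat_odd_le0 => //; exact: sqrtr_ge0.
Qed.
Notation em m := (emf m).

Lemma sm1_X f : sm1 f -> sm1 (fun z => f (X z)). Proof. exact: sm1_affine. Qed.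
Lemma gm_sech2 : gm (fun z => sc (X z) ^+ 2) = 1 - q.
rewrite -Eth2 -[X in X - _](gm_cst 1) -[RHS]addrC -mulN1r -gmeanZ -?gmeanD.
- by eqgm => z; rewrite -sech2E; ring.
- by apply: sm1Z; apply: sm1_X (sm1X 2 sm1_th).
- exact: sm1_cst.
- exact: sm1_X (sm1X 2 sm1_th).
Qed.

Lemma E_chi0E y : E chi0 y = gm (fun z => sc (X z) * heat (sqr y) (fun t => sc t) (X z)).
rewrite EvE /= /T; eqgm => z.
rewrite /heat -gmeanZ; last exact: sm1_affine sm1_sc.
eqgm => z'; rewrite /chi0 LoE LiE /push/=.
by rewrite !(mulr1n, mulr0n, addr0, add0r).
Qed.
Lemma E_chi00 : E chi0 0 = 1 - q.
by rewrite -gm_sech2 EvE (P_diag (fun x y => sc x * sc y)); eqgm => z; ring. Qed.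
Lemma E_psi00 : E psi0 0 = gm (fun z => sc (X z) ^+ 4).
by rewrite EvE (P_diag (fun x y => sc x * sc y ^+ 3)); eqgm => z; ring. Qed.

(* [tanh - tanh^2] is an odd function times [exp (-x)], and this weight shifts
 the mean of [X] from [h] to [h - b]. *)
Lemma mean_tanh_gt : b < h -> q < gm (fun z => tanh (X z)).
move=> bh; pose sb := sqr b; have sb0 : 0 < sb by exact: sqb_gt0.
pose F z := sinh (0 + sb * z) * sc (0 + sb * z) ^+ 2.
have sF : sm1 F by apply: sm1M; [exact: sm1_sinh|apply: sm1X; exact: sm1_sech].
pose a := h / sb; have aE : sb * a = h by rewrite /a mulrCA mulfV ?mulr1// gt_eqF.
have asb : sb < a by rewrite /a ltr_pdivlMr// sqb2.
pose f t := tanh (0 + sb * t) + (-1) * tanh (0 + sb * t) ^+ 2.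
have sf : sm1 f by apply: sm1D; [exact: sm1_tanh|apply: sm1Z; apply: sm1X; exact: sm1_tanh].
rewrite -subr_gt0 -Eth2 -mulN1r -gmeanZ -?gmeanD; last 3 first.
- exact: sm1_X sm1_th.
- by apply: sm1Z; apply: sm1_X (sm1X 2 sm1_th).
- exact: sm1_X (sm1X 2 sm1_th).
have -> : (fun z => tanh (X z) + (-1) * tanh (X z) ^+ 2) = fun z => f (a + z).
 by apply/funext => z; rewrite /f add0r mulrDr aE.
rewrite gmean_shift// mulr_gt0 ?expR_gt0//.
have -> : (fun z => f z * expR (a * z)) = fun z => F z * expR ((a - sb) * z).
 apply/funext => z; rewrite /f /F add0r mulrBl expRD tanhE.
 set e := expR (a * z); have := cosh_neq0 (sb * z); set C := cosh _ => C0.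
 have -> : expR (- (sb * z)) = C - sinh (sb * z) by rewrite /C /cosh /sinh; field.
 by field.
have := gmean_shift (a - sb) sF; rewrite gmean_odd_shift//; last first.
 by move=> z; rewrite /F !add0r mulrN sinhN coshN mulNr.
have e0 : expR (- ((a - sb) ^+ 2 / 2)) != 0 by rewrite gt_eqF ?expR_gt0.
move=> /(mulfI e0) <-.
have ss : sm1 (fun z => sinh ((a - sb) * z)).
 by apply: sm1_ext (sm1_sinh 0 (a - sb)) => z; rewrite add0r.
have key z : 0 < z -> 0 < F z * sinh ((a - sb) * z).
 move=> z0; rewrite /F add0r; apply: mulr_gt0; last by rewrite sinh_gt0// mulr_gt0// subr_gt0.
 by rewrite mulr_gt0 ?exprn_gt0 ?sech_gt0// sinh_gt0// mulr_gt0.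
have keyn z : 0 < - z -> 0 < F z * sinh ((a - sb) * z).
 by move=> /key; rewrite /F !add0r !mulrN !sinhN coshN !mulNr mulrN opprK.
apply: gm_gt0; [exact: sm1_meas (sm1M sF ss)|exact: sm1_eg (sm1M sF ss)| |].
- move=> z; have [z0|z0|->] := ltgtP z 0; [apply/ltW/keyn; lra|exact/ltW/key|].
 by rewrite mulr0 /sinh oppr0 subrr mul0r mulr0.
- by move=> z z0; have [zn|zp] := ltP z 0; [apply: keyn; lra|apply: key; rewrite lt_neqAle eq_sym z0].
Qed.

(** The square of [sqr b * z + b - (b / q) * tanh (X z)] has a nonnegative mean, which integration
    by parts computes. Together with [q < E tanh] from [mean_tanh_gt] this forces [b / q < 1 + b],
    which is the claim. *)
Lemma var_cs : b < h -> b * (1 - q) < q.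
move=> bh; have ET := mean_tanh_gt bh; set T1 := gm _ in ET.
pose sb := sqr b.
have hb : sb * sb = b by exact: sqb2.
have sT : sm1 (fun z => tanh (X z)) by exact: sm1_X sm1_th.
have dT (t : R) : is_derive t 1 (fun z => tanh (X z)) (sb * sc (X t) ^+ 2).
 have dX : is_derive t 1 X sb.
 have := is_deriveD (is_derive_cst h t 1) (is_deriveZ sb (is_derive_id t (1:R))).
 by rewrite add0r -[_ *: 1]/(sb * 1) mulr1.
 by have := @is_derive1_comp _ (@tanh R) X t _ _ (is_derive_tanh _) dX; rewrite mulrC.
have [e1 _] := gmean_ibp sT dT.
rewrite gmeanZ ?gm_sech2 in e1; last by apply: sm1_X (sm1X 2 sm1_sc).
have [e2 _] := gmean_ibp sm1_id (fun t : R => is_derive_id t 1); rewrite gm_cst in e2.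
pose lam := b / q.
have key : 0 <= gm (fun z => (sb * z + b - lam * tanh (X z)) ^+ 2) by apply: gmean_ge0 => z; exact: sqr_ge0.
have e0 : gm (fun z : R => z) = 0.
 have s1 := @sm1_id R; have := gmean_sym s1.
 have -> : gm (fun t : R => - t) = -1 * gm (fun z : R => z).
 by rewrite -gmeanZ//; eqgm => z; rewrite mulN1r.
 by set g0 := gm _ => e; have := e; lra.
have : gm (fun z => (sb * z + b - lam * tanh (X z)) ^+ 2) = b + b ^+ 2 - 2 * lam * (b * (1 - q) + b * T1) + lam ^+ 2 * q.
 have -> : (fun z => (sb * z + b - lam * tanh (X z)) ^+ 2) =
 fun z => (b * (z * z) + ((2 * sb * b) * z + b ^+ 2)) +
 ((- (2 * lam * sb)) * (z * tanh (X z)) + ((- (2 * lam * b)) * tanh (X z) + lam ^+ 2 * tanh (X z) ^+ 2)).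
 apply/funext => z; have -> : b * (z * z) = sb * sb * (z * z) by rewrite hb.
 by rewrite -/sb; ring.
 have s2 : sm1 (fun z => tanh (X z) ^+ 2) by exact: sm1_X (sm1X 2 sm1_th).
 have s3 : sm1 (fun z => z * tanh (X z)) by exact: sm1M sm1_id sT.
 have s4 : sm1 (fun z : R => z * z) by exact: sm1M sm1_id sm1_id.
 have s5 := @sm1_id R.
 have s6 (c : R) := sm1_cst c.
 have s7 (c : R) f : sm1 f -> sm1 (fun z => c * f z) := @sm1Z R c f.
 rewrite !gmeanD ?gmeanZ//; do ?[apply: sm1D|exact: s7|exact: s6|by []].
 rewrite gm_cst e0 e1 e2 Eth2 -/T1.
 have -> : - (2 * lam * sb) * (sb * (1 - q)) = - (2 * lam * b * (1 - q)) by rewrite -hb; ring.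
 ring.
move=> e; rewrite e /lam in key.
have q1 : b / q * q = b by rewrite mulfVK// gt_eqF.
set p := b / q in key q1; have p0 : 0 < p by rewrite divr_gt0.
have : 0 < b * (1 + b - p).
 apply: le_lt_trans key _; rewrite -subr_gt0.
 have -> : b * (1 + b - p) - (b + b ^+ 2 - 2 * p * (b * (1 - q) + b * T1) + p ^+ 2 * q) = 2 * b * p * (T1 - q) by rewrite -q1; ring.
 by apply: mulr_gt0; [rewrite mulr_gt0// mulr_gt0|rewrite subr_gt0].
rewrite pmulr_rgt0// => p1; have : p * q < (1 + b) * q by rewrite ltr_pM2r//; lra.
by rewrite q1; lra.
Qed.

(** Here a condition at inner variance 0 becomes a bound at every inner variance. For [h <= b] the
    damped mean of [psi0] is largest at 0, where it is the mean of [sech ^ 4]. For [b < h] the mean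
    [1 - q] of [sech ^ 2] is small enough by [var_cs]. *)
Lemma psi_sup : exists k, [/\ 0 <= k, (gm (fun z => sc (X z) ^+ 4) * b < q -> k * b < q) &
 forall y, 0 <= y -> 1 - q - k * y <= expR (- (y / 2)) * E chi0 y].
rewrite -E_chi00 -E_psi00; have [hb|bh] := leP h b.
 exists (E psi0 0); split=> //; first by rewrite Ev_ge0//; [exact: smooth_psi0|exact: psi0_ge0].
 move=> y y0; apply: chi_bound => // u /andP[u0 _]; apply: psi_case_small => // v v0.
 exact: psi2_le0.
exists (E chi0 0); split=> [|_|y y0].
- by rewrite Ev_ge0//; [exact: smooth_chi0|move=> x; rewrite mulr_ge0// ltW// sech_gt0].
- by rewrite E_chi00 mulrC var_cs.
- by apply: chi_bound => // u /andP[u0 _]; exact: psi_case_large.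
Qed.

Lemma TtE (g : R -> R) (x : V) : T true (fun x => g (Li x)) x = heat (x (inr true)) g (Li x).
eqgm => z; rewrite !LiE /push/= !(mulr1n, mulr0n, addr0); congr g; ring.
Qed.
Lemma TfE (F : V -> R) (G : R -> R -> R) u : (forall x, F x = G (x (inr true)) (Li x)) ->
 T false F (vec (av u)) = gm (fun z => G (sqr u) (X z)).
move=> FG; eqgm => z; rewrite FG LiE /push/= !(mulr1n, mulr0n, addr0, add0r) //.
Qed.

Section OneRSB.
Variables (m : R).
Hypothesis m1 : 1 <= m.
Let V0 (x : V) := T true (fun x => em m (Li x)) x.
Let w0 t := m * (em m t + (m - 1) * (em m t * tanh t ^+ 2)).
Let W0 (x : V) := T true (fun x => w0 (Li x)) x.

Lemma sm1_w0 : sm1 w0.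
apply: sm1Z; apply: sm1D; first exact: sm1_chm.
by apply: sm1Z; apply: sm1M; [exact: sm1_chm|apply: sm1X; exact: sm1_th].
Qed.
Lemma em_ge1 t : 1 <= em m t.
by rewrite -[leLHS]expR0 /emf ler_expR mulr_ge0 ?ln_ge0 ?cosh_ge1//; have := m1; lra. Qed.
Lemma heat_em_ge1 s t : 1 <= heat s (em m) t.
rewrite -[leLHS](gm_cst 1); apply: gmean_le; [exact: sm1_cst|exact: sm1_affine (sm1_chm m)|].
by move=> z; exact: em_ge1.
Qed.
Lemma V0_ge1 x : 1 <= V0 x.
by rewrite /V0 TtE heat_em_ge1. Qed.
Lemma smooth_V0 : smooth V0.
by apply: smooth_T; apply: smooth_sm1L; exact: sm1_chm. Qed.
Lemma V0_gt0 x : 0 < V0 x. Proof. exact: lt_le_trans (V0_ge1 x). Qed.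
Lemma growth_iV0 : growth (fun x => (V0 x)^-1).
apply: growth_le (growth_cst 1) => x; rewrite normr1 ger0_norm ?invr_ge0 ?(ltW (V0_gt0 x))//.
by rewrite invf_le1 ?V0_ge1// V0_gt0.
Qed.
Lemma smooth_lnV0 : smooth (fun x => ln (V0 x)).
exact: smooth_ln V0_gt0 smooth_V0 growth_iV0. Qed.
Lemma smooth_iVW : smooth (fun x => (V0 x)^-1 * W0 x).
apply: smoothM; last by apply: smooth_T; apply: smooth_sm1L; exact: sm1_w0.
by apply: smooth_inv; [move=> x; rewrite gt_eqF ?V0_gt0|exact: smooth_V0|exact: growth_iV0].
Qed.
Lemma is_derive_em (t : R) : is_derive t 1 (em m) (m * (em m t * tanh t)).
have := @is_derive1_ln _ _ (cosh_gt0 t) => dl.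
have dlc : is_derive t 1 (fun t => ln (cosh t)) (tanh t).
 by have := @is_derive1_comp _ (@ln R) cosh t _ _ dl (is_derive_cosh t); rewrite tanhE mulrC.
have := @is_derive1_comp _ expR (fun t => m * ln (cosh t)) t _ _ (is_derive_expR _) (dZ m dlc).
by congr is_derive; rewrite mulrCA.
Qed.

Lemma DD_em : D (inl true) (D (inl true) (fun x : V => em m (Li x))) = fun x => w0 (Li x).
have p1 : pd (inl true) (fun x : V => em m (Li x)) (fun x => m * (em m (Li x) * tanh (Li x))).
 apply: pd_ext (pd_comp (f' := fun t => m * (em m t * tanh t)) (fun x => is_derive_em (Li x)) (pd_L h (fun _ : bool => 1) (inl true))) => // x.
 by rewrite /wk mulr1.
rewrite (pd_D p1).
apply: pd_D.
have de (t : R) : is_derive t 1 (fun t => m * (em m t * tanh t)) (w0 t).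
 apply: d_ext (dZ m (dM (is_derive_em t) (is_derive_tanh t))) => // .
 rewrite -sech2E /w0; ring.
apply: pd_ext (pd_comp (fun x => de (Li x)) (pd_L h (fun _ : bool => 1) (inl true))) => // x.
by rewrite /wk mulr1.
Qed.

Lemma D_lnV0 i : D (inr i) (fun x => ln (V0 x)) = if i then fun x => x (inr true) * ((V0 x)^-1 * W0 x) else fun=> 0.
have s : smooth (fun x : V => em m (Li x)) by apply: smooth_sm1L; exact: sm1_chm.
have d0 j : D (inr j) (fun x : V => em m (Li x)) = fun=> 0 by exact: (inr0 (fun _ y => em m y)).
rewrite (pd_D (pd_ln V0_gt0 (pd_T (inr i) true s))) /DT d0 DD_em; apply/funext => x.
rewrite -/(W0 x) (_ : T true (fun=> 0) x = 0); last exact: T_indep.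
have -> : (inr i == inr true :> bool + bool) = i by case: i.
by case: i; rewrite /= ?(mul1r, mul0r, add0r, mulr0)//; ring.
Qed.

(** Mean of [tanh ^ 2] under the inner Gaussian tilted by [cosh ^ m], then averaged over the outer
    one. It gives the slope of the one-step functional in the inner variance. *)
Definition tilted u := gm (fun z => heat (sqr u) (fun t => em m t * tanh t ^+ 2) (X z) / heat (sqr u) (em m) (X z)).

Lemma sm1_tilted s : sm1 (fun t => heat s (fun t => em m t * tanh t ^+ 2) t / heat s (em m) t).
apply: sm1M; first by apply: sm1_heat; apply: sm1M; [exact: sm1_chm|apply: sm1X; exact: sm1_th].
by apply: sm1V; [apply: sm1_heat; exact: sm1_chm|exact: heat_em_ge1].
Qed.
Lemma rsb_der u : T false (fun x => (V0 x)^-1 * W0 x) (vec (av u)) = m * (1 + (m - 1) * tilted u).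
have st := sm1_X (sm1_tilted (sqr u)).
rewrite (TfE (G := fun s t => m + m * (m - 1) * (heat s (fun t => em m t * tanh t ^+ 2) t / heat s (em m) t))).
 rewrite (gmeanD (sm1_cst m) (sm1Z (m * (m - 1)) st)) (gmeanZ _ st) gm_cst /tilted; ring.
move=> x; rewrite /V0 /W0 !TtE; set s := x _; set t := Li x.
have -> : heat s w0 t = m * (heat s (em m) t + (m - 1) * heat s (fun t => em m t * tanh t ^+ 2) t).
 have s1 := sm1_affine t s (sm1_chm m).
 have s2 := sm1_affine t s (sm1M (sm1_chm m) (sm1X 2 sm1_th)).
 by rewrite /heat /w0 (gmeanZ m (sm1D s1 (sm1Z (m - 1) s2))) (gmeanD s1 (sm1Z (m - 1) s2)) (gmeanZ _ s2).
have : heat s (em m) t != 0 by rewrite gt_eqF// (lt_le_trans ltr01 (heat_em_ge1 s t)).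
by move: (heat s _ t) (heat s _ t) => A B A0; field.
Qed.

(** The derivative of the left side in the inner variance is [(m / 2) * (1 + (m - 1) * tilted u)];
    the affine majorant of [tilted] is integrated from 0 to [y]. *)
Lemma rsb_bound y k : 0 <= y -> (forall u, 0 <= u <= y -> tilted u <= q + k * u) ->
 gm (fun z => ln (heat (sqr y) (em m) (X z))) <= m * gm (fun z => ln (cosh (X z))) +
 (m / 2) * (y + (m - 1) * (q * y + k * y ^+ 2 / 2)).
move=> y0 hk.
pose F := T false (fun x => ln (V0 x)).
pose hh i := if i then T false (fun x => (V0 x)^-1 * W0 x) else T false (D (inl false) (D (inl false) (fun x => ln (V0 x)))).
have Fh i : D (inr i) F = fun x => x (inr i) * hh i x.
 rewrite /F (D_T _ _ smooth_lnV0) /DT D_lnV0; apply/funext => x; case: i => /=.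
 rewrite mul0r addr0 (T_indepM (A := fun x => x (inr true)) smooth_iVW)//.
 by move=> t; rewrite /push addr0.
 by rewrite (T_indep (F := fun=> 0))// add0r mul1r.
have Fe u : F (vec (av u)) = gm (fun z => ln (heat (sqr u) (em m) (X z))).
 by apply: (TfE (G := fun s t => ln (heat s (em m) t))) => x; rewrite /V0 TtE.
have F0 : F (vec (av 0)) = m * gm (fun z => ln (cosh (X z))).
 rewrite Fe -gmeanZ; last exact: sm1_lncosh.
 eqgm => z; rewrite /heat sqrtr0.
 by under eq_fun do rewrite mul0r addr0; rewrite gm_cst /emf expRK.
have := @interp_le _ _ F hh (av 0) (av y) (smooth_T false smooth_lnV0) (fun k => av_ge0 k (lexx 0)) (fun k => av_ge0 k y0) Fh
 ((m / 2) * (y + (m - 1) * (q * y))) ((m / 2) * ((m - 1) * (k * y ^+ 2))).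
rewrite F0 Fe => H.
suff H1 : forall s : R, 0 < s < 1 -> 2^-1 * (\sum_i (av y i - av 0 i) * hh i (vec (mix (av 0) (av y) s))) <=
 m / 2 * (y + (m - 1) * (q * y)) + m / 2 * ((m - 1) * (k * y ^+ 2)) * s.
 have := H H1; set A := gm _; set B := gm _ => H2; rewrite -lerBlDl (le_trans H2)//; apply: le_of_eq; by field.
move=> s /andP[s0 s1]; rewrite mix_av big_bool /= subrr mul0r addr0 subr0 /hh rsb_der.
have sy : 0 <= s * y <= y by rewrite mulr_ge0 ?(ltW s0)// ler_piMl// ltW.
have t1 := hk (s * y) sy.
have : y * (m * (m - 1)) * tilted (s * y) <= y * (m * (m - 1)) * (q + k * (s * y)).
 by have m1' := m1; rewrite ler_wpM2l// !mulr_ge0//; lra.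
move: (tilted _) => A; lra.
Qed.
End OneRSB.

(** At exponent 1 the normalisation is explicit, since [cosh] is an eigenfunction of the heat flow,
    and [cosh * tanh ^ 2] equals [cosh - 1 / cosh]. *)
Lemma tilted1 u : 0 <= u -> tilted 1 u = 1 - expR (- (u / 2)) * E chi0 u.
move=> u0; rewrite E_chi0E -gmeanZ; last by apply: sm1_X (sm1M sm1_sc (sm1_heat _ sm1_sc)).
have s1 := sm1_X (sm1M sm1_sc (sm1_heat (sqr u) sm1_sc)).
have sG := sm1Z (expR (- (u / 2))) s1.
apply: (@etrans _ _ (gm (fun z => 1 + (-1) * (expR (- (u / 2)) * (sc (X z) * heat (sqr u) (fun t => sc t) (X z)))))); last first.
 by rewrite (gmeanD (sm1_cst 1) (sm1Z (-1) sG)) gm_cst (gmeanZ _ sG) mulN1r.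
eqgm => z; set t := X z; set s := sqr u.
have -> : heat s (em 1) t = expR (u / 2) * cosh t.
 rewrite -[u]sqr_sqrtr// -/s -heat_cosh; eqgm => z'.
 by rewrite /emf mul1r lnK ?posrE ?cosh_gt0.
have -> : heat s (fun t => em 1 t * tanh t ^+ 2) t = expR (u / 2) * cosh t - heat s (fun t => sc t) t.
 have -> : expR (u / 2) * cosh t = heat s cosh t by rewrite heat_cosh sqr_sqrtr.
 have s2 := sm1_affine t s sm1_sc.
 rewrite -mulN1r -(gmeanZ _ s2) -(gmeanD (sm1_affine t s sm1_ch) (sm1Z (-1) s2)).
 eqgm => z'; rewrite /emf mul1r lnK ?posrE ?cosh_gt0// -[tanh _ ^+ 2](subKr 1) sech2E.
 by have := cosh_neq0 (t + s * z') => ?; field.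
have c0 := cosh_neq0 t; have e0 := gt_eqF (expR_gt0 (u / 2)).
have -> : expR (- (u / 2)) = (expR (u / 2))^-1 by rewrite expRN.
by field; rewrite c0 e0.
Qed.

(** Expansion at exponent 1: the slope [k] of [tilted 1] is strictly below [q / b], and this room
    absorbs the error [K * (m - 1)] of [tilt_le] once [m - 1] is small, uniformly for [y <= Y]. *)
Lemma at_1rsb (Y : R) : 0 <= Y -> gm (fun z => sc (X z) ^+ 4) * b < q ->
 exists m c, [/\ 1 < m <= 2, 0 < c & forall y, 0 <= y <= Y ->
 m^-1 * gm (fun z => ln (heat (sqr y) (em m) (X z))) <= gm (fun z => ln (cosh (X z))) + y / 2 +
 (m - 1) / 2 * (q * y + q / b * y ^+ 2 / 2) - c * y ^+ 2].
move=> Y0 hb; have [k [k0 /(_ hb) kb hk]] := psi_sup.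
have [K K0 hK] := tilt_le (sqrtr_ge0 Y).
have kq : k < q / b by rewrite ltr_pdivlMr.
(* Half of the room [q / b - k] goes to the error; the other half yields the constant [c]. *)
pose d := Num.min 1 ((q / b - k) / (2 * (K + 1))).
have K1 : 0 < 2 * (K + 1) by lra.
have d0 : 0 < d by rewrite lt_min ltr01 divr_gt0// subr_gt0.
have d1 : d <= 1 by rewrite ge_min lexx.
have dK : K * d <= (q / b - k) / 2.
 have : d <= (q / b - k) / (2 * (K + 1)) by rewrite ge_min lexx orbT.
 rewrite ler_pdivlMr// => h1; have : 0 <= d by exact: ltW.
 lra.
exists (1 + d), (d / 8 * (q / b - k)); split; first lra.
 by rewrite !mulr_gt0// subr_gt0.
move=> y /andP[y0 yY]; have m1 : 1 <= 1 + d by lra.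
have hT u : 0 <= u <= y -> tilted (1 + d) u <= q + (k + K * d) * u.
 move=> /andP[u0 uy].
 have sK : 0 <= K * d * u by rewrite !mulr_ge0// ltW.
 apply: (@le_trans _ _ (tilted 1 u + K * d * u)); last first.
 by rewrite (tilted1 u0); have := hk u u0; lra.
 have s1 := sm1_X (sm1_tilted (lexx 1) (sqr u)).
 rewrite /tilted; apply: (@le_trans _ _ (gm (fun z => heat (sqr u) (fun t => em 1 t * tanh t ^+ 2) (X z) / heat (sqr u) (em 1) (X z) + K * d * u))); last first.
 by rewrite (gmeanD s1 (sm1_cst (K * d * u))) gm_cst.
 apply: gmean_le; [exact: sm1_X (sm1_tilted m1 _)|exact: sm1D (sm1_cst _)|].
 move=> z; have := hK (X z) (sqr u) (1 + d).
 have -> : 1 + d - 1 = d by ring.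
 have -> : 1 + d <= 2 by lra.
 rewrite sqrtr_ge0 ler_sqrt ?(le_trans y0)// (le_trans uy)// m1 sqr_sqrtr//.
 move=> /(_ isT isT) H; apply: (le_trans H); rewrite lerD2r.
 have e : em 1 = @cosh R.
 by apply/funext => t; rewrite /emf mul1r lnK ?posrE ?cosh_gt0.
 by rewrite e.
have := rsb_bound m1 y0 hT; set A := gm _; set B := gm _ => H.
rewrite mulrC ler_pdivrMr; last lra.
apply: (le_trans H).
have y2 : 0 <= y ^+ 2 by exact: sqr_ge0.
have : 0 <= (1 + d) * d * y ^+ 2 * ((q / b - k) / 2 - K * d).
 by rewrite !mulr_ge0 ?subr_ge0// ltW//; lra.
move: (q / b) => qb; have : d * y ^+ 2 * (1 + d) >= 0 by rewrite !mulr_ge0//; lra.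
lra.
Qed.
End AT.

(** * Correlation of two replicas in correlated Gaussian fields *)

Section TwoFields.
Context {R : realType}.
Notation V := (bool + bool -> R).
Notation Li := (L (_ : R) (fun _ : bool => 1 : R)).
Notation cs := [:: false; true].
Notation Lm h := (L h (fun k : bool => if k then -1 else 1 : R)).
Notation Lp h := (L h (fun k : bool => 1 : R)).
Definition bv (a b : R) (k : bool) := if k then b else a.

Lemma P_cs (F : V -> R) a b : P cs F (vec (bv a b)) =
 gm (fun z => gm (fun z' => F (push (push (vec (bv a b)) (inl false) (sqr a * z)) (inl true) (sqr b * z')))).
by eqgm => z; eqgm => z'; rewrite [push _ _ _ (inr true)]/push/= addr0.
Qed.
Lemma LpE h z z' a b : Lp h (push (push (vec (bv a b)) (inl false) z) (inl true) z') = h + z + z'.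
by rewrite /L big_bool /push/= !(mulr1n, mulr0n, addr0, add0r, mul1r) -addrA [z' + z]addrC. Qed.
Lemma LmE h z z' a b : Lm h (push (push (vec (bv a b)) (inl false) z) (inl true) z') = h + z - z'.
by rewrite /L big_bool /push/= !(mulr1n, mulr0n, addr0, add0r, mul1r, mulN1r) -addrA [- z' + z]addrC. Qed.
Lemma bv_ge0 a b k : 0 <= a -> 0 <= b -> 0 <= bv a b k. Proof. by case: k. Qed.
Lemma P_two (f g : R -> R) h a b : P cs (fun x => f (Lp h x) * g (Lm h x)) (vec (bv a b)) =
 gm (fun z => gm (fun z' => f (h + sqr a * z + sqr b * z') * g (h + sqr a * z - sqr b * z'))).
rewrite P_cs; eqgm => z; eqgm => z'.
by rewrite LpE LmE.
Qed.
Lemma P_plus (f : R -> R) h a b : P cs (fun x => f (Lp h x)) (vec (bv a b)) =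
 gm (fun z => gm (fun z' => f (h + sqr a * z + sqr b * z'))).
by rewrite P_cs; eqgm => z; eqgm => z'; rewrite LpE. Qed.
Lemma P_minus (f : R -> R) h a b : P cs (fun x => f (Lm h x)) (vec (bv a b)) =
 gm (fun z => gm (fun z' => f (h + sqr a * z - sqr b * z'))).
by rewrite P_cs; eqgm => z; eqgm => z'; rewrite LmE. Qed.

(* The law of a sum of two independent Gaussians only depends on the total variance. *)
Lemma heat_semigroup (f : R -> R) h a b : sm1 f -> 0 <= a -> 0 <= b ->
 gm (fun z => gm (fun z' => f (h + sqr a * z + sqr b * z'))) =
 gm (fun z => f (h + sqr (a + b) * z)).
move=> sf a0 b0.
pose F (x : V) := f (Lp h x).
have sF : smooth F by exact: smooth_sm1L.
have F0 i : D (inr i) F = fun=> 0.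
 apply: pd_D => x; rewrite (_ : (fun t : R => _) = fun=> F x); first exact: is_derive_cst.
 by apply/funext => t; rewrite /F /L !big_bool !pushNE.
have DD i : D (inl i) F = D (inl true) F.
 have [f' df sf'] := sm1_der sf.
 have p j := pd_comp (fun x => df (Lp h x)) (pd_L h (fun _ : bool => 1) (inl j)).
 by rewrite !(pd_D (p _)).
have DD2 i : D (inl i) (D (inl i) F) = D (inl true) (D (inl true) F).
 have [f' df sf'] := sm1_der sf; have [f2 df' _] := sm1_der sf'.
 have p j := pd_comp (fun x => df (Lp h x)) (pd_L h (fun _ : bool => 1) (inl j)).
 have p' j := pd_comp (fun x => df' (Lp h x)) (pd_L h (fun _ : bool => 1) (inl j)).
 rewrite !(pd_D (p _)) /=.
 have -> : (fun x => f' (Lp h x) * 1) = fun x => f' (Lp h x) by apply/funext => x; rewrite mulr1.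
 by rewrite !(pd_D (p' _)).
have le A B : (forall k, 0 <= A k) -> (forall k, 0 <= B k) -> A true + A false = B true + B false ->
 P cs F (vec B) - P cs F (vec A) <= 0 + 0 / 2.
 move=> A0 B0 AB; apply: (interp_le (smooth_P _ sF) A0 B0 (h := fun i => P cs (D (inl i) (D (inl i) F)))).
 by move=> i; rewrite D_P_in//; case: i.
 move=> s _; under eq_bigr do rewrite DD2; rewrite big_bool/= -mulrDl.
 by rewrite (_ : _ + _ = 0) ?mul0r ?mulr0 ?addr0//; lra.
have h1 : forall k, 0 <= bv a b k by move=> k; exact: bv_ge0.
have h2 : forall k, 0 <= bv (a + b) 0 k by move=> k; apply: bv_ge0 => //; exact: addr_ge0.
have e1 : P cs F (vec (bv a b)) = gm (fun z => gm (fun z' => f (h + sqr a * z + sqr b * z'))).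
 by rewrite P_cs; eqgm => z; eqgm => z'; rewrite /F LpE.
have e2 : P cs F (vec (bv (a + b) 0)) = gm (fun z => f (h + sqr (a + b) * z)).
 rewrite P_cs; eqgm => z; rewrite -[RHS]gm_cst; eqgm => z'.
 by rewrite /F LpE sqrtr0 mul0r addr0.
have l1 := le _ _ h1 h2; have l2 := le _ _ h2 h1; move: l1 l2; rewrite e1 e2 /= add0r addrC.
move=> /(_ erefl) l1 /(_ erefl); move: l1; clear e1 e2 le.
by set u := gm _; set w := gm _ => l1 l2; apply/eqP; rewrite eq_le; apply/andP; split; lra.
Qed.

Lemma heat_semigroupN (f : R -> R) h a b : sm1 f -> 0 <= a -> 0 <= b ->
 gm (fun z => gm (fun z' => f (h + sqr a * z - sqr b * z'))) =
 gm (fun z => f (h + sqr (a + b) * z)).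
move=> sf a0 b0; rewrite -(heat_semigroup h sf a0 b0); eqgm => z.
rewrite -[LHS](_ : gm (fun z' => f (h + sqr a * z + sqr b * - z')) = _).
 by apply: (gmean_sym (f := fun z' => f (h + sqr a * z + sqr b * z'))); exact: sm1_affine.
by eqgm => z'; rewrite mulrN.
Qed.
Variables (h b q : R).
Hypotheses (b0 : 0 < b) (q0 : 0 < q).
Hypothesis Eth2 : gm (fun z => tanh (h + sqr b * z) ^+ 2) = q.
Let S4 := gm (fun z => (cosh (h + sqr b * z))^-1 ^+ 4).
(** The two fields have variance [b] and covariance [b * c / q]; they are the sum and the difference
    of independent parts. *)
Definition corr (c : R) := gm (fun z => gm (fun z' =>
 tanh (h + sqr (b / q * (q + c) / 2) * z + sqr (b / q * (q - c) / 2) * z') *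
 tanh (h + sqr (b / q * (q + c) / 2) * z - sqr (b / q * (q - c) / 2) * z'))).
Let Fth (x : V) := tanh (Lp h x) * tanh (Lm h x).
Let A c := bv (b / q * (q + c) / 2) (b / q * (q - c) / 2).

Let corrE c : corr c = P cs Fth (vec (A c)). Proof. by rewrite P_two. Qed.
Let sFth : smooth Fth. Proof. by apply: smoothM; exact: smooth_th. Qed.
Let bq : b / q * q = b. Proof. by rewrite mulfVK// gt_eqF. Qed.
Let A_ge0 (c : R) : `|c| <= q -> forall k, 0 <= A c k.
rewrite ler_norml => /andP[c1 c2] k; have bq0 : 0 <= b / q by rewrite divr_ge0// ltW.
by apply: bv_ge0; rewrite divr_ge0// mulr_ge0//; lra.
Qed.
Let amgm4 (p m : R) : p ^+ 2 * m ^+ 2 <= 2^-1 * (p ^+ 4 + m ^+ 4).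
have := sqr_ge0 (p ^+ 2 - m ^+ 2); nra. Qed.
Lemma corr_q : corr q = q.
rewrite -[RHS]Eth2 /corr subrr mulr0 mul0r sqrtr0.
rewrite (_ : b / q * (q + q) / 2 = b); last by rewrite mulrDr bq; field.
eqgm => z; rewrite -[RHS]gm_cst; eqgm => z'.
by rewrite mul0r subr0 addr0 expr2.
Qed.
(** The derivative of [corr] in [c] is [b / q] times the mean of a product of two [sech ^ 2]. Both
    fields keep variance [b], so the arithmetic-geometric inequality bounds that mean by [S4]. *)
Lemma corr_bound (c : R) : `|c| <= q -> q - b / q * S4 * (q - c) <= corr c.
move=> cq; have := cq; rewrite ler_norml => /andP[c1 c2].
have s4 (t : R) : sm1 (fun t : R => (cosh t)^-1 ^+ 4) by apply: sm1X; exact: sm1_sc.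
have S4b c' : `|c'| <= q -> P cs (fun x => (cosh (Lp h x))^-1 ^+ 4) (vec (A c')) = S4 /\
 P cs (fun x => (cosh (Lm h x))^-1 ^+ 4) (vec (A c')) = S4.
 move=> cq'; have A2 : 0 <= b / q * (q + c') / 2 := A_ge0 cq' false.
 have A1 : 0 <= b / q * (q - c') / 2 := A_ge0 cq' true.
 rewrite (P_plus (fun t => (cosh t)^-1 ^+ 4)) (P_minus (fun t => (cosh t)^-1 ^+ 4)).
 rewrite (heat_semigroup _ (s4 0) A2 A1) (heat_semigroupN _ (s4 0) A2 A1).
 have -> : b / q * (q + c') / 2 + b / q * (q - c') / 2 = b by rewrite -[RHS]bq; field; rewrite gt_eqF.
 by [].
pose hh i := P cs (D (inl i) (D (inl i) Fth)).
have d0 i : D (inr i) Fth = fun=> 0.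
 apply: pd_D => x; rewrite (_ : (fun t : R => _) = fun=> Fth x); first exact: is_derive_cst.
 by apply/funext => t; rewrite /Fth /L !big_bool !pushNE.
have hD i : D (inr i) (P cs Fth) = fun x => x (inr i) * hh i x by rewrite D_P_in//; case: i.
have cqq : `|q| <= q by rewrite ger0_norm// ltW.
have := interp_le (smooth_P cs sFth) (A_ge0 cq) (A_ge0 cqq) hD (K0 := b / q * S4 * (q - c)) (K1 := 0).
rewrite -!corrE corr_q mul0r addr0 => H.
suff K : forall s : R, 0 < s < 1 -> 2^-1 * \sum_i (A q i - A c i) * hh i (vec (mix (A c) (A q) s)) <= b / q * S4 * (q - c) + 0 * s.
 by have := H K; lra.
move=> s /andP[s0 s1].
(* The path of variances stays inside the family [A]: each of its points is the pair of fields for a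
   covariance between those of [c] and [q]. *)
pose c' := (1 - s) * c + s * q.
have cq' : `|c'| <= q by rewrite ler_norml /c'; nra.
have -> : mix (A c) (A q) s = A c' by apply/funext => -[]; rewrite /mix /A /= /c'; field; rewrite gt_eqF.
pose G (x : V) := (cosh (Lp h x))^-1 ^+ 2 * (cosh (Lm h x))^-1 ^+ 2.
have sG : smooth G by apply: smoothM; apply: (smooth_sm1L h _ (f := fun t => (cosh t)^-1 ^+ 2)); apply: sm1X; exact: sm1_sc.
pose u := fun k : bool => if k then -1 else 1 : R.
have D2 i : D (inl i) (D (inl i) Fth) = fun x => -2 * (tanh (Lp h x) * (cosh (Lp h x))^-1 ^+ 2 * tanh (Lm h x)
 + tanh (Lp h x) * (tanh (Lm h x) * (cosh (Lm h x))^-1 ^+ 2)) + 2 * u i * G x.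
 have p1 := pd_th h (fun _ : bool => 1) (inl i); have p2 := pd_th h u (inl i).
 rewrite (pd_D (pdM p1 p2)).
 have q1 := pdM (pdM (pd_cst (inl i) 1) (pdZ (-1) (pdM p1 p1))) p1.
 apply: pd_D.
 have r1 := pdD (pd_cst (inl i) 1) (pdZ (-1) (pdM p1 p1)).
 have r2 := pdD (pd_cst (inl i) 1) (pdZ (-1) (pdM p2 p2)).
 have r := pdD (pdM (pdM r1 (pd_cst (inl i) (wk (fun _ : bool => 1) (inl i)))) p2)
 (pdM p1 (pdM r2 (pd_cst (inl i) (wk u (inl i))))).
 apply: pd_ext r => x; first by ring.
 rewrite /G -!sech2E /wk; have -> : u i = if i then -1 else 1 by [].
 by case: (i); ring.
have sD i := (smooth_ex (inl i) (smooth_ex (inl i) sFth).2).2.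
have -> : 2^-1 * (\sum_i (A q i - A c i) * hh i (vec (A c'))) = b / q * (q - c) * P cs G (vec (A c')).
 rewrite big_bool /=.
 have e1 : P cs (fun x => D (inl false) (D (inl false) Fth) x - D (inl true) (D (inl true) Fth) x) =
 fun x => hh false x - hh true x := P_B cs (sD false) (sD true).
 have e2 : (fun x => D (inl false) (D (inl false) Fth) x - D (inl true) (D (inl true) Fth) x) = fun x => 4 * G x.
 by apply/funext => x; rewrite !D2 /u; ring.
 have e3 : P cs (fun x => 4 * G x) = fun x => 4 * P cs G x := P_Z cs 4 sG.
 have e4 x : hh true x = hh false x - 4 * P cs G x.
 have e5 : hh false x - hh true x = 4 * P cs G x.
 by rewrite -[LHS]/((fun x => hh false x - hh true x) x) -e1 e2 e3.
 by rewrite -e5 subKr.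
 rewrite e4 -[T false (T true G)]/(P cs G); move: (hh false _) (P cs G _) => u1 u2.
 have -> : b / q * (q + q) / 2 = b by rewrite mulrDr bq; field.
 rewrite subrr; have -> : b / q * (q + c) / 2 = b / 2 + b / q * c / 2 by rewrite mulrDr bq; ring.
 have -> : b / q * (q - c) = b - b / q * c by rewrite mulrBr bq.
 by move: (b / q) => p; field.
rewrite mul0r addr0 mulrAC ler_wpM2r ?subr_ge0//.
rewrite ler_wpM2l ?divr_ge0 ?(ltW b0) ?(ltW q0)//.
have [E1 E2] := S4b c' cq'.
have s4p : smooth (fun x : V => (cosh (Lp h x))^-1 ^+ 4) by apply: (smooth_sm1L h _ (f := fun t => (cosh t)^-1 ^+ 4)); exact: (s4 0).
have s4m : smooth (fun x : V => (cosh (Lm h x))^-1 ^+ 4) by apply: (smooth_sm1L h _ (f := fun t => (cosh t)^-1 ^+ 4)); exact: (s4 0).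
apply: (@le_trans _ _ (P cs (fun x => 2^-1 * ((cosh (Lp h x))^-1 ^+ 4 + (cosh (Lm h x))^-1 ^+ 4)) (vec (A c')))).
 apply: P_le => //; first by apply: smoothZ; exact: smoothD.
 by move=> x; exact: amgm4.
rewrite P_Z; last exact: smoothD.
by rewrite P_D// E1 E2 -[S4 + S4]mulr2n -[S4 *+ 2]mulr_natl mulKf.
Qed.
End TwoFields.

(** * Gaussian variance bound *)

Section Variance.
Context {R : realType} {I : finType}.
Notation V := (I + I -> R).
Implicit Types F : V -> R.

Lemma P_inrM s F (A : V -> R) x : smooth F -> (forall y i t, A (push y (inl i) t) = A y) ->
 P s (fun x => A x * F x) x = A x * P s F x.
move=> sF hA; elim: s x => //= i s IH x.
rewrite -(T_indepM (smooth_P s sF))//; eqgm => z; exact: IH.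
Qed.
Lemma P_norm s F x C : smooth F -> (forall x, `|F x| <= C) -> `|P s F x| <= C.
move=> sF hF; rewrite ler_norml; apply/andP; split.
 have -> : - C = P s (fun=> - C) x by rewrite P_cst.
 by apply: P_le => //; [exact: smooth_cst|move=> y; have := hF y; rewrite ler_norml => /andP[]].
have -> : C = P s (fun=> C) x by rewrite P_cst.
by apply: P_le => //; [exact: smooth_cst|move=> y; have := hF y; rewrite ler_norml => /andP[]].
Qed.

Lemma T_inr (i j : I) (x : V) z : (push x (inl i) (x (inr i) * z)) (inr j) = x (inr j).
by rewrite /push addr0. Qed.

(* Efron-Stein tensorization; each coordinate contributes the variance of a Lipschitz function. *)
Lemma var_P s F x (B : I -> R) : smooth F -> (forall i x, `|D (inl i) F x| <= B i) ->
 P s (fun x => F x ^+ 2) x - P s F x ^+ 2 <= \sum_(i <- s) x (inr i) ^+ 2 * B i ^+ 2.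
move=> sF hB; elim: s x => [|i s IH] x; first by rewrite big_nil subrr.
have sF2 : smooth (fun x => F x ^+ 2) by apply: smooth_ext (smoothM sF sF) => y; rewrite expr2.
pose G := P s F; have sG : smooth G by exact: smooth_P.
have sG2 : smooth (fun x => G x ^+ 2) by apply: smooth_ext (smoothM sG sG) => y; rewrite expr2.
have hG y : `|D (inl i) G y| <= B i.
 by rewrite D_P_inl//; apply: P_norm => //; exact: (smooth_ex (inl i) sF).2.
rewrite big_cons /= -/G; pose C := \sum_(j <- s) x (inr j) ^+ 2 * B j ^+ 2.
have h1 : T i (P s (fun x => F x ^+ 2)) x <= T i (fun y => G y ^+ 2) x + C.
 have -> : T i (fun y => G y ^+ 2) x + C = T i (fun y => G y ^+ 2 + C) x.
 by rewrite T_D//; [rewrite [in RHS](T_indep (F := fun=> C))|exact: smooth_cst].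
 apply: T_le; [exact: smooth_P|by apply: smoothD => //; exact: smooth_cst|].
 move=> z; rewrite -lerBlDl (le_trans (IH _))// /C.
 by under eq_bigr do rewrite T_inr.
have h2 : T i (fun y => G y ^+ 2) x - T i G x ^+ 2 <= x (inr i) ^+ 2 * B i ^+ 2.
 pose c := G x.
 have h3 : T i (fun y => (G y + - c) ^+ 2) x = T i (fun y => G y ^+ 2) x - 2 * c * T i G x + c ^+ 2.
 have -> : (fun y => (G y + - c) ^+ 2) = fun y => G y ^+ 2 + ((- (2 * c)) * G y + c ^+ 2).
 by apply/funext => y; ring.
 rewrite T_D//; last by apply: smoothD; [exact: smoothZ|exact: smooth_cst].
 rewrite T_D//; [|exact: smoothZ|exact: smooth_cst].
 by rewrite T_Z// (T_indep (F := fun=> c ^+ 2))//; ring.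
 apply: (@le_trans _ _ (T i (fun y => (G y + - c) ^+ 2) x)).
 by rewrite h3; have := sqr_ge0 (T i G x - c); nra.
 have e2 : gm (fun z : R => z * z) = 1.
 by have [-> _] := gmean_ibp (@sm1_id R) (fun t : R => is_derive_id t 1); rewrite gm_cst.
 have sz : sm1 (fun z : R => z * z) by exact: sm1M (@sm1_id R) (@sm1_id R).
 rewrite /T -[leRHS]mulr1 -e2 -gmeanZ//; apply: gmean_le; [|exact: sm1Z|].
 have sg : smooth (fun y => (G y + - c) ^+ 2).
 apply: smooth_ext (smoothM (smoothD sG (smooth_cst (- c))) (smoothD sG (smooth_cst (- c)))) => y.
 by rewrite expr2.
 exact: sm1_push sg.
 move=> z; have [t _ ->] := MVT_pd x (x (inr i) * z) (smooth_ex (inl i) sG).1.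
 have -> : x (inr i) ^+ 2 * B i ^+ 2 * (z * z) = (x (inr i) * z) ^+ 2 * B i ^+ 2 by ring.
 rewrite exprMn ler_wpM2l ?sqr_ge0// -[leLHS]real_normK ?num_real//.
 by apply: lerXn2r (hG _); rewrite nnegrE// (le_trans _ (hG x)).
move: h1 h2; rewrite -/C; lra.
Qed.
End Variance.

(** * Guerra's interpolation with one step of symmetry breaking *)

Section Guerra.
Context {R : realType} {I S : finType}.
Notation V := (I + I -> R).
Variables (a b : S -> R) (v : I -> S -> R) (s0 : S).
Hypotheses (a0 : forall s, 0 <= a s) (as0 : 0 < a s0).
Variables (so si : seq I).
Hypotheses (csU : uniq (so ++ si)) (csA : forall i, i \in so ++ si).
Variable m : R.
Hypothesis (m01 : 0 < m <= 1).
Notation Z := (Zf a b v).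
Notation avg g x := (wav a b v g x).
Let m0 : 0 < m. Proof. by case/andP: m01. Qed.
Let m1 : m <= 1. Proof. by case/andP: m01. Qed.
Let Zp x : 0 < Z x. Proof. exact: Zf_gt0 as0 x. Qed.
Let slnZ : smooth (fun x => ln (Z x)). Proof. exact: smooth_lnZ as0. Qed.

Definition Zpow (x : V) := expR (m * ln (Z x)).

Let exp_pow (z e : R) : 0 <= e <= 1 -> 0 < z -> expR (e * ln z) <= 1 + z.
move=> /andP[e0 e1] z0; have [z1|z1] := leP 1 z.
 rewrite (@le_trans _ _ z)//; last by rewrite lerDr.
 by rewrite -[leRHS]lnK ?posrE// ler_expR ler_piMl// ln_ge0.
rewrite (@le_trans _ _ 1)//; last by rewrite lerDl ltW.
by rewrite -[leRHS]expR0 ler_expR mulr_ge0_le0// ln_le0// ltW.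
Qed.

Lemma smooth_Zpow : smooth Zpow.
apply: smooth_exp; first exact: smoothZ.
apply: growth_le (growthD (growth_cst 1) (smooth_growth (smooth_Zf a b v))) => x.
rewrite !ger0_norm ?expR_ge0 ?addr_ge0 ?(ltW (Zp x))//.
by apply: exp_pow => //; rewrite (ltW m0) m1.
Qed.
Lemma smooth_iZpow : smooth (fun x => (Zpow x)^-1).
have e : (fun x => (Zpow x)^-1) = fun x => expR ((- m) * ln (Z x)).
 by apply/funext => x; rewrite /Zpow -expRN mulNr.
rewrite e; apply: smooth_exp; first exact: smoothZ.
apply: growth_le (growthD (growth_cst 1) (growth_iZ b v a0 as0)) => x.
have zi : 0 < (Z x)^-1 by rewrite invr_gt0.
rewrite !ger0_norm ?expR_ge0 ?addr_ge0 ?(ltW zi)//.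
by rewrite mulNr -mulrN -lnV ?posrE//; apply: exp_pow => //; rewrite (ltW m0) m1.
Qed.
Let W (x : V) := P si Zpow x.
Let sW : smooth W. Proof. exact: smooth_P smooth_Zpow. Qed.
(** Jensen's inequality for the inverse, from [2 <= t / c + c / t] with [c] the mean. It bounds the
    growth of [1 / W], which makes [ln W] smooth. *)
Let WU x : 1 <= W x * P si (fun x => (Zpow x)^-1) x.
have Y0 y : 0 < Zpow y by exact: expR_gt0.
set U := P si _ x.
have key c : 0 < c -> 2 <= c^-1 * W x + c * U.
 move=> c0; rewrite /W /U -(congr1 (fun F => F x) (P_Z si c^-1 smooth_Zpow)) -(congr1 (fun F => F x) (P_Z si c smooth_iZpow)).
 rewrite -(congr1 (fun F => F x) (P_D si (smoothZ c^-1 smooth_Zpow) (smoothZ c smooth_iZpow))).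
 have -> : 2 = P si (fun=> 2) x by rewrite P_cst.
 apply: P_le; [exact: smooth_cst|by apply: smoothD; apply: smoothZ; [exact: smooth_Zpow|exact: smooth_iZpow]|].
 move=> y; have := Y0 y; set t := Zpow y => t0.
 have := sqr_ge0 (t / c - 1) => sq.
 have -> : c^-1 * t + c * t^-1 = 2 + (t / c - 1) ^+ 2 / (t / c) by field; rewrite !gt_eqF.
 by rewrite lerDl divr_ge0// divr_ge0// ltW.
have W_ge0 : 0 <= W x by apply: P_ge0; [exact: smooth_Zpow|move=> y; exact: ltW].
have U_ge0 : 0 <= U by apply: P_ge0; [exact: smooth_iZpow|move=> y; rewrite invr_ge0 ltW].
have [W0|Wn0] := eqVneq (W x) 0.
 have c0 : 0 < (U + 1)^-1 by rewrite invr_gt0; lra.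
 have := key _ c0; rewrite W0 mulr0 add0r.
 have : (U + 1)^-1 * U <= 1 by rewrite mulrC ler_pdivrMr; lra.
 lra.
have W0 : 0 < W x by rewrite lt_neqAle eq_sym Wn0.
by have := key _ W0; rewrite mulVf//; lra.
Qed.
Let Wp x : 0 < W x.
have := WU x; rewrite lt_neqAle => h; rewrite P_ge0 ?andbT; last 2 first.
- exact: smooth_Zpow.
- by move=> y; exact: expR_ge0.
by apply/negP => /eqP e; move: h; rewrite -/(W x) -e mul0r ler10.
Qed.
Lemma W_gt0 x : 0 < P si Zpow x. Proof. exact: Wp. Qed.
Let giW : growth (fun x => (W x)^-1).
apply: growth_le (smooth_growth (smooth_P si smooth_iZpow)) => x.
have U0 : 0 <= P si (fun x => (Zpow x)^-1) x.
 by apply: P_ge0; [exact: smooth_iZpow|move=> y; rewrite invr_ge0 expR_ge0].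
rewrite !ger0_norm ?invr_ge0 ?(ltW (Wp x))// -[leLHS]mul1r ler_pdivrMr// mulrC; exact: WU.
Qed.
Let slnW : smooth (fun x => ln (W x)). Proof. exact: smooth_ln Wp sW giW. Qed.
Lemma smooth_lnW : smooth (fun x => ln (P si Zpow x)). Proof. exact: slnW. Qed.
Let siW : smooth (fun x => (W x)^-1).
by apply: smooth_inv => // x; rewrite gt_eqF. Qed.

(** The one-step functional: the coordinates [si] are averaged inside the logarithm at exponent [m],
    the coordinates [so] outside. *)
Definition guerra (A : I -> R) := P so (fun x => ln (W x)) (vec A).

Let Y1 j x := m * Zpow x * avg (v j) x.
Let Y2 j x := m * Zpow x * (avg (fun s => v j s * v j s) x - (1 - m) * avg (v j) x ^+ 2).

Let pdY j : pd (inl j) Zpow (Y1 j).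
apply: pd_ext (pd_exp (pdZ m (pd_lnZ b v a0 as0 (inl j)))) => x //.
by rewrite /Y1 -/(Zpow x); ring.
Qed.
Let pdY1 j : pd (inl j) (Y1 j) (Y2 j).
apply: pd_ext (pdM (pdZ m (pdY j)) (pd_wav b v a0 as0 (inl j) (v j))) => x //.
rewrite /Y1 /Y2 /=; ring.
Qed.
Let sav g : smooth (fun x => avg g x). Proof. exact: smooth_wav as0 g. Qed.
Let sY1 j : smooth (Y1 j). Proof. by apply: smoothM => //; apply: smoothZ; exact: smooth_Zpow. Qed.
Let sY2 j : smooth (Y2 j). Proof. exact: smooth_pd (sY1 j) (pdY1 j). Qed.
Let inrY j : D (inr j) Zpow = fun=> 0.
apply: pd_D; apply: pd_ext (pd_exp (pdZ m (pd_lnZ b v a0 as0 (inr j)))) => x //.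
by rewrite /wav big1 ?mulr0// => s _; rewrite mulr0.
Qed.
(** The coefficient of the standard deviation of [j] in the derivative of the functional. An outer
    coordinate differentiates [ln W] twice and produces a squared term; an inner one only acts under
    the average [P si]. *)
Let U2 j (x : V) := (W x)^-1 * P si (Y2 j) x - (j \in so)%:R * ((W x)^-1 * P si (Y1 j) x) ^+ 2.
Let sU2 j : smooth (U2 j).
have sq : smooth (fun x => (W x)^-1 * P si (Y1 j) x) by apply: smoothM => //; exact: smooth_P.
apply: smoothB; first by apply: smoothM => //; exact: smooth_P.
by apply: smoothZ; apply: smooth_ext (smoothM sq sq) => x; rewrite expr2.
Qed.
Let Dguerra j : D (inr j) (P so (fun x => ln (W x))) = fun x => x (inr j) * P so (U2 j) x.
have := csA j; rewrite mem_cat; have := csU; rewrite cat_uniq => /and3P[uo /hasPn dis ui].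
have [jo _|jo /= ji] := boolP (j \in so).
 have ji : j \notin si by apply/negP => /dis; rewrite /= jo.
 have d0 : D (inr j) (fun x => ln (W x)) = fun=> 0.
 have [pW _] := smooth_ex (inr j) sW; rewrite (pd_D (pd_ln Wp pW)).
 by rewrite /W D_P_notin//; [rewrite inrY P_cst; apply/funext => x; rewrite mulr0|exact: smooth_Zpow].
 rewrite D_P_in//; apply/funext => x; congr (_ * P _ _ _).
 have p1 : pd (inl j) W (P si (Y1 j)).
 by have [pW _] := smooth_ex (inl j) sW; move: pW; rewrite /W D_P_inl ?(pd_D (pdY j))//; exact: smooth_Zpow.
 have p2 : pd (inl j) (P si (Y1 j)) (P si (Y2 j)).
 by have [pW _] := smooth_ex (inl j) (smooth_P si (sY1 j)); move: pW; rewrite D_P_inl ?(pd_D (pdY1 j)).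
 rewrite (pd_D (pd_ln Wp p1)).
 have Wn y : W y != 0 by rewrite gt_eqF.
 rewrite (pd_D (pdM (pd_inv Wn p1) p2)); apply/funext => y; rewrite /U2 jo mul1r.
 by have := Wn y => ?; field.
rewrite D_P_notin//; apply/funext => x.
have [pW _] := smooth_ex (inr j) sW; rewrite (pd_D (pd_ln Wp pW)).
rewrite {1}/W D_P_in//; [|exact: smooth_Zpow].
rewrite (pd_D (pdY j)) (pd_D (pdY1 j)).
rewrite -(P_inrM so x (A := fun x => x (inr j)) (sU2 j)); last by move=> y i t; rewrite /push addr0.
by congr (P _ _ _); apply/funext => y; rewrite /U2 (negbTE jo) mul0r subr0; ring.
Qed.

(** The derivative along the path combines quadratic forms in two probabilities on [S]: the Gibbs
    measure at fixed fields, and its inner average tilted by [Zpow / W]. Bounding the forms for all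
    probabilities carried by the support of [a] dispenses with any knowledge of these two. *)
Lemma guerra_le (A B : I -> R) K1 K2 : (forall i, 0 <= A i) -> (forall i, 0 <= B i) ->
 (forall p : S -> R, (forall s, 0 <= p s) -> \sum_s p s = 1 -> (forall s, a s = 0 -> p s = 0) ->
 2^-1 * \sum_i (B i - A i) * (\sum_s p s * (v i s * v i s) - (1 - m) * (\sum_s p s * v i s) ^+ 2) <= K1 /\
 - (2^-1 * \sum_(i in so) (B i - A i) * (\sum_s p s * v i s) ^+ 2) <= K2) ->
 guerra B - guerra A <= m * K1 + m ^+ 2 * K2.
move=> A0 B0 hK; have -> : m * K1 + m ^+ 2 * K2 = (m * K1 + m ^+ 2 * K2) + 0 / 2 by rewrite mul0r addr0.
apply: (interp_le (F := P so (fun x => ln (W x))) (h := fun j => P so (U2 j))) => //; first exact: smooth_P.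
move=> s _; rewrite mul0r addr0; set x := vec _.
have sS : smooth (fun x => \sum_i (B i - A i) * U2 i x) by apply: smooth_sum => i; exact: smoothZ.
have -> : 2^-1 * (\sum_i (B i - A i) * P so (U2 i) x) = P so (fun x => 2^-1 * \sum_i (B i - A i) * U2 i x) x.
 rewrite P_Z// P_sum; last by move=> i; exact: smoothZ.
 by congr (_ * _); apply: eq_bigr => i _; rewrite P_Z.
have -> : m * K1 + m ^+ 2 * K2 = P so (fun=> m * K1 + m ^+ 2 * K2) x by rewrite P_cst.
apply: P_le; [exact: smoothZ|exact: smooth_cst|]; move=> {s}{}x.
have -> : 2^-1 * (\sum_i (B i - A i) * U2 i x) =
 (W x)^-1 * P si (fun x => 2^-1 * \sum_i (B i - A i) * Y2 i x) x
 + - (2^-1 * \sum_(i in so) (B i - A i) * ((W x)^-1 * P si (Y1 i) x) ^+ 2).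
 rewrite P_Z; last by apply: smooth_sum => i; exact: smoothZ.
 rewrite P_sum; last by move=> i; exact: smoothZ.
 rewrite mulrCA -mulrBr; congr (_ * _); rewrite mulr_sumr [X in _ - X]big_mkcond -sumrB.
 apply: eq_bigr => i _; rewrite P_Z// /U2; case: (i \in so) => /=; rewrite ?mul1r ?mul0r; ring.
have Wi : 0 < (W x)^-1 by rewrite invr_gt0.
apply: lerD.
 have sw : smooth (fun x => 2^-1 * \sum_i (B i - A i) * Y2 i x) by apply: smoothZ; apply: smooth_sum => i; exact: smoothZ.
 have -> : m * K1 = (W x)^-1 * P si (fun x => (m * K1) * Zpow x) x.
 rewrite P_Z; last exact: smooth_Zpow.
 by rewrite mulrCA mulVf ?mulr1// gt_eqF.
 rewrite ler_wpM2l ?(ltW Wi)//; apply: P_le => //; first by apply: smoothZ; exact: smooth_Zpow.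
 move=> y; have [h1 _] := hK (fun s => wt a b v s y) (fun s => wt_ge0 b v a0 as0 s y) (wt_sum b v a0 as0 y)
 (fun s e => ltac:(by rewrite /wt e !mul0r)).
 have -> : 2^-1 * (\sum_i (B i - A i) * Y2 i y) = m * Zpow y * (2^-1 * \sum_i (B i - A i) *
 (avg (fun s => v i s * v i s) y - (1 - m) * avg (v i) y ^+ 2)).
 rewrite mulrCA; congr (_ * _); rewrite mulr_sumr; apply: eq_bigr => i _; rewrite /Y2; ring.
 rewrite [leRHS]mulrAC ler_wpM2l// mulr_ge0 ?expR_ge0// ltW//.
pose p s := (W x)^-1 * P si (fun x => Zpow x * wt a b v s x) x.
have sZw s : smooth (fun x => Zpow x * wt a b v s x) by apply: smoothM; [exact: smooth_Zpow|exact: smooth_wt as0 s].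
have p0 s : 0 <= p s.
 rewrite mulr_ge0 ?(ltW Wi)//; apply: P_ge0 => // y; rewrite mulr_ge0 ?expR_ge0//; exact: wt_ge0 as0 s y.
have psum : \sum_s p s = 1.
 rewrite -mulr_sumr -(congr1 (fun F => F x) (P_sum si _ xpredT sZw)).
 rewrite (_ : (fun x => \sum_s _) = Zpow) ?mulVf ?gt_eqF//.
 by apply/funext => y; rewrite -mulr_sumr (wt_sum b v a0 as0) mulr1.
have pa s : a s = 0 -> p s = 0.
 by move=> e; rewrite /p (_ : (fun x => _) = fun=> 0) ?P_cst ?mulr0//; apply/funext => y; rewrite /wt e !mul0r mulr0.
have [_ h2] := hK p p0 psum pa.
have -> : - (2^-1 * (\sum_(i in so) (B i - A i) * ((W x)^-1 * P si (Y1 i) x) ^+ 2)) =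
 m ^+ 2 * - (2^-1 * \sum_(i in so) (B i - A i) * (\sum_s p s * v i s) ^+ 2).
 rewrite mulrN mulrCA; congr (- (_ * _)); rewrite mulr_sumr; apply: eq_bigr => i _.
 have -> : (W x)^-1 * P si (Y1 i) x = m * \sum_s p s * v i s; last by ring.
 have -> : Y1 i = fun x => m * \sum_s v i s * (Zpow x * wt a b v s x).
 apply/funext => y; rewrite /Y1 -mulrA; congr (_ * _); rewrite /wav mulr_sumr.
 by apply: eq_bigr => s _; ring.
 rewrite P_Z; last by apply: smooth_sum => s; exact: smoothZ.
 rewrite P_sum; last by move=> s; exact: smoothZ.
 rewrite mulrCA; congr (_ * _); rewrite mulr_sumr; apply: eq_bigr => s _.
 by rewrite P_Z// /p; ring.
by rewrite ler_wpM2l ?sqr_ge0.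
Qed.
End Guerra.

(** * Averages over coordinates that a function does not see *)

Section Reduce.
Context {R : realType} {I : finType}.
Notation V := (I + I -> R).
Implicit Types (F G : V -> R) (s : seq I).

Definition inv F (k : I) := forall x t, F (push x (inl k) t) = F x.

Lemma P_inv s F : (forall k, k \in s -> inv F k) -> P s F = F.
elim: s => //= i s IH h; rewrite IH; last by move=> k ks; apply: h; rewrite in_cons ks orbT.
by apply/funext => x; apply: T_indep => t; apply: h; rewrite mem_head.
Qed.
Lemma inv_T i F k : inv F k -> inv (T i F) k.
move=> h x t; eqgm => z.
by rewrite [push x (inl k) t (inr i)]/push addr0 pushC h.
Qed.
Lemma P_single s F k : uniq s -> k \in s -> (forall j, j \in s -> j != k -> inv F j) -> P s F = T k F.
elim: s => //= i s IH /andP[is_ us]; rewrite in_cons => ks h.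
have [e|ki] := eqVneq k i.
 subst i; rewrite P_inv// => j js; apply: h; first by rewrite in_cons js orbT.
 by apply: contraNneq is_ => <-.
move: ks; rewrite (negbTE ki)/= => ks; rewrite IH//.
 by apply/funext => x; apply: T_indep => t; apply: inv_T; apply: h; rewrite ?mem_head// eq_sym.
by move=> j js; apply: h; rewrite in_cons js orbT.
Qed.

Lemma P_cat s1 s2 F : P (s1 ++ s2) F = P s1 (P s2 F).
by elim: s1 => //= i s ->. Qed.
Lemma P_scale0 s F x : (forall k, k \in s -> x (inr k) = 0) -> P s F x = F x.
elim: s => //= i s IH h; rewrite T_scale0; last by apply: h; rewrite mem_head.
by apply: IH => k ks; apply: h; rewrite in_cons ks orbT.
Qed.
Lemma P_invM s F G x : smooth F -> (forall k, k \in s -> inv G k) ->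
 P s (fun x => G x * F x) x = G x * P s F x.
move=> sF; elim: s x => //= i s IH x h.
rewrite -(T_indepM (smooth_P s sF)); last by move=> t; apply: h; rewrite mem_head.
eqgm => z; apply: IH => k ks; apply: h; rewrite in_cons ks orbT//.
Qed.

Lemma P_prod (J : eqType) (s : seq J) (e : J -> I) (f : J -> V -> R) x : uniq s ->
 (forall j, smooth (f j)) -> (forall j k, j != k -> inv (f j) (e k)) ->
 P [seq e j | j <- s] (fun x => \prod_(j <- s) f j x) x = \prod_(j <- s) T (e j) (f j) x.
move=> us sf h; elim: s us x => [_|j s IH /= /andP[js us]] x.
 by rewrite big_nil /=; rewrite big_nil.
rewrite big_cons.
have -> : P [seq e k | k <- s] (fun x => \prod_(k <- j :: s) f k x) =
 fun x => \prod_(k <- s) T (e k) (f k) x * f j x.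
 apply/funext => y; rewrite -IH// mulrC -P_invM.
 - by congr (P _ _ _); apply/funext => w; rewrite big_cons.
 - exact: smooth_prod.
 - move=> k /mapP[l ls ->]; apply: h; by apply: contraNneq js => ->.
rewrite mulrC; apply: (T_indepM (A := fun x => \prod_(k <- s) T (e k) (f k) x)) => // t.
apply: eq_big_seq => k ks; apply: inv_T; apply: h; by apply: contraNneq js => <-.
Qed.
End Reduce.

Definition i3 (k : nat) : 'I_3 := match k with
 | 0 => Ordinal (isT : 0 < 3) | 1 => Ordinal (isT : 1 < 3) | _ => Ordinal (isT : 2 < 3) end%N.

Lemma i3K k : (k < 3)%N -> val (i3 k) = k. Proof. by case: k => [|[|[|]]]. Qed.
Lemma i3_val (k : 'I_3) : i3 k = k.
by apply/val_inj; rewrite i3K. Qed.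

(** * The spin system, alone and in pairs *)

Section Model.
Context {R : realType}.
Variables (h : R) (N : nat).
Hypothesis N0 : (0 < N)%N.
Definition Ix : finType := (('I_N * 'I_N) + ('I_N * 'I_3))%type.
Notation V := (Ix + Ix -> R).
Notation sp := (spin R).
Notation ov := (overlap R).

Definition fld (i : 'I_N) (k : nat) : Ix := inr (i, i3 k).
Definition b1 (s : config N) : R := h * \sum_i sp s i.
(** Every site has three fields. Number 0 is a field shared by all replicas; numbers 1 and 2 do not
    act on a single replica and serve pairs only. *)
Definition v1 (k : Ix) (s : config N) : R :=
 match k with inl p => sp s p.1 * sp s p.2 | inr p => if val p.2 is 0%N then sp s p.1 else 0 end.
Definition b2 (p : config N * config N) : R := b1 p.1 + b1 p.2.
(** Fields 0 and 1 act on the sum and on the difference of two spins, which gives the replicas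
    correlated outer fields. Field 2, with the sign [e] on the second replica, is the inner field of
    a symmetry breaking step. *)
Definition v2 (e : R) (k : Ix) (p : config N * config N) : R :=
 match k with
 | inl ij => sp p.1 ij.1 * sp p.1 ij.2 + sp p.2 ij.1 * sp p.2 ij.2
 | inr ik => match val ik.2 with
 | 0%N => sp p.1 ik.1 + sp p.2 ik.1
 | 1%N => sp p.1 ik.1 - sp p.2 ik.1
 | _ => sp p.1 ik.1 + e * sp p.2 ik.1 end end.
(* Variances: [c / (2 N)] for the couplings and [y0], [y1], [y2] for the fields. *)
Definition Av (c y0 y1 y2 : R) (k : Ix) : R :=
 match k with inl _ => c / (2 * N%:R) | inr ik => match val ik.2 with 0%N => y0 | 1%N => y1 | _ => y2 end end.

Lemma Av_ge0 c y0 y1 y2 k : 0 <= c -> 0 <= y0 -> 0 <= y1 -> 0 <= y2 -> 0 <= Av c y0 y1 y2 k.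
by case: k => [?|[i [[|[|]]]]] //= *; rewrite divr_ge0// mulr_ge0. Qed.
Lemma AvB c y0 y1 y2 c' y0' y1' y2' k :
 Av c y0 y1 y2 k - Av c' y0' y1' y2' k = Av (c - c') (y0 - y0') (y1 - y1') (y2 - y2') k.
by case: k => [?|[i [[|[|]]]]] //=; rewrite mulrBl. Qed.
Lemma sp2 (s : config N) i : sp s i * sp s i = 1.
by rewrite /spin; case: ifP => _; rewrite ?mulrNN mulr1. Qed.
Lemma sp_norm (s : config N) i : `|sp s i| = 1.
by rewrite /spin; case: ifP => _; rewrite ?normrN normr1. Qed.
Lemma NN0 : N%:R != 0 :> R. Proof. by rewrite pnatr_eq0 -lt0n. Qed.
Lemma NNp : 0 < N%:R :> R. Proof. by rewrite ltr0n. Qed.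
Lemma ov_sum (s t : config N) : \sum_i sp s i * sp t i = N%:R * ov s t.
by rewrite /overlap mulrA mulfV ?mul1r// NN0. Qed.
Lemma ovC (s t : config N) : ov s t = ov t s.
by rewrite /overlap; congr (_ * _); apply: eq_bigr => i _; rewrite mulrC. Qed.
Lemma ov_self (s : config N) : ov s s = 1.
rewrite /overlap; under eq_bigr do rewrite sp2.
by rewrite sumr_const card_ord mulVf// NN0.
Qed.
Lemma ov_norm (s t : config N) : `|ov s t| <= 1.
rewrite /overlap normrM ger0_norm ?invr_ge0// mulrC ler_pdivrMr ?NNp// mul1r.
apply: (le_trans (ler_norm_sum _ _ _)); under eq_bigr do rewrite normrM !sp_norm mulr1.
by rewrite sumr_const card_ord.
Qed.
Lemma sum_sk (f g : 'I_N -> R) : \sum_(p : 'I_N * 'I_N) f p.1 * g p.2 = (\sum_i f i) * (\sum_i g i).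
by rewrite big_distrlr/= pair_big. Qed.
Lemma sum_ov2 (s t : config N) : \sum_(p : 'I_N * 'I_N) (sp s p.1 * sp s p.2) * (sp t p.1 * sp t p.2) = N%:R ^+ 2 * ov s t ^+ 2.
rewrite -exprMn -ov_sum expr2 -sum_sk; apply: eq_bigr => p _; ring.
Qed.
Lemma sum_fld (F : 'I_N -> 'I_3 -> R) : \sum_(p : 'I_N * 'I_3) F p.1 p.2 =
 \sum_i (F i (i3 0) + F i (i3 1) + F i (i3 2)).
rewrite -(pair_big xpredT xpredT F)/=; apply: eq_bigr => i _.
rewrite !big_ord_recl big_ord0 addr0 addrA.
by congr (F i _ + F i _ + F i _); apply/val_inj.
Qed.

Lemma Cov1 c y0 y1 y2 s t : Cov v1 (Av c y0 y1 y2) s t = N%:R * (c / 2 * ov s t ^+ 2 + y0 * ov s t).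
rewrite /Cov big_sumType/=; have n0 := NN0; rewrite mulrDr; congr (_ + _).
 under eq_bigr do rewrite -mulrA; rewrite -mulr_sumr sum_ov2.
 by field.
rewrite (sum_fld (fun i k => Av c y0 y1 y2 (inr (i, k)) * (if val k is 0%N then sp s i else 0) * (if val k is 0%N then sp t i else 0))).
rewrite mulrCA -ov_sum mulr_sumr; apply: eq_bigr => i _; rewrite /=; ring.
Qed.

Lemma Cov2 e c y0 y1 y2 s t s' t' : e ^+ 2 = 1 -> Cov (v2 e) (Av c y0 y1 y2) (s, t) (s', t') =
 N%:R * (c / 2 * (ov s s' ^+ 2 + ov s t' ^+ 2 + ov t s' ^+ 2 + ov t t' ^+ 2)
 + y0 * (ov s s' + ov s t' + ov t s' + ov t t') + y1 * (ov s s' - ov s t' - ov t s' + ov t t')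
 + y2 * (ov s s' + ov t t' + e * (ov s t' + ov t s'))).
move=> e2; rewrite /Cov big_sumType/=; have n0 := NN0.
rewrite -!addrA mulrDr; congr (_ + _).
 transitivity (c / (2 * N%:R) * (\sum_(p : 'I_N * 'I_N) (sp s p.1 * sp s p.2) * (sp s' p.1 * sp s' p.2)
 + \sum_(p : 'I_N * 'I_N) (sp s p.1 * sp s p.2) * (sp t' p.1 * sp t' p.2)
 + \sum_(p : 'I_N * 'I_N) (sp t p.1 * sp t p.2) * (sp s' p.1 * sp s' p.2)
 + \sum_(p : 'I_N * 'I_N) (sp t p.1 * sp t p.2) * (sp t' p.1 * sp t' p.2))).
 rewrite -!big_split mulr_sumr; apply: eq_bigr => p _ /=; ring.
 by rewrite !sum_ov2; field.
rewrite (sum_fld (fun i k => Av c y0 y1 y2 (inr (i, k)) * v2 e (inr (i, k)) (s, t) * v2 e (inr (i, k)) (s', t'))).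
transitivity (y0 * (\sum_i sp s i * sp s' i + \sum_i sp s i * sp t' i + \sum_i sp t i * sp s' i + \sum_i sp t i * sp t' i)
 + y1 * (\sum_i sp s i * sp s' i - \sum_i sp s i * sp t' i - \sum_i sp t i * sp s' i + \sum_i sp t i * sp t' i)
 + y2 * (\sum_i sp s i * sp s' i + \sum_i sp t i * sp t' i + e * (\sum_i sp s i * sp t' i + \sum_i sp t i * sp s' i))).
 rewrite -!sumrN -!big_split !mulr_sumr -!big_split /= !mulr_sumr -!big_split/=.
 apply: eq_bigr => i _; rewrite /=.
 have -> : y2 * (sp s i + e * sp t i) * (sp s' i + e * sp t' i) = y2 * (sp s i * sp s' i + e ^+ 2 * (sp t i * sp t' i)
 + e * (sp s i * sp t' i + sp t i * sp s' i)) by ring.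
 rewrite e2; ring.
rewrite !ov_sum; ring.
Qed.

Definition skL : seq Ix := [seq inl p | p <- enum {: 'I_N * 'I_N}].
Definition fL k : seq Ix := [seq fld i k | i <- enum 'I_N].
Definition so := skL ++ fL 0 ++ fL 1.
Definition si := fL 2.

Lemma fld_inj k : injective (fld^~ k). Proof. by move=> i j []. Qed.
Lemma mem_fL i k j : (fld i k \in fL j) = (i3 k == i3 j :> 'I_3).
apply/mapP/eqP => [[i' _ [_ ->]]//|e]; exists i; rewrite ?mem_enum//.
by rewrite /fld e.
Qed.
Lemma skL_fL i k : fld i k \notin skL. Proof. by apply/mapP => -[]. Qed.
Lemma uniq_fL k : uniq (fL k).
by rewrite map_inj_uniq ?enum_uniq//; exact: fld_inj. Qed.
Lemma uniq_skL : uniq skL.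
by rewrite map_inj_uniq ?enum_uniq//; move=> ? ? []. Qed.
Lemma has_fL k j : (k < 3)%N -> (j < 3)%N -> k != j -> ~~ has (mem (fL k)) (fL j).
move=> k3 j3 kj; apply/hasPn => x /mapP[i _ ->] /=; rewrite mem_fL.
by apply: contra kj => /eqP/(congr1 val); rewrite !i3K// => ->.
Qed.
Lemma has_sk k : ~~ has (mem skL) (fL k).
by apply/hasPn => x /mapP[i _ ->]; exact: skL_fL. Qed.
Lemma uniq_cs : uniq (so ++ si).
rewrite /so /si -!catA !cat_uniq !has_cat !negb_or !has_fL// !has_sk !uniq_fL uniq_skL.
by [].
Qed.
Lemma all_cs k : k \in so ++ si.
rewrite /so /si !mem_cat; case: k => [p|[i k]].
 by rewrite (map_f inl) ?mem_enum.
have -> : inr (i, k) = fld i k by rewrite /fld i3_val.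
by rewrite !mem_fL -!val_eqE i3_val; case: k => [[|[|[|]]]] //= k3; rewrite ?orbT.
Qed.
Lemma mem_so k : (k \in so) = if k is inr ik then (ik.2 != i3 2) else true.
rewrite /so !mem_cat; case: k => [p|[i k]]; first by rewrite (map_f inl) ?mem_enum.
have -> : inr (i, k) = fld i k by rewrite /fld i3_val.
rewrite !mem_fL (negbTE (skL_fL _ _))/= i3_val.
rewrite -[k == i3 2]val_eqE -[k == i3 0]val_eqE -[k == i3 1]val_eqE [val (i3 0)]/= [val (i3 1)]/= [val (i3 2)]/=.
by case: k => [[|[|[|m]]] k3].
Qed.

Lemma fld_neq i k j l : (k < 3)%N -> (l < 3)%N -> (fld i k == fld j l) = (i == j) && (k == l).
move=> k3 l3; apply/eqP/andP => [[-> /(congr1 val)]|[/eqP -> /eqP ->]//].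
by rewrite !i3K// => ->.
Qed.

(* A function of the fields of one site is averaged over these fields only. *)
Lemma P_site (G : V -> R) i : (forall p, inv G (inl p)) -> (forall j k, j != i -> inv G (fld j k)) ->
 P so G = T (fld i 0) (T (fld i 1) G).
move=> G1 G2; rewrite /so !P_cat (@P_single _ _ (fL 1) G (fld i 1)) ?uniq_fL ?mem_fL//; last first.
 by move=> j /mapP[j' _ ->]; rewrite fld_neq// andbT => ji; exact: G2.
rewrite (@P_single _ _ (fL 0) _ (fld i 0)) ?uniq_fL ?mem_fL//; last first.
 by move=> j /mapP[j' _ ->]; rewrite fld_neq// andbT => ji; apply: inv_T; exact: G2.
by apply: P_inv => k /mapP[p _ ->]; apply: inv_T; apply: inv_T; exact: G1.
Qed.
End Model.

(** * Coordinates of variance zero *)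

Section ZeroCoordinates.
Context {R : realType} {I : finType}.
Notation V := (I + I -> R).
Variable D : pred I.
(** A coordinate whose value and standard deviation are 0 keeps both under every Gaussian average,
    so identities valid on such environments may be used inside averages. *)
Definition dead (x : V) := forall k, D k -> x (inr k) = 0 /\ x (inl k) = 0.

Lemma dead_push (x : V) i z : dead x -> dead (push x (inl i) (x (inr i) * z)).
move=> hx k Dk; have [e1 e2] := hx k Dk; rewrite /push addr0 e1; split=> //.
case: (eqVneq (inl k : I + I) (inl i)) => [[ki]|_]; last by rewrite mulr0n addr0.
by rewrite -ki e1 mul0r mul0rn addr0.
Qed.

Lemma dead_vec (A : I -> R) : (forall k, D k -> A k = 0) -> dead (vec A).
by move=> h k /h e; rewrite /vec e sqrtr0. Qed.
Lemma P_eq_dead s (F G : V -> R) x : (forall x, dead x -> F x = G x) -> dead x -> P s F x = P s G x.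
by move=> h; apply: (P_eq_on (Q := dead)) => // y i z _; exact: dead_push. Qed.
Lemma P_le_dead s (F G : V -> R) x : smooth F -> smooth G ->
 (forall x, dead x -> F x <= G x) -> dead x -> P s F x <= P s G x.
by move=> sF sG h; apply: (P_le_on (Q := dead)) => // y i z _; exact: dead_push. Qed.
End ZeroCoordinates.

Section Site.
Context {R : realType}.

Lemma expR_le_quad (x : R) : x <= 2^-1 -> expR x <= 1 + x + 2 * x ^+ 2.
move=> x2; have h := expR_ge1Dx (- x); have e : expR (- x) * expR x = 1 by exact: expRxMexpNx_1 || rewrite mulrC expRxMexpNx_1.
have e0 := expR_gt0 x; have p0 : 0 < 1 - x by lra.
have h1 : (1 - x) * expR x <= 1 by rewrite -[leRHS]e ler_wpM2r// ltW.
rewrite -(ler_pM2l p0) (le_trans h1)//.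
have -> : (1 - x) * (1 + x + 2 * x ^+ 2) = 1 + x ^+ 2 * (1 - 2 * x) by ring.
by rewrite lerDl mulr_ge0 ?sqr_ge0//; lra.
Qed.

Definition sg (a : bool) : R := if a then 1 else -1.

(** Up to the factor [4 * cosh X * cosh Y], the sum is the mean of [expR (l * a * c)] for
    independent spins [a] and [c] of means [tanh X] and [tanh Y]; the rest is the quadratic bound on
    the exponential. *)
Lemma site_bound (l X Y : R) : `|l| <= 2^-1 ->
 \sum_(a : bool) \sum_(c : bool) expR (l * (sg a * sg c) + sg a * X + sg c * Y) <=
 expR (ln 4 + ln (cosh X) + ln (cosh Y) + (l * (tanh X * tanh Y) + 2 * l ^+ 2)).
rewrite ler_norml => /andP[l1 l2].
have -> : \sum_(a : bool) \sum_(c : bool) expR (l * (sg a * sg c) + sg a * X + sg c * Y) =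
 4 * cosh X * cosh Y * ((1 + tanh X * tanh Y) / 2 * expR l + (1 - tanh X * tanh Y) / 2 * expR (- l)).
 rewrite !big_bool /= /sg !(mulr1, mul1r, mulN1r, opprK, mulrN1) !expRD.
 have cx := cosh_neq0 X; have cy := cosh_neq0 Y.
 have -> : 4 * cosh X * cosh Y * ((1 + tanh X * tanh Y) / 2 * expR l + (1 - tanh X * tanh Y) / 2 * expR (- l)) =
 2 * ((cosh X * cosh Y + sinh X * sinh Y) * expR l + (cosh X * cosh Y - sinh X * sinh Y) * expR (- l)).
 by rewrite !tanhE; field; rewrite cx cy.
 by rewrite /cosh /sinh; field.
rewrite !expRD !lnK ?posrE ?cosh_gt0// ler_wpM2l ?mulr_ge0 ?(ltW (cosh_gt0 _))//.
have t1 : `|tanh X * tanh Y| <= 1 by rewrite normrM mulr_ile1// tanh_norm.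
move: t1; rewrite -expRD; set t := tanh X * tanh Y; rewrite ler_norml => /andP[t1 t2].
have e1 := expR_le_quad l2; have l2' : - l <= 2^-1 by lra.
have e2 := expR_le_quad l2'; rewrite sqrrN in e2.
apply: (@le_trans _ _ (1 + (l * t + 2 * l ^+ 2))); last exact: expR_ge1Dx.
have : (1 + t) / 2 * expR l <= (1 + t) / 2 * (1 + l + 2 * l ^+ 2) by rewrite ler_wpM2l//; lra.
have : (1 - t) / 2 * expR (- l) <= (1 - t) / 2 * (1 - l + 2 * l ^+ 2) by rewrite ler_wpM2l//; lra.
move: (expR l) (expR (- l)) => u v; lra.
Qed.

Lemma sum_pairs N (f : 'I_N -> bool -> bool -> R) :
 \sum_(p : config N * config N) \prod_i f i (p.1 i) (p.2 i) = \prod_i \sum_a \sum_c f i a c.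
rewrite -(pair_big xpredT xpredT (fun s t : config N => \prod_i f i (s i) (t i)))/=.
rewrite (bigA_distr_bigA (fun i a => \sum_c f i a c)); apply: eq_bigr => s _.
by rewrite (bigA_distr_bigA (fun i c => f i (s i) c)).
Qed.
End Site.

(** * Interpolation for two replicas with prescribed overlap *)

Section Pair.
Context {R : realType}.
Variables (h : R) (N : nat) (e u eta : R).
Hypotheses (N0 : (0 < N)%N) (e2 : e ^+ 2 = 1).
Notation Ix := (Ix N).
Notation V := (Ix + Ix -> R).
Notation sp := (spin R).
Notation ov := (overlap R).
Notation fld := (@fld N).
Notation so := (so N).
Notation si := (si N).
Notation Ne := (N%:R : R).
(** The overlap constraint is encoded as a 0-1 a priori weight on pairs, which fits the general
    Gibbs measures. *)
Definition aset (p : config N * config N) : R := (`|ov p.1 p.2 - u| <= eta)%R%:R.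
Variable p0 : config N * config N.
Hypothesis ap0 : 0 < aset p0.

Lemma aset_ge0 p : 0 <= aset p. Proof. by rewrite /aset. Qed.
Lemma aset_eq0 p : ~~ (`|ov p.1 p.2 - u| <= eta) -> aset p = 0.
by move=> /negbTE h0; rewrite /aset h0. Qed.
Notation Z2 := (Zf aset (b2 h (N := N)) (v2 e)).

Lemma eta_ge0 : 0 <= eta.
have := ap0; rewrite /aset; case: (boolP (_ <= _)) => [h1 _|_]; last by rewrite ltxx.
exact: le_trans h1.
Qed.
Lemma sum_wCov (w : Ix -> R) (p : config N * config N -> R) : \sum_i w i * (\sum_s p s * v2 e i s) ^+ 2 =
 \sum_s \sum_t p s * p t * Cov (v2 e) w s t.
under eq_bigr do rewrite expr2 big_distrlr/= mulr_sumr.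
rewrite exchange_big/=; apply: eq_bigr => s _.
under eq_bigr do rewrite mulr_sumr.
rewrite exchange_big/=; apply: eq_bigr => t _.
by rewrite /Cov mulr_sumr; apply: eq_bigr => i _; ring.
Qed.

Lemma sum_wCov1 (w : Ix -> R) (p : config N * config N -> R) : \sum_i w i * (\sum_s p s * (v2 e i s * v2 e i s)) =
 \sum_s p s * Cov (v2 e) w s s.
under eq_bigr do rewrite mulr_sumr.
rewrite exchange_big/=; apply: eq_bigr => s _.
by rewrite /Cov mulr_sumr; apply: eq_bigr => i _; ring.
Qed.

Lemma pav_ge (p : config N * config N -> R) (f : config N * config N -> config N * config N -> R) c :
 (forall s, 0 <= p s) -> \sum_s p s = 1 -> (forall s t, c <= f s t) -> c <= \sum_s \sum_t p s * p t * f s t.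
move=> p1 ps hf; have -> : c = \sum_s \sum_t p s * p t * c.
 under eq_bigr do rewrite -mulr_suml -mulr_sumr ps mulr1.
 by rewrite -mulr_suml ps mul1r.
by apply: ler_sum => s _; apply: ler_sum => t _; rewrite ler_wpM2l// mulr_ge0.
Qed.

Section Bound.
Variables (kap q p w f0 m M : R).
Hypotheses (kap0 : 0 <= kap) (qp : 0 <= q + p) (qm : 0 <= q - p) (w0 : 0 <= w) (f00 : 0 <= f0).
Hypotheses (m01 : 0 < m <= 1) (hM : forall r, `|r - u| <= eta -> (r - (p + e * w)) ^+ 2 <= M).
(** [A0] replaces couplings of strength [kap] by fields. The outer ones have variance [kap * q] in
    each replica and covariance [kap * p]; the inner ones add [kap * w] to the variance and
    [e * kap * w] to the covariance. [f0] is a further common field, the same at both ends. *)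
Definition A0 := Av 0 (f0 + kap * (q + p) / 2) (kap * (q - p) / 2) (kap * w) : Ix -> R.
Definition A1 := Av kap f0 0 0 : Ix -> R.
Notation gu := (guerra aset (b2 h (N := N)) (v2 e) so si m).

Lemma A0_ge0 k : 0 <= A0 k.
by apply: Av_ge0; rewrite ?addr_ge0 ?divr_ge0 ?mulr_ge0. Qed.
Lemma A1_ge0 k : 0 <= A1 k. Proof. exact: Av_ge0. Qed.
(** Completing squares in the covariances, the squares between independent pairs have a favourable
    sign and are dropped. What remains is the overlap inside one pair, whose squared distance to
    [p + e * w] the constraint keeps below [M]. *)
Lemma pair_guerra : gu A1 <= gu A0 + m * (Ne * (kap / 2 * ((1 - (q + w)) ^+ 2 + M - m * (2 * q * w + w ^+ 2 + 2 * p * e * w + w ^+ 2)))).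
have m0 : 0 <= m by case/andP: m01 => /ltW.
have m1 : m <= 1 by case/andP: m01.
set q' := q + w; set p' := p + e * w.
have Nk : 0 <= Ne * (kap / 2) by rewrite mulr_ge0// divr_ge0.
pose K1 := Ne * (kap / 2) * ((1 - q') ^+ 2 + M - m * (q' ^+ 2 + p' ^+ 2)).
pose K2 := Ne * (kap / 2) * (q ^+ 2 + p ^+ 2).
have := @guerra_le R Ix (config N * config N)%type aset (b2 h (N := N)) (v2 e) p0 aset_ge0 ap0 so si
 (uniq_cs N) (@all_cs N) m m01 A0 A1 K1 K2 A0_ge0 A1_ge0.
have CovE (s t : config N * config N) : Cov (v2 e) (fun i => A1 i - A0 i) s t = Ne * (kap / 2) *
 ((ov s.1 t.1 - q') ^+ 2 + (ov s.2 t.2 - q') ^+ 2 + (ov s.1 t.2 - p') ^+ 2 + (ov s.2 t.1 - p') ^+ 2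
 - 2 * (q' ^+ 2 + p' ^+ 2)).
 rewrite /A0 /A1; under eq_fun do rewrite AvB.
 case: s t => a1 a2 [c1 c2]; rewrite (Cov2 N0)//= /q' /p'.
 by field.
have CovO (s t : config N * config N) : Cov (v2 e) (Av kap (f0 - (f0 + kap * (q + p) / 2)) (0 - kap * (q - p) / 2) 0) s t =
 Ne * (kap / 2) * ((ov s.1 t.1 - q) ^+ 2 + (ov s.2 t.2 - q) ^+ 2 + (ov s.1 t.2 - p) ^+ 2 + (ov s.2 t.1 - p) ^+ 2
 - 2 * (q ^+ 2 + p ^+ 2)).
 case: s t => a1 a2 [c1 c2]; by rewrite (Cov2 N0)//=; field.
move=> H; have {}H := H _.
suff H2 : gu A1 - gu A0 <= m * K1 + m ^+ 2 * K2.
 rewrite -lerBlDl (le_trans H2)// le_eqVlt; apply/orP; left; apply/eqP; rewrite /K1 /K2 /q' /p'.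
 have -> : (p + e * w) ^+ 2 = p ^+ 2 + 2 * p * e * w + e ^+ 2 * w ^+ 2 by ring.
 rewrite e2; ring.
apply: H => pr pr0 pr1 pra; split.
 have -> : \sum_i (A1 i - A0 i) * (\sum_s pr s * (v2 e i s * v2 e i s) - (1 - m) * (\sum_s pr s * v2 e i s) ^+ 2) =
 \sum_i (A1 i - A0 i) * (\sum_s pr s * (v2 e i s * v2 e i s)) - (1 - m) * \sum_i (A1 i - A0 i) * (\sum_s pr s * v2 e i s) ^+ 2.
 by rewrite mulr_sumr -sumrB; apply: eq_bigr => i _; ring.
 rewrite sum_wCov1 sum_wCov.
 have h1 : \sum_s pr s * Cov (v2 e) (fun i => A1 i - A0 i) s s <= Ne * (kap / 2) * (2 * (1 - q') ^+ 2 + 2 * M - 2 * (q' ^+ 2 + p' ^+ 2)).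
 set c0 := (X in _ <= X); have -> : c0 = \sum_s pr s * c0 by rewrite -mulr_suml pr1 mul1r.
 apply: ler_sum => s _; rewrite /c0.
 have [s_in|s_out] := boolP (`|ov s.1 s.2 - u| <= eta); last by rewrite pra ?mul0r// aset_eq0.
 rewrite ler_wpM2l// CovE ler_wpM2l// !ov_self// (ovC s.2).
 have := hM s_in; rewrite -/p'; move: (ov _ _) => r; lra.
 have h2 : - (2 * (q' ^+ 2 + p' ^+ 2)) * (Ne * (kap / 2)) <= \sum_s \sum_t pr s * pr t * Cov (v2 e) (fun i => A1 i - A0 i) s t.
 apply: pav_ge => // s t; rewrite CovE mulrC ler_wpM2l//.
 move: (sqr_ge0 (ov s.1 t.1 - q')) (sqr_ge0 (ov s.2 t.2 - q')) (sqr_ge0 (ov s.1 t.2 - p')) (sqr_ge0 (ov s.2 t.1 - p')).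
 move: (_ ^+ 2) (_ ^+ 2) (_ ^+ 2) (_ ^+ 2) => x1 x2 x3 x4; lra.
 have m10 : 0 <= 1 - m by lra.
 have h3 := ler_wpM2l m10 h2.
 move: h1 h3; rewrite /K1; clear CovE CovO h2 pr1; set X := \sum_s _; set Y := \sum_s _; clearbody X Y => h1 h3; lra.
have -> : \sum_(i in so) (A1 i - A0 i) * (\sum_s pr s * v2 e i s) ^+ 2 =
 \sum_i Av kap (f0 - (f0 + kap * (q + p) / 2)) (0 - kap * (q - p) / 2) 0 i * (\sum_s pr s * v2 e i s) ^+ 2.
 rewrite big_mkcond/=; apply: eq_bigr => k _; rewrite mem_so /A1 /A0 AvB subr0.
 case: k => [?|[i k]] //=.
 by case: k => [[|[|[|]]]] //= k3; rewrite mul0r.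
rewrite sum_wCov.
have h2 : - (2 * (q ^+ 2 + p ^+ 2)) * (Ne * (kap / 2)) <= \sum_s \sum_t pr s * pr t *
 Cov (v2 e) (Av kap (f0 - (f0 + kap * (q + p) / 2)) (0 - kap * (q - p) / 2) 0) s t.
 apply: pav_ge => // s t; rewrite CovO mulrC ler_wpM2l//.
 move: (sqr_ge0 (ov s.1 t.1 - q)) (sqr_ge0 (ov s.2 t.2 - q)) (sqr_ge0 (ov s.1 t.2 - p)) (sqr_ge0 (ov s.2 t.1 - p)).
 move: (_ ^+ 2) (_ ^+ 2) (_ ^+ 2) (_ ^+ 2) => x1 x2 x3 x4; lra.
move: h2; rewrite /K2; clear CovE CovO pr1; set X := \sum_s _; clearbody X => h2; lra.
Qed.

(** At [A1] the inner fields have variance 0, so the inner average is trivial and the exponent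
    leaves the logarithm as a factor. *)
Lemma guerra_end : gu A1 = m * P (so ++ si) (fun x => ln (Z2 x)) (vec A1).
have sl : smooth (fun x => ln (Z2 x)) by exact: (smooth_lnZ (b2 h (N := N)) (v2 e) aset_ge0 ap0).
rewrite -(congr1 (fun F => F (vec A1)) (P_Z _ m sl)) P_cat.
apply: (P_eq_dead (D := fun k => k \in si)) => [x hx|]; last first.
 by apply: dead_vec => k /mapP[i _ ->].
rewrite P_scale0; last by move=> k /hx[].
by rewrite P_scale0 /Zpow ?expRK// => k /hx[].
Qed.
End Bound.
End Pair.

Opaque gauss_mean.
Section Sm1More.
Context {R : realType}.
Lemma sm1_ln (f : R -> R) : sm1 f -> (forall t, 1 <= f t) -> sm1 (fun t => ln (f t)).
move=> sf f1; apply: smooth_ln => //; first by move=> x; rewrite (lt_le_trans _ (f1 _)).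
apply: growth_le (growth_cst 1) => x; rewrite normr1 ger0_norm ?invr_ge0 ?invf_le1//.
 exact: lt_le_trans (f1 _).
exact: le_trans (f1 _).
Qed.

Lemma heatN (s : R) f t : sm1 f -> heat (- s) f t = heat s f t.
move=> sf; rewrite /heat -[RHS](gmean_sym (sm1_affine t s sf)).
by eqgm => z; rewrite mulNr mulrN.
Qed.
Lemma emf_ge1 (m t : R) : 0 <= m -> 1 <= emf m t.
by move=> m0; rewrite -[leLHS]expR0 /emf ler_expR mulr_ge0 ?ln_ge0 ?cosh_ge1. Qed.
Lemma gmean_cs (f g : R -> R) : sm1 f -> sm1 g -> (forall t, 1 <= f t) -> (forall t, 1 <= g t) ->
 gm (fun t => f t * g t) <= sqr (gm (fun t => f t ^+ 2)) * sqr (gm (fun t => g t ^+ 2)).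
move=> sf sg f1 g1.
have ge1 k : sm1 k -> (forall t, 1 <= k t) -> 1 <= gm (fun t : R => k t ^+ 2).
 move=> sk k1; rewrite -[leLHS](gm_cst 1); apply: gmean_le; [exact: sm1_cst|exact: sm1X|].
 by move=> t; exact: exprn_ege1.
set F := gm (fun t => f t ^+ 2); set G := gm (fun t => g t ^+ 2).
have F1 : 1 <= F by exact: ge1. have G1 : 1 <= G by exact: ge1.
have F0 : 0 < sqr F by rewrite sqrtr_gt0 (lt_le_trans _ F1).
have G0 : 0 < sqr G by rewrite sqrtr_gt0 (lt_le_trans _ G1).
pose l := sqr G / sqr F.
have l0 : 0 < l by rewrite divr_gt0.
have sf2 := sm1X 2 sf; have sg2 := sm1X 2 sg.
apply: (@le_trans _ _ (gm (fun t => (l / 2) * f t ^+ 2 + (l^-1 / 2) * g t ^+ 2))).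
 apply: gmean_le; [exact: sm1M|by apply: sm1D; exact: sm1Z|] => t.
 have : 0 <= (l * f t - g t) ^+ 2 / (2 * l) by rewrite divr_ge0 ?sqr_ge0// mulr_ge0// ltW.
 have -> : (l * f t - g t) ^+ 2 / (2 * l) = (l / 2) * f t ^+ 2 + (l^-1 / 2) * g t ^+ 2 - f t * g t.
 by field; rewrite gt_eqF.
 by rewrite subr_ge0.
rewrite gmeanD ?gmeanZ//; try exact: sm1Z.
have eF : sqr F ^+ 2 = F by rewrite sqr_sqrtr// (le_trans ler01).
have eG : sqr G ^+ 2 = G by rewrite sqr_sqrtr// (le_trans ler01).
move: eF eG F0 G0; rewrite -/F -/G /l; set x := sqr F; set w := sqr G => <- <- x0 w0.
by apply: le_of_eq; field; rewrite !gt_eqF.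
Qed.
(** The inner field is common to both replicas up to sign. Cauchy-Schwarz separates them at the
    price of doubling the exponent, so a pair functional at exponent [m / 2] is controlled by a
    single replica at exponent [m]. *)
Lemma emf_cs (m X Y c d : R) : 0 <= m ->
 gm (fun t => emf m (X + c * t) * emf m (Y + d * t)) <=
 sqr (heat c (emf (2 * m)) X) * sqr (heat d (emf (2 * m)) Y).
move=> m0.
have e X' c' : heat c' (emf (2 * m)) X' = gm (fun t => emf m (X' + c' * t) ^+ 2).
 by eqgm => z; rewrite /emf -expRM_natl; congr expR; ring.
rewrite !e; apply: gmean_cs => [||t|t]; try exact: emf_ge1.
- exact: sm1_affine (sm1_chm m).
- exact: sm1_affine (sm1_chm m).
Qed.
Lemma half_add (x : R) : 2^-1 * (x + x) = x. Proof. by field. Qed.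
End Sm1More.

Lemma sum_fldp (R : realType) N (F : 'I_N * 'I_3 -> R) : \sum_p F p =
 \sum_i (F (i, i3 0) + F (i, i3 1) + F (i, i3 2)).
by rewrite -(sum_fld (fun i k => F (i, k))); apply: eq_bigr => -[]. Qed.

Section SiteFields.
Context {R : realType}.
Variables (h : R) (N : nat).
Hypothesis N0 : (0 < N)%N.
Notation Ix := (Ix N).
Notation V := (Ix + Ix -> R).
Notation fld := (@fld N).
Notation so := (so N).
Definition wX (c1 c2 : R) (i : 'I_N) (k : Ix) : R :=
 match k with inl _ => 0 | inr jl => (jl.1 == i)%:R * match val jl.2 with 0%N => 1 | 1%N => c1 | _ => c2 end end.
Definition XX (c1 c2 : R) i : V -> R := L h (wX c1 c2 i).

Lemma XE c1 c2 i (x : V) : XX c1 c2 i x = h + (x (inl (fld i 0)) + c1 * x (inl (fld i 1)) + c2 * x (inl (fld i 2))).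
rewrite /XX /L; congr (_ + _).
rewrite big_sumType/= big1 ?add0r => [|p _]; last by rewrite mul0r.
rewrite sum_fldp (bigD1 i)//= big1 ?addr0.
 by rewrite eqxx !mul1r.
by move=> j ji; rewrite /= (negbTE ji) !mul0r !addr0.
Qed.

Lemma smooth_XX (f : R -> R) c1 c2 i : sm1 f -> smooth (fun x => f (XX c1 c2 i x)).
exact: smooth_sm1L. Qed.
Lemma inv_XX c1 c2 i k : (forall l, (l < 3)%N -> k != fld i l) -> inv (XX c1 c2 i) k.
move=> hk x t; rewrite !XE.
by rewrite !pushNE//; apply/negP => /eqP [] /esym/eqP; apply/negP; apply: hk.
Qed.
Lemma inv_XX_sk c1 c2 i p : inv (XX c1 c2 i) (inl p). Proof. exact: inv_XX. Qed.
Lemma inv_XX_fld c1 c2 i j k : j != i -> inv (XX c1 c2 i) (fld j k).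
by move=> ji; apply: inv_XX => l _; apply: contra ji => /eqP[->]. Qed.
Lemma P_so_two (f g : R -> R) c1 c2 d1 d2 i (A : Ix -> R) a b : A (fld i 0) = a -> A (fld i 1) = b ->
 P so (fun x => f (XX c1 c2 i x) * g (XX d1 d2 i x)) (vec A) =
 gm (fun z => gm (fun z' => f (h + sqr a * z + c1 * (sqr b * z')) * g (h + sqr a * z + d1 * (sqr b * z')))).
move=> ha hb; rewrite (@P_site _ _ _ i).
- rewrite /T; eqgm => z; eqgm => z'.
 have e01 : (inl (fld i 0) == inl (fld i 1) :> Ix + Ix) = false by apply/eqP => -[].
 have e10 : (inl (fld i 1) == inl (fld i 0) :> Ix + Ix) = false by apply/eqP => -[].
 have e20 : (inl (fld i 2) == inl (fld i 0) :> Ix + Ix) = false by apply/eqP => -[].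
 have e21 : (inl (fld i 2) == inl (fld i 1) :> Ix + Ix) = false by apply/eqP => -[].
 rewrite [X in f X]XE [X in g X]XE /push e01 e10 e20 e21 !eqxx /vec ha hb.
 by rewrite !(mulr1n, mulr0n, addr0, add0r, mulr0) addrA [in X in _ * X]addrA.
- by move=> p x t; rewrite !inv_XX_sk.
- by move=> j k ji x t; rewrite !inv_XX_fld.
Qed.

Lemma P_so_one (f : R -> R) c1 c2 i (A : Ix -> R) a b : sm1 f -> A (fld i 0) = a -> A (fld i 1) = b ->
 0 <= a -> 0 <= b -> c1 = 1 \/ c1 = -1 ->
 P so (fun x => f (XX c1 c2 i x)) (vec A) = gm (fun z => f (h + sqr (a + b) * z)).
move=> sf ha hb a0 b0 hc.
have -> : (fun x => f (XX c1 c2 i x)) = fun x => f (XX c1 c2 i x) * (fun=> 1) (XX c1 c2 i x).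
 by apply/funext => x; rewrite mulr1.
rewrite (P_so_two f (fun=> 1) c1 c2 1 1 ha hb).
case: hc => ->; [rewrite -(heat_semigroup h sf a0 b0)|rewrite -(heat_semigroupN h sf a0 b0)].
 by eqgm => z; eqgm => z'; rewrite mulr1 mul1r.
by eqgm => z; eqgm => z'; rewrite mulr1 mulN1r.
Qed.
End SiteFields.

(** * The endpoint with independent sites *)

Section PairEnd.
Context {R : realType}.
Variables (h : R) (N : nat) (e u eta : R).
Hypotheses (N0 : (0 < N)%N) (e2 : e ^+ 2 = 1).
Notation Ix := (Ix N).
Notation V := (Ix + Ix -> R).
Notation sp := (spin R).
Notation ov := (overlap R).
Notation fld := (@fld N).
Notation so := (so N).
Notation si := (si N).
Notation Ne := (N%:R : R).
Notation aset := (@aset R N u eta).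
Variable p0 : config N * config N.
Hypothesis ap0 : 0 < aset p0.
Notation Z2 := (Zf aset (b2 h (N := N)) (v2 e)).
Notation X1 := (@XX R h N 1 1).
Notation X2 := (@XX R h N (-1) e).
Let isk (k : Ix) : bool := if k is inl _ then true else false.
Let isd (k : Ix) : bool := if k is inr jl then jl.2 == i3 2 else true.

Lemma En2 p (x : V) : dead isk x -> En (b2 h (N := N)) (v2 e) p x = \sum_i (sp p.1 i * X1 i x + sp p.2 i * X2 i x).
move=> hx; rewrite /En big_sumType/= big1 ?add0r; last first.
 by move=> k _; have [_ ->] := hx (inl k) isT; rewrite mulr0.
rewrite sum_fldp.
rewrite /b2 /b1 !mulr_sumr -!big_split/=; apply: eq_bigr => i _; rewrite !XE; ring.
Qed.

Lemma Z2_gt0 x : 0 < Z2 x. Proof. exact: Zf_gt0 (@aset_ge0 _ _ _ _) ap0 x. Qed.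
Lemma sp_sg (s : config N) i : sp s i = sg (s i). Proof. by []. Qed.
(** On the constraint set, inserting [expR (l * N * (R - u))] costs a factor at most
    [expR (N * |l| * eta)]; dropping the constraint afterwards makes the sites factorise. *)
Lemma lnZ2_le (l : R) (x : V) : `|l| <= 2^-1 -> dead isk x ->
 ln (Z2 x) <= Ne * (`|l| * eta - l * u + ln 4 + 2 * l ^+ 2) +
 \sum_i (ln (cosh (X1 i x)) + ln (cosh (X2 i x)) + l * (tanh (X1 i x) * tanh (X2 i x))).
move=> l2 hx; rewrite -[leRHS]expRK ler_ln ?posrE ?expR_gt0 ?Z2_gt0//.
pose f i a c := expR (l * (sg a * sg c) + sg a * X1 i x + sg c * X2 i x) : R.
apply: (@le_trans _ _ (expR (Ne * (`|l| * eta - l * u)) * \prod_i \sum_a \sum_c f i a c)).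
 rewrite -sum_pairs mulr_sumr; apply: ler_sum => p _.
 rewrite -expR_sum -expRD /aset.
 have [hp|hp] := boolP (`|ov p.1 p.2 - u| <= eta); last by rewrite mul0r expR_ge0.
 rewrite mul1r ler_expR En2//.
 under [X in _ <= _ + X]eq_bigr do rewrite -!sp_sg -addrA.
 rewrite [X in _ <= _ + X]big_split/= -[X in _ <= _ + (X + _)]mulr_sumr ov_sum// addrA lerDr mulrCA -mulrDr mulr_ge0//.
 have -> : `|l| * eta - l * u + l * ov p.1 p.2 = `|l| * eta + l * (ov p.1 p.2 - u) by ring.
 have : `|l * (ov p.1 p.2 - u)| <= `|l| * eta by rewrite normrM ler_wpM2l.
 by rewrite ler_norml => /andP[h1 _]; lra.
rewrite (_ : expR (Ne * _ + _) = expR (Ne * (`|l| * eta - l * u)) * \prod_i expR (ln 4 + ln (cosh (X1 i x)) + ln (cosh (X2 i x)) +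
 (l * (tanh (X1 i x) * tanh (X2 i x)) + 2 * l ^+ 2))); last first.
 rewrite -expR_sum -expRD; congr expR.
 rewrite [X in _ = _ + X](_ : _ = \sum_(i < N) (ln 4 + 2 * l ^+ 2) +
 \sum_i (ln (cosh (X1 i x)) + ln (cosh (X2 i x)) + l * (tanh (X1 i x) * tanh (X2 i x)))).
 by rewrite sumr_const card_ord -mulr_natl; ring.
 by rewrite -big_split/=; apply: eq_bigr => i _; ring.
rewrite ler_wpM2l ?expR_ge0//; apply: ler_prod => i _; apply/andP; split.
 by apply: sumr_ge0 => a _; apply: sumr_ge0 => c _; exact: expR_ge0.
exact: site_bound.
Qed.
Let sm_lncosh : sm1 (fun t : R => ln (cosh t)).
by apply: (sm1_ext _ (sm1_lncosh 0 1)) => t; rewrite add0r mul1r. Qed.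
Let slc i : smooth (fun x => ln (cosh (X1 i x))). Proof. exact: (smooth_XX h 1 1 i sm_lncosh). Qed.
Let slc2 i : smooth (fun x => ln (cosh (X2 i x))). Proof. exact: (smooth_XX h (-1) e i sm_lncosh). Qed.
Let sth i : smooth (fun x => tanh (X1 i x) * tanh (X2 i x)).
by apply: smoothM; apply: smooth_XX; exact: sm1_th. Qed.
Variables (a b y : R).
Hypotheses (a0 : 0 <= a) (b0 : 0 <= b) (y0 : 0 <= y).
Notation AA := (Av 0 a b y : Ix -> R).

Lemma dead_sk : dead isk (vec AA). Proof. by apply: dead_vec => -[]//= _ _; rewrite mul0r. Qed.
Lemma end_lambda l : `|l| <= 2^-1 -> y = 0 ->
 guerra aset (b2 h (N := N)) (v2 e) so si 1 AA <=
 Ne * (`|l| * eta - l * u + ln 4 + 2 * l ^+ 2 + 2 * gm (fun z => ln (cosh (h + sqr (a + b) * z))) +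
 l * gm (fun z => gm (fun z' => tanh (h + sqr a * z + sqr b * z') * tanh (h + sqr a * z - sqr b * z')))).
move=> l2 y00.
have hd : dead isd (vec AA).
 apply: dead_vec => -[?|[i k]] /=; first by rewrite mul0r.
 by move=> /eqP ->; rewrite /= y00.
have sl : smooth (fun x => ln (Z2 x)) by exact: (smooth_lnZ (b2 h (N := N)) (v2 e) (@aset_ge0 _ _ _ _) ap0).
rewrite /guerra (@P_eq_dead _ _ isd so _ (fun x => ln (Z2 x)))//; last first.
 move=> x hx; rewrite P_scale0; last first.
 by move=> k /mapP[i _ ->]; have [] := hx (fld i 2) (eqxx _).
 by rewrite /Zpow expRK mul1r.
set c := Ne * (_ + 2 * l ^+ 2 + _ + _).
pose G (x : V) := Ne * (`|l| * eta - l * u + ln 4 + 2 * l ^+ 2) +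
 \sum_i (ln (cosh (X1 i x)) + ln (cosh (X2 i x)) + l * (tanh (X1 i x) * tanh (X2 i x))).
have sg i : smooth (fun x => ln (cosh (X1 i x)) + ln (cosh (X2 i x)) + l * (tanh (X1 i x) * tanh (X2 i x))).
 by apply: smoothD; [exact: smoothD|exact: smoothZ].
have sG : smooth G by apply: smoothD; [exact: smooth_cst|exact: smooth_sum].
apply: (@le_trans _ _ (P so G (vec AA))).
 apply: (P_le_dead (D := isd)) => // x hx; apply: lnZ2_le => // -[p|//] _; exact: hx (inl p) isT.
rewrite /G P_D; [|exact: smooth_cst|exact: smooth_sum].
rewrite P_cst P_sum// /c -!addrA mulrDr [X in _ <= X](_ : _ = Ne * (`|l| * eta + (- (l * u) + (ln 4 + 2 * l ^+ 2))) +
 \sum_(i < N) (2 * gm (fun z => ln (cosh (h + sqr (a + b) * z))) +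
 l * gm (fun z => gm (fun z' => tanh (h + sqr a * z + sqr b * z') * tanh (h + sqr a * z - sqr b * z'))))); last first.
 by rewrite sumr_const card_ord -mulr_natl; ring.
apply: le_of_eq; apply: (congr2 +%R); first by ring.
apply: eq_bigr => i _.
rewrite P_D; [|exact: smoothD|exact: smoothZ].
rewrite P_D// P_Z//.
rewrite (@P_so_one R h N (fun t => ln (cosh t)) 1 1 i AA a b sm_lncosh erefl erefl a0 b0 (or_introl erefl)).
rewrite (@P_so_one R h N (fun t => ln (cosh t)) (-1) e i AA a b sm_lncosh erefl erefl a0 b0 (or_intror erefl)).
rewrite (@P_so_two R h N (@tanh R) (@tanh R) 1 1 (-1) e i AA a b erefl erefl).
rewrite [2 * gm _]mulr_natl [gm _ *+ 2]mulr2n; apply: (congr1 (fun g => _ + l * g)).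
eqgn => z; eqgn => z'.
by rewrite mul1r mulN1r.
Qed.

Lemma end_rsb m : 2^-1 <= m <= 1 ->
 guerra aset (b2 h (N := N)) (v2 e) so si m AA <=
 Ne * (m * ln 4 + gm (fun z => ln (heat (sqr y) (emf (2 * m)) (h + sqr (a + b) * z)))).
move=> /andP[m2 m1]; have m0 : 0 < m by lra.
have m01 : 0 < m <= 1 by rewrite m0.
have mm1 : 1 <= 2 * m by lra.
pose H := heat (sqr y) (emf (2 * m)).
have H1 t : 1 <= H t by exact: (heat_em_ge1 mm1).
have sH : sm1 H by apply: sm1_heat; exact: sm1_chm.
have slH : sm1 (fun t => ln (H t)) by exact: sm1_ln.
have sZp : smooth (Zpow aset (b2 h (N := N)) (v2 e) m) by exact: (smooth_Zpow _ _ (@aset_ge0 _ _ _ _) ap0 m01).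
pose f i (x : V) := emf m (X1 i x) * emf m (X2 i x).
have sf i : smooth (f i) by apply: smoothM; apply: smooth_XX; exact: sm1_chm.
have f1 i x : 1 <= f i x by rewrite -[leLHS]mulr1 ler_pM// emf_ge1// ltW.
have Xpush c1 c2 i (x : V) t : XX h c1 c2 i (push x (inl (fld i 2)) t) = XX h c1 c2 i x + c2 * t.
 rewrite !XE /push eqxx.
 have -> : (inl (fld i 0) == inl (fld i 2) :> Ix + Ix) = false by apply/eqP => -[].
 have -> : (inl (fld i 1) == inl (fld i 2) :> Ix + Ix) = false by apply/eqP => -[].
 rewrite !(mulr1n, mulr0n, addr0); ring.
have Tf i (x : V) : x (inr (fld i 2)) = sqr y ->
 T (fld i 2) (f i) x <= sqr (H (X1 i x)) * sqr (H (X2 i x)).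
 move=> xy; rewrite /T xy /f.
 under eq_fun do rewrite !Xpush !mul1r mulrA.
 apply: (le_trans (emf_cs (X1 i x) (X2 i x) (sqr y) (e * sqr y) (ltW m0))).
 have eH : heat (e * sqr y) (emf (2 * m)) (X2 i x) = H (X2 i x).
 have : (e == 1) || (e == -1) by rewrite -eqf_sqr e2 expr1n.
 case/orP => /eqP ->; first by rewrite mul1r.
 by rewrite mulN1r heatN//; exact: sm1_chm.
 by rewrite eH.
rewrite -/H; clearbody H.
have dsk := dead_sk.
pose Q (x : V) := dead isk x /\ forall i, x (inr (fld i 2)) = sqr y.
have Qp x i z : Q x -> Q (push x (inl i) (x (inr i) * z)).
 by move=> [q1 q2]; split; [exact: dead_push|move=> j; rewrite /push addr0].
have Q0 : Q (vec AA) by split.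
pose G (x : V) := Ne * (m * ln 4) + \sum_i 2^-1 * (ln (H (X1 i x)) + ln (H (X2 i x))).
have sgi i : smooth (fun x => 2^-1 * (ln (H (X1 i x)) + ln (H (X2 i x)))).
 by apply: smoothZ; apply: smoothD; apply: (smooth_XX h _ _ i slH).
have sG : smooth G by apply: smoothD; [exact: smooth_cst|exact: smooth_sum].
rewrite /guerra; apply: (@le_trans _ _ (P so G (vec AA))).
 have sW : smooth (P si (Zpow aset (b2 h (N := N)) (v2 e) m)) by exact: smooth_P.
 apply: (P_le_on (Q := Q)) => //; [|by move=> x i z _; exact: Qp|].
 exact: (smooth_lnW _ _ (@aset_ge0 _ _ _ _) ap0 _ m01).
 move=> x [x1 x2].
 rewrite -[leRHS]expRK ler_ln ?posrE ?expR_gt0//; last exact: (W_gt0 _ _ (@aset_ge0 _ _ _ _) ap0 _ m01).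
 apply: (@le_trans _ _ (P si (fun x => expR (Ne * (m * ln 4)) * \prod_(i <- enum 'I_N) f i x) x)).
 apply: (P_le_on (Q := Q)) => //; [|by move=> w i z _; exact: Qp|].
 by apply: smoothZ; apply: smooth_prod.
 move=> w [w1 w2]; rewrite /Zpow.
 (* The multiplier 0 merely drops the constraint: in this bound the gain comes from the inner
    field. *)
 have l0 : `|0 : R| <= 2^-1 by rewrite normr0.
 have := lnZ2_le l0 w1; rewrite normr0 !mul0r expr0n mulr0 subr0 add0r addr0 => hle.
 rewrite big_enum/= (eq_bigr (fun i => expR (m * (ln (cosh (X1 i w)) + ln (cosh (X2 i w)))))); last first.
 by move=> i _; rewrite /f /emf -expRD mulrDr.
 rewrite -expR_sum -expRD ler_expR mulrCA -mulr_sumr -mulrDr ler_wpM2l ?(ltW m0)//.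
 apply: (le_trans hle); rewrite lerD2l; apply: ler_sum => i _; by rewrite mul0r addr0.
 rewrite P_Z; last exact: smooth_prod.
 have finv : forall i j, i != j -> inv (f i) (fld j 2).
 by move=> i j ij w t; rewrite /f !inv_XX_fld// eq_sym.
 rewrite /si /fL (P_prod x (enum_uniq 'I_N) sf finv).
 rewrite expRD; apply: ler_wpM2l; first exact: expR_ge0.
 rewrite big_enum/= expR_sum; apply: ler_prod => i _; apply/andP; split.
 apply: le_trans ler01 _; rewrite -[leLHS](gm_cst 1) /T; apply: ler_gauss_mean => //.
 - exact: (smooth_mD _ _ _ (sf i)).1.
 - exact: egrowth_cst.
 - exact: (smooth_mD _ _ _ (sf i)).2.
 apply: (le_trans (Tf i x (x2 i))).
 apply: le_of_eq.
 have Hs t : sqr (H t) = expR (2^-1 * ln (H t)).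
 have Ht : 0 < H t by exact: lt_le_trans (H1 t).
 have e0 : 0 <= expR (2^-1 * ln (H t)) by exact: expR_ge0.
 by rewrite -[RHS](ger0_norm e0) -sqrtr_sqr -expRM_natl mulrA mulfV// mul1r lnK.
 by rewrite (Hs (X1 i x)) (Hs (X2 i x)) mulrDr expRD.
rewrite /G P_D; [|exact: smooth_cst|exact: smooth_sum].
rewrite P_cst P_sum// mulrDr -[X in _ <= _ + X](_ : \sum_(i < N) gm (fun z => ln (H (h + sqr (a + b) * z))) = _); last first.
 by rewrite sumr_const card_ord [RHS]mulr_natl.
apply: le_of_eq; apply: (congr1 (fun g => _ + g)); apply: eq_bigr => i _.
have s1 : smooth (fun x => ln (H (X1 i x))) by exact: (smooth_XX h _ _ i slH).
have s2 : smooth (fun x => ln (H (X2 i x))) by exact: (smooth_XX h _ _ i slH).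
rewrite P_Z ?P_D//; last exact: smoothD.
rewrite (@P_so_one R h N (fun t => ln (H t)) 1 1 i AA a b slH erefl erefl a0 b0 (or_introl erefl)).
rewrite (@P_so_one R h N (fun t => ln (H t)) (-1) e i AA a b slH erefl erefl a0 b0 (or_intror erefl)).
exact: half_add.
Qed.
End PairEnd.

Section Numerics.
Context {R : realType}.
Implicit Types (B q t u eta F S a : R).

(** The chosen [l] minimises [2 * l ^+ 2 + l * (F - u)], with value [- (F - u) ^+ 2 / 8]; it stays
    below 1/2 because [u] and [F] are at most 1 in modulus. *)
Lemma num_lambda u F eta : `|u| <= 1 -> `|F| <= 1 -> 0 <= eta -> let l := - (F - u) / 4 in
 `|l| <= 2^-1 /\ `|l| * eta - l * u + 2 * l ^+ 2 + l * F <= eta / 2 - (F - u) ^+ 2 / 8.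
move=> hu hF eta0 l; have hl : `|l| <= 2^-1.
 move: hu hF; rewrite /l !ler_norml => /andP[u1 u2] /andP[F1 F2]; apply/andP; split; lra.
split=> //; have : `|l| * eta <= 2^-1 * eta by rewrite ler_wpM2r.
have -> : - l * u + 2 * l ^+ 2 + l * F = - ((F - u) ^+ 2 / 8) -> `|l| * eta - l * u + 2 * l ^+ 2 + l * F =
 `|l| * eta - ((F - u) ^+ 2 / 8) by lra.
 lra.
by rewrite /l; field.
Qed.

(** Since [kap <= B], the second-order term of the hypothesis, with its coefficient [B^-1], is
    absorbed by the quadratic term of the interpolation, leaving the strict gain in [c1]. *)
Lemma num_rsb kap q w m X Y eta c1 B : 0 <= w -> 0 <= kap -> kap <= B -> 0 < B -> 1 <= m -> 0 <= eta ->
 X <= Y + kap * w / 2 + (m - 1) / 2 * (q * (kap * w) + B^-1 * (kap * w) ^+ 2 / 2) - c1 * (kap * w) ^+ 2 ->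
 2 * X + kap / 2 * ((1 - (q + w)) ^+ 2 + eta - m * (2 * q * w + w ^+ 2)) <=
 2 * Y + kap / 2 * (1 - q) ^+ 2 - 2 * c1 * (kap * w) ^+ 2 + B / 2 * eta.
move=> w0 k0 kB B0 m1 eta0; set Z := (kap * w) ^+ 2 => hX.
have h1 : B^-1 * Z <= kap * w ^+ 2.
 rewrite /Z exprMn mulrA ler_wpM2r ?sqr_ge0// expr2 mulrA ler_piMl// mulrC ler_pdivrMr// mul1r//.
have h2 : (m - 1) * (B^-1 * Z) <= (m - 1) * (kap * w ^+ 2) by rewrite ler_wpM2l// subr_ge0.
have h3 : kap * eta <= B * eta by rewrite ler_wpM2r.
have e : 2 * Y + kap / 2 * (1 - q) ^+ 2 - 2 * c1 * Z + B / 2 * eta -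
 (2 * X + kap / 2 * ((1 - (q + w)) ^+ 2 + eta - m * (2 * q * w + w ^+ 2))) =
 2 * (Y + kap * w / 2 + (m - 1) / 2 * (q * (kap * w) + B^-1 * Z / 2) - c1 * Z - X)
 + 2^-1 * ((m - 1) * (kap * w ^+ 2) - (m - 1) * (B^-1 * Z)) + 2^-1 * (B * eta - kap * eta).
 by field; rewrite gt_eqF.
by rewrite -subr_ge0 e !addr_ge0// mulr_ge0// subr_ge0.
Qed.

Lemma sqr_gap (q u d : R) : 0 <= q -> q <= 1 -> `|u| <= 1 -> 0 <= d -> (u - q) ^+ 2 <= 4.
by move=> q0 q1; rewrite ler_norml => /andP[u1 u2] _; nra. Qed.
Lemma num_frac B : 0 < B -> B <= (1 + B) ^+ 2.
nra. Qed.
End Numerics.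

(** * A quadratic gap for the coupled free energy *)

Section Coupled.
Context {R : realType}.
Variables (h B q : R).
Hypotheses (h0 : 0 < h) (B0 : 0 < B) (q0 : 0 < q) (q1 : q <= 1).
Hypothesis Eth2 : gm (fun z => tanh (h + sqr (B * q) * z) ^+ 2) = q.
Hypothesis aT : B * gm (fun z => (cosh (h + sqr (B * q) * z))^-1 ^+ 4) < 1.
Definition RS0 := gm (fun z => ln (cosh (h + sqr (B * q) * z))).
Let b := B * q.
Let b0 : 0 < b. Proof. exact: mulr_gt0. Qed.
Let bq : b / q = B. Proof. by rewrite /b mulfK// gt_eqF. Qed.
Lemma Zf_pair_indep N e u eta (x : Ix N + Ix N -> R) :
 dead (fun k : Ix N => if k is inr jl then jl.2 == i3 2 else false) x ->
 Zf (aset u eta) (b2 h (N := N)) (v2 e) x = Zf (aset u eta) (b2 h (N := N)) (v2 1) x.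
move=> hx; rewrite /Zf; apply: eq_bigr => p _; congr (_ * expR _); rewrite /En; congr (_ + _).
rewrite !big_sumType/=; congr (_ + _); rewrite !sum_fldp; apply: eq_bigr => i _ /=.
by have [_ ->] := hx (fld i 2) (eqxx _); rewrite !mulr0.
Qed.

(** Time [t] trades couplings of strength [t * B] against fields of variance [(1 - t) * b]. Without
    inner field both signs [e] give the same pair energy, and 1 stands for both. *)
Definition pfree N u eta t := P (so N ++ si N) (fun x => ln (Zf (aset u eta) (b2 h (N := N)) (v2 1) x))
 (vec (@A1 R N (t * B) ((1 - t) * b))).

(* The two ways of bounding the coupled free energy: a Lagrange multiplier [l]
 with replica symmetric fields, or one step of symmetry breaking. *)
Lemma pfree_lambda N u eta p0 t p M l : (0 < N)%N -> 0 < aset (R := R) (N := N) u eta p0 -> 0 <= t <= 1 ->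
 - q <= p <= q -> (forall r, `|r - u| <= eta -> (r - p) ^+ 2 <= M) -> `|l| <= 2^-1 ->
 pfree N u eta t <= N%:R * (`|l| * eta - l * u + ln 4 + 2 * l ^+ 2 + 2 * RS0 + l * corr h b q ((1 - t) * q + t * p)
 + t * B / 2 * ((1 - q) ^+ 2 + M)).
move=> N0 ap0 /andP[t0 t1] /andP[p1 p2] hM l2.
have kap0 : 0 <= t * B by rewrite mulr_ge0// ltW.
have qp : 0 <= q + p by lra.
have qm : 0 <= q - p by lra.
have f00 : 0 <= (1 - t) * b by rewrite mulr_ge0 ?subr_ge0// ltW.
have m01 : 0 < (1 : R) <= (1 : R) by rewrite lexx andbT; exact: ltr01.
have e1 : (1 : R) ^+ 2 = 1 by exact: expr1n.
have hM' : forall r, `|r - u| <= eta -> (r - (p + 1 * 0)) ^+ 2 <= M by move=> r; rewrite mulr0 addr0; exact: hM.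
have := pair_guerra h N0 e1 ap0 kap0 qp qm (lexx 0) f00 m01 hM'.
rewrite (guerra_end h _ ap0 (t * B) ((1 - t) * b) _) mul1r -/(pfree N u eta t).
have a0 : 0 <= (1 - t) * b + t * B * (q + p) / 2 by rewrite addr_ge0// divr_ge0// mulr_ge0.
have c0 : 0 <= t * B * (q - p) / 2 by rewrite divr_ge0// mulr_ge0.
have y0 : 0 <= t * B * 0 by rewrite mulr0.
have := end_lambda h 1 N0 ap0 a0 c0 l2 (mulr0 (t * B)); rewrite -/(@A0 R N (t * B) q p 0 ((1 - t) * b)).
have -> : (1 - t) * b + t * B * (q + p) / 2 + t * B * (q - p) / 2 = B * q by rewrite /b; field.
rewrite -/RS0.
have -> : (1 - t) * b + t * B * (q + p) / 2 = b / q * (q + ((1 - t) * q + t * p)) / 2 by rewrite bq /b; field.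
have -> : t * B * (q - p) / 2 = b / q * (q - ((1 - t) * q + t * p)) / 2 by rewrite bq; field.
rewrite -/(corr h b q _); set C := corr _ _ _ _; set G := guerra _ _ _ _ _ _ _ => hG hP.
apply: (le_trans hP); apply: (@le_trans _ _ (N%:R * (`|l| * eta - l * u + ln 4 + 2 * l ^+ 2 + 2 * RS0 + l * C) +
 1 * (N%:R * (t * B / 2 * ((1 - (q + 0)) ^+ 2 + M - 1 * (2 * q * 0 + 0 ^+ 2 + 2 * p * 1 * 0 + 0 ^+ 2)))))).
 by rewrite lerD2r.
apply: le_of_eq; rewrite !(mulr0, addr0, expr0n, mul1r, subr0)/=.
by rewrite -mulrDr.
Qed.

Lemma pfree_rsb N u eta p0 t e w m : (0 < N)%N -> 0 < aset (R := R) (N := N) u eta p0 -> 0 <= t <= 1 ->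
 e ^+ 2 = 1 -> 0 <= w -> u = e * (q + w) -> 0 <= eta <= 1 -> 1 <= m <= 2 ->
 pfree N u eta t <= N%:R * (ln 4 + 2 * (m^-1 * gm (fun z => ln (heat (sqr (t * B * w)) (emf m) (h + sqr b * z))))
 + t * B / 2 * ((1 - (q + w)) ^+ 2 + eta - m * (2 * q * w + w ^+ 2))).
move=> N0 ap0 /andP[t0 t1] e2 w0 uE /andP[eta0 eta1] /andP[m1 m2].
have e1 : (e == 1) || (e == -1) by rewrite -eqf_sqr e2 expr1n.
have kap0 : 0 <= t * B by rewrite mulr_ge0// ltW.
have qe : 0 <= q + e * q /\ 0 <= q - e * q.
 by have q0' := q0; case/orP: e1 => /eqP ->; split; lra.
have f00 : 0 <= (1 - t) * b by rewrite mulr_ge0 ?subr_ge0// ltW.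
(* The pair is taken at half the exponent, which [emf_cs] doubles back to [m]. *)
pose m' := m / 2.
have m01 : 0 < m' <= 1 by apply/andP; split; rewrite /m'; lra.
have m2' : 2^-1 <= m' <= 1 by apply/andP; split; rewrite /m'; lra.
have hM : forall r, `|r - u| <= eta -> (r - (e * q + e * w)) ^+ 2 <= eta.
 move=> r; rewrite -mulrDr -uE => hr; rewrite -real_normK ?num_real// expr2.
 by rewrite (le_trans (ler_pM _ _ hr hr))// ler_piMr.
have := pair_guerra h N0 e2 ap0 kap0 qe.1 qe.2 w0 f00 m01 hM.
rewrite (guerra_end h _ ap0 (t * B) ((1 - t) * b) _).
have -> : P (so N ++ si N) (fun x => ln (Zf (aset u eta) (b2 h (N:=N)) (v2 e) x)) (vec (@A1 R N (t * B) ((1 - t) * b))) = pfree N u eta t.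
 apply: (P_eq_dead (D := fun k : Ix N => if k is inr jl then jl.2 == i3 2 else false)).
 by move=> x hx; rewrite Zf_pair_indep.
 by apply: dead_vec => -[//|[i k]] /= /eqP ->.
have a0 : 0 <= (1 - t) * b + t * B * (q + e * q) / 2 by rewrite addr_ge0// divr_ge0// mulr_ge0// qe.1.
have c0 : 0 <= t * B * (q - e * q) / 2 by rewrite divr_ge0// mulr_ge0// qe.2.
have y0 : 0 <= t * B * w by rewrite mulr_ge0.
have := end_rsb h N0 e2 ap0 (t * B * w) a0 c0 m2'; rewrite -/(@A0 R N (t * B) q (e * q) w ((1 - t) * b)).
have -> : (1 - t) * b + t * B * (q + e * q) / 2 + t * B * (q - e * q) / 2 = b by rewrite /b; field.
have -> : 2 * m' = m by rewrite /m'; field.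
set C := gm _; set G := guerra _ _ _ _ _ _ _ => hG hP.
have m0 : 0 < m' by case/andP: m01.
rewrite -(ler_pM2l m0); apply: (le_trans hP).
apply: (@le_trans _ _ (N%:R * (m' * ln 4 + C) + m' * (N%:R * (t * B / 2 * ((1 - (q + w)) ^+ 2 + eta -
 m' * (2 * q * w + w ^+ 2 + 2 * (e * q) * e * w + w ^+ 2)))))); first by rewrite lerD2r.
have -> : 2 * (e * q) * e * w = e ^+ 2 * (2 * q * w) by ring.
rewrite e2 /m' le_eqVlt; apply/orP; left; apply/eqP.
have mn : m != 0 by rewrite gt_eqF//; lra.
clearbody C; by field.
Qed.

Lemma corr_norm c : `|corr h b q c| <= 1.
rewrite /corr -P_two; apply: P_norm; first by apply: smoothM; exact: smooth_th.
by move=> x; rewrite normrM mulr_ile1// tanh_norm.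
Qed.

Ltac prune := clear -h0 B0 q0 q1 Eth2 aT b0 bq.
(** Four regimes. For small [t * B] the multiplier at [p = q] already gives the gap. Otherwise:
    [p = u] for [|u| <= q]; [p = - q] just below [- q], where the gap at [- q] leaves a margin [d];
    and symmetry breaking with [w = |u| - q] elsewhere, whose gain of order [(t * B * w) ^+ 2] needs
    [t * B] bounded below. *)
Lemma coupled : exists c C, [/\ 0 < c, 0 <= C & forall N u eta p0 t, (0 < N)%N -> 0 < aset (R := R) (N := N) u eta p0 ->
 0 <= t <= 1 -> `|u| <= 1 -> eta <= 1 ->
 pfree N u eta t <= N%:R * (ln 4 + 2 * RS0 + t * B * (1 - q) ^+ 2 / 2 - c * (u - q) ^+ 2 + C * eta)].
have q0' := q0; have q1' := q1; have B0' := B0; have aT' := aT.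
pose S4 := gm (fun z => (cosh (h + sqr (B * q) * z))^-1 ^+ 4).
have S40 : 0 <= S4 by apply: gmean_ge0 => z; rewrite exprn_ge0// ltW// sech_gt0.
pose a := B * S4; have a1 : a < 1 by [].
have a0 : 0 <= a by rewrite mulr_ge0// ltW.
have sb : S4 * b < q by rewrite /b mulrA [S4 * B]mulrC gtr_pMl.
have Y0 : 0 <= B * (1 - q) by rewrite mulr_ge0 ?subr_ge0// ltW.
have [m [c1 [/andP[m1 m2] c10 h1]]] := at_1rsb h0 b0 q0 Eth2 Y0 sb.
(* At [u = - q] the multiplier gains at least [q ^+ 2 * (1 - a) ^+ 2 / 2]; this [d] keeps the cost
   [B * d ^+ 2] of moving away below half of it. *)
pose d := q * (1 - a) / (2 * (1 + B)).
have oB : 0 < 2 * (1 + B) by lra.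
have d0 : 0 < d by rewrite divr_gt0// mulr_gt0// subr_gt0.
have hd : B * d ^+ 2 <= q ^+ 2 * (1 - a) ^+ 2 / 4.
 have o1 : 0 < 1 + B by rewrite addr_gt0.
 have -> : B * d ^+ 2 = q ^+ 2 * (1 - a) ^+ 2 / 4 * (B / (1 + B) ^+ 2).
 by rewrite /d; field; rewrite gt_eqF.
 have h7 : 0 <= q ^+ 2 * (1 - a) ^+ 2 / 4 by rewrite divr_ge0// mulr_ge0// sqr_ge0.
 apply: ler_piMr => //; rewrite ler_pdivrMr ?exprn_gt0// mul1r.
 exact: num_frac.
(* Curvatures for [|u| <= q], for [u] just below [- q], for [u > q] and for [u < - q - d]. The
   distance [(u - q) ^+ 2] is at most 4 in [e2] and [e4], and 256 is the square of the threshold 16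
   on [t * B]. *)
pose e1 := (1 - a) ^+ 2 / 8; pose e2 := q ^+ 2 * (1 - a) ^+ 2 / 16.
pose e3 := 2 * c1 / 256; pose e4 := e3 * d ^+ 2 / 4.
have a1' : 0 < 1 - a by rewrite subr_gt0.
have p1 : 0 < e1 by rewrite divr_gt0// exprn_gt0.
have p2 : 0 < e2 by rewrite divr_gt0// mulr_gt0// exprn_gt0.
have p3 : 0 < e3 by rewrite divr_gt0// mulr_gt0.
have p4 : 0 < e4 by rewrite divr_gt0// mulr_gt0// exprn_gt0.
pose c := Num.min 32^-1 (Num.min e1 (Num.min e2 (Num.min e3 e4))).
have c0 : 0 < c by rewrite !lt_min p1 p2 p3 p4 invr_gt0 ltr0n.
have [cc0 cc1 cc2 cc3 cc4] : [/\ c <= 32^-1, c <= e1, c <= e2, c <= e3 & c <= e4].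
 by rewrite /c; clear; split; rewrite !ge_min lexx ?orbT.
exists c, (5 + B); split=> //; first lra.
move=> N u eta p0 t N0 ap0 t01 u1 eta1.
have eta0 : 0 <= eta := eta_ge0 ap0.
have [t0 t1] := andP t01.
have tB0 : 0 <= t * B by rewrite mulr_ge0// ltW.
have tB1 : t * B <= B by rewrite ler_piMl// ltW.
have N1 : 0 <= (N%:R : R) by exact: ler0n.
have [u1' u1''] : -1 <= u /\ u <= 1 by move: u1; rewrite ler_norml => /andP[].
have gap4 : (u - q) ^+ 2 <= 4 by exact: (sqr_gap (ltW q0') q1' u1 (lexx 0)).
have gap0 := sqr_ge0 (u - q).
set RS := RS0.
have fin c' X : c <= c' -> pfree N u eta t <= N%:R * X ->
 X <= ln 4 + 2 * RS + t * B * (1 - q) ^+ 2 / 2 - c' * (u - q) ^+ 2 + (5 + B) * eta ->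
 pfree N u eta t <= N%:R * (ln 4 + 2 * RS + t * B * (1 - q) ^+ 2 / 2 - c * (u - q) ^+ 2 + (5 + B) * eta).
 move=> cc' hX X1; apply: (le_trans hX); rewrite ler_wpM2l//; apply: (le_trans X1).
 have : c * (u - q) ^+ 2 <= c' * (u - q) ^+ 2 by rewrite ler_wpM2r.
 by move: (ln 4) (c * _) (c' * _) => x1 x2 x3; lra.
have lamb p M F : - q <= p <= q -> (forall r, `|r - u| <= eta -> (r - p) ^+ 2 <= M) ->
 F = corr h b q ((1 - t) * q + t * p) ->
 pfree N u eta t <= N%:R * (ln 4 + 2 * RS + t * B / 2 * (1 - q) ^+ 2 + (eta / 2 - (F - u) ^+ 2 / 8) + t * B / 2 * M).
 move=> pq hM FE; have F1 : `|F| <= 1 by rewrite FE corr_norm.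
 have [l2 hl] := num_lambda u1 F1 eta0.
 apply: (le_trans (pfree_lambda N0 ap0 t01 pq hM l2)); rewrite ler_wpM2l// -FE.
 by move: hl; rewrite -/RS; set l := - (F - u) / 4; prune; move: (ln 4) (`|l| * eta) => x y; lra.
have [tsm|tbig] := leP (t * B) 16^-1.
 have cq : corr h b q ((1 - t) * q + t * q) = q.
 by rewrite -mulrDl subrK mul1r corr_q.
 apply: (fin _ _ cc0 (lamb q ((u - q) ^+ 2 + 5 * eta) q _ _ (esym cq))); first by rewrite lexx andbT; lra.
 move=> r; rewrite ler_norml => /andP[r1 r2].
 have -> : (r - q) ^+ 2 = (u - q) ^+ 2 + (r - u) * (2 * (u - q) + (r - u)) by ring.
 rewrite lerD2l; move: u1' u1'' q0' q1' eta0 eta1 r1 r2; prune; nra.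
 have e5 : t * B / 2 * (u - q) ^+ 2 <= 16^-1 / 2 * (u - q) ^+ 2 by rewrite ler_wpM2r// ler_wpM2r.
 have e6 : t * B * eta <= B * eta by rewrite ler_wpM2r.
 have e7 : t * B * eta <= 16^-1 * eta by rewrite ler_wpM2r.
 have e8 : 0 <= B * eta by rewrite mulr_ge0// ltW.
 rewrite -[(q - u) ^+ 2]sqrrN opprB; move: gap0 e5 e7 e8 eta0; prune; move: (ln 4) ((u - q) ^+ 2) => x y; lra.
have B1 : 0 <= B * eta by rewrite mulr_ge0// ltW.
have Mle x : x <= eta -> t * B / 2 * x <= B * eta by move=> hx; move: tB0 tB1 eta0 hx; prune; nra.
have eta2 : eta ^+ 2 <= eta by rewrite expr2 ler_piMl.
have [uq|uq] := leP `|u| q.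
 have [uq1 uq2] : - q <= u /\ u <= q by move: uq; rewrite ler_norml => /andP[].
 set F := corr h b q ((1 - t) * q + t * u).
 have hF : q - a * (t * (q - u)) <= F.
 have cq : `|(1 - t) * q + t * u| <= q by rewrite ler_norml; move: t0 t1 uq1 uq2 q0'; prune; nra.
 have := corr_bound b0 q0 Eth2 cq; rewrite bq -/S4 -/F -/a.
 by have -> : q - ((1 - t) * q + t * u) = t * (q - u) by ring.
 apply: (fin _ _ cc1 (lamb u eta F _ _ erefl)); first by rewrite uq1 uq2.
 by move=> r hr; apply: le_trans eta2; rewrite -[leLHS]real_normK ?num_real//; apply: lerXn2r => //; rewrite nnegrE.
 have g0 : 0 <= (1 - a) * (q - u) by rewrite mulr_ge0// ?subr_ge0// ltW.
 have g1 : (1 - a) * (q - u) <= F - u.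
 have : a * (t * (q - u)) <= a * (q - u) by rewrite ler_wpM2l// ler_piMl// subr_ge0.
 by move: hF; prune; lra.
 have g2 : ((1 - a) * (q - u)) ^+ 2 <= (F - u) ^+ 2 by rewrite lerXn2r ?nnegrE ?(le_trans g0).
 have g3 : e1 * (u - q) ^+ 2 = ((1 - a) * (q - u)) ^+ 2 / 8 by rewrite /e1; field.
 have g4 := Mle _ (lexx eta).
 by move: g2 g4 eta0 B1; rewrite g3; prune; move: (ln 4) (t * B / 2 * eta) ((F - u) ^+ 2) (((1 - a) * (q - u)) ^+ 2) => x y z w; lra.
have [/andP[ud1 ud2]|hud] := boolP (- q - d <= u <= - q).
 set F := corr h b q ((1 - t) * q + t * - q).
 have hF : q - a * (t * (2 * q)) <= F.
 have cq : `|(1 - t) * q + t * - q| <= q by rewrite ler_norml; move: t0 t1 q0'; prune; nra.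
 have := corr_bound b0 q0 Eth2 cq; rewrite bq -/S4 -/F -/a.
 by have -> : q - ((1 - t) * q + t * - q) = t * (2 * q) by ring.
 apply: (fin _ _ cc2 (lamb (- q) (2 * d ^+ 2 + 2 * eta) F _ _ erefl)); first by rewrite lexx/=; lra.
 move=> r; rewrite ler_norml => /andP[r1 r2]; rewrite opprK.
 have h5 : `|r + q| <= d + eta by rewrite ler_norml; apply/andP; split; lra.
 apply: (@le_trans _ _ ((d + eta) ^+ 2)).
 by rewrite -[leLHS]real_normK ?num_real//; apply: lerXn2r => //; rewrite nnegrE ?addr_ge0// ltW.
 by move: eta2 (sqr_ge0 (d - eta)); prune; nra.
 have g0 : 0 <= 2 * q * (1 - a) by rewrite !mulr_ge0// ltW.
 have g1 : 2 * q * (1 - a) <= F - u.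
 have : a * (t * (2 * q)) <= a * (2 * q) by rewrite ler_wpM2l// ler_piMl// mulr_ge0// ltW.
 by move: hF ud2; prune; lra.
 have g2 : (2 * q * (1 - a)) ^+ 2 <= (F - u) ^+ 2 by rewrite lerXn2r ?nnegrE ?(le_trans g0).
 have g3 : (2 * q * (1 - a)) ^+ 2 = 4 * (q ^+ 2 * (1 - a) ^+ 2) by ring.
 have g4 : t * B * eta <= B * eta by rewrite ler_wpM2r.
 have g5 : t * B * d ^+ 2 <= B * d ^+ 2 by rewrite ler_wpM2r ?sqr_ge0.
 have g6 : e2 * (u - q) ^+ 2 <= e2 * 4 by rewrite ler_wpM2l// ltW.
 move: g2 g4 g5 g6 hd eta0 B1; rewrite g3 /e2; clear.
 move: (ln 4) ((F - u) ^+ 2) (q ^+ 2 * (1 - a) ^+ 2) => x z w; move: (t * B) ((u - q) ^+ 2) => tb g.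
 move: (d ^+ 2) ((1 - q) ^+ 2) => dd y; lra.
pose e := Num.sg u; pose w := `|u| - q.
have un0 : u != 0 by apply: contraTneq uq => ->; rewrite normr0 -leNgt ltW.
have es : e ^+ 2 = 1 by rewrite /e sqr_sg un0.
have w0 : 0 <= w by rewrite /w; lra.
have uE : u = e * (q + w) by rewrite /e /w addrC subrK -numEsg.
have m12 : 1 <= m <= 2 by rewrite m2 (ltW m1).
have eta01 : 0 <= eta <= 1 by rewrite eta0.
have w1 : w <= 1 - q by rewrite /w; lra.
have yY : 0 <= t * B * w <= B * (1 - q).
 by rewrite mulr_ge0//= ler_pM.
have hr := h1 _ yY; have m1' := ltW m1.
have qb : q / b = B^-1 by rewrite /b invfM mulrCA mulfV ?mulr1// gt_eqF.
rewrite qb in hr.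
have := pfree_rsb N0 ap0 t01 es w0 uE eta01 m12.
set X := m^-1 * gm _ => hp.
have RSE : gm (fun z => ln (cosh (h + sqr b * z))) = RS by [].
have := num_rsb w0 tB0 tB1 B0 m1' eta0 hr; rewrite RSE -/X => hX.
have kw : 256^-1 * w ^+ 2 <= (t * B * w) ^+ 2.
 rewrite exprMn ler_wpM2r ?sqr_ge0//; move: tbig; prune; move: (t * B) => x; nra.
have gapw : e3 * w ^+ 2 <= 2 * c1 * (t * B * w) ^+ 2.
 have -> : e3 * w ^+ 2 = 2 * c1 * (256^-1 * w ^+ 2) by rewrite /e3; ring.
 by rewrite ler_wpM2l// mulr_ge0// ltW.
have concl c' : c <= c' -> c' * (u - q) ^+ 2 <= e3 * w ^+ 2 ->
 pfree N u eta t <= N%:R * (ln 4 + 2 * RS + t * B * (1 - q) ^+ 2 / 2 - c * (u - q) ^+ 2 + (5 + B) * eta).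
 move=> cc' hc'; apply: (fin c' _ cc' hp); rewrite -addrA.
 move: hX gapw hc' B1 eta0; prune; move: (t * B / 2 * (_ - _)) (2 * c1 * _) (e3 * _) (c' * _) => x1 x2 x3 x4.
 move: (ln 4) (X) (RS) => x5 x6 x7; lra.
have [up|un] := leP 0 u.
 by apply: (concl e3 cc3); rewrite /w ger0_norm.
apply: (concl e4 cc4).
have wd : d <= w.
 move: hud; rewrite negb_and -!ltNge /w ltr0_norm// => /orP[]; first lra.
 by move=> h5; move: uq; rewrite ltr0_norm//; lra.
have : d ^+ 2 <= w ^+ 2 by rewrite lerXn2r ?nnegrE// ltW.
have e40 : e4 * (u - q) ^+ 2 <= e4 * 4 by rewrite ler_wpM2l// ltW.
move=> dw; apply: (le_trans e40); rewrite /e4 -mulrA mulVf// mulr1; apply: ler_wpM2l => //; exact: ltW.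
Qed.
End Coupled.
Transparent gauss_mean.

Lemma sqrB_lin (R : realType) (y e : R) : (y - e) ^+ 2 = y ^+ 2 + (- (2 * e) * y + e ^+ 2).
ring. Qed.

(** * From free energies to overlap probabilities *)

Section Concentration.
Context {R : realType}.
Variables (h B q : R) (N : nat).
Hypotheses (N0 : (0 < N)%N) (B0 : 0 < B) (q0 : 0 < q) (q1 : q <= 1).
Notation Ix := (Ix N).
Notation V := (Ix + Ix -> R).
Notation sp := (spin R).
Notation ov := (overlap R).
Notation fld := (@fld N).
Notation so := (so N).
Notation si := (si N).
Notation Ne := (N%:R : R).
Definition one1 (s : config N) : R := 1.
Notation vv := (@v1 R N).
Notation w1 := (wt one1 (b1 h (N := N)) vv).
Notation Z1 := (Zf one1 (b1 h (N := N)) vv).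
Definition s1 : config N := [ffun=> true].
Definition isx (k : Ix) : bool := if k is inr jl then (0 < jl.2)%N else false.

Lemma one1_ge0 s : 0 <= one1 s. Proof. exact: ler01. Qed.
Lemma one1_gt0 : 0 < one1 s1. Proof. exact: ltr01. Qed.
Hint Resolve one1_ge0 one1_gt0 : core.
Let Zp x : 0 < Z1 x. Proof. exact: Zf_gt0 one1_gt0 x. Qed.
Let w0 s x : 0 <= w1 s x. Proof. exact: wt_ge0. Qed.
Let w1s x : \sum_s w1 s x = 1. Proof. exact: wt_sum one1_gt0 x. Qed.

Definition pav (f : config N -> config N -> R) (x : V) : R := \sum_s \sum_t w1 s x * w1 t x * f s t.

Lemma smooth_pav f : smooth (pav f).
have sw s : smooth (w1 s) by exact: (smooth_wt _ _ one1_ge0 one1_gt0).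
apply: smooth_sum => s; apply: smooth_sum => t.
by apply: smoothM; [exact: smoothM|exact: smooth_cst].
Qed.
Lemma pav_le f g x : (forall s t, f s t <= g s t) -> pav f x <= pav g x.
by move=> fg; apply: ler_sum => s _; apply: ler_sum => t _; rewrite ler_wpM2l// mulr_ge0. Qed.
Lemma pav_cst c x : pav (fun _ _ => c) x = c.
rewrite /pav; under eq_bigr do rewrite -mulr_suml -mulr_sumr w1s mulr1.
by rewrite -mulr_suml w1s mul1r.
Qed.
Lemma pavD f g x : pav (fun s t => f s t + g s t) x = pav f x + pav g x.
by rewrite -big_split; apply: eq_bigr => s _; rewrite -big_split; apply: eq_bigr => t _; rewrite mulrDr. Qed.
Lemma pavZ c f x : pav (fun s t => c * f s t) x = c * pav f x.
by rewrite mulr_sumr; apply: eq_bigr => s _; rewrite mulr_sumr; apply: eq_bigr => t _; rewrite mulrCA. Qed.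
Lemma pav_sum n (f : 'I_n -> config N -> config N -> R) x :
 pav (fun s t => \sum_j f j s t) x = \sum_j pav (f j) x.
rewrite /pav [RHS]exchange_big/=; apply: eq_bigr => s _; rewrite [RHS]exchange_big/=; apply: eq_bigr => t _.
by rewrite mulr_sumr.
Qed.
Lemma Zf_pair u eta x : dead isx x ->
 Zf (aset u eta) (b2 h (N := N)) (v2 1) x = Z1 x ^+ 2 * pav (fun s t => aset u eta (s, t)) x.
move=> hx; rewrite /pav mulr_sumr [LHS]/Zf.
have en p : En (b2 h (N := N)) (v2 1) p x = En (b1 h (N := N)) vv p.1 x + En (b1 h (N := N)) vv p.2 x.
 rewrite /En addrACA /b2 -big_split/=; congr (_ + _); apply: eq_bigr => -[ij|[i [[|k] hk]]] _ /=.
 - by rewrite mulrDl.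
 - by rewrite mulrDl.
 by have [_ ->] := hx (inr (i, Ordinal hk)) isT; rewrite !mulr0 addr0.
rewrite -(pair_big xpredT xpredT (fun s t => aset u eta (s, t) * expR (En (b2 h (N := N)) (v2 1) (s, t) x)))/=.
apply: eq_bigr => s _; rewrite mulr_sumr; apply: eq_bigr => t _; rewrite en/= expRD /wt.
have zn : Z1 x != 0 by rewrite gt_eqF.
move: (Z1 x) zn => z zn; rewrite /one1 !mul1r.
move: (expR _) (expR _) (aset _ _ _) => a c d.
by field.
Qed.

(** At [t = 1] this is the original model, at [t = 0] independent sites in a Gaussian field of
    variance [B * q]. *)
Definition At (t : R) : Ix -> R := A1 (t * B) ((1 - t) * (B * q)).
Definition fren (t : R) := P (so ++ si) (fun x => ln (Z1 x)) (vec (At t)).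

Let U2 u eta := Zf (aset u eta) (b2 h (N := N)) (v2 (R := R) 1).
(** By [Zf_pair], the logarithm of the Gibbs probability that two replicas satisfy the
    constraint. *)
Let wr u eta x := ln (U2 u eta x) - 2 * ln (Z1 x).

Lemma dead_At t : dead isx (vec (At t)).
by apply: dead_vec => -[//|[i [[|[|k]] hk]]]; rewrite /At /A1. Qed.
Lemma At_ge0 t : 0 <= t <= 1 -> forall k, 0 <= At t k.
move=> /andP[t0 t1] k; apply: Av_ge0 => //; rewrite !mulr_ge0 ?subr_ge0//; exact: ltW.
Qed.
Lemma sum_cs (F : Ix -> R) : \sum_(k <- so ++ si) F k = \sum_k F k.
rewrite -big_enum/=; apply: perm_big; apply: uniq_perm; rewrite ?enum_uniq ?uniq_cs//.
by move=> k; rewrite all_cs mem_enum.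
Qed.
(** Each partial derivative of [wr] is a pair average minus twice a single average, at most 2 + 2 in
    modulus, and the variances of all coordinates add up to at most [2 * B * Ne]. *)
Lemma var_ratio u eta p0 t : 0 < aset (R := R) (N := N) u eta p0 -> 0 <= t <= 1 ->
 P (so ++ si) (fun x => wr u eta x ^+ 2) (vec (At t)) - P (so ++ si) (wr u eta) (vec (At t)) ^+ 2 <= 32 * B * Ne.
move=> ap0 t01; set w := wr u eta.
have sl2 : smooth (fun x => ln (U2 u eta x)) by exact: (smooth_lnZ (b2 h (N := N)) (v2 1) (@aset_ge0 R N u eta) ap0).
have sl1 : smooth (fun x => ln (Z1 x)) by exact: (smooth_lnZ (b1 h (N := N)) vv one1_ge0 one1_gt0).
have sw : smooth w by apply: smoothB => //; exact: smoothZ.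
have dw k x : D (inl k) w x = wav (aset u eta) (b2 h (N := N)) (v2 1) (v2 1 k) x - 2 * wav one1 (b1 h (N := N)) vv (vv k) x.
 have := pd_D (pdD (pd_lnZ (b2 h (N := N)) (v2 1) (@aset_ge0 R N u eta) ap0 (inl k))
 (pdZ (-2) (pd_lnZ (b1 h (N := N)) vv one1_ge0 one1_gt0 (inl k)))).
 move=> /(congr1 (@^~ x)) /=; rewrite mulNr => <-; apply: (congr1 (fun g => D (inl k) g x)).
 by apply/funext => y; rewrite /w /wr /U2 mulNr.
have wn (S : finType) (a b : S -> R) (v : Ix -> S -> R) (s0 : S) (g : S -> R) C x : (forall s, 0 <= a s) -> 0 < a s0 ->
 (forall s, `|g s| <= C) -> `|wav a b v g x| <= C.
 move=> a0 as0 hg; apply: (le_trans (ler_norm_sum _ _ _)).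
 have -> : C = \sum_s wt a b v s x * C by rewrite -mulr_suml (wt_sum b v a0 as0) mul1r.
 by apply: ler_sum => s _; have h0' := wt_ge0 b v a0 as0 s x; rewrite normrM ger0_norm// ler_wpM2l.
have v1n k s : `|vv k s : R| <= 1.
 case: k => [p|[i [[|k] hk]]] /=; rewrite ?normrM ?sp_norm ?mulr1//.
 by rewrite normr0 ler01.
have v2n (k : Ix) p : `|v2 1 k p : R| <= 2.
 have h2 (a c : R) : `|a| = 1 -> `|c| = 1 -> `|a + c| <= 2.
 by move=> ha hc; rewrite (le_trans (ler_normD _ _))// ha hc.
 case: k => [ij|[i [[|[|k]] hk]]] /=; rewrite ?mul1r; apply: h2; by rewrite ?normrN ?normrM ?sp_norm ?mulr1.
have hB k x : `|D (inl k) w x| <= 4.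
 rewrite dw; apply: (le_trans (ler_normB _ _)).
 have h1 := wn _ _ (b2 h (N := N)) (v2 1) p0 (v2 1 k) 2 x (@aset_ge0 R N u eta) ap0 (v2n k).
 have h2 := wn _ _ (b1 h (N := N)) vv s1 (vv k) 1 x one1_ge0 one1_gt0 (v1n k).
 rewrite normrM (ger0_norm (_ : 0 <= 2))//; move: h1 h2; lra.
apply: (le_trans (@var_P _ _ (so ++ si) w _ (fun=> 4) sw hB)).
rewrite sum_cs -mulr_suml.
have -> : \sum_k vec (At t) (inr k) ^+ 2 = Ne * (t * B / 2 + (1 - t) * (B * q)).
 transitivity (\sum_k At t k); first by apply: eq_bigr => k _; rewrite /vec sqr_sqrtr// At_ge0.
 rewrite big_sumType/= sumr_const card_prod card_ord (sum_fldp (fun p => At t (inr p)))/= sumr_const card_ord.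
 rewrite !addr0 -[X in _ + X]mulr_natl -[X in X + _]mulr_natl natrM [RHS]mulrDr; apply: (congr1 (+%R^~ _)).
 have n0 : Ne != 0 by rewrite pnatr_eq0 -lt0n.
 by move: (Ne) n0 => n n0; field.
have [t0 t1] := andP t01.
have h1 : (1 - t) * (B * q) <= (1 - t) * B by rewrite ler_wpM2l ?subr_ge0// ler_piMr// ltW.
have h2 : t * B / 2 + (1 - t) * (B * q) <= B * 2.
 have : 0 <= t * B by rewrite mulr_ge0// ltW.
 have : t * B <= B by rewrite ler_piMl// ltW.
 have B0' := B0; move: h1 B0'; rewrite [(1 - t) * B]mulrBl mul1r.
 move: ((1 - t) * (B * q)) (t * B) => x y; lra.
have -> : 32 * B * Ne = Ne * (32 * B) by ring.
rewrite -mulrA; apply: ler_wpM2l; first exact: ler0n.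
by move: h2; move: (_ + _) => x; rewrite !expr2; lra.
Qed.

(** Chebyshev's inequality: [wr] has mean at most [- M], so either it is below [- M / 2], which
    makes the probability at most [2 / M], or it deviates from its mean by [M / 2]. For [M]
    proportional to [N] the total is of order [1 / N]. *)
Lemma pair_prob u eta t M : 0 <= t <= 1 -> 0 < M ->
 (forall p0, 0 < aset (R := R) (N := N) u eta p0 -> pfree h B q N u eta t <= 2 * fren t - M) ->
 P (so ++ si) (pav (fun s t => aset u eta (s, t))) (vec (At t)) <= 2 / M + 128 * B * Ne / M ^+ 2.
move=> t01 M0 hM; set a := fun s t => _.
have BN : 0 <= 128 * B * Ne / M ^+ 2 by rewrite divr_ge0 ?exprn_ge0 ?mulr_ge0//; exact: ltW.
case: (pselect (exists p0, 0 < aset (R := R) (N := N) u eta p0)) => [[p0 ap0]|ha]; last first.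
 have -> : pav a = fun=> 0.
 apply/funext => x; rewrite -(pav_cst 0 x) /pav; apply: eq_bigr => s _; apply: eq_bigr => t' _; congr (_ * _).
 by apply/eqP; apply: contra_notT ha => h1; exists (s, t'); rewrite lt0r h1 aset_ge0.
 by rewrite P_cst addr_ge0// divr_ge0// ltW.
pose w := wr u eta.
have sl2 : smooth (fun x => ln (U2 u eta x)) by exact: (smooth_lnZ (b2 h (N := N)) (v2 1) (@aset_ge0 R N u eta) ap0).
have sl1 : smooth (fun x => ln (Z1 x)) by exact: (smooth_lnZ (b1 h (N := N)) vv one1_ge0 one1_gt0).
have sw : smooth w by apply: smoothB => //; exact: smoothZ.
set E := P (so ++ si) w (vec (At t)).
have EM : E <= - M.
 rewrite /E /w /wr P_B//; last exact: smoothZ.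
 rewrite P_Z// -/(fren t).
 have := hM p0 ap0; rewrite /pfree -/(U2 u eta) -/(At t); move: (P _ _ _) (fren t) => y z; lra.
have hvar := var_ratio ap0 t01.
have s2 : smooth (fun x => (w x - E) ^+ 2).
 have sc : smooth (fun x => w x - E) by apply: smoothB => //; exact: smooth_cst.
 exact: smoothM.
apply: (@le_trans _ _ (P (so ++ si) (fun x => expR (- (M / 2)) + 4 / M ^+ 2 * (w x - E) ^+ 2) (vec (At t)))).
 apply: (P_le_dead (D := isx)); [exact: smooth_pav| |move=> x hx|exact: dead_At].
 by apply: smoothD; [exact: smooth_cst|exact: smoothZ].
 have Up : 0 < U2 u eta x := Zf_gt0 _ _ (@aset_ge0 R N u eta) ap0 x.
 have z2 : 0 < Z1 x ^+ 2 by rewrite exprn_gt0.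
 have e1 : pav a x = expR (w x).
 have lz : 2 * ln (Z1 x) = ln (Z1 x ^+ 2) by rewrite lnXn// mulr_natl.
 rewrite /w /wr lz expRB !lnK ?posrE// /U2 Zf_pair//.
 by move: (pav a x) (Z1 x ^+ 2) z2 => y z z0; rewrite mulrAC mulfV ?mul1r// gt_eqF.
 have w0' : w x <= 0.
 rewrite -ler_expR -e1 expR0 -(pav_cst 1 x); apply: pav_le => s' t'.
 by rewrite /a /aset -[leRHS]/(1%:R) ler_nat leq_b1.
 rewrite e1; move: (w x) w0' => y y0.
 have [yM|yM] := leP y (- (M / 2)).
 by rewrite ler_wpDr ?ler_expR// mulr_ge0 ?sqr_ge0// divr_ge0// sqr_ge0.
 apply: ler_wpDl; first exact: expR_ge0.
 have h1 : expR y <= 1 by rewrite -expR0 ler_expR.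
 have h2 : M / 2 <= y - E by move: yM EM; lra.
 have h3 : (M / 2) ^+ 2 <= (y - E) ^+ 2 by rewrite lerXn2r ?nnegrE ?(le_trans _ h2)// divr_ge0// ltW.
 apply: (le_trans h1); apply: (@le_trans _ _ (4 / M ^+ 2 * (M / 2) ^+ 2)).
 have M1 : M != 0 by rewrite gt_eqF.
 by apply: le_of_eq; move: M1; move=> M1; field.
 by apply: ler_wpM2l => //; rewrite divr_ge0// sqr_ge0.
rewrite P_D; [|exact: smooth_cst|exact: smoothZ]; rewrite P_cst P_Z//.
have -> : (fun x => (w x - E) ^+ 2) = fun x => w x ^+ 2 + (- (2 * E) * w x + E ^+ 2).
 by apply/funext => x; exact: sqrB_lin.
have sww : smooth (fun x => w x ^+ 2) by exact: smoothM.
rewrite P_D//; last by apply: smoothD; [exact: smoothZ|exact: smooth_cst].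
rewrite P_D//; [|exact: smoothZ|exact: smooth_cst].
rewrite P_Z// P_cst -/E.
move: hvar; rewrite -/w -/E; move: (P _ _ _) => W hW.
apply: lerD.
 rewrite expRN -[leRHS]invrK lef_pV2 ?posrE ?expR_gt0 ?invr_gt0 ?divr_gt0// invf_div.
 by apply: le_trans (expR_ge1Dx _); rewrite lerDr.
have -> : 128 * B * Ne / M ^+ 2 = 4 / M ^+ 2 * (32 * B * Ne).
 by have M1 : M != 0 by [rewrite gt_eqF]; move: M1; move=> M1; field.
apply: ler_wpM2l; first by rewrite divr_ge0// sqr_ge0.
have e9 (y : R) : - (2 * y) * y + y ^+ 2 = - y ^+ 2 by ring.
by rewrite e9.
Qed.

Definition tl (eps : R) (s t : config N) : R := (eps <= `|ov s t - q|)%R%:R.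

Lemma grid n (r : R) : (0 < n)%N -> `|r| <= 1 -> exists j : 'I_n, `|r - (-1 + 2 * j%:R / n%:R)| <= 2 / n%:R.
move=> n0; rewrite ler_norml => /andP[r1 r2].
have np : 0 < n%:R :> R by rewrite ltr0n.
pose y := (r + 1) * n%:R / 2.
have y0 : 0 <= y by rewrite /y divr_ge0// mulr_ge0//; lra.
have /andP[k1 k2] := Num.Theory.truncn_itv y0.
set k := Num.truncn y in k1 k2.
have yn : y <= n%:R by rewrite /y -mulrA mulrCA ler_piMr//; lra.
(* At [r = 1] the integer part is [n], past the last grid point; capping it costs at most one
   cell. *)
have kn : (minn k n.-1 < n)%N by rewrite gtn_min prednK// leqnn orbT.
exists (Ordinal kn); have -> : r - (-1 + 2 * (Ordinal kn)%:R / n%:R) = 2 / n%:R * (y - (minn k n.-1)%:R).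
 by rewrite /y; field; rewrite gt_eqF.
rewrite normrM ger0_norm ?divr_ge0//; apply: ler_piMr; first by rewrite divr_ge0.
have [kl|kl] := leqP k n.-1.
 rewrite ger0_norm ?subr_ge0//; move: k2; rewrite -natr1; lra.
have e : (n.-1)%:R + 1 = n%:R :> R by rewrite natr1 prednK.
have e2 : (n.-1)%:R + 1 <= y.
 apply: le_trans k1; rewrite natr1 ler_nat//.
rewrite ler_norml; lra.
Qed.

(** A union bound over [n] windows of overlaps. The number of windows is independent of [N], so the
    order [1 / N] is kept. *)
Lemma tail_le eps t n rho : (0 < n)%N -> 0 <= t <= 1 -> 0 < rho ->
 (forall u p0, `|u| <= 1 -> eps - 2 / n%:R <= `|u - q| -> 0 < aset (R := R) (N := N) u (2 / n%:R) p0 ->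
 pfree h B q N u (2 / n%:R) t <= 2 * fren t - Ne * rho) ->
 P (so ++ si) (pav (tl eps)) (vec (At t)) <= n%:R * (2 / rho + 128 * B / rho ^+ 2) / Ne.
move=> n0 t01 rho0 hp; have np : 0 < n%:R :> R by rewrite ltr0n.
have Np : 0 < Ne by rewrite ltr0n.
pose u (j : 'I_n) : R := -1 + 2 * j%:R / n%:R.
pose f (j : 'I_n) (s t : config N) := (eps - 2 / n%:R <= `|u j - q|)%R%:R * aset (u j) (2 / n%:R) (s, t) : R.
have f0 j s t' : 0 <= f j s t' by rewrite mulr_ge0// aset_ge0.
apply: (@le_trans _ _ (P (so ++ si) (pav (fun s t => \sum_j f j s t)) (vec (At t)))).
 apply: P_le; [exact: smooth_pav|exact: smooth_pav|] => x; apply: pav_le => s t'.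
 rewrite /tl; case: (leP eps) => [he|_]; last exact: sumr_ge0.
 have [j hj] := grid n0 (ov_norm N0 s t').
 rewrite (bigD1 j)//=; apply: ler_wpDr; first exact: sumr_ge0.
 rewrite /f /aset/= hj mulr1 -/(u j); case: (leP (eps - 2 / n%:R) `|u j - q|) => hlt; first exact: lexx.
 exfalso.
 have : eps < eps; last by rewrite ltxx.
 apply: (le_lt_trans he); rewrite -(ltrD2r (- (2 / n%:R))); apply: le_lt_trans hlt.
 have -> : ov s t' - q = (ov s t' - u j) + (u j - q) by rewrite addrA subrK.
 by rewrite lerBlDr; apply: (le_trans (ler_normD _ _)); rewrite addrC lerD2l.
have -> : pav (fun s t => \sum_j f j s t) = fun x => \sum_j pav (f j) x by apply/funext => x; exact: pav_sum.
rewrite P_sum; last by move=> j; exact: smooth_pav.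
have -> : n%:R * (2 / rho + 128 * B / rho ^+ 2) / Ne = \sum_(j < n) (Ne^-1 * (2 / rho + 128 * B / rho ^+ 2)).
 by rewrite sumr_const card_ord -[RHS]mulr_natl mulrAC mulrA.
apply: ler_sum => j _.
have K0 : 0 <= Ne^-1 * (2 / rho + 128 * B / rho ^+ 2).
 by rewrite mulr_ge0 ?invr_ge0// addr_ge0// divr_ge0 ?exprn_ge0 ?mulr_ge0//; exact: ltW.
have -> : pav (f j) = fun x => (eps - 2 / n%:R <= `|u j - q|)%R%:R * pav (fun s t => aset (u j) (2 / n%:R) (s, t)) x.
 by apply/funext => x; exact: pavZ.
rewrite P_Z; last exact: smooth_pav.
case: (leP (eps - 2 / n%:R) `|u j - q|) => he; last by rewrite mul0r.
rewrite mul1r; apply: (le_trans (@pair_prob _ _ _ (Ne * rho) t01 _ _)).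
- by rewrite mulr_gt0.
- move=> p0 ap0; apply: (hp _ p0 _ he ap0).
 have jn : j%:R <= n%:R :> R by rewrite ler_nat ltnW.
 rewrite ler_norml /u; apply/andP; split; first by rewrite lerDl divr_ge0// mulr_ge0.
 rewrite -lerBrDl ler_pdivrMr//; move: jn; lra.
apply: le_of_eq.
have n1 := Np; have r1 := rho0; rewrite !lt0r in n1 r1; case/andP: n1 => n1 _; case/andP: r1 => r1 _.
by move: (B) => B'; field; rewrite n1 r1.
Qed.

Definition gap2 (s t : config N) : R := (ov s t - q) ^+ 2.
(** Excess of the replica symmetric value over the free energy at time [t]. Its derivative is, up to
    a factor, the second moment of the overlap gap that it is used to bound. *)
Definition dlt (t : R) : R := Ne * (ln 2 + RS0 h B q + t * B * (1 - q) ^+ 2 / 4) - fren t.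

Lemma At_mix t : At t = mix (At 0) (At 1) t.
apply/funext => k; rewrite /At /A1 /mix; case: k => [p|[i [[|[|k]] hk]]] /=; rewrite ?mulr0 ?addr0//.
 by rewrite !(mul0r, mul1r, mulr0, add0r) mulrA.
by rewrite !(subrr, subr0, mul0r, mul1r, mulr0, addr0).
Qed.
Lemma der_fren (t : R) : 0 < t < 1 -> is_derive t 1 fren
 (Ne * B / 4 * ((1 - q) ^+ 2 - P (so ++ si) (pav gap2) (vec (At t)))).
move=> t01.
have a0 : forall k, 0 <= At 0 k by apply: At_ge0; rewrite lexx ler01.
have a1 : forall k, 0 <= At 1 k by apply: At_ge0; rewrite lexx ler01.
have [df _] := free_interp (b1 h (N := N)) vv one1_ge0 one1_gt0 (uniq_cs N) (@all_cs N) a0 a1.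
move: (df t t01); rewrite -At_mix.
have -> : (fun s => free one1 (b1 h (N := N)) vv (so ++ si) (mix (At 0) (At 1) s)) = fren.
 by apply/funext => s; rewrite -At_mix.
have -> : kern2 one1 (b1 h (N := N)) vv (fun i => At 1 i - At 0 i) =
 fun x => Ne * B / 4 * (1 - q) ^+ 2 + - (Ne * B / 4) * pav gap2 x.
 apply/funext => x; rewrite /kern2.
 have cv s s' : Cov vv (fun i => At 1 i - At 0 i) s s' = Ne * (B / 2 * ov s s' ^+ 2 - B * q * ov s s').
 have -> : (fun i => At 1 i - At 0 i) = Av B (- (B * q)) 0 0.
 apply/funext => i; rewrite /At /A1 AvB; congr (Av _ _ _ _ i); ring.
 by rewrite Cov1// mulNr.
 have e1 s : Cov vv (fun i => At 1 i - At 0 i) s s - \sum_t0 w1 t0 x * Cov vv (fun i => At 1 i - At 0 i) s t0 =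
 \sum_t0 w1 t0 x * (Ne * B / 2 * ((1 - q) ^+ 2 - gap2 s t0)).
 have ec C : C = \sum_t0 w1 t0 x * C by rewrite -mulr_suml w1s mul1r.
 rewrite cv ov_self// [X in X - _]ec -sumrB; apply: eq_bigr => t0 _.
 rewrite cv /gap2 -mulrBr; congr (_ * _); move: (ov s t0) (Ne) => o n'; move: (B) (q) => B' q'; by field.
 under eq_bigr do rewrite e1 mulr_sumr.
 under eq_bigr do under eq_bigr do rewrite mulrA.
 rewrite -/(pav (fun s t => Ne * B / 2 * ((1 - q) ^+ 2 - gap2 s t)) x) pavZ.
 have -> : (fun s t => (1 - q) ^+ 2 - gap2 s t) = fun s t => (1 - q) ^+ 2 + -1 * gap2 s t.
 by apply/funext => s; apply/funext => t0; rewrite mulN1r.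
 by rewrite pavD pav_cst pavZ; move: (pav _ _) ((1 - q) ^+ 2) => y z; field.
have sg2 := smooth_pav gap2.
rewrite P_D; [|exact: smooth_cst|exact: smoothZ]; rewrite P_cst P_Z// => h1.
by apply: is_derive_eq; rewrite mulNr -mulrBr.
Qed.

Lemma ln_Z1 x : dead (fun k : Ix => isx k || (if k is inl _ then true else false)) x ->
 ln (Z1 x) = \sum_i (ln 2 + ln (cosh (XX h 1 0 i x))).
move=> hx; have e s : one1 s * expR (En (b1 h (N := N)) vv s x) = \prod_i expR (sp s i * XX h 1 0 i x).
 rewrite /one1 mul1r -expR_sum; congr expR; rewrite /En /b1 mulr_sumr big_sumType/= [X in _ + (X + _)]big1 ?add0r; last first.
 by move=> p _; have [_ ->] := hx (inl p) isT; rewrite mulr0.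
 rewrite sum_fldp -big_split/=; apply: eq_bigr => i _; rewrite XE.
 have [_ ->] := hx (fld i 1) isT; have [_ ->] := hx (fld i 2) isT; ring.
rewrite /Zf; under eq_bigr do rewrite e.
have -> : \sum_(s : config N) \prod_i expR (sp s i * XX h 1 0 i x) = \prod_i (2 * cosh (XX h 1 0 i x)).
 rewrite -(bigA_distr_bigA (fun i a => expR (sg a * XX h 1 0 i x)))/=; apply: eq_bigr => i _.
 by rewrite big_bool/= /sg mul1r mulN1r /cosh mulrC divfK.
have pr (n : nat) (g : 'I_n -> R) : (forall i, 0 < g i) -> ln (\prod_i g i) = \sum_i ln (g i).
 elim: n g => [|n IH] g g0; first by rewrite !big_ord0 ln1.
 rewrite !big_ord_recl lnM ?posrE ?IH//; apply: prodr_gt0 => i _; exact: g0.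
rewrite pr; last by move=> i; rewrite mulr_gt0 ?cosh_gt0.
by apply: eq_bigr => i _; rewrite lnM ?posrE ?cosh_gt0.
Qed.

(** Without couplings the sites are independent and the replica symmetric value is exact: this is
    the initial condition of the comparison. *)
Lemma fren0 : fren 0 = Ne * (ln 2 + RS0 h B q).
have sm_lncosh : sm1 (fun t : R => ln (cosh t)).
 by apply: (sm1_ext _ (sm1_lncosh 0 1)) => t; rewrite add0r mul1r.
have sl (i : 'I_N) : smooth (fun x => ln (cosh (XX h 1 0 i x))) by exact: (smooth_XX h 1 0 i sm_lncosh).
have AE : At 0 = Av 0 (B * q) 0 0 by apply/funext => k; rewrite /At /A1 mul0r subr0 mul1r.
rewrite /fren AE (@P_eq_dead _ _ (fun k : Ix => isx k || (if k is inl _ then true else false)) _ _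
 (fun x => \sum_i (ln 2 + ln (cosh (XX h 1 0 i x))))); last 2 first.
- by move=> x; exact: ln_Z1.
- by apply: dead_vec => -[ij|[i [[|[|k]] hk]]] //= _; rewrite mul0r.
have sl2 (i : 'I_N) : smooth (fun x => ln 2 + ln (cosh (XX h 1 0 i x))) by apply: smoothD => //; exact: smooth_cst.
rewrite P_sum// mulr_natl -[in RHS](card_ord N) -sumr_const; apply: eq_bigr => i _.
rewrite P_D//; last exact: smooth_cst.
rewrite P_cst P_cat; apply: (congr1 (+%R (ln 2))).
rewrite (_ : P si (fun x => ln (cosh (XX h 1 0 i x))) = fun x => ln (cosh (XX h 1 0 i x))); last first.
 apply: P_inv => k /mapP[j _ ->] x t.
 have nf l : (l < 2)%N -> inl (fld i l) != inl (fld j 2) :> Ix + Ix.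
 move=> l2; apply/eqP => e.
 have e' : fld i l = fld j 2 := congr1 (fun z : Ix + Ix => if z is inl y then y else fld i l) e.
 have := fld_neq i j (ltnW l2 : (l < 3)%N) (isT : (2 < 3)%N); rewrite e' eqxx => /esym/andP[_ /eqP l2e].
 by rewrite l2e in l2.
 by rewrite !XE !mul0r !addr0 !pushNE// nf.
rewrite (@P_so_one R h N (fun t => ln (cosh t)) 1 0 i (Av 0 (B * q) 0 0) (B * q) 0 sm_lncosh erefl erefl _ (lexx 0) (or_introl erefl)).
 by rewrite addr0.
by rewrite mulr_ge0//; exact: ltW.
Qed.

Lemma gap2_tail (eps : R) x : pav gap2 x <= eps ^+ 2 + 4 * pav (tl eps) x.
rewrite -(pav_cst (eps ^+ 2) x) -pavZ -pavD; apply: pav_le => s t; rewrite /gap2 /tl.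
case: (leP eps `|ov s t - q|) => h1.
 apply: ler_wpDl; first exact: sqr_ge0.
 rewrite mulr1; apply: (sqr_gap (ltW q0) q1 (ov_norm N0 s t) (lexx 0)).
rewrite mulr0 addr0 -[leLHS]real_normK ?num_real// lerXn2r ?nnegrE// (le_trans _ (ltW h1))//.
Qed.
End Concentration.

(** * Closing the loop: concentration of the overlap *)

Section ConcentrationTheorem.
Context {R : realType}.
Variables (h B q : R).
Hypotheses (h0 : 0 < h) (B0 : 0 < B) (q0 : 0 < q) (q1 : q <= 1).
Hypothesis Eth2 : gm (fun z => tanh (h + sqr (B * q) * z) ^+ 2) = q.
Hypothesis aT : B * gm (fun z => (cosh (h + sqr (B * q) * z))^-1 ^+ 4) < 1.
Notation PN N t f := (P (so N ++ si N) (@pav R h N f) (vec (@At R B q N t))).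

Let Kc (eta : R) := 2 / eta + 128 * B / eta ^+ 2.
Let Kc0 eta : 0 < eta -> 0 <= Kc eta.
by move=> e0; rewrite addr_ge0// divr_ge0 ?exprn_ge0 ?mulr_ge0//; exact: ltW. Qed.
Lemma num_gap (c C eta d K s : R) : 0 < c -> 0 <= C -> 0 <= eta -> eta <= 1 -> 0 <= d -> s ^+ 2 = (2 * d + (C + 1) * eta) / c ->
 (eta + s) ^+ 2 + K <= 4 / c * d + (2 + 2 * (C + 1) / c) * eta + K.
move=> c0 C0 e0 e1 d0 hs; rewrite lerD2r.
have h1 : (eta + s) ^+ 2 <= 2 * eta ^+ 2 + 2 * s ^+ 2 by have := sqr_ge0 (eta - s); rewrite -subr_ge0; nra.
apply: (le_trans h1); rewrite hs.
have -> : 4 / c * d + (2 + 2 * (C + 1) / c) * eta = 2 * eta + 2 * ((2 * d + (C + 1) * eta) / c) by field; rewrite gt_eqF.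
by rewrite lerD2r ler_pM2l// expr2 ler_piMr.
Qed.

Section Fixed.
Variables (c C : R).
Hypotheses (c0 : 0 < c) (C0 : 0 <= C).
Hypothesis hc : forall N u eta p0 t, (0 < N)%N -> 0 < aset (R := R) (N := N) u eta p0 ->
 0 <= t <= 1 -> `|u| <= 1 -> eta <= 1 ->
 pfree h B q N u eta t <= N%:R * (ln 4 + 2 * RS0 h B q + t * B * (1 - q) ^+ 2 / 2 - c * (u - q) ^+ 2 + C * eta).
Variables (N n : nat).
Hypotheses (N0 : (0 < N)%N) (n2 : (1 < n)%N).
Let eta : R := 2 / n%:R.
Let np : 0 < n%:R :> R. Proof. by rewrite ltr0n ltnW. Qed.
Let Np : 0 < N%:R :> R. Proof. by rewrite ltr0n. Qed.
Let e0 : 0 < eta. Proof. by rewrite divr_gt0. Qed.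
Let e1 : eta <= 1. Proof. by rewrite ler_pdivrMr// mul1r ler_nat. Qed.
Let dl t := dlt h B q N t / N%:R.

(** The coupled bound is relative to the replica symmetric value. Passing to the free energy costs
    [2 * dl t], so the tail is small beyond a distance of the order of the square root of [dl t]
    plus [eta]. *)
Lemma tail_at eps t : 0 <= t <= 1 -> eta <= eps -> 2 * dl t + (C + 1) * eta <= c * (eps - eta) ^+ 2 ->
 PN N t (tl q eps) <= n%:R * Kc eta / N%:R.
move=> t01 ee hd; apply: (tail_le N0 B0 q0 q1 (ltnW n2) t01 e0).
move=> u p0 u1 hu ap0; apply: (le_trans (hc N0 ap0 t01 u1 e1)).
have -> : fren h B q N t = N%:R * (ln 2 + RS0 h B q + t * B * (1 - q) ^+ 2 / 4) - N%:R * dl t.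
 have -> : N%:R * dl t = dlt h B q N t by rewrite /dl mulrCA mulfV ?mulr1// gt_eqF.
 by rewrite /dlt opprB addrC subrK.
have -> : ln 4 = 2 * ln 2 :> R.
 by rewrite (_ : 4 = 2 ^+ 2); [rewrite lnXn// mulr_natl|rewrite expr2; ring].
have gu : c * (eps - eta) ^+ 2 <= c * (u - q) ^+ 2.
 apply: ler_wpM2l; first exact: ltW.
 rewrite -[leRHS]real_normK ?num_real//; apply: lerXn2r => //; by rewrite nnegrE subr_ge0.
rewrite -subr_ge0.
have -> : 2 * (N%:R * (ln 2 + RS0 h B q + t * B * (1 - q) ^+ 2 / 4) - N%:R * dl t) - N%:R * eta -
 N%:R * (2 * ln 2 + 2 * RS0 h B q + t * B * (1 - q) ^+ 2 / 2 - c * (u - q) ^+ 2 + C * eta) =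
 N%:R * (c * (u - q) ^+ 2 - (2 * dl t + (C + 1) * eta)).
 by move: (ln 2) (RS0 h B q) (dl t) => x y z; field.
apply: mulr_ge0; first exact: ltW.
by rewrite subr_ge0 (le_trans hd).
Qed.

Lemma der_dl (t : R) : 0 < t < 1 -> is_derive t 1 dl (B / 4 * PN N t (gap2 q (N := N))).
move=> t01; have d1 := der_fren h (q := q) N0 B0 q0 t01.
have -> : dl = fun t => (ln 2 + RS0 h B q) + (B * (1 - q) ^+ 2 / 4) * t + - N%:R^-1 * fren h B q N t.
 apply/funext => s; rewrite /dl /dlt; move: (ln 2) (RS0 h B q) (fren h B q N s) => x y z.
 by have n0 : N%:R != 0 :> R by [rewrite gt_eqF]; field.
apply: (d_ext _ _ (dD (dD (is_derive_cst (ln 2 + RS0 h B q) t (1 : R)) (dZ (B * (1 - q) ^+ 2 / 4) (is_derive_id t (1 : R)))) (dZ (- N%:R^-1) d1))) => //.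
move: (P _ _ _) => g; have n0 : N%:R != 0 :> R by [rewrite gt_eqF]; by field.
Qed.

Lemma cont_dl : continuous dl.
have a0 : forall k, 0 <= At (N := N) B q 0 k by apply: At_ge0; rewrite ?lexx ?ler01.
have a1 : forall k, 0 <= At (N := N) B q 1 k by apply: At_ge0; rewrite ?lexx ?ler01.
have [_] := free_interp (b1 h (N := N)) (@v1 R N) (@one1_ge0 R N) (@one1_gt0 R N) (uniq_cs N) (@all_cs N) a0 a1.
have -> : (fun s => free (@one1 R N) (b1 h (N := N)) (@v1 R N) (so N ++ si N) (mix (At B q 0) (At B q 1) s)) = fren h B q N.
 by apply/funext => s; rewrite -At_mix.
move=> cf; have -> : dl = fun t => (ln 2 + RS0 h B q) + (B * (1 - q) ^+ 2 / 4) * t + - N%:R^-1 * fren h B q N t.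
 apply/funext => s; rewrite /dl /dlt; move: (ln 2) (RS0 h B q) (fren h B q N s) => x y z.
 by have n0 : N%:R != 0 :> R by [rewrite gt_eqF]; field.
move=> t; apply: cvgD; last by apply: cvgM; [exact: cvg_cst|exact: cf].
by apply: cvgD; [exact: cvg_cst|cvg_scale].
Qed.

Lemma dl0 : dl 0 = 0.
by rewrite /dl /dlt fren0// !mul0r addr0 subrr mul0r. Qed.
Let g0 t : 0 <= PN N t (gap2 q (N := N)).
apply: P_ge0; first exact: smooth_pav.
move=> x; rewrite -(pav_cst h (N := N) 0 x); apply: pav_le => s t'; exact: sqr_ge0.
Qed.
Lemma dl_ge0 (t : R) : 0 < t < 1 -> 0 <= dl t.
move=> /andP[t0 t1].
have dd (s : R) : s \in `]0, t[ -> is_derive s 1 dl (B / 4 * PN N s (gap2 q (N := N))).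
 by rewrite in_itv/= => /andP[s0 s1]; apply: der_dl; rewrite s0 (lt_trans s1).
have [s _] := MVT t0 dd (continuous_subspaceT cont_dl).
by rewrite dl0 !subr0 => ->; rewrite mulr_ge0 ?mulr_ge0//; exact: ltW.
Qed.
Let K2 := 2 + 2 * (C + 1) / c.
Let Kn := 4 * (n%:R * Kc eta / N%:R).

(** [tail_at] at the smallest distance it allows bounds the derivative of [dl] by a multiple of [dl]
    plus small errors. *)
Lemma gap_le (t : R) : 0 < t < 1 -> PN N t (gap2 q (N := N)) <= 4 / c * dl t + K2 * eta + Kn.
move=> t01; have d0 := dl_ge0 t01; have [t0 t1] := andP t01.
set X := (2 * dl t + (C + 1) * eta) / c.
have c0' := ltW c0; have e0' := ltW e0.
have X0 : 0 <= X by rewrite divr_ge0// addr_ge0// mulr_ge0// addr_ge0.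
pose eps := eta + sqr X.
have s2 := sqr_sqrtr X0.
have tt : PN N t (tl q eps) <= n%:R * Kc eta / N%:R.
 apply: tail_at; first by rewrite !ltW.
 by rewrite lerDl sqrtr_ge0.
 have -> : eps - eta = sqr X by rewrite /eps addrC addKr.
 by rewrite s2 /X [c * _]mulrCA mulfV ?mulr1// gt_eqF.
apply: (@le_trans _ _ (eps ^+ 2 + 4 * PN N t (tl q eps))).
 have sp := @smooth_pav R h N (tl q eps).
 have s4 : smooth (fun x => 4 * @pav R h N (tl q eps) x) by exact: smoothZ.
 have -> : eps ^+ 2 + 4 * PN N t (tl q eps) = P (so N ++ si N) (fun x => eps ^+ 2 + 4 * @pav R h N (tl q eps) x) (vec (@At R B q N t)).
 by rewrite P_D//; [rewrite P_cst P_Z|exact: smooth_cst].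
 apply: P_le; [exact: smooth_pav|by apply: smoothD => //; exact: smooth_cst|].
 by move=> x; exact: gap2_tail.
apply: (le_trans _ (num_gap Kn c0 C0 (ltW e0) e1 d0 s2)).
by rewrite lerD2l ler_pM2l.
Qed.

(** Gronwall's inequality, started from [dl 0 = 0]. *)
Lemma dl1_le : dl 1 <= expR (B / c) * (B / 4) * (K2 * eta + Kn).
have Kp : 0 <= B / 4 * (K2 * eta + Kn).
 have := Kc0 e0 => k0; rewrite mulr_ge0 ?divr_ge0//; first exact: ltW.
 by rewrite addr_ge0 ?mulr_ge0 ?addr_ge0 ?divr_ge0 ?mulr_ge0 ?addr_ge0//; exact: ltW.
have := @exp_interp_le R dl (fun t => B / 4 * PN N t (gap2 q (N := N))) (B / c) (B / 4 * (K2 * eta + Kn)) 0 (dl 1)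
 dl0 erefl cont_dl der_dl.
rewrite add0r => h1; have {h1} : expR (- (B / c)) * dl 1 <= B / 4 * (K2 * eta + Kn).
 apply: h1 => s s01; have gl := gap_le s01; have [s0 s1] := andP s01.
 apply: (@le_trans _ _ (expR (- (B / c * s)) * (B / 4 * (K2 * eta + Kn)))).
 rewrite ler_wpM2l ?expR_ge0//.
 have : B / 4 * PN N s (gap2 q (N := N)) <= B / 4 * (4 / c * dl s + K2 * eta + Kn).
 by rewrite ler_wpM2l// divr_ge0// ltW.
 have -> : B / 4 * (4 / c * dl s + K2 * eta + Kn) = B / c * dl s + B / 4 * (K2 * eta + Kn).
 by move: (K2 * eta) (Kn) (dl s) => x y z; field; rewrite gt_eqF.
 by rewrite lerBlDl.
 rewrite ler_piMl// -expR0 ler_expR oppr_le0 mulr_ge0 ?divr_ge0//; exact: ltW.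
by move=> h1; rewrite -[leRHS]mulrA -ler_pdivrMl ?expR_gt0// -expRN.
Qed.
End Fixed.

(** The window width is fixed first, small compared with [eps ^+ 2]; the other errors are of order
    [1 / N]. When [N] is too small for them to be absorbed, the claimed bound exceeds 1 and there is
    nothing to prove. *)
Theorem overlap_concentration (eps : R) : 0 < eps -> exists2 C, 0 <= C &
 forall N, (0 < N)%N -> PN N 1 (tl q eps) <= C / N%:R.
move=> eps0; have [c [C [c0 C0 hc]]] := coupled h0 B0 q0 q1 Eth2 aT.
pose K2 := 2 + 2 * (C + 1) / c; pose A := 2 * (expR (B / c) * (B / 4)).
have A0 : 0 <= A by rewrite !mulr_ge0 ?expR_ge0// ?divr_ge0//; exact: ltW.
have K20 : 0 <= K2 by rewrite addr_ge0// divr_ge0 ?mulr_ge0 ?addr_ge0//; exact: ltW.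
pose W := A * K2 + C + 1; have W0 : 0 < W by rewrite ltr_pwDr// addr_ge0// mulr_ge0.
have ce0 : 0 < c * eps ^+ 2 / 8 by rewrite divr_gt0// mulr_gt0// exprn_gt0.
(* More windows than [Y] give [W * eta <= c * eps ^+ 2 / 8] and [eta <= eps / 2]. *)
pose Y := 2 * (W / (c * eps ^+ 2 / 8)) + 4 / eps + 2.
have y1 : 0 <= W / (c * eps ^+ 2 / 8) by rewrite divr_ge0//; exact: ltW.
have y2 : 0 <= 4 / eps by rewrite divr_ge0//; exact: ltW.
have Y0 : 0 <= Y by rewrite addr_ge0// addr_ge0// mulr_ge0.
have := archi_boundP Y0; set n := Num.bound Y => hn.
have np : 0 < n%:R :> R by rewrite (le_lt_trans Y0).
have n2 : (1 < n)%N by rewrite -(ltr_nat R); move: hn y1 y2; rewrite /Y; lra.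
pose eta : R := 2 / n%:R; have e0 : 0 < eta by rewrite divr_gt0.
have eW : W * eta <= c * eps ^+ 2 / 8.
 rewrite /eta mulrA ler_pdivrMr// mulrC -ler_pdivrMl// mulrC -mulrA mulrCA.
 by move: hn y1 y2; rewrite /Y; lra.
have ee : eta <= eps / 2.
 have h4 : 4 / eps <= n%:R by move: hn y1 y2; rewrite /Y; set u := W / _; lra.
 by rewrite ler_pdivrMr// in h4; rewrite /eta ler_pdivrMr//; move: h4; lra.
have k0 := Kc0 e0.
pose K4 := n%:R * Kc eta; have K40 : 0 <= K4 by rewrite mulr_ge0// ltW.
have Q0 : 0 <= A * (4 * K4) / (c * eps ^+ 2 / 8) by rewrite divr_ge0 ?mulr_ge0//; exact: ltW.
exists (K4 + A * (4 * K4) / (c * eps ^+ 2 / 8)); first exact: addr_ge0.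
move=> N N0; have Np : 0 < N%:R :> R by rewrite ltr0n.
have hd := dl1_le c0 C0 hc N0 n2; rewrite -/K2 -/eta -/K4 in hd.
have d2 : 2 * (dlt h B q N 1 / N%:R) <= A * (K2 * eta + 4 * (K4 / N%:R)).
 by rewrite /A -mulrA ler_pM2l//; exact: hd.
have [hN|hN] := leP (A * (4 * (K4 / N%:R))) (c * eps ^+ 2 / 8).
 apply: (@le_trans _ _ (K4 / N%:R)); last by rewrite ler_wpM2r ?invr_ge0// lerDl.
 have t1 : 0 <= (1 : R) <= 1 by rewrite lexx ler01.
 rewrite /K4 /eta.
 apply: (tail_at c0 hc N0 n2 t1).
 by apply: (le_trans ee); lra.
 have l1 : c * (eps / 2) ^+ 2 <= c * (eps - eta) ^+ 2.
 rewrite ler_pM2l// lerXn2r ?nnegrE ?divr_ge0//; try exact: ltW; move: ee; lra.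
 apply: le_trans l1.
 have -> : c * (eps / 2) ^+ 2 = c * eps ^+ 2 / 8 + c * eps ^+ 2 / 8 by field.
 rewrite -/eta; move: d2 eW hN; rewrite /W mulrDr; move: (dlt _ _ _ _ _ / _) (A * (4 * _)) (c * eps ^+ 2 / 8) => x y z.
 have -> : (A * K2 + C + 1) * eta = A * (K2 * eta) + (C + 1) * eta by ring.
 lra.
apply: (@le_trans _ _ 1).
 have e1 : PN N 1 (fun _ _ => 1) = 1.
 have -> : @pav R h N (fun _ _ => 1) = fun=> 1 by apply/funext => x; exact: pav_cst.
 by rewrite P_cst.
 rewrite -[leRHS]e1.
 apply: P_le; [exact: smooth_pav|exact: smooth_pav|] => x; apply: pav_le => s t.
 by rewrite /tl -[leRHS]/(1%:R) ler_nat leq_b1.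
apply: (@le_trans _ _ (A * (4 * K4) / (c * eps ^+ 2 / 8) / N%:R)); last by rewrite ler_wpM2r ?invr_ge0// lerDr.
rewrite ler_pdivlMr// mul1r ler_pdivlMr//.
have -> : A * (4 * K4) = N%:R * (A * (4 * (K4 / N%:R))) by field; rewrite gt_eqF.
by apply: ler_wpM2l; exact: ltW.
Qed.
End ConcentrationTheorem.

Section Calculus01.
Context {R : realType}.
Implicit Types (f g : R -> R).

Lemma mon01 f f' (s t : R) : continuous f -> (forall x : R, 0 < x < 1 -> is_derive x 1 f (f' x)) ->
 (forall x : R, 0 < x < 1 -> 0 <= f' x) -> 0 <= s -> s <= t -> t <= 1 -> f s <= f t.
move=> cf df f0 s0; rewrite le_eqVlt => /orP[/eqP->//|st] t1.
have i01 (x : R) : x \in `]s, t[ -> 0 < x < 1.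
 by rewrite in_itv/= => /andP[sx xt]; rewrite (le_lt_trans s0 sx) (lt_le_trans xt t1).
have [x xst e] := MVT st (fun x xs => df x (i01 x xs)) (continuous_subspaceT cf).
by rewrite -subr_ge0 e mulr_ge0 ?subr_ge0 ?(ltW st)//; apply: f0; exact: i01.
Qed.

Lemma lip01 f f' K (s t : R) : continuous f -> (forall x : R, 0 < x < 1 -> is_derive x 1 f (f' x)) ->
 (forall x : R, 0 < x < 1 -> `|f' x| <= K) -> 0 <= s -> s <= t -> t <= 1 -> `|f t - f s| <= K * (t - s).
move=> cf df hK s0 st t1.
have cK : continuous (fun x : R => K * x) by move=> x; cvg_scale.
have dK (x : R) : is_derive x 1 (fun x => K * x) K by apply: (d_ext _ _ (dZ K (is_derive_id x (1 : R)))) => //; rewrite mulr1.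
have h1 : K * s + f s <= K * t + f t.
 apply: (@mon01 (fun x => K * x + f x) (fun x => K + f' x) s t _ _ _ s0 st t1).
 - by move=> x; apply: cvgD; [exact: cK|exact: cf].
 - by move=> x x01; exact: dD (dK x) (df x x01).
 - by move=> x /hK; rewrite ler_norml => /andP[k1 _]; rewrite -lerBlDl sub0r.
have h2 : K * s + -1 * f s <= K * t + -1 * f t.
 apply: (@mon01 (fun x => K * x + -1 * f x) (fun x => K + -1 * f' x) s t _ _ _ s0 st t1).
 - by move=> x; apply: cvgD; [exact: cK|apply: cvgM; [exact: cvg_cst|exact: cf]].
 - by move=> x x01; exact: dD (dK x) (dZ (-1) (df x x01)).
 - by move=> x /hK; rewrite ler_norml => /andP[_ k1]; rewrite mulN1r subr_ge0.
have e : K * (t - s) = K * t - K * s by rewrite mulrBr.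
rewrite e ler_norml; clear -h1 h2; move: h1 h2; rewrite !mulN1r.
move: (K * t) (K * s) (f t) (f s) => a b c d h1 h2; apply/andP; split; lra.
Qed.

Lemma taylor01 f f' f'' K : continuous f -> continuous f' -> (forall x : R, 0 < x < 1 -> is_derive x 1 f (f' x)) ->
 (forall x : R, 0 < x < 1 -> is_derive x 1 f' (f'' x)) -> (forall x : R, 0 < x < 1 -> `|f'' x| <= K) ->
 `|f 1 - f 0 - f' 0| <= K.
move=> cf cf' df df' hK.
have K0 : 0 <= K by apply: le_trans (hK 2^-1 _) => //; lra.
have h1 (x : R) : 0 < x < 1 -> `|f' x - f' 0| <= K.
 move=> /andP[x0 x1]; apply: (le_trans (lip01 cf' df' hK (lexx 0) (ltW x0) (ltW x1))).
 by rewrite subr0 ler_piMr// ltW.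
have cg : continuous (fun x => f x + - f' 0 * x).
 by move=> x; apply: cvgD; [exact: cf|cvg_scale].
have dg (x : R) : 0 < x < 1 -> is_derive x 1 (fun x => f x + - f' 0 * x) (f' x - f' 0).
 move=> x01; apply: (d_ext _ _ (dD (df x x01) (dZ (- f' 0) (is_derive_id x (1 : R))))) => //.
 by rewrite mulr1.
have := lip01 cg dg h1 (lexx 0) ler01 (lexx 1); rewrite mulr0 mulr1 addr0 subr0 mulr1.
by rewrite addrAC.
Qed.
End Calculus01.

(** * Decoupling one site *)

Section CavityModel.
Context {R : realType}.
Variables (h B q : R) (N : nat).
Notation Ix := (Ix N).
Notation V := (Ix + Ix -> R).
Notation sp := (spin R).
Notation ov := (overlap R).
Notation fld := (@fld N).
Notation cs := (so N ++ si N).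
Notation Ne := (N%:R : R).
Notation vv := (@v1 R N).
Notation bb := (b1 h (N := N)).
Notation one1 := (@one1 R N).
(** Test functions involve four replicas and each differentiation adds two, so a second-order
    expansion reaches eight; comparing its remainder at two times differentiates once more, hence
    ten. *)
Definition reps := {ffun 'I_10 -> config N}.
Implicit Types (sg : reps) (l : 'I_10).
Definition Rv l l' sg : R := ov (sg l) (sg l').
Definition Ao : Ix -> R := At B q 1.
Definition pairs8 (l l' : 'I_10) : bool := [&& l != l', (l < 8)%N & (l' < 8)%N].
(** A single majorant for all overlap deviations among the first eight replicas; the term [Ne^-1]
    also covers the change of an overlap when one site is removed. *)
Definition rho sg : R := Ne^-1 + \sum_l \sum_(l' | pairs8 l l') `|Rv l l' sg - q|.

Lemma rho_ge sg l l' : pairs8 l l' -> `|Rv l l' sg - q| <= rho sg.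
move=> p; rewrite /rho (bigD1 l)//= (bigD1 l')//= addrCA -[leLHS]addr0 -addrA lerD2l.
have s0 (P : pred 'I_10) k : 0 <= \sum_(k' | P k') `|Rv k k' sg - q| by apply: sumr_ge0.
by rewrite !addr_ge0 ?invr_ge0//; apply: sumr_ge0 => k _; exact: sumr_ge0.
Qed.

Lemma rho_geN sg : Ne^-1 <= rho sg.
by rewrite lerDl; apply: sumr_ge0 => l _; apply: sumr_ge0. Qed.
Lemma rho_ge0 sg : 0 <= rho sg. Proof. by apply: le_trans (rho_geN sg); rewrite invr_ge0. Qed.
Hypotheses (N0 : (0 < N)%N) (B0 : 0 < B) (q0 : 0 < q) (q1 : q <= 1).
Definition rhoM : R := 1 + \sum_(l < 10) \sum_(l' < 10) 3.
Lemma Rv_gap l l' sg : `|Rv l l' sg - q| <= 3.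
apply: (le_trans (ler_normB _ _)); have := @ov_norm R N N0 (sg l) (sg l'); rewrite -/(Rv l l' sg).
rewrite (ger0_norm (ltW q0)); have q1' := q1; lra.
Qed.
Lemma rho_indep l : (8 <= l)%N -> indep rho l.
move=> hl sg a; rewrite /rho; congr (_ + _); apply: eq_bigr => k _; apply: eq_bigr => k' /and3P[_ k8 k8'].
have ne (j : 'I_10) : (j < 8)%N -> upd sg l a j = sg j.
 by move=> j8; rewrite /upd ffunE; case: eqP => // e; move: hl; rewrite -e leqNgt j8.
by rewrite /Rv !ne.
Qed.

Section Site.
Variable i : 'I_N.
Definition se l sg : R := sp (sg l) i.
(** The couplings that touch site [i] are switched off and replaced by one Gaussian field on [i], of
    the variance [B * q] that they would produce if all overlaps equalled [q]. *)
Definition Ac : Ix -> R := fun k => match k with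
 | inl p => if (p.1 == i) || (p.2 == i) then 0 else B / (2 * Ne)
 | inr jk => if (jk.1 == i) && (val jk.2 == 0)%N then B * q else 0 end.
Definition nuS (s : R) (f : reps -> R) : R := nu one1 bb vv cs (mix Ac Ao s) f.

Lemma Ac_ge0 k : 0 <= Ac k.
case: k => [p|p] /=; case: ifP => // _; first by rewrite divr_ge0 ?mulr_ge0//; exact: ltW.
by rewrite mulr_ge0//; exact: ltW.
Qed.
Lemma Ao_ge0 k : 0 <= Ao k. Proof. by apply: At_ge0 => //; rewrite ler01 lexx. Qed.
(** The coupling [(i, i)] lies both in the row and in the column of [i]; counting it once leaves the
    constant [B / (2 * Ne)], which later disappears because the replica weights sum to 0. *)
Lemma Cov_cav (s t : config N) : Cov vv (fun k => Ao k - Ac k) s t =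
 B * (sp s i * sp t i * (ov s t - q)) - B / (2 * Ne).
pose u a := sp s a * sp t a.
have ui : u i ^+ 2 = 1 by rewrite /u expr2 mulrACA !sp2 mulr1.
have n0 := NN0 N0 : Ne != 0.
have sel (F : 'I_N -> R) : \sum_a (a == i)%:R * F a = F i.
 by rewrite (bigD1 i)//= eqxx mul1r big1 ?addr0// => j /negbTE ->; rewrite mul0r.
have ou : \sum_a u a = Ne * ov s t by exact: ov_sum.
have e1 : \sum_(p : 'I_N * 'I_N) (Ao (inl p) - Ac (inl p)) * (sp s p.1 * sp s p.2) * (sp t p.1 * sp t p.2) =
 B / (2 * Ne) * ((u i * (Ne * ov s t) + (Ne * ov s t) * u i) - u i * u i).
 have s1 : u i * (Ne * ov s t) = \sum_(p : 'I_N * 'I_N) ((p.1 == i)%:R * u p.1) * u p.2.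
 by rewrite (sum_sk (fun a => (a == i)%:R * u a) u) sel ou.
 have s2 : Ne * ov s t * u i = \sum_(p : 'I_N * 'I_N) u p.1 * ((p.2 == i)%:R * u p.2).
 by rewrite (sum_sk u (fun a => (a == i)%:R * u a)) sel ou.
 have s3 : u i * u i = \sum_(p : 'I_N * 'I_N) ((p.1 == i)%:R * u p.1) * ((p.2 == i)%:R * u p.2).
 by rewrite (sum_sk (fun a => (a == i)%:R * u a) (fun a => (a == i)%:R * u a)) sel.
 rewrite s1 s2 s3 -big_split/= -sumrB mulr_sumr; apply: eq_bigr => p _.
 rewrite /Ao /At /A1 /= mul1r /u.
 by case: (p.1 == i); case: (p.2 == i) => /=; ring.
have e2 : \sum_(p : 'I_N * 'I_3) (Ao (inr p) - Ac (inr p)) * vv (inr p) s * vv (inr p) t = - (B * q) * u i.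
 rewrite (sum_fldp (fun p => (Ao (inr p) - Ac (inr p)) * vv (inr p) s * vv (inr p) t)) -(sel u) mulr_sumr.
 apply: eq_bigr => j _; rewrite /Ao /At /A1 /= /u !andbF !mulr0 !addr0 andbT subrr mul0r.
 by case: (j == i) => /=; ring.
rewrite /Cov big_sumType; apply: (etrans (congr2 +%R e1 e2)).
rewrite -/(u i); move: (u i) (ov s t) ui n0 => x y ui n0.
have -> : Ne * y * x = x * (Ne * y) by ring.
have -> : x * x = 1 by rewrite -expr2.
by move: n0; move: (Ne) => n n0; field.
Qed.

Definition Kn (n : nat) sg : R := B / 2 * \sum_l \sum_(l' | l != l') gam n l * gam n.+1 l' * (se l sg * se l' sg * (Rv l l' sg - q)).

Lemma gam_mul n (l : 'I_10) : gam n l * gam n.+1 l = gam n l :> R.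
rewrite /gam; have [h1|h1|h1] := ltngtP (l : nat) n.
- by rewrite ltnS (ltnW h1) [(l == n.+1 :> nat)]ltn_eqF ?mulr0 ?subr0 ?mulr1// ltnS ltnW.
- by rewrite mulr0 subr0 mul0r.
by rewrite h1 ltnSn ltn_eqF// mulr0 subr0 mulr1.
Qed.

(** Constants drop out since the weights [gam] sum to 0, and so does the diagonal, where every term
    is [1 - q] with weight [gam n l] by [gam_mul]. *)
Lemma kernE n sg : (n.+1 < 10)%N -> kern vv n (fun k => Ao k - Ac k) sg = Kn n sg.
move=> n10; rewrite /kern /Kn.
have g0 : \sum_(l < 10) gam n l = 0 :> R by apply: sum_gam; exact: ltnW.
have g1 : \sum_(l < 10) gam n.+1 l = 0 :> R by exact: sum_gam.
pose X (l l' : 'I_10) := se l sg * se l' sg * (Rv l l' sg - q).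
have -> : \sum_(l < 10) \sum_(l' < 10) gam n l * gam n.+1 l' * Cov vv (fun k => Ao k - Ac k) (sg l) (sg l') =
 B * (\sum_(l < 10) \sum_(l' < 10) gam n l * gam n.+1 l' * X l l') - B / (2 * Ne) * ((\sum_(l < 10) gam n l) * \sum_(l < 10) gam n.+1 l).
 rewrite big_distrlr/= !mulr_sumr -sumrB; apply: eq_bigr => l _; rewrite !mulr_sumr -sumrB; apply: eq_bigr => l' _.
 by rewrite Cov_cav -/(se l sg) -/(se l' sg) -/(Rv l l' sg) -/(X l l'); ring.
rewrite g0 mul0r mulr0 subr0 mulrA [2^-1 * B]mulrC; congr (_ * _).
have -> : \sum_(l < 10) \sum_(l' < 10) gam n l * gam n.+1 l' * X l l' =
 \sum_(l < 10) gam n l * (1 - q) + \sum_(l < 10) \sum_(l' < 10 | l != l') gam n l * gam n.+1 l' * X l l'.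
 rewrite -big_split/=; apply: eq_bigr => l _; rewrite (bigD1 l)//= gam_mul.
 congr (_ * _ + _); first by rewrite /X /se sp2 mul1r /Rv ov_self.
 by apply: eq_bigl => l'; rewrite eq_sym.
by rewrite -mulr_suml g0 mul0r add0r.
Qed.

Lemma se_norm l sg : `|se l sg| = 1. Proof. exact: sp_norm. Qed.
Lemma gam_norm n l : (n < 10)%N -> `|gam n l : R| <= 10.
move=> n10; rewrite /gam; have [h1|h1|h1] := ltngtP (l : nat) n.
- by rewrite mulr0 subr0 normr1 ler1n.
- by rewrite mulr0 subr0 normr0.
by rewrite sub0r mulr1 normrN ger0_norm// ler_nat ltnW.
Qed.

(** A crude count, each weight [gam] being at most 10; it is kept as a double sum to be compared
    with [Kn] term by term. *)
Definition KB : R := B / 2 * \sum_(l < 10) \sum_(l' < 10) 10 * 10.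
Lemma KB_ge0 : 0 <= KB.
by rewrite mulr_ge0 ?divr_ge0 ?(ltW B0)//; apply: sumr_ge0 => l _; apply: sumr_ge0 => l' _; rewrite mulr_ge0. Qed.
Lemma Kn_bound n sg (D : R) : (n.+1 < 10)%N -> (forall l l', l != l' -> gam n l * gam n.+1 l' != 0 :> R -> `|Rv l l' sg - q| <= D) ->
 0 <= D -> `|Kn n sg| <= KB * D.
move=> n10 hD D0; rewrite /Kn normrM ger0_norm ?divr_ge0 ?(ltW B0)//.
have -> : KB * D = B / 2 * \sum_(l < 10) \sum_(l' < 10) 10 * 10 * D.
 by rewrite /KB -mulrA mulr_suml; apply: (congr1 ( *%R (B / 2))); apply: eq_bigr => l _; rewrite mulr_suml.
rewrite ler_wpM2l ?divr_ge0 ?(ltW B0)//; apply: (le_trans (ler_norm_sum _ _ _)); apply: ler_sum => l _.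
apply: (le_trans (ler_norm_sum _ _ _)); rewrite big_mkcond/=; apply: ler_sum => l' _.
case: ifP => [ll|_]; last by rewrite !mulr_ge0.
have [->|g0] := eqVneq (gam n l * gam n.+1 l' : R) 0; first by rewrite mul0r normr0 !mulr_ge0.
rewrite normrM ler_pM//; last by rewrite normrM normrM !se_norm !mul1r; apply: hD.
by rewrite normrM ler_pM// gam_norm// ltnW.
Qed.

Lemma gam_neq0 n l : gam n l != 0 :> R -> (l <= n)%N.
rewrite /gam; have [h1|h1|h1] := ltngtP (l : nat) n => //; first by rewrite mulr0 subr0 eqxx.
Qed.
Lemma Kn_rho n sg : (n <= 6)%N -> `|Kn n sg| <= KB * rho sg.
move=> n6; apply: Kn_bound (rho_ge0 sg); first by rewrite !ltnS (leq_trans n6).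
move=> l l' ll; rewrite mulf_eq0 negb_or => /andP[/gam_neq0 l1 /gam_neq0 l2]; apply: rho_ge.
by rewrite /pairs8 ll !ltnS (leq_trans l1) ?(leq_trans l2)// ltnW.
Qed.

Lemma Kn_cst n sg : (n.+1 < 10)%N -> `|Kn n sg| <= KB * 3.
move=> n10; by apply: Kn_bound => // l l' _ _; exact: Rv_gap.
Qed.
Lemma upd_neq sg l a (k : 'I_10) : k != l -> upd sg l a k = sg k.
by move=> kl; rewrite /upd ffunE (negbTE kl). Qed.
Lemma Kn_indep n l : (n.+1 < l)%N -> indep (Kn n) l.
move=> nl sg a; rewrite /Kn; congr (_ * _); apply: eq_bigr => k _; apply: eq_bigr => k' _.
have [->|g0] := eqVneq (gam n k * gam n.+1 k' : R) 0; first by rewrite !mul0r.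
move: g0; rewrite mulf_eq0 negb_or => /andP[/gam_neq0 l1 /gam_neq0 l2].
have ne (j : 'I_10) : (j <= n.+1)%N -> upd sg l a j = sg j.
 by move=> jn; apply: upd_neq; apply: contraTneq nl => <-; rewrite -leqNgt.
by rewrite /se /Rv !ne// ltnW.
Qed.

Lemma cont_nuS f : continuous (fun s => nuS s f).
exact: (nu_cont (@one1_ge0 R N) (@one1_gt0 R N)). Qed.
Lemma der_nuS n f (s : R) : (n.+1 < 10)%N -> (forall l, (n <= l)%N -> indep f l) -> 0 < s < 1 ->
 is_derive s 1 (fun s => nuS s f) (nuS s (fun sg => f sg * Kn n sg)).
move=> n10 fi s01.
have := nu_der bb vv (@one1_ge0 R N) (@one1_gt0 R N) (uniq_cs N) (@all_cs N) n10 fi Ac_ge0 Ao_ge0 s01.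
by rewrite (eq_nu _ _ _ _ _ (_ : _ =1 fun sg => f sg * Kn n sg))// => sg; rewrite kernE.
Qed.

Lemma nuS_le s f g : (forall sg, f sg <= g sg) -> nuS s f <= nuS s g.
exact: (nu_le _ _ (@one1_ge0 R N) (@one1_gt0 R N)). Qed.
Lemma nuS_norm s f g : (forall sg, `|f sg| <= g sg) -> `|nuS s f| <= nuS s g.
by move=> fg; apply: (le_trans (nu_norm _ _ (@one1_ge0 R N) (@one1_gt0 R N) _ _ _)); exact: nuS_le.
Qed.
Lemma nuSZ s c f : nuS s (fun sg => c * f sg) = c * nuS s f.
exact: (nuZ _ _ (@one1_ge0 R N) (@one1_gt0 R N)). Qed.
Lemma nuSD s f g : nuS s (fun sg => f sg + g sg) = nuS s f + nuS s g.
exact: (nuD _ _ (@one1_ge0 R N) (@one1_gt0 R N)). Qed.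
Lemma nuS_cst s c : nuS s (fun=> c) = c.
exact: (nu_cst _ _ (@one1_ge0 R N) (@one1_gt0 R N)). Qed.

Definition E0 : R := expR (KB * 3).

(** The kernel is at most [3 * KB] in modulus, so [expR (3 * KB * s) * nuS s F] is nondecreasing for
    nonnegative [F]: averages at intermediate times are controlled by the original model. *)
Lemma nuS_back F (s : R) : 0 <= s <= 1 -> (forall sg, 0 <= F sg) -> (forall l : 'I_10, (8 <= l)%N -> indep F l) ->
 nuS s F <= E0 * nuS 1 F.
move=> /andP[s0 s1] F0 Fi; pose c := KB * 3.
have c0 : 0 <= c by rewrite mulr_ge0// KB_ge0.
have de (x : R) : is_derive x 1 (fun x => expR (c * x)) (c * expR (c * x)).
 have dl : is_derive x 1 (fun x => c * x) c by apply: (d_ext _ _ (dZ c (is_derive_id x (1 : R)))) => //; rewrite mulr1.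
 have := @is_derive1_comp _ expR (fun s => c * s) x _ _ (is_derive_expR _) dl.
 by apply: d_ext => //; rewrite mulrC.
have ce : continuous (fun x : R => expR (c * x)) by exact: (derive_cont de).
have h1 : expR (c * s) * nuS s F <= expR (c * 1) * nuS 1 F.
 apply: (@mon01 _ (fun x => expR (c * x) * nuS x F) (fun x => c * expR (c * x) * nuS x F + expR (c * x) * nuS x (fun sg => F sg * Kn 8 sg)) s 1 _ _ _ s0 s1 (lexx 1)).
 - by move=> x; apply: cvgM; [exact: ce|exact: cont_nuS].
 - by move=> x x01; apply: (dM (de x)); exact: (@der_nuS 8 F x isT Fi x01).
 move=> x x01; rewrite [c * expR _]mulrC -mulrA -mulrDr mulr_ge0 ?expR_ge0//.
 rewrite -nuSZ -nuSD -(nuS_cst x 0); apply: nuS_le => sg.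
 by have := @Kn_cst 8 sg isT; rewrite ler_norml -/c => /andP[k1 _]; rewrite mulrC -mulrDr mulr_ge0//; lra.
rewrite mulr1 in h1; apply: le_trans h1; rewrite ler_peMl//.
 by rewrite -(nuS_cst s 0); exact: nuS_le.
by rewrite -expR0 ler_expR mulr_ge0.
Qed.

Lemma cav_first n f (F : reps -> R) : (n <= 6)%N -> (forall l, (n <= l)%N -> indep f l) -> (forall l : 'I_10, (8 <= l)%N -> indep F l) ->
 (forall sg, `|f sg| <= F sg) ->
 `|nuS 1 f - nuS 0 f| <= E0 * KB * nuS 1 (fun sg => F sg * rho sg).
move=> n6 fi Fi fF; have n10 : (n.+1 < 10)%N by rewrite !ltnS (leq_trans n6).
have := @lip01 _ (fun s => nuS s f) _ (E0 * KB * nuS 1 (fun sg => F sg * rho sg)) 0 1 (@cont_nuS f)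
 (fun x x01 => der_nuS n10 fi x01).
rewrite subr0 mulr1; apply=> // x /andP[x0 x1].
have F0 sg : 0 <= F sg := le_trans (normr_ge0 _) (fF sg).
apply: (@le_trans _ _ (nuS x (fun sg => KB * (F sg * rho sg)))).
 apply: nuS_norm => sg; rewrite normrM mulrCA; apply: ler_pM => //; exact: Kn_rho.
rewrite nuSZ -mulrA mulrCA ler_wpM2l ?KB_ge0//; apply: nuS_back; first by rewrite !ltW.
 by move=> sg; rewrite mulr_ge0// rho_ge0.
by move=> l l8 sg a; rewrite Fi// rho_indep.
Qed.

Lemma cav_second f (F : reps -> R) : (forall l : 'I_10, (4 <= l)%N -> indep f l) -> (forall l : 'I_10, (8 <= l)%N -> indep F l) ->
 (forall sg, `|f sg| <= F sg) ->
 `|nuS 1 f - nuS 0 f - nuS 0 (fun sg => f sg * Kn 4 sg)| <= E0 * KB ^+ 2 * nuS 1 (fun sg => F sg * rho sg ^+ 2).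
move=> fi Fi fF; have F0 sg : 0 <= F sg := le_trans (normr_ge0 _) (fF sg).
have fi6 : forall l : 'I_10, (6 <= l)%N -> indep (fun sg => f sg * Kn 4 sg) l.
 by move=> l l6 sg a; rewrite fi ?Kn_indep// (leq_trans _ l6).
apply: (@taylor01 _ (fun s => nuS s f) (fun s => nuS s (fun sg => f sg * Kn 4 sg)) (fun s => nuS s (fun sg => f sg * Kn 4 sg * Kn 6 sg))).
- exact: cont_nuS.
- exact: cont_nuS.
- by move=> x x01; exact: der_nuS.
- by move=> x x01; exact: der_nuS.
move=> x /andP[x0 x1].
apply: (@le_trans _ _ (nuS x (fun sg => KB ^+ 2 * (F sg * rho sg ^+ 2)))).
 apply: nuS_norm => sg; rewrite (normrM (f sg * _)) (normrM (f sg)).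
 have -> : KB ^+ 2 * (F sg * rho sg ^+ 2) = F sg * (KB * rho sg) * (KB * rho sg) by ring.
 apply: ler_pM; rewrite ?mulr_ge0 ?KB_ge0//; last exact: Kn_rho.
 by apply: ler_pM => //; exact: Kn_rho.
rewrite nuSZ -mulrA mulrCA ler_wpM2l ?sqr_ge0//; apply: nuS_back; first by rewrite !ltW.
 by move=> sg; rewrite mulr_ge0// sqr_ge0.
by move=> l l8 sg a; rewrite Fi// rho_indep.
Qed.
End Site.
End CavityModel.

(** * Exact averages over a decoupled site *)

Section SiteMean.
Context {R : realType}.
Variables (h B q : R) (N : nat) (i : 'I_N).
Hypotheses (N0 : (0 < N)%N) (B0 : 0 < B) (q0 : 0 < q) (q1 : q <= 1).
Notation Ix := (Ix N).
Notation V := (Ix + Ix -> R).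
Notation sp := (spin R).
Notation fld := (@fld N).
Notation cs := (so N ++ si N).
Notation vv := (@v1 R N).
Notation bb := (b1 h (N := N)).
Notation one1 := (@one1 R N).
Notation reps := (reps N).
Notation w1 := (wt one1 bb vv).
Notation gib f := (gibbs one1 bb vv (J := 'I_10) f).
Notation nu0 := (@nuS R h B q N i 0).
Notation ses := (@se R N i).
Let ge1 := @one1_ge0 R N.
Let gt1 := @one1_gt0 R N.
Definition flip (s : config N) : config N := [ffun j => if j == i then ~~ s j else s j].
(** The coordinates of variance 0 at the decoupled end of the path. *)
Definition Di (k : Ix) : bool := match k with
 | inl p => (p.1 == i) || (p.2 == i)
 | inr jk => ~~ ((jk.1 == i) && (val jk.2 == 0)%N) end.
Definition TX (x : V) : R := tanh (XX h 0 0 i x).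
Definition finv (G : reps -> R) := forall l sg, G (upd sg l (flip (sg l))) = G sg.

Lemma flipK : involutive flip.
by move=> s; apply/ffunP => j; rewrite !ffunE; case: eqP => // _; rewrite negbK. Qed.
Lemma sp_flip (s : config N) : sp (flip s) i = - sp s i.
by rewrite /spin ffunE eqxx; case: (s i); rewrite /= ?opprK. Qed.
Lemma sp_flipN (s : config N) j : j != i -> sp (flip s) j = sp s j.
by move=> ji; rewrite /spin ffunE (negbTE ji). Qed.
Lemma En_flip s (x : V) : dead Di x -> En bb vv (flip s) x = En bb vv s x - 2 * sp s i * XX h 0 0 i x.
move=> hx; apply/eqP; rewrite -subr_eq0; apply/eqP.
have e1 : bb (flip s) - bb s = - (2 * h * sp s i).
 rewrite /b1 -mulrBr -sumrB (bigD1 i)//= big1 ?addr0; last by move=> j ji; rewrite sp_flipN// subrr.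
 by rewrite sp_flip; ring.
have e2 : \sum_k vv k (flip s) * x (inl k) - \sum_k vv k s * x (inl k) = - (2 * sp s i * x (inl (fld i 0))).
 rewrite -sumrB (bigD1 (fld i 0))//= big1 ?addr0; first by rewrite sp_flip; ring.
 move=> [p|[j [[|k] hk]]] kne; rewrite -mulrBl.
 - have [hp|] := boolP (Di (inl p)); first by have [_ ->] := hx _ hp; rewrite mulr0.
 by rewrite /= negb_or => /andP[p1 p2]; rewrite !sp_flipN// subrr mul0r.
 - have [hp|] := boolP (Di (inr (j, Ordinal hk))); first by have [_ ->] := hx _ hp; rewrite mulr0.
 rewrite /= negbK andbT => /eqP ji; move: kne; rewrite ji; case/eqP; congr (inr (_, _)); exact: val_inj.
 by rewrite /= subrr mul0r.
rewrite /En XE !mul0r !addr0.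
have -> : bb (flip s) = bb s - 2 * h * sp s i by rewrite -e1 addrC subrK.
have -> : \sum_k vv k (flip s) * x (inl k) = \sum_k vv k s * x (inl k) - 2 * sp s i * x (inl (fld i 0)).
 by rewrite -e2 addrC subrK.
by move: (\sum_k _) (bb s) => a c; ring.
Qed.

Lemma tanh_exp (X s : R) : s = 1 \/ s = -1 -> s - tanh X = expR (- (2 * s * X)) * (s + tanh X).
have a0 := expR_gt0 X; have c0 := expR_gt0 (- X); have s0 : expR X + expR (- X) != 0 by rewrite gt_eqF ?addr_gt0.
have ac : expR X * expR (- X) = 1 by rewrite -expRD subrr expR0.
case=> ->; rewrite /tanh.
 have -> : - (2 * 1 * X) = - X + - X by ring.
 rewrite expRD; move: (expR X) (expR (- X)) ac s0 => a c ac s0.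
 have -> : c * c * (1 + (a - c) / (a + c)) = 2 * (a * c) * c / (a + c) by field.
 by rewrite ac; field.
have -> : - (2 * -1 * X) = X + X by ring.
rewrite expRD; move: (expR X) (expR (- X)) ac s0 => a c ac s0.
have -> : a * a * (-1 + (a - c) / (a + c)) = - (2 * (a * c) * a / (a + c)) by field.
by rewrite ac; field.
Qed.

(** Detailed balance for flipping spin [i]: at the decoupled end the energy depends on this spin
    through its local field only, and [tanh_exp] expresses the ratio of the two weights. *)
Lemma wt_flip s (x : V) : dead Di x -> w1 s x * (sp s i - TX x) = w1 (flip s) x * (sp s i + TX x).
move=> hx; rewrite /wt /TX (tanh_exp _ (s := sp s i)); last by rewrite /spin; case: (s i); [left|right].
rewrite En_flip// expRD /one1 !mul1r.
move: (Zf _ _ _ _) (expR (En _ _ _ _)) (expR (- _)) (_ + tanh _) => z a c d; ring.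
Qed.

Lemma site_zero (g : config N -> R) (x : V) : dead Di x -> (forall s, g (flip s) = g s) ->
 \sum_s w1 s x * ((sp s i - TX x) * g s) = 0.
move=> hx hg; set S := \sum_s _.
have : S = - S; last by move=> /eqP; rewrite -addr_eq0 -mulr2n -mulr_natl mulf_eq0 pnatr_eq0/= => /eqP.
rewrite {1}/S; under eq_bigr do rewrite mulrA wt_flip//.
rewrite (reindex_inj (inv_inj flipK))/= -sumrN; apply: eq_bigr => s _.
by rewrite flipK hg sp_flip; ring.
Qed.

Lemma gibbs_site l (F : reps -> R) (x : V) : dead Di x -> (forall sg, F (upd sg l (flip (sg l))) = F sg) ->
 gib (fun sg => ses l sg * F sg) x = TX x * gib F x.
move=> hx hF; have W1 := wt_sum bb vv ge1 gt1 x.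
apply/eqP; rewrite -subr_eq0 -mulNr; apply/eqP; rewrite /gibbs -(gavZ (fun s => w1 s x)) -gavD (gav_resample W1 l).
rewrite -[RHS](gav_cst (J := 'I_10) W1 0); apply: eq_gav => sg.
rewrite -[RHS](@site_zero (fun a => F (upd sg l a)) x hx); last first.
 by move=> s; have := hF (upd sg l s); rewrite updE upd_upd.
by apply: eq_bigr => a _; rewrite /se updE; ring.
Qed.

Lemma wav_site (x : V) : dead Di x -> wav one1 bb vv (fun s => sp s i) x = TX x.
move=> hx; have := @site_zero (fun=> 1) x hx (fun=> erefl).
under eq_bigr do rewrite mulr1 mulrBr.
rewrite sumrB -mulr_suml (wt_sum bb vv ge1 gt1) mul1r => /eqP; rewrite subr_eq0 => /eqP; exact.
Qed.

Lemma dead_push0 (x : V) t : dead Di x -> dead Di (push x (inl (fld i 0)) t).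
move=> hx k Dk; have [r1 l1] := hx k Dk.
rewrite pushNE//; split=> //; rewrite pushNE//.
by apply: contraTN Dk => /eqP[->]; rewrite /= !eqxx.
Qed.
(** The derivative in the local field is a sum over replicas of covariances between [G] and spin
    [i]; each vanishes because [gibbs_site] factorises the average. *)
Lemma gibbs_push (G : reps -> R) (x : V) t : dead Di x -> finv G -> gib G (push x (inl (fld i 0)) t) = gib G x.
move=> hx hG; set k : Ix := fld i 0.
have d (u : R) : is_derive u 1 (fun u => gib G (push x (inl k) u)) 0.
 have hy := dead_push0 u hx; have := pd_at x u (pd_gibbs0 bb vv ge1 gt1 (inl k) G).
 rewrite card_ord (_ : wav _ _ _ (dE vv (inl k)) _ = TX (push x (inl k) u)); last exact: wav_site.
 have -> : gib (fun sg => G sg * \sum_l dE vv (inl k) (sg l)) (push x (inl k) u) =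
 \sum_(l < 10) TX (push x (inl k) u) * gib G (push x (inl k) u).
 rewrite /gibbs; under eq_gav do rewrite mulr_sumr; rewrite gav_sum; apply: eq_bigr => l _.
 rewrite -(@gibbs_site l G _ hy)//; apply: eq_gav => sg; by rewrite mulrC.
 move=> hd; apply: (d_ext _ _ hd) => //; rewrite sumr_const card_ord -[X in X - _]mulr_natl.
 by rewrite [gib G _ * TX _]mulrC subrr.
have [u] := mvt_ex 0 t d; rewrite mul0r push0 => /eqP; rewrite subr_eq0 => /eqP; exact.
Qed.

Lemma smooth_TXn n : smooth (fun x => TX x ^+ n).
elim: n => [|n IH]; first by apply: smooth_ext (smooth_cst 1) => x; rewrite expr0.
have -> : (fun x => TX x ^+ n.+1) = fun x => tanh (XX h 0 0 i x) * TX x ^+ n by apply/funext => x; rewrite exprS.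
by apply: smoothM => //; apply: smooth_XX; exact: sm1_th.
Qed.

Lemma inv_TXn n k : k != fld i 0 -> inv (fun x => TX x ^+ n) k.
by move=> hk x t; rewrite /TX !XE !mul0r !addr0 pushNE// eq_sym; apply: contra hk => /eqP[->]. Qed.
Lemma dead_mix0 : dead Di (vec (mix (@Ac R B q N i) (@Ao R B q N) 0)).
by apply: dead_vec => k; rewrite /mix subr0 mul1r mul0r addr0; case: k => [p|p] /=; [move=> ->|move=> /negbTE ->]. Qed.
Lemma P_TXn n : P cs (fun x => TX x ^+ n) (vec (mix (@Ac R B q N i) (@Ao R B q N) 0)) =
 gm (fun z => tanh (h + sqr (B * q) * z) ^+ n).
rewrite (P_single (k := fld i 0) (uniq_cs N) (@all_cs N _) (fun j _ => @inv_TXn n j)).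
rewrite /T; eqgn => z; rewrite /TX XE !mul0r !addr0 pushE /= add0r.
by rewrite /mix subr0 mul1r mul0r addr0 /= !eqxx.
Qed.

Lemma nu0_site n (f G : reps -> R) : finv G ->
 (forall x, dead Di x -> gib f x = TX x ^+ n * gib G x) ->
 nu0 f = gm (fun z => tanh (h + sqr (B * q) * z) ^+ n) * nu0 G.
move=> hG hf; rewrite /nuS /nu (@P_eq_dead _ _ Di cs _ _ _ hf dead_mix0) -P_TXn.
apply: (P_indepM (smooth_TXn n) (smooth_gibbs bb vv ge1 gt1 G) (Q := dead Di)); last exact: dead_mix0.
 by move=> x k z _; exact: dead_push.
move=> k _; have [->|kn] := eqVneq k (fld i 0); [right|left].
 by move=> x z hx; exact: gibbs_push.
by move=> x z _; exact: inv_TXn.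
Qed.

Lemma finv_se l k sg : k != l -> ses l (upd sg k (flip (sg k))) = ses l sg.
by move=> kl; rewrite /se upd_neq// eq_sym. Qed.
Lemma nu0_two (G : reps -> R) (a c : 'I_10) : a != c -> finv G ->
 gm (fun z => tanh (h + sqr (B * q) * z) ^+ 2) = q ->
 nu0 (fun sg => ses a sg * ses c sg * G sg) = q * nu0 G.
move=> ac hG Eq; rewrite -{2}Eq; apply: nu0_site => // x hx.
have -> : gib (fun sg => ses a sg * ses c sg * G sg) x = gib (fun sg => ses a sg * (ses c sg * G sg)) x.
 by apply: eq_gav => sg; rewrite mulrA.
rewrite gibbs_site//; last by move=> sg; rewrite hG finv_se.
by rewrite gibbs_site// mulrA -expr2.
Qed.

Lemma nu0_four (G : reps -> R) (a c d e : 'I_10) : uniq [:: a; c; d; e] -> finv G ->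
 nu0 (fun sg => ses a sg * ses c sg * (ses d sg * ses e sg) * G sg) =
 gm (fun z => tanh (h + sqr (B * q) * z) ^+ 4) * nu0 G.
move=> /and4P[]; rewrite !inE !negb_or => /and3P[ac ad ae] /andP[cd ce] de _ hG; apply: nu0_site => // x hx.
have -> : gib (fun sg => ses a sg * ses c sg * (ses d sg * ses e sg) * G sg) x =
 gib (fun sg => ses a sg * (ses c sg * (ses d sg * (ses e sg * G sg)))) x.
 by apply: eq_gav => sg; rewrite !mulrA.
rewrite gibbs_site//; last by move=> sg; rewrite hG !finv_se.
rewrite gibbs_site//; last by move=> sg; rewrite hG !finv_se.
rewrite gibbs_site//; last by move=> sg; rewrite hG !finv_se.
rewrite gibbs_site//; move: (gib G x) (TX x) => g t; ring.
Qed.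
End SiteMean.

Lemma norm3 (R : realType) (a b c A B C : R) : `|a| <= A -> `|b| <= B -> `|c| <= C -> `|a + b + c| <= A + B + C.
by move=> ha hb hc; apply: (le_trans (ler_normD _ _)); apply: lerD => //; apply: (le_trans (ler_normD _ _)); exact: lerD.
Qed.

(** * Second-order cavity expansion *)

Section Expansion.
Context {R : realType}.
Variables (h B q r : R) (N : nat).
Hypotheses (N0 : (0 < N)%N) (B0 : 0 < B) (q0 : 0 < q) (q1 : q <= 1).
Hypothesis Eth2 : gm (fun z => tanh (h + sqr (B * q) * z) ^+ 2) = q.
Hypothesis Eth4 : gm (fun z => tanh (h + sqr (B * q) * z) ^+ 4) = r.
Notation Ix := (Ix N).
Notation sp := (spin R).
Notation cs := (so N ++ si N).
Notation reps := (reps N).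
Notation Rw := (@Rv R N).
Notation Ne := (N%:R : R).
Definition nuT (f : reps -> R) : R := nu (@one1 R N) (b1 h (N := N)) (@v1 R N) cs (@Ao R B q N) f.
Definition o k (hk : (k < 10)%N) : 'I_10 := Ordinal hk.
Notation l0 := (@o 0 isT).
Notation l1 := (@o 1 isT).
Let ge1 := @one1_ge0 R N.
Let gt1 := @one1_gt0 R N.

(** For proper pairs, the covariance of [se a * se b] and [se l * se l'] at a decoupled site,
    according to whether the pairs share two replicas, one or none. *)
Definition cc (a b l l' : 'I_10) : R :=
 if ((a == l) && (b == l')) || ((a == l') && (b == l)) then 1 - q ^+ 2
 else if [|| a == l, a == l', b == l | b == l'] then q - q ^+ 2 else r - q ^+ 2.

Variables (phi dphi : R -> R) (M0 M1 L1 L2 : R).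
Hypotheses (M00 : 0 <= M0) (M10 : 0 <= M1) (L10 : 0 <= L1) (L20 : 0 <= L2).
Hypothesis phiM : forall x, `|phi x| <= M0 + M1 * `|x - q|.
Hypothesis dphiM : forall x, `|dphi x| <= L1.
Hypothesis phiL : forall x y, `|phi y - phi x| <= L1 * `|y - x|.
Hypothesis dphiL : forall x y, `|dphi y - dphi x| <= L2 * `|y - x|.
Hypothesis phiT : forall x y, `|phi y - phi x - dphi x * (y - x)| <= L2 * (y - x) ^+ 2.

Definition VV (l l' : 'I_10) : R := nuT (fun sg => (Rw l l' sg - q) * phi (Rw l0 l1 sg)).
Definition Phi : R := nuT (fun sg => dphi (Rw l0 l1 sg)).
Notation rho := (rho q (N := N)).
Notation D1 := (E0 B * KB B).
Notation D2 := (E0 B * KB B ^+ 2).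
(** The affine bound on [phi] serves two purposes: bounded test functions, with [M1 = 0], and
    [x - q], with [M0 = 0], where only a third moment of [rho] may remain. *)
Definition Err : R := M0 * nuT (fun sg => rho sg ^+ 2) + M1 * nuT (fun sg => rho sg ^+ 3) + M0 / Ne +
 (L1 + M1) * nuT rho / Ne + L2 / Ne ^+ 2.

Let Np : 0 < Ne. Proof. by rewrite ltr0n. Qed.
Let iN : 0 <= Ne^-1. Proof. by rewrite invr_ge0. Qed.
Let KB0 : 0 <= KB B. Proof. exact: KB_ge0. Qed.
Let E00 : 0 <= E0 B. Proof. exact: expR_ge0. Qed.
Let D10 : 0 <= D1. Proof. exact: mulr_ge0. Qed.
Let D20 : 0 <= D2. Proof. by rewrite mulr_ge0// exprn_ge0. Qed.
Lemma nu1_le f g : (forall sg, f sg <= g sg) -> nuT f <= nuT g.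
exact: (nu_le _ _ ge1 gt1). Qed.
Lemma nu1_norm f g : (forall sg, `|f sg| <= g sg) -> `|nuT f| <= nuT g.
by move=> fg; apply: (le_trans (nu_norm _ _ ge1 gt1 _ _ _)); exact: nu1_le. Qed.
Lemma nu1Z c f : nuT (fun sg => c * f sg) = c * nuT f. Proof. exact: (nuZ _ _ ge1 gt1). Qed.
Lemma nu1D f g : nuT (fun sg => f sg + g sg) = nuT f + nuT g. Proof. exact: (nuD _ _ ge1 gt1). Qed.
Lemma nu1B f g : nuT (fun sg => f sg - g sg) = nuT f - nuT g. Proof. exact: (nuB _ _ ge1 gt1). Qed.
Lemma nu1_cst c : nuT (fun=> c) = c. Proof. exact: (nu_cst _ _ ge1 gt1). Qed.
Let n0 k : 0 <= nuT (fun sg => rho sg ^+ k).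
by rewrite -(nu1_cst 0); apply: nu1_le => sg; rewrite exprn_ge0// rho_ge0. Qed.
Let n01 : 0 <= nuT rho. Proof. by rewrite -(nu1_cst 0); apply: nu1_le => sg; exact: rho_ge0. Qed.
Lemma upd_lt n sg (k : 'I_10) a (l : 'I_10) : (n <= k)%N -> (l < n)%N -> upd sg k a l = sg l :> config N.
by move=> nk ln; apply: upd_neq; apply: contraTneq nk => <-; rewrite -ltnNge. Qed.

Section Site.
Variable i : 'I_N.
Notation es := (@se R N i).
Notation nus := (@nuS R h B q N i).
Notation fin := (@finv R N i).
(** Overlap without site [i]: for distinct replicas it is insensitive to flipping that spin, as the
    factorisation at the decoupled end demands. *)
Definition Rm l l' sg : R := Rw l l' sg - es l sg * es l' sg / Ne.

Lemma nuS1 f : nus 1 f = nuT f.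
rewrite /nuS /nuT; apply: (congr1 (fun A => nu _ _ _ _ A f)); apply/funext => k.
by rewrite /mix subrr mul0r add0r mul1r.
Qed.
Lemma finv_Rm l l' k sg : l != l' -> Rm l l' (upd sg k (flip i (sg k))) = Rm l l' sg.
move=> ll; have e sg' : Rm l l' sg' = Ne^-1 * \sum_(j | j != i) sp (sg' l) j * sp (sg' l') j.
 by rewrite /Rm /Rv /overlap (bigD1 i)//= mulrDr [_ / Ne]mulrC addrC addKr.
rewrite !e; congr (_ * _); apply: eq_bigr => j ji.
by congr (_ * _); rewrite /upd ffunE; case: eqP => // ->; rewrite sp_flipN.
Qed.

Lemma se2 l sg : es l sg * es l sg = 1. Proof. exact: sp2. Qed.
Lemma seN l sg : `|es l sg| = 1. Proof. exact: sp_norm. Qed.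
Lemma RvRm l l' sg : Rw l l' sg - Rm l l' sg = es l sg * es l' sg / Ne.
by rewrite /Rm opprB addrC subrK. Qed.
Lemma RvRm_norm l l' sg : `|Rw l l' sg - Rm l l' sg| = Ne^-1.
by rewrite RvRm !normrM !seN !mul1r ger0_norm. Qed.
Lemma Rm_rho l l' sg : pairs8 l l' -> `|Rm l l' sg - q| <= 2 * rho sg.
move=> p; have -> : Rm l l' sg - q = (Rw l l' sg - q) - (Rw l l' sg - Rm l l' sg) by rewrite /Rm; ring.
apply: (le_trans (ler_normB _ _)); rewrite RvRm_norm mulr_natl mulr2n; apply: lerD; [exact: rho_ge|exact: rho_geN].
Qed.

Lemma nu0_cc (a b l l' : 'I_10) (G : reps -> R) : a != b -> l != l' -> fin G ->
 nus 0 (fun sg => (es a sg * es b sg - q) * (es l sg * es l' sg) * G sg) = cc a b l l' * nus 0 G.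
move=> ab ll fG.
pose X := nus 0 (fun sg => es a sg * es b sg * (es l sg * es l' sg) * G sg).
have -> : nus 0 (fun sg => (es a sg * es b sg - q) * (es l sg * es l' sg) * G sg) = X - q ^+ 2 * nus 0 G.
 rewrite expr2 -mulrA -(nu0_two ll fG Eth2) -mulNr -nuSZ -nuSD; apply: eq_nu => sg.
 by move: (es a sg) (es b sg) (es l sg) (es l' sg) (G sg) => x y z t g; ring.
have two c d (F : reps -> R) : c != d -> F =1 (fun sg => es c sg * es d sg * G sg) -> nus 0 F = q * nus 0 G.
 by move=> cd FE; rewrite -(nu0_two cd fG Eth2); apply: eq_nu.
suff -> : X = (cc a b l l' + q ^+ 2) * nus 0 G by rewrite mulrDl addrK.
have s2 := se2.
rewrite /cc /X; have [al|al] := eqVneq a l; rewrite /=.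
 have [bl|bl] := eqVneq b l'; rewrite /=.
 rewrite subrK mul1r; apply: eq_nu => sg; rewrite al bl mulrACA !se2 !mul1r//.
 rewrite al in ab *; rewrite (negbTE ll) /= subrK; apply: (two _ _ _ bl) => sg.
 by rewrite mulrACA !se2 mul1r.
have [al'|al'] := eqVneq a l'; rewrite /=.
 have [bl|bl] := eqVneq b l; rewrite /=.
 rewrite subrK mul1r; apply: eq_nu => sg; rewrite al' bl [es l sg * es l' sg]mulrC mulrACA !se2 !mul1r//.
 rewrite subrK; apply: (two _ _ _ bl) => sg.
 by rewrite al' [es l sg * es l' sg]mulrC mulrACA !se2 mul1r.
have [bl|bl] := eqVneq b l; rewrite /=.
 rewrite subrK; apply: (two _ _ _ al') => sg.
 have -> : es a sg * es b sg * (es l sg * es l' sg) = es a sg * (es l sg * es l sg) * es l' sg by rewrite bl; ring.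
 by rewrite se2 mulr1.
have [bl'|bl'] := eqVneq b l'; rewrite /=.
 rewrite subrK; apply: (two _ _ _ al) => sg.
 have -> : es a sg * es b sg * (es l sg * es l' sg) = es a sg * (es l' sg * es l' sg) * es l sg by rewrite bl'; ring.
 by rewrite se2 mulr1.
have u4 : uniq [:: a; b; l; l'] by rewrite /= !inE !negb_or ab al al' bl bl' ll.
rewrite subrK -Eth4; exact: (nu0_four h B q u4 fG).
Qed.

Lemma cc_norm a b l l' : 0 <= r <= 1 -> `|cc a b l l'| <= 2.
move=> /andP[r0 r1]; have qq : 0 <= q ^+ 2 <= 1 by rewrite exprn_ge0 ?(ltW q0)//= expr2 mulr_ile1 ?(ltW q0).
have q0' := q0; have q1' := q1; have [q2 q3] := andP qq.
by rewrite /cc ler_norml; case: ifP => _; [|case: ifP => _]; apply/andP; split; lra.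
Qed.

Lemma see_norm a b sg : `|es a sg * es b sg - q| <= 2.
by rewrite (le_trans (ler_normB _ _))// normrM !seN (ger0_norm (ltW q0)); have q1' := q1; lra. Qed.
Lemma phim sg : `|phi (Rm l0 l1 sg)| <= M0 + M1 * (2 * rho sg).
by apply: (le_trans (phiM _)); rewrite lerD2l ler_wpM2l// Rm_rho. Qed.

Definition CE : R := 4 + 4 * D1 + 4 * D2 + 2 * KB B * (4 * D1 + 2).

Hypothesis r01 : 0 <= r <= 1.
Variables (a b : 'I_10).
Hypotheses (ab : a != b) (a4 : (a < 4)%N) (b4 : (b < 4)%N).
Let f sg := (es a sg * es b sg - q) * phi (Rm l0 l1 sg).
Let g sg := (es a sg * es b sg - q) * (es l0 sg * es l1 sg) * dphi (Rm l0 l1 sg).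
Let t1 := M0 * nuT (fun sg => rho sg ^+ 2).
Let t2 := M1 * nuT (fun sg => rho sg ^+ 3).
Let t3 := M0 / Ne.
Let t4 := L1 * nuT rho / Ne.
Let t5 := M1 * nuT rho / Ne.
Let t6 := L2 / Ne ^+ 2.
Let tp : [/\ 0 <= t1, 0 <= t2, 0 <= t3, 0 <= t4 & 0 <= t5 /\ 0 <= t6].
by do 2?split; rewrite ?mulr_ge0 ?invr_ge0 ?exprn_ge0. Qed.
(** First-order Taylor expansion of the test function when site [i] is removed from its argument. *)
Let part1 : `|nuT (fun sg => (es a sg * es b sg - q) * phi (Rw l0 l1 sg)) - nuT f - Ne^-1 * nuT g| <= 2 * t6.
have -> : nuT (fun sg => (es a sg * es b sg - q) * phi (Rw l0 l1 sg)) - nuT f - Ne^-1 * nuT g =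
 nuT (fun sg => (es a sg * es b sg - q) * (phi (Rw l0 l1 sg) - phi (Rm l0 l1 sg) - dphi (Rm l0 l1 sg) * (Rw l0 l1 sg - Rm l0 l1 sg))).
 rewrite -nu1Z -!nu1B; apply: eq_nu => sg; rewrite RvRm /f /g.
 by move: (phi _) (phi _) (dphi _) (Ne^-1) (es a sg) (es b sg) (es _ sg) (es _ sg) => *; ring.
rewrite -(nu1_cst (2 * t6)); apply: nu1_norm => sg; rewrite normrM; apply: ler_pM => //; first exact: see_norm.
apply: (le_trans (phiT _ _)); rewrite -[X in _ * X]real_normK ?num_real// RvRm_norm exprVn.
exact: lexx.
Qed.
(** The first-order term already carries [Ne^-1], so it may be moved to the decoupled end, evaluated
    by [nu0_cc], and moved back at first order. *)
Let part2 : `|Ne^-1 * nuT g - Ne^-1 * cc a b l0 l1 * Phi| <= 4 * D1 * t4 + 2 * t6.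
have gi (k : 'I_10) : (4 <= k)%N -> indep g k.
 by move=> k4 sg c; rewrite /g /Rm /Rv /se !(upd_lt _ _ k4).
have di (k : 'I_10) : (4 <= k)%N -> indep (fun sg => dphi (Rm l0 l1 sg)) k.
 by move=> k4 sg c; rewrite /Rm /Rv /se !(upd_lt _ _ k4).
have ci c (k : 'I_10) : (8 <= k)%N -> indep (fun _ : reps => c : R) k by [].
have gn sg : `|g sg| <= 2 * L1.
 by rewrite /g -mulrA normrM ler_pM ?see_norm// normrM normrM !seN !mul1r.
pose dp sg := dphi (Rm l0 l1 sg).
have h1 : `|nuT g - nus 0 g| <= D1 * (2 * L1 * nuT rho).
 by have := cav_first h N0 B0 q0 q1 i (isT : (4 <= 6)%N) gi (ci (2 * L1)) gn; rewrite !nuS1 nu1Z.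
have h2 : `|nuT dp - nus 0 dp| <= D1 * (L1 * nuT rho).
 by have := cav_first h N0 B0 q0 q1 i (isT : (4 <= 6)%N) di (ci L1) (fun sg => dphiM _); rewrite !nuS1 nu1Z.
have g0 : nus 0 g = cc a b l0 l1 * nus 0 dp.
 by apply: nu0_cc => // l sg; rewrite finv_Rm.
rewrite g0 in h1.
have h3 : `|nuT dp - Phi| <= L2 * Ne^-1.
 rewrite /Phi -nu1B -(nu1_cst (L2 * Ne^-1)); apply: nu1_norm => sg; apply: (le_trans (dphiL _ _)).
 by rewrite distrC RvRm_norm.
have cn := cc_norm a b l0 l1 r01.
set x := nuT g in h1 *; set y := nus 0 dp in h1 h2; set z := nuT dp in h2 h3; set c := cc _ _ _ _ in h1 cn *.
have -> : Ne^-1 * x - Ne^-1 * c * Phi = Ne^-1 * (x - c * y + c * (y - z) + c * (z - Phi)) by ring.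
rewrite normrM ger0_norm//.
have -> : 4 * D1 * t4 + 2 * t6 = Ne^-1 * (D1 * (2 * L1 * nuT rho) + 2 * (D1 * (L1 * nuT rho)) + 2 * (L2 * Ne^-1)).
 by rewrite /t4 /t6 -exprVn; move: (E0 B) (KB B) (nuT rho) => *; ring.
rewrite ler_wpM2l//; apply: norm3 => //.
 have h2' : `|y - z| <= D1 * (L1 * nuT rho) by rewrite distrC; exact: h2.
 by rewrite normrM; apply: ler_pM.
by rewrite normrM; apply: ler_pM.
Qed.
(** [f] has mean 0 at the decoupled end, so the second-order expansion leaves the first derivative
    of the path alone. *)
Let part3 : `|nuT f - nus 0 (fun sg => f sg * Kn B q i 4 sg)| <= 4 * D2 * (t1 + t2).
have fi (k : 'I_10) : (4 <= k)%N -> indep f k.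
 by move=> k4 sg c; rewrite /f /Rm /Rv /se !(upd_lt _ _ k4).
pose F sg := 2 * (M0 + M1 * (2 * rho sg)).
have Fi (k : 'I_10) : (8 <= k)%N -> indep F k by move=> k8 sg c; rewrite /F rho_indep.
have fF sg : `|f sg| <= F sg by rewrite /f normrM ler_pM ?see_norm ?phim.
have := cav_second h N0 B0 q0 q1 i fi Fi fF; rewrite !nuS1.
have -> : nus 0 f = 0.
 have fG : fin (fun sg => phi (Rm l0 l1 sg)) by move=> l sg; rewrite finv_Rm.
 have -> : nus 0 f = nus 0 (fun sg => es a sg * es b sg * phi (Rm l0 l1 sg)) + - q * nus 0 (fun sg => phi (Rm l0 l1 sg)).
 by rewrite -nuSZ -nuSD; apply: eq_nu => sg; rewrite /f mulrBl mulNr.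
 by rewrite (nu0_two ab fG Eth2) mulNr subrr.
rewrite subr0 => h1; apply: (le_trans h1).
have -> : nuT (fun sg => F sg * rho sg ^+ 2) = 2 * t1 + 4 * t2.
 rewrite /t1 /t2 !mulrA -!nu1Z -nu1D; apply: eq_nu => sg; rewrite /F; move: (rho sg) => x; ring.
have [p1 p2 _ _ _] := tp; move: D20 p1 p2; move: (D2) (t1) (t2) => d x y d0 x0 y0.
have -> : 4 * d * (x + y) = d * (4 * x + 4 * y) by ring.
by rewrite ler_wpM2l//; lra.
Qed.
(** That derivative is evaluated at the decoupled end by [nu0_cc], and the resulting averages are
    brought back to the original model, site [i] included. *)
Let part4 : `|nus 0 (fun sg => f sg * Kn B q i 4 sg) -
 B / 2 * \sum_l \sum_(l' | l != l') gam 4 l * gam 5 l' * (cc a b l l' * VV l l')| <= 2 * KB B * (4 * D1 + 2) * (t1 + t2 + t3 + t4 + t5).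
pose G l l' sg := (Rm l l' sg - q) * phi (Rm l0 l1 sg).
have fG l l' : l != l' -> fin (G l l') by move=> ll k sg; rewrite /G !finv_Rm.
have fP : fin (fun sg => phi (Rm l0 l1 sg)) by move=> l sg; rewrite finv_Rm.
have e1 : nus 0 (fun sg => f sg * Kn B q i 4 sg) =
 B / 2 * \sum_l \sum_(l' | l != l') gam 4 l * gam 5 l' * (cc a b l l' * nus 0 (G l l')).
 rewrite mulr_sumr.
 (* Replacing [Rw] by [Rm] in the kernel adds [Ne^-1 * f], as spins square to 1; this has mean 0 at
    the decoupled end. *)
 transitivity (nus 0 (fun sg => \sum_l \sum_(l' | l != l') B / 2 * (gam 4 l * gam 5 l') *
 ((es a sg * es b sg - q) * (es l sg * es l' sg) * G l l' sg + Ne^-1 * f sg))).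
 apply: eq_nu => sg; rewrite /Kn mulrCA mulr_sumr mulr_sumr; apply: eq_bigr => l _.
 rewrite mulr_sumr mulr_sumr; apply: eq_bigr => l' _.
 have -> : Rw l l' sg = Rm l l' sg + es l sg * es l' sg / Ne by rewrite /Rm subrK.
 have s1 := se2 l sg; have s2 := se2 l' sg; rewrite /G /f.
 move: (es l sg) (es l' sg) s1 s2 (phi _) (Ne^-1) => x y xx yy p n.
 have e9 : n * p = n * ((x * x) * (y * y)) * p by rewrite xx yy !mulr1.
 rewrite mulrDr [n * (_ * p)]mulrCA e9; ring.
 rewrite /nuS (nu_sum _ _ ge1 gt1); apply: eq_bigr => l _.
 rewrite (nu_sum _ _ ge1 gt1) mulr_sumr; apply: eq_bigr => l' ll.
 rewrite (nuZ _ _ ge1 gt1) (nuD _ _ ge1 gt1) (nuZ _ _ ge1 gt1) -!/(nus 0 _) nu0_cc//; last exact: fG.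
 have -> : nus 0 f = 0.
 have -> : nus 0 f = nus 0 (fun sg => es a sg * es b sg * phi (Rm l0 l1 sg)) + - q * nus 0 (fun sg => phi (Rm l0 l1 sg)).
 by rewrite -nuSZ -nuSD; apply: eq_nu => sg; rewrite /f mulrBl mulNr.
 by rewrite (nu0_two ab fP Eth2) mulNr subrr.
 by rewrite mulr0 addr0 -!mulrA.
have T0 : 0 <= t1 + t2 + t3 + t4 + t5 by have [p1 p2 p3 p4 [p5 _]] := tp; rewrite !addr_ge0.
have pg l l' : l != l' -> gam 4 l * gam 5 l' != 0 :> R -> `|nus 0 (G l l') - VV l l'| <= (4 * D1 + 2) * (t1 + t2 + t3 + t4 + t5).
 move=> ll; rewrite mulf_eq0 negb_or => /andP[/gam_neq0 k1 /gam_neq0 k2].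
 have l6 : (l < 6)%N by rewrite ltnS (leq_trans k1).
 have l6' : (l' < 6)%N by rewrite ltnS.
 have Gi (k : 'I_10) : (6 <= k)%N -> indep (G l l') k.
 by move=> k6 sg c; rewrite /G /Rm /Rv /se !(upd_lt _ _ k6).
 pose F sg := 2 * rho sg * (M0 + M1 * (2 * rho sg)).
 have Fi (k : 'I_10) : (8 <= k)%N -> indep F k by move=> k8 sg c; rewrite /F rho_indep.
 have p8 : pairs8 l l' by rewrite /pairs8 ll (leq_trans l6)// (leq_trans l6').
 have GF sg : `|G l l' sg| <= F sg by rewrite /G normrM ler_pM ?Rm_rho ?phim.
 have h1 := cav_first h N0 B0 q0 q1 i (leqnn 6) Gi Fi GF; rewrite !nuS1 in h1.
 have h2 : `|nuT (G l l') - VV l l'| <= t3 + 2 * t5 + t4.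
 have -> : t3 + 2 * t5 + t4 = nuT (fun sg => Ne^-1 * (M0 + M1 * (2 * rho sg)) + rho sg * (L1 * Ne^-1)).
 have -> : (fun sg => Ne^-1 * (M0 + M1 * (2 * rho sg)) + rho sg * (L1 * Ne^-1)) = fun sg => Ne^-1 * M0 + (2 * M1 * Ne^-1 + L1 * Ne^-1) * rho sg.
 by apply/funext => sg; move: (rho sg) (Ne^-1) => x y; ring.
 by rewrite nu1D nu1_cst nu1Z /t3 /t4 /t5; move: (nuT rho) (Ne^-1) => x y; ring.
 rewrite /VV -nu1B; apply: nu1_norm => sg.
 have -> : G l l' sg - (Rw l l' sg - q) * phi (Rw l0 l1 sg) =
 (Rm l l' sg - Rw l l' sg) * phi (Rm l0 l1 sg) + (Rw l l' sg - q) * (phi (Rm l0 l1 sg) - phi (Rw l0 l1 sg)).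
 by rewrite /G; move: (Rm l l' sg) (phi _) (phi _) => *; ring.
 apply: (le_trans (ler_normD _ _)); apply: lerD; rewrite normrM; apply: ler_pM => //.
 - by rewrite distrC RvRm_norm.
 - exact: phim.
 - exact: rho_ge.
 by rewrite (le_trans (phiL _ _))// distrC RvRm_norm.
 have h3 : nuT (fun sg => F sg * rho sg) = 2 * t1 + 4 * t2.
 by rewrite /t1 /t2 !mulrA -!nu1Z -nu1D; apply: eq_nu => sg; rewrite /F; move: (rho sg) => x; ring.
 rewrite h3 in h1.
 have -> : nus 0 (G l l') - VV l l' = - (nuT (G l l') - nus 0 (G l l')) + (nuT (G l l') - VV l l') by ring.
 apply: (le_trans (ler_normD _ _)); rewrite normrN; apply: (le_trans (lerD h1 h2)).
 have [p1 p2 p3 p4 [p5 _]] := tp; move: D10 p1 p2 p3 p4 p5; move: (D1) (t1) (t2) (t3) (t4) (t5) => d x1 x2 x3 x4 x5 d0 y1 y2 y3 y4 y5.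
 have -> : (4 * d + 2) * (x1 + x2 + x3 + x4 + x5) = d * (4 * x1 + 4 * x2 + 4 * x3 + 4 * x4 + 4 * x5) + 2 * (x1 + x2 + x3 + x4 + x5) by ring.
 by apply: lerD; [rewrite ler_wpM2l//; lra|lra].
rewrite e1 -mulrBr -sumrB normrM ger0_norm ?divr_ge0 ?(ltW B0)//.
set T := (4 * D1 + 2) * _ in pg; have T00 : 0 <= T by rewrite mulr_ge0// addr_ge0// mulr_ge0.
have -> : 2 * KB B * (4 * D1 + 2) * (t1 + t2 + t3 + t4 + t5) = B / 2 * \sum_(l < 10) \sum_(l' < 10) 10 * 10 * (2 * T).
 have -> : 2 * KB B * (4 * D1 + 2) * (t1 + t2 + t3 + t4 + t5) = KB B * (2 * T) by rewrite /T; move: (4 * D1 + 2) (t1 + _) => *; ring.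
 by rewrite /KB -mulrA mulr_suml; apply: (congr1 ( *%R (B / 2))); apply: eq_bigr => l _; rewrite mulr_suml.
rewrite ler_wpM2l ?divr_ge0 ?(ltW B0)//; apply: (le_trans (ler_norm_sum _ _ _)); apply: ler_sum => l _.
rewrite -sumrB; apply: (le_trans (ler_norm_sum _ _ _)); rewrite big_mkcond/=; apply: ler_sum => l' _.
have T1 : 0 <= 10 * 10 * (2 * T) by apply: mulr_ge0; rewrite mulr_ge0.
case: ifP => [ll|//]; rewrite -mulrBr -mulrBr.
have [->|gn] := eqVneq (gam 4 l * gam 5 l' : R) 0; first by rewrite mul0r normr0.
rewrite normrM; apply: ler_pM => //; first by rewrite normrM ler_pM// gam_norm.
by rewrite normrM; apply: ler_pM => //; [exact: cc_norm|exact: pg].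
Qed.

Lemma site_expand : `|nuT (fun sg => (es a sg * es b sg - q) * phi (Rw l0 l1 sg)) - Ne^-1 * cc a b l0 l1 * Phi -
 B / 2 * \sum_l \sum_(l' | l != l') gam 4 l * gam 5 l' * (cc a b l l' * VV l l')| <= CE * Err.
set X := nuT _; set S := B / 2 * _.
have -> : X - Ne^-1 * cc a b l0 l1 * Phi - S = (X - nuT f - Ne^-1 * nuT g) + (Ne^-1 * nuT g - Ne^-1 * cc a b l0 l1 * Phi) +
 ((nuT f - nus 0 (fun sg => f sg * Kn B q i 4 sg)) + (nus 0 (fun sg => f sg * Kn B q i 4 sg) - S)) by ring.
apply: (le_trans (norm3 part1 part2 (le_trans (ler_normD _ _) (lerD part3 part4)))).
have -> : Err = t1 + t2 + t3 + t4 + t5 + t6 by rewrite /Err /t1 /t2 /t3 /t4 /t5 /t6; ring.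
rewrite /CE; have [p1 p2 p3 p4 [p5 p6]] := tp.
have k1 : 0 <= 2 * KB B * (4 * D1 + 2) by apply: mulr_ge0; [rewrite mulr_ge0|rewrite addr_ge0// mulr_ge0].
move: k1 D10 D20; move: (D1) (D2) (2 * KB B * (4 * D1 + 2)) => d e k k0 d0 e0.
move: p1 p2 p3 p4 p5 p6; move: (t1) (t2) (t3) (t4) (t5) (t6) => x1 x2 x3 x4 x5 x6 p1 p2 p3 p4 p5 p6.
have m1 : 0 <= d * (x1 + x2 + x3 + x5 + x6) by rewrite mulr_ge0// !addr_ge0.
have m2 : 0 <= e * (x3 + x4 + x5 + x6) by rewrite mulr_ge0// !addr_ge0.
have m3 : 0 <= k * x6 by rewrite mulr_ge0.
rewrite -subr_ge0.
have -> : (4 + 4 * d + 4 * e + k) * (x1 + x2 + x3 + x4 + x5 + x6) - (2 * x6 + (4 * d * x4 + 2 * x6) + (4 * e * (x1 + x2) + k * (x1 + x2 + x3 + x4 + x5))) =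
 4 * (x1 + x2 + x3 + x4 + x5) + 4 * (d * (x1 + x2 + x3 + x5 + x6)) + 4 * (e * (x3 + x4 + x5 + x6)) + k * x6 by ring.
by rewrite !addr_ge0// !mulr_ge0// !addr_ge0.
Qed.
End Site.
End Expansion.

(* The linear system for the three kinds of overlap *)
From mathcomp Require Import fingroup perm.

(** Origin of the variance: the rows [(1, -2, 1)] and [(1, -4, 3)] are left eigenvectors of the
    matrix of the system, for [1 - 2 * q + r] and for [k], and [(-2, 6, -3)] completes the second
    one to a Jordan block with off-diagonal entry [- ze]. As [(1, 0, 0)] equals
    [3 * (1, -2, 1) + (-2, 6, -3)], solving for [v1] gives one term over [1 - al], one over
    [1 - B * k] and, from the block, one over its square. *)
Lemma lin3 (R : realType) (B q r v1 v2 v3 x d : R) :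
 let al := B * (1 - 2 * q + r) in let k := 1 - 4 * q + 3 * r in let ze := 2 * q + q ^+ 2 - 3 * r in
 0 <= B -> al < 1 -> B * k < 1 ->
 `|v1 - (1 - q ^+ 2) * x - B * ((1 - q ^+ 2) * v1 - 4 * (q - q ^+ 2) * v2 + 3 * (r - q ^+ 2) * v3)| <= d ->
 `|v2 - (q - q ^+ 2) * x - B * ((q - q ^+ 2) * v1 + ((1 - q ^+ 2) - 2 * (q - q ^+ 2) - 3 * (r - q ^+ 2)) * v2 + (- 3 * (q - q ^+ 2) + 6 * (r - q ^+ 2)) * v3)| <= d ->
 `|v3 - (r - q ^+ 2) * x - B * ((r - q ^+ 2) * v1 + (4 * (q - q ^+ 2) - 8 * (r - q ^+ 2)) * v2 + ((1 - q ^+ 2) - 8 * (q - q ^+ 2) + 10 * (r - q ^+ 2)) * v3)| <= d ->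
 `|v1 - (3 * (1 - 2 * q + r) / (1 - al) - 2 * k / (1 - B * k) - ze / (1 - B * k) ^+ 2) * x| <=
 (12 / (1 - al) + 21 / (1 - B * k) + 8 * B * `|ze| / (1 - B * k) ^+ 2) * d.
move=> al k ze B0 a1 k1.
set e1 := v1 - _ - _; set e2 := v2 - _ - _; set e3 := v3 - _ - _ => h1 h2 h3.
have an : 1 - al != 0 by rewrite subr_eq0 gt_eqF.
have kn : 1 - B * k != 0 by rewrite subr_eq0 gt_eqF.
have u0 : 0 <= (1 - al)^-1 by rewrite invr_ge0 subr_ge0 ltW.
have w0 : 0 <= (1 - B * k)^-1 by rewrite invr_ge0 subr_ge0 ltW.
have n3 (a b c : R) : 0 <= a -> 0 <= b -> 0 <= c -> forall f1 f2 f3 : R, `|f1| <= a * d -> `|f2| <= b * d -> `|f3| <= c * d -> `|f1 + f2 + f3| <= (a + b + c) * d.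
 move=> a0 b0 c0 f1 f2 f3 g1 g2 g3; have -> : (a + b + c) * d = a * d + b * d + c * d by ring.
 exact: norm3.
have c3 (a b c : R) : `|a * e1 + b * e2 + c * e3| <= (`|a| + `|b| + `|c|) * d.
 by apply: n3 => //; rewrite normrM ler_wpM2l.
have -> : v1 - (3 * (1 - 2 * q + r) / (1 - al) - 2 * k / (1 - B * k) - ze / (1 - B * k) ^+ 2) * x =
 3 * (1 - al)^-1 * (1 * e1 + (-2) * e2 + 1 * e3) + (1 - B * k)^-1 * ((-2) * e1 + 6 * e2 + (-3) * e3)
 + - (B * ze * (1 - B * k)^-1 ^+ 2) * (1 * e1 + (-4) * e2 + 3 * e3).
 rewrite /e1 /e2 /e3; move: an kn; rewrite /al /k /ze => an kn; field.
 by rewrite kn an.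
have nn (m : nat) : `|- m%:R| = m%:R :> R by rewrite normrN ger0_norm.
have np (m : nat) : `|m%:R| = m%:R :> R by rewrite ger0_norm.
have d0 : 0 <= d := le_trans (normr_ge0 _) h1.
have s1 := c3 1 (-2) 1; have s2 := c3 (-2) 6 (-3); have s3 := c3 1 (-4) 3.
rewrite ?normr1 !nn ?np in s1 s2 s3.
apply: (@le_trans _ _ ((3 * (1 - al)^-1 * 4 + (1 - B * k)^-1 * 11 + B * `|ze| * (1 - B * k)^-1 ^+ 2 * 8) * d)).
 have cm (c F a m : R) : `|c| = a -> `|F| <= m * d -> `|c * F| <= a * m * d.
 by move=> <- hF; rewrite normrM -mulrA ler_wpM2l.
 apply: n3; rewrite ?mulr_ge0 ?exprn_ge0//; apply: cm.
 - by rewrite ger0_norm// mulr_ge0.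
 - by apply: (le_trans s1); rewrite ler_wpM2r//; lra.
 - by rewrite ger0_norm.
 - by apply: (le_trans s2); rewrite ler_wpM2r//; lra.
 - by rewrite normrN normrM normrM (ger0_norm B0) (ger0_norm (exprn_ge0 _ w0)).
 - by apply: (le_trans s3); rewrite ler_wpM2r//; lra.
rewrite ler_wpM2r// exprVn; move: u0 w0; move: ((1 - al)^-1) ((1 - B * k)^-1) (((1 - B * k) ^+ 2)^-1) => u v y u0 v0; lra.
Qed.

Section System.
Context {R : realType}.
Variables (h B q r : R) (N : nat).
Hypotheses (N0 : (0 < N)%N) (B0 : 0 < B) (q0 : 0 < q) (q1 : q <= 1).
Hypothesis Eth2 : gm (fun z => tanh (h + sqr (B * q) * z) ^+ 2) = q.
Hypothesis Eth4 : gm (fun z => tanh (h + sqr (B * q) * z) ^+ 4) = r.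
Hypothesis r01 : 0 <= r <= 1.
Notation reps := (reps N).
Notation Ne := (N%:R : R).
Notation rv := (@Rv R N).
Notation nuR := (@nuT R h B q N).
Notation l0 := (@o 0 isT).
Notation l1 := (@o 1 isT).
Notation l2 := (@o 2 isT).
Notation l3 := (@o 3 isT).
Let ge1 := @one1_ge0 R N.
Let gt1 := @one1_gt0 R N.
Variables (phi dphi : R -> R) (M0 M1 L1 L2 : R).
Hypotheses (M00 : 0 <= M0) (M10 : 0 <= M1) (L10 : 0 <= L1) (L20 : 0 <= L2).
Hypothesis phiM : forall x, `|phi x| <= M0 + M1 * `|x - q|.
Hypothesis dphiM : forall x, `|dphi x| <= L1.
Hypothesis phiL : forall x y, `|phi y - phi x| <= L1 * `|y - x|.
Hypothesis dphiL : forall x y, `|dphi y - dphi x| <= L2 * `|y - x|.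
Hypothesis phiT : forall x y, `|phi y - phi x - dphi x * (y - x)| <= L2 * (y - x) ^+ 2.
Notation V := (@VV R h B q N phi).
Notation Ph := (@Phi R h B q N dphi).
Notation del := (CE B * @Err R h B q N M0 M1 L1 L2).
Notation c4 := (cc q r).

Definition Sab a b : R := B / 2 * \sum_l \sum_(l' | l != l') gam 4 l * gam 5 l' * (c4 a b l l' * V l l').

(** An overlap minus [q] is the average over sites of a product of two spins minus [q], so the
    expansion at one site is averaged over all sites. *)
Lemma site_average (a b : 'I_10) : a != b -> (a < 4)%N -> (b < 4)%N ->
 `|V a b - Ne^-1 * c4 a b l0 l1 * Ph - Sab a b| <= del.
move=> ab a4 b4; have Np : 0 < Ne by rewrite ltr0n.
have nn : Ne != 0 by rewrite gt_eqF.
pose D := Ne^-1 * c4 a b l0 l1 * Ph + Sab a b.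
have -> : V a b - Ne^-1 * c4 a b l0 l1 * Ph - Sab a b = Ne^-1 * \sum_(i < N) (nuR (fun sg => (@se R N i a sg * @se R N i b sg - q) * phi (rv l0 l1 sg)) - D).
 rewrite sumrB sumr_const card_ord mulrBr -[D *+ N]mulr_natl mulrA mulVf// mul1r /D -addrA -opprD; congr (_ - _).
 rewrite /VV /nuT -(nu_sum _ _ ge1 gt1) -(nuZ _ _ ge1 gt1); apply: eq_nu => sg.
 rewrite -mulr_suml mulrA; congr (_ * _).
 by rewrite sumrB sumr_const card_ord mulrBr -[q *+ N]mulr_natl mulrA mulVf// mul1r.
rewrite normrM ger0_norm ?invr_ge0// ler_pdivrMl//.
apply: (le_trans (ler_norm_sum _ _ _)); rewrite mulr_natl -[X in _ *+ X]card_ord -sumr_const; apply: ler_sum => i _.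
rewrite /D opprD addrA.
exact: (site_expand N0 B0 q0 q1 Eth2 Eth4 M00 M10 L10 L20 phiM dphiM phiL dphiL phiT i r01 ab a4 b4).
Qed.

Lemma V_sym l l' : V l l' = V l' l.
by apply: eq_nu => sg; rewrite /Rv ovC. Qed.
(** Replicas are exchangeable, and the test function of the overlap of replicas 0 and 1 is also
    invariant under swapping these two. Hence only three values of [V] remain. *)
Lemma V_perm (s : {perm 'I_10}) l l' : (s l0 = l0 /\ s l1 = l1) \/ (s l0 = l1 /\ s l1 = l0) -> V (s l) (s l') = V l l'.
move=> hs; rewrite -[RHS](nu_perm _ _ _ _ _ _ (@perm_inj _ s)); apply: eq_nu => sg.
rewrite /Rv !ffunE; congr (_ * phi _).
by case: hs => -[-> ->] //; rewrite ovC.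
Qed.

Lemma V0l (l : 'I_10) : (2 <= l)%N -> V l0 l = V l0 l2.
move=> hl; rewrite -(@V_perm (tperm l2 l) l0 l2) ?tpermL.
 by rewrite tpermD// -val_eqE/= gtn_eqF// (leq_trans _ hl).
by left; rewrite !tpermD// -val_eqE/= gtn_eqF// (leq_trans _ hl).
Qed.
Lemma V1l (l : 'I_10) : (2 <= l)%N -> V l1 l = V l0 l2.
move=> hl; rewrite -(V0l hl) -(@V_perm (tperm l0 l1) l0 l) ?tpermL ?tpermR; last by right.
by rewrite tpermD// -val_eqE/= ltn_eqF// (leq_trans _ hl).
Qed.
Lemma Vll (l l' : 'I_10) : (2 <= l)%N -> (2 <= l')%N -> l != l' -> V l l' = V l2 l3.
move=> hl hl' ll; pose x := tperm l2 l l3; pose s := (tperm l2 l * tperm x l')%g.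
have ne (k j : 'I_10) : (k < 2)%N -> (2 <= j)%N -> j != k by move=> k2 j2; rewrite -val_eqE/= gtn_eqF// (leq_trans k2).
have f0 (k : 'I_10) : (k < 2)%N -> s k = k.
 have x2 : (2 <= x)%N by rewrite /x; case: tpermP => [_|_|_ _]; [exact: hl| |].
 move=> k2; have t1 : tperm l2 l k = k by rewrite tpermD// ne.
 by rewrite /s permM t1 tpermD ?ne.
have xl : x != l by rewrite -(tpermL l2 l) (inj_eq perm_inj).
have s2 : s l2 = l by rewrite /s permM tpermL tpermD// eq_sym.
have s3 : s l3 = l' by rewrite /s permM -/x tpermL.
by rewrite -s2 -s3 V_perm//; left; rewrite !f0.
Qed.

(** Copies of the coefficients over natural numbers, on which the finite double sum [Sab] reduces by
    computation. *)
Definition ccn (a b l l' : nat) : R :=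
 if ((a == l) && (b == l')) || ((a == l') && (b == l)) then 1 - q ^+ 2
 else if [|| a == l, a == l', b == l | b == l'] then q - q ^+ 2 else r - q ^+ 2.
Definition vcl (v1 v2 v3 : R) (l l' : nat) : R := if (l < 2)%N && (l' < 2)%N then v1 else if (l < 2)%N || (l' < 2)%N then v2 else v3.
Definition gmn (n l : nat) : R := (l < n)%N%:R - n%:R * (l == n)%:R.

Lemma V_class (l l' : 'I_10) : l != l' -> V l l' = vcl (V l0 l1) (V l0 l2) (V l2 l3) l l'.
rewrite /vcl; have [hl|hl] := ltnP l 2; have [hl'|hl'] := ltnP l' 2 => ll /=.
- have lE (k : 'I_10) : (k < 2)%N -> k = l0 \/ k = l1.
 by case: k => [[|[|k]] hk] //= _; [left|right]; exact: val_inj.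
 case: (lE _ hl) (lE _ hl') ll => -> [] ->; rewrite ?eqxx// => _; exact: V_sym.
- have [|] : l = l0 \/ l = l1 by case: (l) hl => [[|[|k]] hk] //= _; [left|right]; exact: val_inj.
 by move=> ->; exact: V0l.
 by move=> ->; exact: V1l.
- rewrite V_sym; have [|] : l' = l0 \/ l' = l1 by case: (l') hl' => [[|[|k]] hk] //= _; [left|right]; exact: val_inj.
 by move=> ->; exact: V0l.
 by move=> ->; exact: V1l.
exact: Vll.
Qed.

Lemma SabE (a b : 'I_10) : Sab a b = B / 2 * \sum_(0 <= l < 10) \sum_(0 <= l' < 10)
 (if l == l' then 0 else gmn 4 l * gmn 5 l' * (ccn a b l l' * vcl (V l0 l1) (V l0 l2) (V l2 l3) l l')).
rewrite /Sab big_mkord; congr (_ * _); apply: eq_bigr => l _; rewrite big_mkord big_mkcond; apply: eq_bigr => l' _.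
rewrite -val_eqE; have [//|ll] := eqVneq (val l) (val l').
by rewrite V_class.
Qed.

Lemma Sab_values v1 v2 v3 : v1 = V l0 l1 -> v2 = V l0 l2 -> v3 = V l2 l3 ->
 [/\ Sab l0 l1 = B * ((1 - q ^+ 2) * v1 - 4 * (q - q ^+ 2) * v2 + 3 * (r - q ^+ 2) * v3),
 Sab l0 l2 = B * ((q - q ^+ 2) * v1 + ((1 - q ^+ 2) - 2 * (q - q ^+ 2) - 3 * (r - q ^+ 2)) * v2 + (- 3 * (q - q ^+ 2) + 6 * (r - q ^+ 2)) * v3) &
 Sab l2 l3 = B * ((r - q ^+ 2) * v1 + (4 * (q - q ^+ 2) - 8 * (r - q ^+ 2)) * v2 + ((1 - q ^+ 2) - 8 * (q - q ^+ 2) + 10 * (r - q ^+ 2)) * v3)].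
move=> e1 e2 e3; rewrite !SabE -e1 -e2 -e3 /index_iota !unlock /reducebig /ccn /vcl /gmn /=.
clear e1 e2 e3.
move: (1 - q ^+ 2) (q - q ^+ 2) (r - q ^+ 2) => x y z.
rewrite !(mulr0, mul0r, subr0, add0r, addr0, mulr1, mul1r, sub0r, subrr).
by split; field.
Qed.

Definition s2lim : R := 3 * (1 - 2 * q + r) / (1 - B * (1 - 2 * q + r)) - 2 * (1 - 4 * q + 3 * r) / (1 - B * (1 - 4 * q + 3 * r))
 - (2 * q + q ^+ 2 - 3 * r) / (1 - B * (1 - 4 * q + 3 * r)) ^+ 2.
Definition KS : R := 12 / (1 - B * (1 - 2 * q + r)) + 21 / (1 - B * (1 - 4 * q + 3 * r)) +
 8 * B * `|2 * q + q ^+ 2 - 3 * r| / (1 - B * (1 - 4 * q + 3 * r)) ^+ 2.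

(** By [r <= q] the second eigenvalue [1 - 4 * q + 3 * r] is at most [1 - 2 * q + r], so that one
    condition keeps both denominators positive. *)
Lemma stein_approx : B * (1 - 2 * q + r) < 1 -> r <= q -> `|V l0 l1 - s2lim * (Ne^-1 * Ph)| <= KS * del.
move=> a1 rq; have [S1 S2 S3] := Sab_values erefl erefl erefl.
have k1 : B * (1 - 4 * q + 3 * r) < 1.
 by apply: le_lt_trans a1; apply: ler_wpM2l; [exact: ltW|move: rq; lra].
have A1 := site_average (isT : l0 != l1) isT isT; have A2 := site_average (isT : l0 != l2) isT isT.
have A3 := site_average (isT : l2 != l3) isT isT.
rewrite S1 {1}/cc /= in A1; rewrite S2 {1}/cc /= in A2; rewrite S3 {1}/cc /= in A3.
apply: (@lin3 R B q r (V l0 l1) (V l0 l2) (V l2 l3) (Ne^-1 * Ph) del (ltW B0) a1 k1).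
- by rewrite mulrA [_ * Ne^-1]mulrC.
- by rewrite mulrA [_ * Ne^-1]mulrC.
by rewrite mulrA [_ * Ne^-1]mulrC.
Qed.
End System.

(** * Moments of the overlap and the approximate Stein identity *)

Lemma sum_pow (R : realType) (J : finType) (x : J -> R) k : (0 < #|J|)%N -> (forall j, 0 <= x j) ->
 (\sum_j x j) ^+ k <= \sum_j (#|J|%:R * x j) ^+ k.
move=> J0 x0; have mp : 0 < #|J|%:R :> R by rewrite ltr0n.
have S0 : 0 <= \sum_j x j by apply: sumr_ge0.
(* Some term is at least the average of all terms. *)
have [j hj] : exists j, \sum_j x j <= #|J|%:R * x j.
 apply: contrapT => hn; have lt j : #|J|%:R * x j < \sum_j x j.
 by rewrite ltNge; apply/negP => h1; apply: hn; exists j.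
 have : \sum_j (#|J|%:R * x j) < \sum_(j : J) \sum_j x j.
 case/card_gt0P: J0 => j0 _; rewrite (bigD1 j0)//= [ltRHS](bigD1 j0)//=.
 by apply: ltr_leD => //; apply: ler_sum => j _; exact: ltW.
 by rewrite -mulr_sumr sumr_const -[ltRHS]mulr_natl ltxx.
apply: (@le_trans _ _ ((#|J|%:R * x j) ^+ k)); first by apply: lerXn2r => //; rewrite nnegrE// mulr_ge0.
by rewrite [leRHS](bigD1 j)//= lerDl; apply: sumr_ge0 => i _; rewrite exprn_ge0// mulr_ge0.
Qed.

Lemma add_pow (R : realType) (a b : R) k : 0 <= a -> 0 <= b -> (a + b) ^+ k <= (2 * a) ^+ k + (2 * b) ^+ k.
move=> a0 b0; have [ab|ba] := leP a b.
 apply: ler_wpDl; first by rewrite exprn_ge0// mulr_ge0.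
 by apply: lerXn2r; rewrite ?nnegrE ?addr_ge0 ?mulr_ge0// mulr_natl mulr2n lerD2r.
apply: ler_wpDr; first by rewrite exprn_ge0// mulr_ge0.
by apply: lerXn2r; rewrite ?nnegrE ?addr_ge0 ?mulr_ge0// mulr_natl mulr2n lerD2l ltW.
Qed.

Lemma num_third (R : realType) (x y y3 z w C : R) : z <= w + 27 * x -> x <= C * y -> y3 <= y -> y3 + z <= (1 + 27 * C) * y + w.
move=> a b c; lra. Qed.
Lemma num_half (R : realType) (x : R) : 0 <= x -> x * (2 * x + 1)^-1 <= 2^-1.
by move=> x0; rewrite ler_pdivrMr ?ltr_wpDl ?mulr_ge0//; lra. Qed.
Lemma num_four (R : realType) (x y : R) : x <= 1 -> y <= 3 -> x + y <= 4.
move=> a b; lra. Qed.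
Lemma num_absorb (R : realType) (x y z : R) : z <= y + x -> x <= 2^-1 * z -> z <= 2 * y.
move=> a b; lra. Qed.

Section Moments.
Context {R : realType}.
Variables (h B q r : R).
Hypotheses (h0 : 0 < h) (B0 : 0 < B) (q0 : 0 < q) (q1 : q <= 1).
Hypothesis Eth2 : gm (fun z => tanh (h + sqr (B * q) * z) ^+ 2) = q.
Hypothesis Eth4 : gm (fun z => tanh (h + sqr (B * q) * z) ^+ 4) = r.
Hypothesis aT : B * gm (fun z => (cosh (h + sqr (B * q) * z))^-1 ^+ 4) < 1.
Hypothesis a1 : B * (1 - 2 * q + r) < 1.
Hypotheses (r01 : 0 <= r <= 1) (rq : r <= q).
Notation l0 := (@o 0 isT).
Notation l1 := (@o 1 isT).
Notation ov := (overlap R).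

Section FixedN.
Variable N : nat.
Hypothesis N0 : (0 < N)%N.
Notation nuR := (@nuT R h B q N).
Notation rv := (@Rv R N).
Notation Ne := (N%:R : R).
Let ge1 := @one1_ge0 R N.
Let gt1 := @one1_gt0 R N.
Let Np : 0 < Ne. Proof. by rewrite ltr0n. Qed.
Definition mean2 (F : config N -> config N -> R) : R := P (so N ++ si N) (pav h F) (vec (At B q 1)).

Lemma nu1_two l l' (F : config N -> config N -> R) : l != l' -> nuR (fun sg => F (sg l) (sg l')) = mean2 F.
move=> ll; rewrite /nuT /nu /mean2; apply: (congr1 (fun g => P _ g _)); apply/funext => x.
rewrite /gibbs (gav_two (wt_sum _ _ ge1 gt1 x) F ll) /pav; apply: eq_bigr => s _; rewrite mulr_sumr.
by apply: eq_bigr => t _; rewrite mulrA.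
Qed.

Lemma mean2_le F G : (forall s t, F s t <= G s t) -> mean2 F <= mean2 G.
by move=> FG; apply: P_le; [exact: smooth_pav|exact: smooth_pav|move=> x; exact: pav_le]. Qed.
Lemma mean2_lin a b F G : mean2 (fun s t => a * F s t + b * G s t) = a * mean2 F + b * mean2 G.
have sF := smooth_pav h F; have sG := smooth_pav h G.
rewrite /mean2 (_ : pav h _ = fun x => a * pav h F x + b * pav h G x); last by apply/funext => x; rewrite pavD !pavZ.
by rewrite P_D; [rewrite !P_Z|exact: smoothZ|exact: smoothZ].
Qed.

Lemma mean2_cst c : mean2 (fun _ _ => c) = c.
by rewrite /mean2 (_ : pav h _ = fun=> c) ?P_cst//; apply/funext => x; exact: pav_cst. Qed.

Definition AA k : R := mean2 (fun s t => `|ov s t - q| ^+ k).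
Lemma AA_ge0 k : 0 <= AA k.
by rewrite -(mean2_cst 0); apply: mean2_le => s t; rewrite exprn_ge0. Qed.
Notation m := (#|{: 'I_10 * 'I_10}|%:R : R).
Definition ck (k : nat) : R := m * (m ^+ k * 2 ^+ k).
Lemma ck_ge0 k : 0 <= ck k. Proof. by rewrite !mulr_ge0// exprn_ge0. Qed.
Lemma rho_pow k : nuR (fun sg => rho q sg ^+ k.+1) <= ck k.+1 * (Ne^-1 ^+ k.+1 + AA k.+1).
have J0 : (0 < #|{: 'I_10 * 'I_10}|)%N by rewrite card_prod !card_ord.
pose x (p : 'I_10 * 'I_10) sg : R := if pairs8 p.1 p.2 then `|rv p.1 p.2 sg - q| else 0.
have x0 p sg : 0 <= x p sg by rewrite /x; case: ifP.
have iN : 0 <= Ne^-1 by rewrite invr_ge0.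
apply: (@le_trans _ _ (nuR (fun sg => \sum_(p : 'I_10 * 'I_10) (m ^+ k.+1 * 2 ^+ k.+1) * (Ne^-1 ^+ k.+1 + x p sg ^+ k.+1)))).
 apply: nu1_le => // sg; apply: (@le_trans _ _ ((\sum_(p : 'I_10 * 'I_10) (Ne^-1 + x p sg)) ^+ k.+1)).
 apply: lerXn2r; rewrite ?nnegrE ?rho_ge0//; first by apply: sumr_ge0 => p _; rewrite addr_ge0.
 rewrite big_split/= /rho; apply: lerD.
 case/card_gt0P: J0 => p _; rewrite (bigD1 p)//= lerDl; apply: sumr_ge0 => *; exact: iN.
 rewrite -(pair_big xpredT xpredT (fun l l' => x (l, l') sg))/=; apply: ler_sum => l _.
 by rewrite big_mkcond; apply: ler_sum => l' _.
 apply: (le_trans (sum_pow _ J0 _)); first by move=> p; rewrite addr_ge0.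
 apply: ler_sum => p _; rewrite exprMn -mulrA; apply: ler_wpM2l; first by rewrite exprn_ge0.
 by apply: (le_trans (add_pow _ iN (x0 p sg))); rewrite !exprMn mulrDr.
have mE (Y : R) : m * Y = \sum_(p : 'I_10 * 'I_10) Y by rewrite sumr_const mulr_natl.
rewrite /nuT (nu_sum _ _ ge1 gt1) /ck -mulrA mE; apply: ler_sum => p _.
rewrite (nuZ _ _ ge1 gt1); apply: ler_wpM2l; first by rewrite mulr_ge0// exprn_ge0.
rewrite (nuD _ _ ge1 gt1) (nu_cst _ _ ge1 gt1) lerD2l.
have [p8|p8] := boolP (pairs8 p.1 p.2).
 have /and3P[ll _ _] := p8; rewrite /AA -(nu1_two (fun s t => `|ov s t - q| ^+ k.+1) ll).
 by rewrite (eq_nu _ _ _ _ _ (_ : _ =1 fun sg => `|rv p.1 p.2 sg - q| ^+ k.+1))// => sg; rewrite /x p8.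
rewrite (eq_nu _ _ _ _ _ (_ : _ =1 fun=> 0)) ?(nu_cst _ _ ge1 gt1) ?AA_ge0// => sg.
by rewrite /x (negbTE p8) expr0n.
Qed.

Lemma nu1_rho_le : nuR (rho q (N := N)) <= ck 1 * (Ne^-1 + AA 1).
have e : nuR (fun sg => rho q sg ^+ 1) = nuR (rho q (N := N)) by apply: eq_nu => sg; rewrite expr1.
by have := rho_pow 0; rewrite e !expr1.
Qed.
Lemma ov_gap (s t : config N) : `|ov s t - q| <= 3.
apply: (le_trans (ler_normB _ _)); have := @ov_norm R N N0 s t.
rewrite (ger0_norm (ltW q0)); have q1' := q1; lra.
Qed.
(** Below [eps] one factor of the cube is at most [eps]; above it the cube is at most 27, as
    [|R - q| <= 3]. *)
Lemma AA3_le eps : 0 < eps -> AA 3 <= eps * AA 2 + 27 * mean2 (tl q eps).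
move=> e0; rewrite -mean2_lin; apply: mean2_le => s t; rewrite /tl.
have g := ov_gap s t; have x0 := normr_ge0 (ov s t - q); move: (`|_|) g x0 => x g x0.
case: (leP eps x) => hx.
 apply: ler_wpDl; first by rewrite mulr_ge0 ?exprn_ge0// ltW.
 rewrite mulr1 (_ : 27 = 3 ^+ 3); last by rewrite -natrX.
 by apply: lerXn2r; rewrite ?nnegrE.
by rewrite mulr0 addr0 exprS ler_wpM2r ?exprn_ge0// ltW.
Qed.

(** Arithmetic-geometric inequality for 1 and [sqr Ne * |R - q|]: with a second moment of order
    [1 / N], the first absolute moment is of order [1 / sqr N]. *)
Lemma AA1_le : AA 1 <= (1 + Ne * AA 2) / (2 * sqr Ne).
have sp : 0 < sqr Ne by rewrite sqrtr_gt0.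
have s2 : sqr Ne ^+ 2 = Ne by rewrite sqr_sqrtr// ltW.
have -> : (1 + Ne * AA 2) / (2 * sqr Ne) = (2 * sqr Ne)^-1 * mean2 (fun _ _ => 1) + (Ne / (2 * sqr Ne)) * AA 2.
 by rewrite mean2_cst; move: (sqr Ne) sp (AA 2) => s sp x; field; rewrite gt_eqF.
rewrite -mean2_lin; apply: mean2_le => s t; rewrite expr1; move: (`|_|) => x.
have d0 : 0 < 2 * sqr Ne by rewrite mulr_gt0.
move: (sqr Ne) sp s2 d0 => u up <- d0; rewrite -subr_ge0.
have -> : (2 * u)^-1 * 1 + u ^+ 2 / (2 * u) * x ^+ 2 - x = (1 - u * x) ^+ 2 / (2 * u) by field; rewrite gt_eqF.
by rewrite divr_ge0 ?sqr_ge0// ltW.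
Qed.
End FixedN.

Let CE0 : 0 <= CE B.
have k0 := KB_ge0 B0; have e0 : 0 <= E0 B by exact: expR_ge0.
have d0 : 0 <= E0 B * KB B by rewrite mulr_ge0.
have d2 : 0 <= E0 B * KB B ^+ 2 by rewrite mulr_ge0// exprn_ge0.
rewrite /CE; move: (E0 B * KB B) (E0 B * KB B ^+ 2) (KB B) d0 d2 k0 => x y z x0 y0 z0.
by apply: addr_ge0; [apply: addr_ge0; [apply: addr_ge0|]|]; rewrite ?mulr_ge0// addr_ge0// mulr_ge0.
Qed.
Let k1 : B * (1 - 4 * q + 3 * r) < 1.
by apply: le_lt_trans a1; apply: ler_wpM2l; [exact: ltW|move: rq; lra]. Qed.
Let KS0 : 0 <= KS B q r.
have u0 : 0 <= (1 - B * (1 - 2 * q + r))^-1 by rewrite invr_ge0 subr_ge0 ltW.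
have w0 : 0 <= (1 - B * (1 - 4 * q + 3 * r))^-1 by rewrite invr_ge0 subr_ge0 ltW.
have B0' := ltW B0.
by rewrite /KS -exprVn; apply: addr_ge0; [apply: addr_ge0; exact: mulr_ge0|apply: mulr_ge0; [rewrite mulr_ge0// mulr_ge0|exact: exprn_ge0]].
Qed.
Notation s2 := (s2lim B q r).

(** Stein's identity for the test function [x - q]: its remainder is a third moment, which
    concentration turns into a small multiple of the second moment itself. *)
Theorem second_moment : exists2 C, 0 <= C & forall N, (0 < N)%N -> AA N 2 <= C / N%:R.
pose K := KS B q r * CE B; have K0 : 0 <= K by exact: mulr_ge0.
(* Concentration is used at this single level, for which the third moment costs at most half of
   [AA N 2]. *)
pose e := (2 * (K * ck 3) + 1)^-1.
have kk : 0 <= K * ck 3 by rewrite mulr_ge0// ck_ge0.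
have e0 : 0 < e by rewrite invr_gt0 ltr_wpDl// mulr_ge0.
have [Ct Ct0 ht] := overlap_concentration h0 B0 q0 q1 Eth2 aT e0.
pose W := `|s2| + K * (ck 3 * (1 + 27 * Ct) + 2 * (ck 1 * 4)).
have ckp := @ck_ge0.
have W0 : 0 <= W.
 by apply: addr_ge0 => //; apply: mulr_ge0 => //; apply: addr_ge0; apply: mulr_ge0; rewrite ?ck_ge0 ?addr_ge0 ?mulr_ge0 ?ck_ge0.
exists (2 * W); first by rewrite mulr_ge0.
move=> N N0; have Np : 0 < N%:R :> R by rewrite ltr0n.
have iN1 : N%:R^-1 <= 1 :> R by rewrite invf_le1// ler1n.
have iN0 : 0 <= N%:R^-1 :> R by rewrite invr_ge0 ltW.
have pM (x : R) : `|x - q| <= 0 + 1 * `|x - q| by rewrite add0r mul1r.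
have dM (x : R) : `|(fun=> 1) x : R| <= 1 by rewrite normr1.
have pL (x y : R) : `|(y - q) - (x - q)| <= 1 * `|y - x|.
 by rewrite mul1r; have -> : y - q - (x - q) = y - x by ring.
have dL (x y : R) : `|(fun=> 1) y - (fun=> 1) x : R| <= 0 * `|y - x| by rewrite subrr normr0 mul0r.
have pT (x y : R) : `|(y - q) - (x - q) - (fun=> 1) x * (y - x)| <= 0 * (y - x) ^+ 2.
 by rewrite mul1r mul0r (_ : y - q - (x - q) - (y - x) = 0) ?normr0//; ring.
have := stein_approx N0 B0 q0 q1 Eth2 Eth4 r01 (lexx 0) ler01 ler01 (lexx 0) pM dM pL dL pT a1 rq.
have -> : VV h B q N (fun x => x - q) l0 l1 = AA N 2.
 rewrite /AA -(nu1_two (fun s t => `|ov s t - q| ^+ 2) (isT : l0 != l1)).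
 by apply: eq_nu => sg; rewrite real_normK ?num_real// expr2.
rewrite /Phi nu1_cst mulr1 /Err !(mul0r, add0r, addr0) mul1r => h1.
have A3 := AA3_le N0 e0; have {}ht := ht N N0; rewrite -/(mean2 _) in ht.
have r3 : nuT h B q (fun sg : reps N => rho q sg ^+ 3) <= ck 3 * (N%:R^-1 ^+ 3 + AA N 3) by apply: rho_pow.
have r1 : nuT h B q (rho q (N := N)) <= ck 1 * (N%:R^-1 + AA N 1) by apply: nu1_rho_le.
have AA1 : AA N 1 <= 3.
 rewrite -(mean2_cst N 3); apply: mean2_le => s t; rewrite expr1; exact: ov_gap.
have A20 := AA_ge0 N 2.
have r3' : nuT h B q (fun sg : reps N => rho q sg ^+ 3) <= ck 3 * ((1 + 27 * Ct) * N%:R^-1 + e * AA N 2).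
 apply: (le_trans r3); apply: ler_wpM2l; first exact: ck_ge0.
 have n3 : N%:R^-1 ^+ 3 <= N%:R^-1 :> R by rewrite exprS ler_piMr// exprn_ile1.
 exact: (num_third A3 ht n3).
have r1' : nuT h B q (rho q (N := N)) <= ck 1 * 4.
 by apply: (le_trans r1); apply: ler_wpM2l; [exact: ck_ge0|exact: num_four].
have h2 : AA N 2 <= `|s2| * N%:R^-1 + K * (ck 3 * ((1 + 27 * Ct) * N%:R^-1 + e * AA N 2) + 2 * (ck 1 * 4) * N%:R^-1).
 have : AA N 2 <= s2 * N%:R^-1 + K * (nuT h B q (fun sg : reps N => rho q sg ^+ 3) + (1 + 1) * nuT h B q (rho q (N := N)) * N%:R^-1).
 by rewrite -lerBlDl (le_trans (ler_norm _))// /K -mulrA.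
 move=> h3; apply: (le_trans h3); apply: lerD; first by rewrite ler_wpM2r// ler_norm.
 apply: ler_wpM2l => //; apply: lerD => //; rewrite ler_wpM2r//.
 by rewrite (_ : 1 + 1 = 2)// ler_wpM2l.
have h4 : K * ck 3 * e <= 2^-1.
 exact: num_half.
have h5 : K * ck 3 * e * AA N 2 <= 2^-1 * AA N 2 by rewrite ler_wpM2r.
have e5 : `|s2| * N%:R^-1 + K * (ck 3 * ((1 + 27 * Ct) * N%:R^-1 + e * AA N 2) + 2 * (ck 1 * 4) * N%:R^-1) =
 W * N%:R^-1 + K * ck 3 * e * AA N 2.
 by rewrite /W; move: (N%:R^-1) (AA N 2) (`|s2|) (ck 3) (ck 1) (e) => *; ring.
rewrite e5 in h2; rewrite -mulrA; exact: num_absorb h2 h5.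
Qed.

(** The rescaled test function has derivatives of orders [sqr N] and [N]. By the second moment bound
    [Err] is still of order [1 / N], and the prefactor [sqr N] leaves [1 / sqr N]. *)
Theorem stein_clt : exists2 C, 0 <= C & forall N, (0 < N)%N -> forall (f df : R -> R) (M L1 L2 : R),
 0 <= M -> 0 <= L1 -> 0 <= L2 -> (forall x : R, `|f x| <= M) -> (forall x : R, `|df x| <= L1) ->
 (forall x y : R, `|f y - f x| <= L1 * `|y - x|) -> (forall x y : R, `|df y - df x| <= L2 * `|y - x|) ->
 (forall x y : R, `|f y - f x - df x * (y - x)| <= L2 * (y - x) ^+ 2) ->
 `|mean2 (fun s t : config N => sqr N%:R * (ov s t - q) * f (sqr N%:R * (ov s t - q))) -
 s2 * mean2 (fun s t : config N => df (sqr N%:R * (ov s t - q)))| <= C * (M + L1 + L2) / sqr N%:R.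
have [C C0 hC] := second_moment.
pose K := KS B q r * CE B; have K0 : 0 <= K by exact: mulr_ge0.
pose W := ck 2 * (1 + C) + 1 + ck 1 * (2 + C) + 1.
have c1 := ck_ge0 1; have c2 := ck_ge0 2.
have w1 : 0 <= ck 2 * (1 + C) by rewrite mulr_ge0// addr_ge0.
have w2 : 0 <= ck 1 * (2 + C) by rewrite mulr_ge0// addr_ge0.
have W0 : 0 <= W by rewrite /W !addr_ge0.
exists (K * W); first exact: mulr_ge0.
move=> N N0 f df M L1 L2 M0 L10 L20 fM dM fL dL fT.
have Np : 0 < N%:R :> R by rewrite ltr0n.
set s := sqr N%:R; have sp : 0 < s by rewrite sqrtr_gt0.
have ss : s * s = N%:R by rewrite -expr2 sqr_sqrtr// ltW.
have s1 : 1 <= s by rewrite -[leLHS]sqrtr1 ler_wsqrtr// ler1n.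
pose phi x := f (s * (x - q)); pose dphi x := s * df (s * (x - q)).
have sd x y : s * (y - q) - s * (x - q) = s * (y - x) by ring.
have pM x : `|phi x| <= M + 0 * `|x - q| by rewrite mul0r addr0; exact: fM.
have dpM x : `|dphi x| <= s * L1 by rewrite normrM gtr0_norm// ler_wpM2l// ltW.
have pL x y : `|phi y - phi x| <= s * L1 * `|y - x|.
 by apply: (le_trans (fL _ _)); rewrite sd normrM gtr0_norm// mulrCA mulrA.
have dpL x y : `|dphi y - dphi x| <= N%:R * L2 * `|y - x|.
 rewrite -mulrBr normrM gtr0_norm// -ss -!mulrA ler_wpM2l ?(ltW sp)//.
 by apply: (le_trans (dL _ _)); rewrite sd normrM gtr0_norm// mulrCA.
have pT x y : `|phi y - phi x - dphi x * (y - x)| <= N%:R * L2 * (y - x) ^+ 2.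
 have -> : dphi x * (y - x) = df (s * (x - q)) * (s * (y - q) - s * (x - q)) by rewrite sd /dphi; ring.
 by apply: (le_trans (fT _ _)); rewrite sd exprMn expr2 ss mulrCA mulrA.
have sL : 0 <= s * L1 by rewrite mulr_ge0// ltW.
have nL : 0 <= N%:R * L2 by rewrite mulr_ge0// ltW.
have := stein_approx N0 B0 q0 q1 Eth2 Eth4 r01 M0 (lexx 0) sL nL pM dpM pL dpL pT a1 rq.
have -> : VV h B q N phi l0 l1 = s^-1 * mean2 (fun s' t : config N => s * (ov s' t - q) * f (s * (ov s' t - q))).
 rewrite -(nu1_two (fun s' t => s * (ov s' t - q) * f (s * (ov s' t - q))) (isT : l0 != l1)) -nu1Z; apply: eq_nu => sg.
 by rewrite !mulrA mulVf ?mul1r// gt_eqF.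
have -> : Phi h B q N dphi = s * mean2 (fun s' t : config N => df (s * (ov s' t - q))).
 by rewrite -(nu1_two (fun s' t => df (s * (ov s' t - q))) (isT : l0 != l1)) -nu1Z; apply: eq_nu.
set X := @mean2 N _; set Y := @mean2 N _ => h1.
have i0 : 0 <= N%:R^-1 :> R by rewrite invr_ge0 ltW.
have eI : N%:R^-1 = s^-1 * s^-1 by rewrite -ss invfM.
have h2 : `|X - s2 * Y| <= s * (K * Err h B q N M 0 (s * L1) (N%:R * L2)).
 have -> : X - s2 * Y = s * (s^-1 * X - s2 * (N%:R^-1 * (s * Y))).
 have ge (u x y : R) : 0 < u -> x - s2 * y = u * (u^-1 * x - s2 * (u^-1 * u^-1 * (u * y))).
 by move=> up; field; rewrite gt_eqF.
 by rewrite eI; exact: ge.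
 by rewrite normrM gtr0_norm// ler_wpM2l ?(ltW sp)// /K -mulrA.
apply: (le_trans h2).
have n2 : nuT h B q (fun sg : reps N => rho q sg ^+ 2) <= ck 2 * (N%:R^-1 ^+ 2 + AA N 2) by apply: rho_pow.
have n1 : nuT h B q (rho q (N := N)) <= ck 1 * (N%:R^-1 + AA N 1) by apply: nu1_rho_le.
have A2 := hC N N0; have A1 := AA1_le N0; rewrite -/s in A1.
have is0 : 0 <= s^-1 by rewrite invr_ge0 ltW.
have iN1 : N%:R^-1 <= 1 :> R by rewrite invf_le1// ler1n.
have iNs : N%:R^-1 <= s^-1 by rewrite eI ler_piMr// invf_le1.
have b2 : nuT h B q (fun sg : reps N => rho q sg ^+ 2) <= ck 2 * (1 + C) * N%:R^-1.
 apply: (le_trans n2); rewrite -mulrA ler_wpM2l// mulrDl mul1r; apply: lerD => //.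
 by rewrite expr2 ler_piMr.
have b1 : nuT h B q (rho q (N := N)) <= ck 1 * (2 + C) * s^-1.
 apply: (le_trans n1); rewrite -mulrA ler_wpM2l//.
 have : AA N 1 <= (1 + C) * s^-1.
 apply: (le_trans A1); rewrite invfM mulrA ler_wpM2r//.
 have : N%:R * AA N 2 <= C by rewrite mulrC -ler_pdivlMr.
 by have a0 := AA_ge0 N 2; move: (N%:R * AA N 2) => x; lra.
 by move: iNs; move: (s^-1) (N%:R^-1) (AA N 1) => x y z; lra.
have hE : Err h B q N M 0 (s * L1) (N%:R * L2) <= W * (M + L1 + L2) * N%:R^-1.
 have t1 : M * nuT h B q (fun sg : reps N => rho q sg ^+ 2) <= M * (ck 2 * (1 + C) * N%:R^-1) by rewrite ler_wpM2l.
 have t2 : (s * L1 + 0) * nuT h B q (rho q (N := N)) / N%:R <= L1 * (ck 1 * (2 + C)) * N%:R^-1.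
 rewrite addr0 ler_wpM2r// -mulrA mulrCA ler_wpM2l//.
 by apply: (@le_trans _ _ (s * (ck 1 * (2 + C) * s^-1))); [rewrite ler_wpM2l ?(ltW sp)|rewrite mulrCA mulfV ?mulr1 ?gt_eqF].
 have t3 : N%:R * L2 / N%:R ^+ 2 = L2 * N%:R^-1 by field; rewrite gt_eqF.
 rewrite /Err t3 mul0r addr0.
 have p1 : 0 <= ck 2 * (1 + C) * N%:R^-1 * (L1 + L2) by rewrite mulr_ge0 ?addr_ge0// mulr_ge0.
 have p2 : 0 <= ck 1 * (2 + C) * N%:R^-1 * (M + L2) by rewrite mulr_ge0 ?addr_ge0// mulr_ge0.
 have p3 : 0 <= N%:R^-1 * (L1 + L2) by rewrite mulr_ge0// addr_ge0.
 have p4 : 0 <= N%:R^-1 * (M + L1) by rewrite mulr_ge0// addr_ge0.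
 move: t1 t2 p1 p2 p3 p4; rewrite /W; move: (N%:R^-1) (ck 1 * (2 + C)) (ck 2 * (1 + C)) ((s * L1 + 0) * nuT h B q (rho q (N := N)) / N%:R) (M * nuT h B q (fun sg : reps N => rho q sg ^+ 2)) => n b a y x t1 t2 p1 p2 p3 p4.
 have -> : (a + 1 + b + 1) * (M + L1 + L2) * n = M * (a * n) + M * n + L1 * b * n + L2 * n + (a * n * (L1 + L2) + b * n * (M + L2) + n * (L1 + L2) + n * (M + L1)) by ring.
 by move: t1 t2 p1 p2 p3 p4; move: (M * (a * n)) (M * n) (L1 * b * n) (L2 * n) (a * n * _) (b * n * _) (n * (L1 + L2)) (n * (M + L1)) => *; lra.
apply: (@le_trans _ _ (s * (K * (W * (M + L1 + L2) * N%:R^-1)))).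
 by apply: ler_wpM2l; [exact: ltW|apply: ler_wpM2l].
by rewrite le_eqVlt eI; apply/orP; left; apply/eqP; move: (s) sp (K) (W) => u up k w; field; rewrite gt_eqF.
Qed.
End Moments.

(** * The fixed point [q] and positivity of the variance *)

Section FixedPoint.
Context {R : realType}.
Variables (beta h : R).
Hypotheses (be0 : 0 < beta) (h0 : 0 < h).

Let tq (B x : R) := gm (fun z => tanh (h + sqr (B * x) * z) ^+ 2).

Lemma cont_tq B : 0 <= B -> continuous (tq B).
move=> B0; have sF : smooth (fun x : unit + unit -> R => tanh (L h (fun=> 1) x) ^+ 2).
 have -> : (fun x : unit + unit -> R => tanh (L h (fun=> 1) x) ^+ 2) = fun x => tanh (L h (fun=> 1) x) * tanh (L h (fun=> 1) x).
 by apply/funext => x; rewrite expr2.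
 by apply: smoothM; apply: (smooth_sm1L h (fun=> 1) sm1_th).
have cT := @P_cont R unit [:: tt] _ (fun=> 0) (fun=> B) sF.
have -> : tq B = fun s => P [:: tt] (fun x : unit + unit -> R => tanh (L h (fun=> 1) x) ^+ 2) (vec (mix (fun=> 0) (fun=> B) s)).
 apply/funext => s; rewrite /tq /= /T; eqgn => z.
 by rewrite L_unit mul1r pushE /= /mix mulr0 !add0r [s * B]mulrC.
exact: cT.
Qed.

Lemma sqrt_beta x : 0 <= x -> beta * sqr x = sqr (beta ^+ 2 * x).
by move=> x0; rewrite sqrtrM ?sqr_ge0// sqrtr_sqr gtr0_norm. Qed.
Lemma tanh2_bounds (x : R) : 0 <= tanh x ^+ 2 <= 1.
by rewrite sqr_ge0 tanh2_le1. Qed.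
Let st (B : R) k : sm1 (fun z : R => tanh (h + sqr B * z) ^+ k).
exact: (sm1X k (sm1_affine h (sqr B) sm1_th)). Qed.
Lemma exists_q : exists x, is_q beta h x.
have B0 : 0 <= beta ^+ 2 by exact: sqr_ge0.
have c1 : {within `[0, 1], continuous (fun x => x - tq (beta ^+ 2) x)}.
 apply: continuous_subspaceT => x; apply: cvgB; [exact: cvg_id|exact: cont_tq].
have t01 x : 0 <= tq (beta ^+ 2) x <= 1.
 rewrite gmean_ge0 => [|z]; last exact: sqr_ge0.
 rewrite -[X in _ <= X](@gm_cst R 1); apply: gmean_le; [exact: st|exact: sm1_cst|move=> z; exact: tanh2_le1].
have v0 : Num.min (0 - tq (beta ^+ 2) 0) (1 - tq (beta ^+ 2) 1) <= 0 <= Num.max (0 - tq (beta ^+ 2) 0) (1 - tq (beta ^+ 2) 1).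
 have /andP[a0 _] := t01 0; have /andP[_ b1] := t01 1.
 by rewrite ge_min le_max sub0r oppr_le0 a0 subr_ge0 b1 orbT.
have [x x01 /eqP] := IVT ler01 c1 v0; rewrite subr_eq0 => /eqP xE.
rewrite in_itv/= in x01; exists x; split=> //; rewrite {1}xE /tq; eqgn => z.
by rewrite sqrt_beta//; case/andP: x01.
Qed.

Lemma q_spec : is_q beta h (q beta h).
exact: xgetPex exists_q. Qed.
Let qq := q beta h.
Let rr := r beta h.
Let B := beta ^+ 2.
(** For [q = 0] the fixed point equation would read [tanh h ^+ 2 = 0]. *)
Lemma q_range : 0 < qq /\ qq <= 1.
have [/andP[a b] e] := q_spec; split=> //; rewrite lt0r a andbT; apply/eqP => e0.
have : 0 < tanh h ^+ 2 by rewrite exprn_gt0// tanh_gt0.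
rewrite (_ : tanh h ^+ 2 = 0) ?ltxx//.
transitivity (gm (fun z => tanh (h + beta * sqr qq * z) ^+ 2)); last by rewrite -e.
by rewrite e0 sqrtr0 mulr0 -[LHS](@gm_cst R); eqgn => z; rewrite mul0r addr0.
Qed.

Lemma Eth2_q : gm (fun z => tanh (h + sqr (B * qq) * z) ^+ 2) = qq.
have [q0 _] := q_range; have [_ e] := q_spec; rewrite [RHS]e; eqgn => z.
by rewrite -sqrt_beta// ltW.
Qed.
Lemma Eth4_r : gm (fun z => tanh (h + sqr (B * qq) * z) ^+ 4) = rr.
have [q0 _] := q_range; eqgn => z.
by rewrite -sqrt_beta// ltW.
Qed.
Notation th z := (tanh (h + sqr (B * qq) * z)).
Lemma lin_th (a b c : R) : gm (fun z => a + (b * th z ^+ 2 + c * th z ^+ 4)) = a + (b * qq + c * rr).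
have s2 : sm1 (fun z : R => b * th z ^+ 2) by exact: sm1Z.
have s4 : sm1 (fun z : R => c * th z ^+ 4) by exact: sm1Z.
rewrite gmeanD; [|exact: sm1_cst|exact: sm1D].
by rewrite gm_cst gmeanD// !gmeanZ ?Eth2_q ?Eth4_r//; exact: st.
Qed.

Lemma sech4_mean : gm (fun z => (cosh (h + sqr (B * qq) * z))^-1 ^+ 4) = 1 - 2 * qq + rr.
rewrite -(_ : 1 + (-2 * qq + 1 * rr) = 1 - 2 * qq + rr); last ring.
rewrite -lin_th; eqgn => z.
have -> : (cosh (h + sqr (B * qq) * z))^-1 ^+ 4 = ((cosh (h + sqr (B * qq) * z))^-1 ^+ 2) ^+ 2 by rewrite -exprM.
by rewrite -sech2E; ring.
Qed.
Let lin_ge0 (a b c : R) : (forall t : R, 0 <= t <= 1 -> 0 <= a + (b * t + c * t ^+ 2)) -> 0 <= a + (b * qq + c * rr).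
by move=> H; rewrite -lin_th; apply: gmean_ge0 => z; rewrite (exprM _ 2 2); apply: H; exact: tanh2_bounds.
Qed.
Lemma r_facts : [/\ 0 <= rr <= 1, rr <= qq, qq ^+ 2 <= rr & 0 < 1 - 2 * qq + rr].
have e1 : 0 <= 0 + (0 * qq + 1 * rr) by apply: lin_ge0 => t _; rewrite mul0r !add0r mul1r sqr_ge0.
have e2 : 0 <= 0 + (1 * qq + -1 * rr) by apply: lin_ge0 => t /andP[t0 t1]; nra.
have e3 : 0 <= qq ^+ 2 + (-2 * qq * qq + 1 * rr).
 by apply: lin_ge0 => t _; have := sqr_ge0 (t - qq); lra.
have [_ q1] := q_range; split; [lra|lra|lra|].
rewrite -sech4_mean; apply: gm_gt0; first exact: sm1_meas (sm1X 4 (sm1_affine h _ sm1_sc)).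
- exact: sm1_eg (sm1X 4 (sm1_affine h _ sm1_sc)).
- by move=> z; rewrite exprn_ge0// ltW// sech_gt0.
by move=> z _; rewrite exprn_gt0// sech_gt0.
Qed.

(** The variance is rearranged with the coefficients [1 - 2 * q + r > 0], [q - r >= 0] and
    [r - q ^+ 2 >= 0]. The factor of the second is nonnegative because [kappa <= 1 - 2 * q + r]
    makes [1 - alpha] the smaller denominator. *)
Lemma sigma2_gt0 : alpha beta h < 1 -> 0 < sigma2 beta h.
have [r01 rq qr a0] := r_facts; rewrite /sigma2 /alpha /kappa /zeta -/qq -/rr -/B.
have B0 : 0 <= B by exact: sqr_ge0.
move: rq qr a0 B0; move: (qq) (rr) (B) => q' r' b rq qr a0 b0 a1.
have k1 : b * (1 - 4 * q' + 3 * r') <= b * (1 - 2 * q' + r') by apply: ler_wpM2l => //; lra.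
set al := b * (1 - 2 * q' + r') in a1 k1 *; set be := b * (1 - 4 * q' + 3 * r') in k1 *.
have u0 : 0 < 1 - al by rewrite subr_gt0.
have v0 : 0 < 1 - be by rewrite subr_gt0 (le_lt_trans k1).
have -> : 3 * (1 - 2 * q' + r') / (1 - al) - 2 * (1 - 4 * q' + 3 * r') / (1 - be) - (2 * q' + q' ^+ 2 - 3 * r') / (1 - be) ^+ 2 =
 (1 - 2 * q' + r') / (1 - al) + 2 * (q' - r') * ((1 - be)^-1 * (2 * (1 - al)^-1 - (1 - be)^-1)) + (r' - q' ^+ 2) / (1 - be) ^+ 2.
 by rewrite /al /be in u0 v0 *; field; rewrite !gt_eqF.
have uv : (1 - be)^-1 <= (1 - al)^-1 by rewrite lef_pV2 ?posrE// lerD2l lerN2.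
have iu : 0 < (1 - al)^-1 by rewrite invr_gt0.
have iv : 0 < (1 - be)^-1 by rewrite invr_gt0.
apply: ltr_pwDl; last by rewrite divr_ge0 ?sqr_ge0// subr_ge0.
apply: ltr_pwDl; first by rewrite divr_gt0.
rewrite mulr_ge0//; first by rewrite mulr_ge0// subr_ge0.
by apply: mulr_ge0; [exact: ltW|move: uv iv iu; lra].
Qed.

Lemma aT_q : alpha beta h < 1 -> B * gm (fun z => (cosh (h + sqr (B * qq) * z))^-1 ^+ 4) < 1.
by rewrite sech4_mean. Qed.
End FixedPoint.

Lemma d_sum (R : realType) (J : Type) (s : seq J) (f : J -> R -> R) (df : J -> R) (x : R) :
 (forall j, is_derive x 1 (f j) (df j)) -> is_derive x 1 (fun t => \sum_(j <- s) f j t) (\sum_(j <- s) df j).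
move=> hf; elim: s => [|j s IH].
 by apply: (d_ext _ _ (is_derive_cst (0 : R) x (1 : R))) => [t|]; rewrite big_nil.
by apply: (d_ext _ _ (dD (hf j) IH)) => [t|]; rewrite big_cons.
Qed.

(** * Heat flow along a moving point and a moving width *)

Section HeatPath.
Context {R : realType}.
Implicit Types (g c t : R -> R).
Let K1 : bool + bool -> R := fun=> 0.

Lemma sum_bool_bool (f : bool + bool -> R) : \sum_k f k = f (inl true) + f (inl false) + (f (inr true) + f (inr false)).
by rewrite big_sumType/= !big_bool. Qed.
Lemma D_lin g g1 (k : bool + bool) : (forall u : R, is_derive u 1 g (g1 u)) ->
 D k (fun x : bool + bool -> R => g (L 0 (fun=> 1) x)) =
 fun x => (if k is inl _ then 1 else 0) * g1 (L 0 (fun=> 1) x).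
move=> dg; rewrite (pd_D (pd_comp (fun x => dg (L 0 (fun _ : bool => 1) x)) (pd_L 0 (fun _ : bool => 1) k))).
by apply/funext => x; case: k => b; exact: mulrC.
Qed.

(** Chain rule on the two-coordinate environment of [heatE]: the width contributes its heat term
    with [g2], the starting point the usual first derivative. *)
Lemma heat_path g g1 g2 c t (c' t' s : R) : sm1 g -> (forall u : R, is_derive u 1 g (g1 u)) -> (forall u : R, is_derive u 1 g1 (g2 u)) ->
 is_derive s 1 c c' -> is_derive s 1 t t' ->
 is_derive s 1 (fun s => heat (c s) g (t s)) (c' * (c s * heat (c s) g2 (t s)) + t' * heat (c s) g1 (t s)).
move=> sg dg dg1 dc dt; pose F0 (f : R -> R) (x : bool + bool -> R) := f (L 0 (fun=> 1) x).
have sF : smooth (F0 g) by exact: (smooth_sm1L 0 (fun _ : bool => 1) sg).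
have sg1 := sm1_unique sg dg.
pose gam (u : R) : bool + bool -> R := push (fun k => if k is inr _ then c u else 0) (inl false) (t u).
pose gam' (k : bool + bool) : R := match k with inl true => 0 | inl false => t' | inr _ => c' end.
have dgam k : is_derive s 1 (gam ^~ k) (gam' k).
 case: k => [[]|b]; rewrite /gam /gam' /push /=.
 - by apply: (d_ext _ _ (is_derive_cst (0 : R) s (1 : R))) => // u; rewrite addr0.
 - by apply: (d_ext _ _ dt) => // u; rewrite add0r.
 by apply: (d_ext _ _ dc) => // u; rewrite addr0.
have := smooth_chain (smooth_T true sF) dgam.
apply: d_ext => [u|]; first by rewrite heatE.
have hE f : heat (c s) f (t s) = T true (F0 f) (gam s) by exact: heatE.
have DF k : D k (F0 g) = fun x => (if k is inl _ then 1 else 0) * g1 (L 0 (fun=> 1) x) by exact: D_lin.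
have DF1 k : D k (F0 g1) = fun x => (if k is inl _ then 1 else 0) * g2 (L 0 (fun=> 1) x) by exact: D_lin.
have DF' b : D (inl b) (F0 g) = F0 g1 by rewrite DF; apply/funext => x; rewrite mul1r.
have DF1' b : D (inl b) (F0 g1) = F0 g2 by rewrite DF1; apply/funext => x; rewrite mul1r.
have DF0 b : D (inr b) (F0 g) = fun=> 0 by rewrite DF; apply/funext => x; rewrite mul0r.
have gi : gam s (inr true) = c s by rewrite /gam pushNE.
have T0 : T true (fun=> 0) (gam s) = 0 by rewrite T_indep.
have dt' k : DT k true (F0 g) (gam s) = match k with inl _ => heat (c s) g1 (t s) | inr b => b%:R * (c s * heat (c s) g2 (t s)) end.
 case: k => b; rewrite /DT ?DF' ?DF0.
 by rewrite (_ : (inl b == inr true) = false)// mul0r addr0 hE.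
 by rewrite T0 add0r DF1' gi hE (_ : (inr b == inr true) = b)//; case: (b).
rewrite sum_bool_bool !D_T// !dt' /gam' mul0r add0r !mul1r mul0r mulr0 addr0 addrC.
by [].
Qed.

Lemma heat_bound g (s t M : R) : sm1 g -> (forall u, `|g u| <= M) -> `|heat s g t| <= M.
move=> sg gM; have sa := sm1_affine t s sg; rewrite ler_norml; apply/andP; split.
 by rewrite -[leLHS](@gm_cst R); apply: gmean_le => // [|u]; [exact: sm1_cst|by have := gM (t + s * u); rewrite ler_norml => /andP[]].
by rewrite -[leRHS](@gm_cst R); apply: gmean_le => // [|u]; [exact: sm1_cst|by have := gM (t + s * u); rewrite ler_norml => /andP[]].
Qed.

Lemma taylor_bound (f f1 f2 : R -> R) (M x y : R) : (forall u : R, is_derive u 1 f (f1 u)) -> (forall u : R, is_derive u 1 f1 (f2 u)) ->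
 (forall u, `|f2 u| <= M) -> `|f y - f x - f1 x * (y - x)| <= M * (y - x) ^+ 2.
move=> df df1 f2M; set d := y - x.
have dl (u : R) : is_derive u 1 (fun u => x + d * u) d.
 by apply: (d_ext _ _ (dD (is_derive_cst x u (1 : R)) (dZ d (is_derive_id u (1 : R))))) => //; rewrite add0r mulr1.
have dc (h h' : R -> R) (u : R) : (forall v : R, is_derive v 1 h (h' v)) -> is_derive u 1 (fun u => h (x + d * u)) (d * h' (x + d * u)).
 by move=> dh; have := @is_derive1_comp _ h (fun u => x + d * u) u _ _ (dh _) (dl u); apply: d_ext => //; rewrite mulrC.
have d1 (u : R) := dc f f1 u df.
have d2 (u : R) : is_derive u 1 (fun u => d * f1 (x + d * u)) (d * (d * f2 (x + d * u))) by exact: dZ (dc f1 f2 u df1).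
have := @taylor01 _ _ _ _ (M * d ^+ 2) (derive_cont d1) (derive_cont d2) (fun u _ => d1 u) (fun u _ => d2 u).
rewrite mulr0 addr0 mulr1 [x + d]addrC subrK [d * f1 x]mulrC; apply=> u _.
by rewrite mulrA -expr2 normrM [leRHS]mulrC ger0_norm ?sqr_ge0// ler_wpM2l ?sqr_ge0.
Qed.
End HeatPath.

(** * Smoothing bounded continuous test functions *)

Section Mollify.
Context {R : realType}.
Variables (f : R -> R) (M : R).
Hypotheses (cf : continuous f) (fM : forall z, `|f z| <= M).
Notation U := (unit + unit -> R)%type.

Let M0 : 0 <= M. Proof. exact: le_trans (normr_ge0 (f 0)) (fM 0). Qed.
Lemma egrowth_bounded (g : R -> R) (c : R) : (forall z, `|g z| <= c) -> egrowth g.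
by move=> gc; apply: (egrowth_le _ (egrowth_cst c)) => z; apply: (le_trans (gc z)); exact: ler_norm.
Qed.
Lemma egrowthX k : egrowth (fun z : R => z ^+ k).
elim: k => [|k IH]; first by under eq_fun do rewrite expr0; exact: egrowth_cst.
by under eq_fun do rewrite exprS; exact: egrowthM egrowth_id IH.
Qed.
Lemma egrowth_norm (g : R -> R) : egrowth g -> egrowth (fun z => `|g z|).
by apply: egrowth_le => z; rewrite normr_id. Qed.
Lemma egrowth_exp_norm (A : R) : 0 <= A -> egrowth (fun z : R => expR (A * `|z|)).
move=> A0; exists (A + 1); split; first by rewrite addr_ge0.
move=> z; rewrite ger0_norm ?expR_ge0// -[leLHS]mul1r; apply: ler_pM; rewrite ?ler01 ?expR_ge0 ?lerDr//.
by rewrite ler_expR ler_wpM2r// lerDl.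
Qed.

Lemma cont_shift (g : R -> R) (a e : R) : continuous g -> continuous (fun z : R => g (a + e * z)).
move=> cg z; apply: (@continuous_comp _ _ _ (fun z => a + e * z) g); last exact: cg.
by apply: cvgD; [exact: cvg_cst|cvg_scale].
Qed.
Lemma contX (g : R -> R) k : continuous g -> continuous (fun z : R => g z ^+ k).
move=> cg z; elim: k => [|k IH]; first by under eq_fun do rewrite expr0; exact: cvg_cst.
rewrite (_ : (fun z => g z ^+ k.+1) = fun z => g z * g z ^+ k); last by apply/funext => u; rewrite exprS.
by rewrite /continuous_at; apply: cvgM; [exact: cg|exact: IH].
Qed.

Lemma cont_pow k (a : R) : continuous (fun z : R => (z - a) ^+ k).
by apply: contX => z; apply: cvgB; [exact: cvg_id|exact: cvg_cst]. Qed.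
Lemma dX (g : R -> R) k (t g' : R) : is_derive t 1 g g' -> is_derive t 1 (fun u => g u ^+ k) (k%:R * g t ^+ k.-1 * g').
move=> dg; elim: k => [|k IH].
 by apply: (d_ext _ _ (is_derive_cst (1 : R) t (1 : R))) => [u|]; rewrite ?expr0// !mul0r.
apply: (d_ext _ _ (dM dg IH)) => [u|]; first by rewrite exprS.
case: k {IH} => [|k] /=; first by rewrite !expr0; ring.
by rewrite -[k.+2%:R]natr1 exprS; ring.
Qed.

Lemma egrowth_pow k (a : R) : egrowth (fun z : R => (z - a) ^+ k).
have := egrowth_addl (- a) (egrowthX k); apply: egrowth_le => z.
by rewrite addrC.
Qed.

(** Shifting the Gaussian measure moves the dependence on [a] from [f], which is merely continuous,
    to the density. All derivatives of [Kh 0] are therefore combinations of the functions [Kh k]. *)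
Definition Kh k (a : R) : R := gm (fun z => f (a + z) * z ^+ k).

Let J k (a z : R) : R := f z * (z - a) ^+ k * expR (a * z - a ^+ 2 / 2).
Let cfp k a : continuous (fun z => f z * (z - a) ^+ k).
by move=> z; apply: cvgM; [exact: cf|exact: cont_pow]. Qed.
Let efp k a : egrowth (fun z => f z * (z - a) ^+ k).
exact: egrowthM (egrowth_bounded fM) (egrowth_pow k a). Qed.
Let ce (a : R) : continuous (fun z : R => expR (a * z - a ^+ 2 / 2)).
move=> z; apply: continuous_comp; last exact: continuous_expR.
by apply: cvgB; [cvg_scale|exact: cvg_cst].
Qed.
Let ee (a : R) : egrowth (fun z : R => expR (a * z - a ^+ 2 / 2)).
by under eq_fun do rewrite expRD mulrC; apply: egrowthM; [exact: egrowth_cst|exact: egrowth_exp]. Qed.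
Lemma KhE k a : Kh k a = gm (J k a).
rewrite /Kh /J -(@gm_shift R (fun z => f z * (z - a) ^+ k) a (@cfp k a) (@efp k a)); eqgn => z.
by rewrite [a + z - a]addrC addKr.
Qed.
Let mJ k a : mfun (J k a).
by apply: cont_meas => z; apply: cvgM; [exact: cfp|exact: ce]. Qed.
Let eJ k a : egrowth (J k a). Proof. exact: egrowthM (efp k a) (ee a). Qed.
Let d_J k (a z : R) : is_derive a 1 (J k ^~ z) (J k.+1 a z - k%:R * J k.-1 a z).
have d1 : is_derive a 1 (fun a : R => z - a) (-1).
 have := dD (is_derive_cst z a (1 : R)) (dZ (-1) (is_derive_id a (1 : R))).
 by apply: d_ext => [u|]; [rewrite mulN1r|rewrite add0r mulr1].
have d2 : is_derive a 1 (fun a : R => (z - a) ^+ k) (- (k%:R * (z - a) ^+ k.-1)).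
 by have := dX k d1; apply: d_ext => //; rewrite mulrN1.
have d3 : is_derive a 1 (fun a : R => a * z - a ^+ 2 / 2) (z - a).
 have := dD (dZ z (is_derive_id a (1 : R))) (dZ (- 2^-1) (dX 2 (is_derive_id a (1 : R)))).
 by apply: d_ext => [u|]; rewrite /=; field.
have d4 : is_derive a 1 (fun a : R => expR (a * z - a ^+ 2 / 2)) ((z - a) * expR (a * z - a ^+ 2 / 2)).
 by have := @is_derive1_comp _ (@expR R) _ a _ _ (is_derive_expR _) d3; apply: d_ext => //; rewrite mulrC.
have := dM (dZ (f z) d2) d4; apply: d_ext => //; rewrite /J [(z - a) ^+ k.+1]exprS.
by move: (expR _) (f z) ((z - a) ^+ k) ((z - a) ^+ k.-1) (z - a) => x y p p' d; ring.
Qed.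

Lemma is_derive_Kh k (a : R) : is_derive a 1 (Kh k) (Kh k.+1 a - k%:R * Kh k.-1 a).
have -> : Kh k = fun a => gm (J k a) by apply/funext => b; exact: KhE.
have -> : Kh k.+1 a - k%:R * Kh k.-1 a = gm (fun z => J k.+1 a z - k%:R * J k.-1 a z).
 rewrite !KhE -mulNr -(gmZ (- k%:R) (mJ k.-1 a) (eJ k.-1 a)) -gmD//.
 - by eqgn => z; rewrite mulNr.
 - exact: measurable_funM.
 exact: egrowthM (egrowth_cst _) (eJ _ _).
pose A := `|a| + 1; have A0 : 0 <= A by rewrite addr_ge0.
pose u j (z : R) := `|z - 0| ^+ j.
pose w j (z : R) := (A + `|z|) ^+ j.
have ew j : egrowth (w j).
 rewrite /w; elim: j => [|j IH]; first by under eq_fun do rewrite expr0; exact: egrowth_cst.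
 under eq_fun do rewrite exprS; apply: egrowthM => //.
 exact: egrowthD (egrowth_cst _) (egrowth_norm egrowth_id).
have cw j : continuous (w j).
 by apply: contX => z; apply: cvgD; [exact: cvg_cst|exact: norm_continuous].
pose G (z : R) := M * ((w k.+1 z + k%:R * w k.-1 z) * expR (A * `|z|)).
apply: (gm_derive (f' := fun a z => J k.+1 a z - k%:R * J k.-1 a z) (G := G) ltr01).
- by move=> x _; split; [exact: mJ|exact: eJ].
- by move=> x y _; exact: d_J.
- apply: cont_meas => z; apply: cvgM; first exact: cvg_cst.
 apply: cvgM; first by apply: cvgD; [exact: cw|apply: cvgM; [exact: cvg_cst|exact: cw]].
 apply: continuous_comp; last exact: continuous_expR.
 by apply: cvgM; [exact: cvg_cst|exact: norm_continuous].
- apply: egrowthM (egrowth_cst _) _; apply: egrowthM; last exact: egrowth_exp_norm.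
 by apply: egrowthD => //; exact: egrowthM (egrowth_cst _) (ew _).
move=> x z xa; rewrite /J /G.
have xA : `|x| <= A by rewrite -[x](subrK a) (le_trans (ler_normD _ _))// addrC lerD2l ltW.
have zx j : `|(z - x) ^+ j| <= w j z.
 rewrite normrX /w lerXn2r ?nnegrE ?addr_ge0// (le_trans (ler_normB _ _))// addrC lerD2r//.
have ex : `|expR (x * z - x ^+ 2 / 2)| <= expR (A * `|z|).
 rewrite ger0_norm ?expR_ge0// ler_expR (le_trans (_ : _ <= x * z))//.
 by rewrite gerDl oppr_le0 divr_ge0// sqr_ge0.
 by rewrite (le_trans (ler_norm _))// normrM ler_wpM2r.
have -> : f z * (z - x) ^+ k.+1 * expR (x * z - x ^+ 2 / 2) - k%:R * (f z * (z - x) ^+ k.-1 * expR (x * z - x ^+ 2 / 2)) =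
 f z * (((z - x) ^+ k.+1 - k%:R * (z - x) ^+ k.-1) * expR (x * z - x ^+ 2 / 2)).
 by move: (expR _) ((z - x) ^+ _) ((z - x) ^+ _) => e' p p'; ring.
rewrite normrM; apply: ler_pM => //; rewrite normrM; apply: ler_pM => //.
apply: (le_trans (ler_normB _ _)); apply: lerD => //.
by rewrite normrM ger0_norm// ler_wpM2l.
Qed.

Lemma Kh_bound k : exists2 C, 0 <= C & forall a, `|Kh k a| <= C.
have cz : continuous (fun z : R => z ^+ k) by apply: contX => z; exact: cvg_id.
have cn : continuous (fun z : R => M * `|z ^+ k|) by move=> z; apply: cvgM; [exact: cvg_cst|apply: cvg_norm; exact: cz].
have en : egrowth (fun z : R => M * `|z ^+ k|) by exact: egrowthM (egrowth_cst _) (egrowth_norm (egrowthX k)).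
exists (gm (fun z => M * `|z ^+ k|)); first by apply: gmean_ge0 => z; rewrite mulr_ge0.
move=> a; have ca : continuous (fun z => f (a + z)).
 move=> z; apply: (@continuous_comp _ _ _ (fun z => a + z) f); last exact: cf.
 by apply: cvgD; [exact: cvg_cst|exact: cvg_id].
have cp : continuous (fun z => f (a + z) * z ^+ k) by move=> z; apply: cvgM; [exact: ca|exact: cz].
have ep : egrowth (fun z => f (a + z) * z ^+ k) by exact: egrowthM (egrowth_bounded (fun z => fM (a + z))) (egrowthX k).
apply: (le_trans (gm_abs (cont_meas cp) ep)); apply: ler_gauss_mean => //.
- by apply: cont_meas => z; apply: cvg_norm; exact: cp.
- exact: cont_meas.
- exact: egrowth_norm.
by move=> z; rewrite normrM ler_wpM2r.
Qed.

Lemma sm1_Kh k : sm1 (Kh k).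
move=> n; elim: n k => [|n IH] k.
 split=> // B; have [C C0 hC] := Kh_bound k; exists C; split=> // x _.
 by apply: (le_trans (hC _)); rewrite ler_peMr// -expR0 ler_expR mulr_ge0// nrm_ge0.
have gr k' : growth (fun x : U => Kh k' (x (inl tt))) by case: n IH => [|n] /(_ k') [].
split=> // j; exists (fun x : U => (Kh k.+1 (x (inl tt)) - k%:R * Kh k.-1 (x (inl tt))) * (inl tt == j)%:R).
 exact: (pd_comp (F := fun x : U => x (inl tt)) (f' := fun a => Kh k.+1 a - k%:R * Kh k.-1 a) (fun x : U => is_derive_Kh k (x (inl tt))) (pd_coord j (inl tt))).
apply: smM; last exact: sm_cst.
rewrite (_ : (fun x : U => _) = fun x : U => Kh k.+1 (x (inl tt)) + - k%:R * Kh k.-1 (x (inl tt))); last first.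
 by apply/funext => x; rewrite mulNr.
by apply: smD; [exact: IH|apply: smM; [exact: sm_cst|exact: IH]].
Qed.
End Mollify.

Section HeatMollifier.
Context {R : realType}.
Variables (f : R -> R) (M : R).
Hypotheses (cf : continuous f) (fM : forall z, `|f z| <= M).

Let M0 : 0 <= M. Proof. exact: le_trans (normr_ge0 (f 0)) (fM 0). Qed.
Lemma heat_mollifier e : 0 < e -> exists g1 g2 g3 C, [/\ sm1 (heat e f),
 forall u : R, is_derive u 1 (heat e f) (g1 u), forall u : R, is_derive u 1 g1 (g2 u),
 forall u : R, is_derive u 1 g2 (g3 u) &
 [/\ 0 <= C, forall u, `|g1 u| <= C, forall u, `|g2 u| <= C & forall u, `|g3 u| <= C]].
move=> e0; pose fe (u : R) := f (e * u).
have en : e != 0 by rewrite gt_eqF.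
have cfe : continuous fe.
 move=> z; apply: (@continuous_comp _ _ _ (fun z => e * z) f); last exact: cf.
 by cvg_scale.
have feM z : `|fe z| <= M by exact: fM.
(* Rescaling turns smoothing at width [e] into smoothing at unit width; each derivative costs one
   factor [i]. *)
pose i := e^-1; pose Ki k (u : R) := Kh fe k (0 + i * u).
have sK k : sm1 (Ki k) by exact: sm1_affine (sm1_Kh cfe feM k).
have hE : heat e f = Ki 0%N.
 apply/funext => t; eqgn => z.
 by rewrite expr0 mulr1 /fe add0r mulrDr mulVKf.
have dK k (u : R) : is_derive u 1 (Ki k) (i * (Ki k.+1 u - k%:R * Ki k.-1 u)).
 have dl : is_derive u 1 (fun u => 0 + i * u) i.
 by have := dD (is_derive_cst (0 : R) u (1 : R)) (dZ i (is_derive_id u (1 : R))); apply: d_ext => //; rewrite add0r mulr1.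
 by have := @is_derive1_comp _ (Kh fe k) _ u _ _ (is_derive_Kh cfe feM k _) dl; apply: d_ext => //; rewrite mulrC.
have [C1 C10 hC1] := Kh_bound cfe feM 1; have [C2 C20 hC2] := Kh_bound cfe feM 2.
have [C3 C30 hC3] := Kh_bound cfe feM 3; have [C0 C00 hC0] := Kh_bound cfe feM 0.
pose C := C0 + C1 + C2 + C3.
have i0 : 0 <= i by rewrite invr_ge0 ltW.
have Cs : 0 <= C by rewrite /C !addr_ge0.
pose D := (1 + i + i ^+ 2 + i ^+ 3) * (4 * C).
exists (fun u => i * Ki 1%N u), (fun u => i ^+ 2 * (Ki 2%N u - Ki 0%N u)), (fun u => i ^+ 3 * (Ki 3%N u - 3 * Ki 1%N u)), D.
have b0 u : `|Ki 0%N u| <= C by apply: (le_trans (hC0 _)); rewrite /C; move: C10 C20 C30; lra.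
have b1 u : `|Ki 1%N u| <= C by apply: (le_trans (hC1 _)); rewrite /C; move: C00 C20 C30; lra.
have b2 u : `|Ki 2%N u| <= C by apply: (le_trans (hC2 _)); rewrite /C; move: C10 C00 C30; lra.
have b3 u : `|Ki 3%N u| <= C by apply: (le_trans (hC3 _)); rewrite /C; move: C10 C20 C00; lra.
have C4 : 0 <= 4 * C by rewrite mulr_ge0.
have i2 : 0 <= i ^+ 2 by rewrite exprn_ge0.
have i3' : 0 <= i ^+ 3 by rewrite exprn_ge0.
have fin (p x : R) : 0 <= p -> p <= 1 + i + i ^+ 2 + i ^+ 3 -> `|x| <= 4 * C -> `|p * x| <= D.
 by move=> p0 pi xC; rewrite normrM ger0_norm//; apply: ler_pM.
split.
- by rewrite hE.
- by move=> u; rewrite hE; have := dK 0%N u; apply: d_ext => //=; rewrite mul0r subr0.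
- move=> u; have := dZ i (dK 1%N u); apply: d_ext => //=; rewrite mul1r; move: (Ki _ _) (Ki _ _) => x y; ring.
- move=> u; have := dZ (i ^+ 2) (dD (dK 2%N u) (dZ (-1) (dK 0%N u))); apply: d_ext => [v|]; first by rewrite mulN1r.
 by rewrite /= mul0r subr0; move: (Ki _ _) (Ki _ _) => x y; ring.
split; first by rewrite mulr_ge0// !addr_ge0.
- move=> u; apply: fin => //; first by move: i2 i3'; lra.
 by apply: (le_trans (b1 u)); move: Cs; lra.
- move=> u; apply: fin => //; first by move: i0 i3'; lra.
 by apply: (le_trans (ler_normB _ _)); have := b2 u; have := b0 u; move: Cs; lra.
move=> u; apply: fin => //; first by move: i0 i2; lra.
apply: (le_trans (ler_normB _ _)); rewrite [`|3 * _|]normrM ger0_norm//.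
by have := b3 u; have := b1 u; move: Cs; lra.
Qed.

(** Compactness of the segment. Only [y] is confined to it, since [z] will be a Gaussian
    perturbation of [y]. *)
Lemma locally_uniform (K w : R) : 0 < w -> exists2 dl, 0 < dl &
 forall y z, `|y| <= K -> `|z - y| < dl -> `|f z - f y| <= w.
move=> w0; pose Pd (dl y : R) := forall z, `|z - y| < dl -> `|f z - f y| <= w.
have nc := proj1 (compact_near_coveringP _) (@segment_compact R (- K) K) .
have loc (x : R) : `[- K, K]%classic x -> \forall x' \near x & dl \near 0^'+, Pd dl x'.
 move=> _; have w2 : 0 < w / 2 by rewrite divr_gt0.
 have cx : f @ x --> f x by exact: cf.
 move/cvgrPdist_lt: cx => /(_ _ w2)/nbhs_ballP[eta /= eta0 he].
 exists (ball x (eta / 2), [set dl | dl < eta / 2]); first split.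
 - by apply: nbhsx_ballx; rewrite divr_gt0.
 - by apply: nbhs_right_lt; rewrite divr_gt0.
 move=> [x' dl] /= [bx dle] z zx.
 rewrite -ball_normE /= in bx.
 have h1 := he x' _; have h2 := he z _.
 have e1 : `|f x - f x'| < w / 2 by apply: h1; rewrite -ball_normE /=; move: bx eta0; lra.
 have e2 : `|f x - f z| < w / 2.
 apply: h2; rewrite -ball_normE /=; have := ler_distD x' x z; rewrite [`|x' - z|]distrC.
 by move: bx dle zx; lra.
 have := ler_distD (f x) (f z) (f x'); rewrite [`|f z - f x|]distrC; move: e1 e2; lra.
have h := nc R (0^'+) Pd _ loc; have : exists2 dl, 0 < dl & `[- K, K]%classic `<=` Pd dl.
 have : \forall dl \near 0^'+, 0 < dl /\ `[- K, K]%classic `<=` Pd dl.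
 by apply: filterI; [exact: nbhs_right_gt|exact: h].
 by move=> /filter_ex[dl [dl0 hd]]; exists dl.
move=> [dl dl0 hd]; exists dl => // y z yK; apply: hd.
by rewrite /= in_itv/= -ler_norml.
Qed.

Lemma gm_sqr : gm (fun z : R => z ^+ 2) = 1.
have := gmean_ibp (f := id) (f' := fun=> 1) sm1_id (fun t => is_derive_id t (1 : R)).
by move=> [+ _]; rewrite gm_cst => <-; eqgn => z; rewrite expr2.
Qed.
Lemma gm_dist (g k l : R -> R) : continuous g -> continuous k -> continuous l -> egrowth g -> egrowth k -> egrowth l ->
 (forall z, `|g z - k z| <= l z) -> `|gm g - gm k| <= gm l.
move=> cg ck cl eg ek el H.
have cN : continuous (fun z => -1 * k z) by move=> z; apply: cvgM; [exact: cvg_cst|exact: ck].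
have eN : egrowth (fun z => -1 * k z) by exact: egrowthM (egrowth_cst _) ek.
have -> : gm g - gm k = gm (fun z => g z + -1 * k z).
 rewrite gmD//; [|exact: cont_meas|exact: cont_meas].
 by rewrite gmZ ?mulN1r//; exact: cont_meas.
have cD : continuous (fun z => g z + -1 * k z) by move=> z; apply: cvgD; [exact: cg|exact: cN].
have eD := egrowthD eg eN.
apply: (le_trans (gm_abs (cont_meas cD) eD)); apply: ler_gauss_mean => //.
- by apply: cont_meas => z; apply: cvg_norm; exact: cD.
- exact: cont_meas.
- exact: egrowth_norm.
by move=> z; rewrite mulN1r.
Qed.

(** Three sources of error: the local oscillation [w], a Gaussian increment beyond [dl], and [y]
    beyond [K]. The last two are bounded as in Chebyshev's inequality, by squares, so that only
    second moments will be needed. *)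
Lemma heat_close (K w dl e : R) : 0 < K -> 0 < dl -> 0 <= w ->
 (forall y z, `|y| <= K -> `|z - y| < dl -> `|f z - f y| <= w) ->
 forall y, `|heat e f y - f y| <= w + 2 * M * (e ^+ 2 / dl ^+ 2) + 2 * M / K ^+ 2 * y ^+ 2.
move=> K0 dl0 w0 H y; set a := 2 * M / K ^+ 2 * y ^+ 2; set b := 2 * M * (e ^+ 2 / dl ^+ 2).
have M2 : 0 <= 2 * M by rewrite mulr_ge0.
have a0 : 0 <= a by apply: mulr_ge0; [apply: divr_ge0 => //; exact: sqr_ge0|exact: sqr_ge0].
have b0 : 0 <= b by apply: mulr_ge0 => //; apply: divr_ge0; exact: sqr_ge0.
have c2 : continuous (fun z : R => z ^+ 2) by apply: contX => z; exact: cvg_id.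
have -> : w + b + a = gm (fun z : R => (w + a) + b * z ^+ 2).
 rewrite gmeanD; [|exact: sm1_cst|by apply: sm1Z; apply: sm1X; exact: sm1_id].
 by rewrite gm_cst gmeanZ ?gm_sqr ?mulr1 1?addrAC//; apply: sm1X; exact: sm1_id.
rewrite -[f y](@gm_cst R); apply: gm_dist.
- exact: cont_shift.
- by move=> z; exact: cvg_cst.
- by move=> z; apply: cvgD; [exact: cvg_cst|apply: cvgM; [exact: cvg_cst|exact: c2]].
- exact: (egrowth_bounded (fun z => fM (y + e * z))).
- exact: egrowth_cst.
- exact: egrowthD (egrowth_cst _) (egrowthM (egrowth_cst _) (egrowthX 2)).
move=> z; have tr : `|f (y + e * z) - f y| <= 2 * M.
 by apply: (le_trans (ler_normB _ _)); have := fM y; have := fM (y + e * z); lra.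
have z2 : 0 <= b * z ^+ 2 by rewrite mulr_ge0// sqr_ge0.
case: (lerP `|y| K) => [yK|yK]; last first.
 have : 2 * M <= a.
 rewrite /a -mulrA ler_peMr// mulrC ler_pdivlMr ?exprn_gt0// mul1r -[y ^+ 2]real_normK ?num_real//.
 by apply: lerXn2r; rewrite ?nnegrE; [exact: ltW|exact: normr_ge0|exact: ltW].
 by move: tr z2 w0; lra.
case: (ltrP `|e * z| dl) => [ed|ed].
 have : `|f (y + e * z) - f y| <= w by apply: H => //; rewrite addrC addKr.
 by move: a0 z2; lra.
have : 2 * M <= b * z ^+ 2.
 have -> : b * z ^+ 2 = 2 * M * ((e * z) ^+ 2 / dl ^+ 2) by rewrite /b; move: (dl ^+ 2)^-1 => i; ring.
 rewrite ler_peMr// ler_pdivlMr ?exprn_gt0// mul1r -[(e * z) ^+ 2]real_normK ?num_real//.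
 by rewrite lerXn2r ?nnegrE// ltW.
by move: tr a0 w0; lra.
Qed.
End HeatMollifier.

(** * From Stein's identity to convergence in law *)

Section SmoothCLT.
Context {R : realType}.
Variables (h B q r : R).
Hypotheses (h0 : 0 < h) (B0 : 0 < B) (q0 : 0 < q) (q1 : q <= 1).
Hypothesis Eth2 : gm (fun z => tanh (h + sqr (B * q) * z) ^+ 2) = q.
Hypothesis Eth4 : gm (fun z => tanh (h + sqr (B * q) * z) ^+ 4) = r.
Hypothesis aT : B * gm (fun z => (cosh (h + sqr (B * q) * z))^-1 ^+ 4) < 1.
Hypothesis a1 : B * (1 - 2 * q + r) < 1.
Hypotheses (r01 : 0 <= r <= 1) (rq : r <= q).
Hypothesis s20 : 0 < s2lim B q r.
Notation ov := (overlap R).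
Notation sg := (sqr (s2lim B q r)).
Notation Y N := (fun a b : config N => sqr N%:R * (ov a b - q)).
Definition meanY N (F : R -> R) : R := mean2 h B q (fun a b : config N => F (Y N a b)).

(** The average is a finite combination of values of [F] with weights that do not depend on [F], so
    derivatives in a parameter pass through it. *)
Lemma mean2_sum N (F : config N -> config N -> R) : mean2 h B q F =
 \sum_(a : config N) \sum_(b : config N) F a b * mean2 h B q (fun a' b' => ((a', b') == (a, b))%:R).
rewrite /mean2; have sw (a : config N) : smooth (wt (@one1 R N) (b1 h (N := N)) (@v1 R N) a).
 exact: (smooth_wt _ _ (@one1_ge0 R N) (@one1_gt0 R N)).
have e (a b : config N) : pav h (fun a' b' => ((a', b') == (a, b))%:R) =
 fun x => wt (@one1 R N) (b1 h (N := N)) (@v1 R N) a x * wt (@one1 R N) (b1 h (N := N)) (@v1 R N) b x.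
 apply/funext => x; rewrite /pav (bigD1 a)//= (bigD1 b)//= eqxx mulr1 big1 ?addr0 => [|b' hb]; last first.
 by rewrite xpair_eqE (negbTE hb) andbF mulr0.
 rewrite big1 ?addr0// => a' ha; rewrite big1// => b' _.
 by rewrite xpair_eqE (negbTE ha) mulr0.
rewrite (_ : pav h F = fun x => \sum_a \sum_b F a b * pav h (fun a' b' => ((a', b') == (a, b))%:R) x); last first.
 by apply/funext => x; apply: eq_bigr => a _; apply: eq_bigr => b _; rewrite e mulrC.
rewrite P_sum; last by move=> a; apply: smooth_sum => b; apply: smoothZ; exact: smooth_pav.
apply: eq_bigr => a _; rewrite P_sum; last by move=> b; apply: smoothZ; exact: smooth_pav.
by apply: eq_bigr => b _; rewrite P_Z//; exact: smooth_pav.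
Qed.

Lemma d_mean2 N (F F' : R -> config N -> config N -> R) (s : R) : (forall a b, is_derive s 1 (fun u => F u a b) (F' s a b)) ->
 is_derive s 1 (fun u => mean2 h B q (F u)) (mean2 h B q (F' s)).
move=> dF; rewrite (mean2_sum (F' s)).
have -> : (fun u => mean2 h B q (F u)) = fun u => \sum_a \sum_b F u a b * mean2 h B q (fun a' b' : config N => ((a', b') == (a, b))%:R).
 by apply/funext => u; exact: mean2_sum.
apply: d_sum => a; apply: d_sum => b.
by have := dZ (mean2 h B q (fun a' b' : config N => ((a', b') == (a, b))%:R)) (dF a b); apply: d_ext => [u|]; rewrite mulrC.
Qed.

Theorem clt_smooth : exists2 C, 0 <= C & forall N, (0 < N)%N -> forall (g g1 g2 g3 : R -> R) M, sm1 g ->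
 (forall u : R, is_derive u 1 g (g1 u)) -> (forall u : R, is_derive u 1 g1 (g2 u)) -> (forall u : R, is_derive u 1 g2 (g3 u)) ->
 0 <= M -> (forall u, `|g1 u| <= M) -> (forall u, `|g2 u| <= M) -> (forall u, `|g3 u| <= M) ->
 `|meanY N g - gm (fun z => g (sg * z))| <= C * M / sqr N%:R.
have [C C0 hC] := stein_clt h0 B0 q0 q1 Eth2 Eth4 aT a1 r01 rq.
pose th : R := pi / 2; have th0 : 0 <= th by rewrite divr_ge0// pi_ge0.
exists (th * (C * 3)); first by rewrite mulr_ge0// mulr_ge0.
move=> N N0 g g1 g2 g3 M sg0 dg dg1 dg2 M0 g1M g2M g3M.
have sg1 := sm1_unique sg0 dg; have sg2 := sm1_unique sg1 dg1; have sg3 := sm1_unique sg2 dg2.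
(* A quarter turn from the Gaussian at [s = 0] to the overlap at [s = 1]. Since [c * c'] is
   [- s2lim] times [t * t'], the two terms of the derivative combine into Stein's identity. *)
pose c s := sg * cos (th * s); pose t s := sin (th * s).
have dth (s : R) : is_derive s 1 (fun s => th * s) th.
 by apply: (d_ext _ _ (dZ th (is_derive_id s (1 : R)))) => //; rewrite mulr1.
have dt (s : R) : is_derive s 1 t (th * cos (th * s)).
 have := @is_derive1_comp _ (@sin R) (fun s => th * s) s _ _ (is_derive_sin _) (dth s).
 by apply: d_ext => //; rewrite mulrC.
have dc (s : R) : is_derive s 1 c (sg * (- (th * sin (th * s)))).
 apply: dZ; have := @is_derive1_comp _ (@cos R) (fun s => th * s) s _ _ (is_derive_cos _) (dth s).
 by apply: d_ext => //; rewrite mulNr mulrC.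
pose f s y := heat (c s) g1 (t s * y); pose df s y := t s * heat (c s) g2 (t s * y).
pose F s := mean2 h B q (fun a b : config N => heat (c s) g (t s * Y N a b)).
pose F' s := th * cos (th * s) * (mean2 h B q (fun a b : config N => Y N a b * f s (Y N a b)) - s2lim B q r * mean2 h B q (fun a b : config N => df s (Y N a b))).
have dF (s : R) : is_derive s 1 F (F' s).
 have e : F' s = mean2 h B q (fun a b : config N => sg * (- (th * sin (th * s))) * (c s * heat (c s) g2 (t s * Y N a b)) + th * cos (th * s) * Y N a b * heat (c s) g1 (t s * Y N a b)).
 rewrite /F' mulrBr mulrA -mulNr -mean2_lin; congr (mean2 _ _ _ _); apply/funext => a; apply/funext => b.
 have aux (c' s' S v x y g' : R) : S = g' ^+ 2 ->
 th * c' * (v * x) + - (th * c' * S) * (s' * y) = g' * - (th * s') * (g' * c' * y) + th * c' * v * x.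
 by move=> ->; ring.
 by apply: aux; rewrite sqr_sqrtr ?ltW.
 rewrite e; apply: (d_mean2 (F' := fun s (a b : config N) => _)) => a b.
 have dtY : is_derive s 1 (fun s => t s * Y N a b) (th * cos (th * s) * Y N a b).
 by have := dZ (Y N a b) (dt s); apply: d_ext => [u|]; rewrite mulrC.
 exact: (heat_path sg0 dg dg1 (dc s) dtY).
have t1 s : `|t s| <= 1 by rewrite ler_norml sin_geN1 sin_le1.
have bF s : `|F' s| <= th * (C * (M + M + M) / sqr N%:R).
 rewrite /F' normrM; apply: ler_pM => //.
 by rewrite normrM ger0_norm// ler_piMr// ler_norml cos_geN1 cos_le1.
 have dtu (u : R) : is_derive u 1 (fun u => t s * u) (t s).
 by apply: (d_ext _ _ (dZ (t s) (is_derive_id u (1 : R)))) => //; rewrite mulr1.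
 have dh (k k1 : R -> R) (u : R) : sm1 k -> (forall v : R, is_derive v 1 k (k1 v)) ->
 is_derive u 1 (fun u => heat (c s) k (t s * u)) (t s * heat (c s) k1 (t s * u)).
 move=> sk dk; have := @is_derive1_comp _ (heat (c s) k) (fun u => t s * u) u _ _ (is_derive_heat (c s) _ sk dk) (dtu u).
 by apply: d_ext => //; rewrite mulrC.
 have df1 (u : R) : is_derive u 1 (f s) (df s u) by exact: (dh g1 g2 u sg1 dg1).
 have df2 (u : R) : is_derive u 1 (df s) (t s * (t s * heat (c s) g3 (t s * u))) by exact: (dZ (t s) (dh g2 g3 u sg2 dg2)).
 have bf x : `|f s x| <= M by exact: heat_bound.
 have bdf x : `|df s x| <= M by rewrite normrM -[M]mul1r; apply: ler_pM => //; exact: heat_bound.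
 have bddf x : `|t s * (t s * heat (c s) g3 (t s * x))| <= M.
 rewrite normrM -[M]mul1r; apply: ler_pM => //; rewrite normrM -[M]mul1r; apply: ler_pM => //; exact: heat_bound.
 apply: (hC N N0 (f s) (df s) M M M M0 M0 M0 bf bdf).
 - by move=> x y; exact: (lip_derive x y df1 bdf).
 - by move=> x y; exact: (lip_derive x y df2 bddf).
 by move=> x y; exact: (taylor_bound x y df1 df2 bddf).
have cF : continuous F by exact: (derive_cont dF).
have := lip01 cF (fun s _ => dF s) (fun s _ => bF s) (lexx 0) ler01 (lexx 1).
have -> : F 1 = meanY N g.
 rewrite /F /meanY; congr (mean2 _ _ _ _); apply/funext => a; apply/funext => b.
 rewrite /c /t mulr1 cos_pihalf sin_pihalf mulr0 mul1r /heat -[RHS](@gm_cst R).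
 by eqgn => z; rewrite mul0r addr0.
have -> : F 0 = gm (fun z => g (sg * z)).
 rewrite /F -[RHS](mean2_cst h B q N); congr (mean2 _ _ _ _); apply/funext => a; apply/funext => b.
 rewrite /c /t mulr0 cos0 sin0 mulr1 mul0r /heat.
 by eqgn => z; rewrite add0r.
rewrite subr0 mulr1 => /le_trans; apply; apply: le_of_eq.
by move: (th) (sqr N%:R)^-1 => x y; ring.
Qed.
Notation s2 := (s2lim B q r).

Let dist_triangle3 (mf mg ef eg x1 x2 x3 x4 eps : R) : `|mf - mg| <= x4 + x1 -> `|ef - eg| <= x4 + x2 -> `|mg - eg| <= x3 ->
 x3 <= eps / 4 -> x1 + x2 <= eps / 4 -> x4 <= eps / 4 -> `|ef - mf| <= eps.
rewrite !ler_norml => /andP[p1 p2] /andP[p3 p4] /andP[p5 p6] p7 p8 p9; apply/andP; split; lra.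
Qed.

Lemma meanY_dist N (f g l : R -> R) : (forall y, `|f y - g y| <= l y) -> `|meanY N f - meanY N g| <= meanY N l.
move=> H; rewrite /meanY.
have -> : forall F G : config N -> config N -> R, mean2 h B q F - mean2 h B q G = mean2 h B q (fun a b => 1 * F a b + -1 * G a b).
 by move=> F G; rewrite mean2_lin mul1r mulN1r.
set D := fun a b : config N => _; set L := fun a b : config N => _.
have hD a b : `|D a b| <= L a b by rewrite /D /L mul1r mulN1r; exact: H.
rewrite ler_norml; apply/andP; split; last by apply: mean2_le => a b; have := hD a b; rewrite ler_norml => /andP[].
have -> : - mean2 h B q L = mean2 h B q (fun a b => -1 * L a b + 0 * L a b) by rewrite mean2_lin mulN1r mul0r addr0.
by apply: mean2_le => a b; rewrite mulN1r mul0r addr0; have := hD a b; rewrite ler_norml => /andP[].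
Qed.

Theorem clt_bounded_continuous (f : R -> R) M : continuous f -> (forall z, `|f z| <= M) ->
 (fun N => meanY N f) @ \oo --> gm (fun z => f (sqr s2 * z)).
move=> cf fM; have M0 : 0 <= M by exact: le_trans (normr_ge0 (f 0)) (fM 0).
have [C C0 hC] := second_moment h0 B0 q0 q1 Eth2 Eth4 aT a1 r01 rq.
have [C' C'0 hC'] := clt_smooth.
apply/cvgrPdist_le => eps eps0.
pose w := eps / 8; have w0 : 0 < w by rewrite divr_gt0.
(* Beyond [K] the error is [2 * M / K ^+ 2] times a second moment, at most [C] for the rescaled
   overlap and [s2] for the Gaussian; this [K] makes both together at most [eps / 4]. *)
pose K := 8 * M * (C + s2) / eps + 1.
have Cs : 0 <= C + s2 by rewrite addr_ge0// ltW.
have K1 : 1 <= K by rewrite lerDr; apply: divr_ge0; [apply: mulr_ge0; [exact: mulr_ge0|exact: Cs]|exact: ltW].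
have K0 : 0 < K by exact: lt_le_trans ltr01 K1.
have [dl dl0 hdl] := locally_uniform cf K w0.
(* Width of the smoothing in units of [dl], chosen so that [2 * M * t <= eps / 8]. *)
pose t := eps / (16 * (M + 1) + eps).
have tden : 0 < 16 * (M + 1) + eps by rewrite addr_gt0// mulr_gt0// ltr_wpDl.
have t0 : 0 < t by rewrite divr_gt0.
have t1 : t <= 1 by rewrite ler_pdivrMr// mul1r lerDr mulr_ge0// addr_ge0.
pose e := dl * t; have e0 : 0 < e by rewrite mulr_gt0.
have et : 2 * M * (e ^+ 2 / dl ^+ 2) <= eps / 8.
 have -> : e ^+ 2 / dl ^+ 2 = t ^+ 2 by rewrite /e exprMn mulrAC mulfV ?mul1r// expf_neq0// gt_eqF.
 apply: (@le_trans _ _ (2 * M * t)); first by rewrite ler_wpM2l ?mulr_ge0// expr2 ler_piMr// ltW.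
 rewrite /t mulrA ler_pdivrMr// -[leRHS]mulrAC.
 have : 0 <= eps * (2 + eps / 8) by rewrite mulr_ge0 ?addr_ge0// ?divr_ge0// ltW.
 lra.
pose b := 2 * M / K ^+ 2; pose a := w + 2 * M * (e ^+ 2 / dl ^+ 2).
have b0 : 0 <= b by rewrite divr_ge0 ?sqr_ge0// mulr_ge0.
have bK : b * (C + s2) <= eps / 4.
 rewrite /b mulrAC ler_pdivrMr ?exprn_gt0//.
 have KK : K <= K ^+ 2 by rewrite expr2 ler_peMr// ltW.
 have : 2 * M * (C + s2) <= eps / 4 * K.
 have -> : eps / 4 * K = 2 * M * (C + s2) + eps / 4.
 by rewrite /K; move: (C + s2) => X; field; rewrite gt_eqF.
 by rewrite lerDl divr_ge0// ltW.
 by move=> /le_trans; apply; rewrite ler_wpM2l// divr_ge0// ltW.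
have [g1 [g2 [g3 [D [sg d1 d2 d3 [D0 G1 G2 G3]]]]]] := heat_mollifier cf fM e0.
have hc := heat_close cf fM e K0 dl0 (ltW w0) hdl.
pose g := heat e f; pose l (y : R) := a + b * y ^+ 2.
have hl y : `|f y - g y| <= l y by rewrite distrC; exact: hc.
have T2 : `|gm (fun z => f (sqr s2 * z)) - gm (fun z => g (sqr s2 * z))| <= a + b * s2.
 have cs (k : R -> R) : continuous k -> continuous (fun z : R => k (sqr s2 * z)).
 move=> ck z; apply: (@continuous_comp _ _ _ (fun z => sqr s2 * z) k); last exact: ck.
 by cvg_scale.
 have -> : a + b * s2 = gm (fun z : R => a + b * s2 * z ^+ 2).
 rewrite gmeanD; [|exact: sm1_cst|by apply: sm1Z; apply: sm1X; exact: sm1_id].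
 by rewrite gm_cst gmeanZ ?gm_sqr ?mulr1//; apply: sm1X; exact: sm1_id.
 have ss : sm1 (fun z => g (0 + sqr s2 * z)) by exact: sm1_affine.
 have ss' : sm1 (fun z => g (sqr s2 * z)) by apply: sm1_ext ss => z; rewrite add0r.
 have sl : sm1 (fun z : R => a + b * s2 * z ^+ 2) by apply: sm1D; [exact: sm1_cst|apply: sm1Z; apply: sm1X; exact: sm1_id].
 apply: gm_dist.
 - exact: cs.
 - exact: sm1_cont ss'.
 - exact: sm1_cont sl.
 - exact: (egrowth_bounded (fun z => fM (sqr s2 * z))).
 - exact: sm1_eg ss'.
 - exact: sm1_eg sl.
 move=> z; have -> : b * s2 * z ^+ 2 = b * (sqr s2 * z) ^+ 2 by rewrite exprMn sqr_sqrtr ?mulrA// ltW.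
 exact: hl.
pose x := (eps / 4)^-1 * (C' * D).
near=> N.
have N0 : (0 < N)%N by near: N; exact: nbhs_infty_gt.
have NR : 0 < (N%:R : R) by rewrite ltr0n.
have T1 : `|meanY N f - meanY N g| <= a + b * C.
 apply: (le_trans (meanY_dist N hl)).
 have -> : meanY N l = a + b * (N%:R * AA h B q N 2).
 rewrite /meanY /AA.
 have -> : forall F : config N -> config N -> R, a + b * (N%:R * mean2 h B q F) = mean2 h B q (fun x y => 1 * (fun _ _ => a) x y + b * N%:R * F x y).
 by move=> F; rewrite mean2_lin mul1r mean2_cst mulrA.
 congr (mean2 _ _ _ _); apply/funext => x'; apply/funext => y'.
 by rewrite /l exprMn sqr_sqrtr ?ltW// mul1r real_normK ?num_real// mulrA.
 rewrite lerD2l ler_wpM2l// mulrC -ler_pdivlMr//; exact: hC.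
have T3 : `|meanY N g - gm (fun z => g (sqr s2 * z))| <= C' * D / sqr N%:R.
 exact: (hC' N N0 g g1 g2 g3 D sg d1 d2 d3 D0 G1 G2 G3).
have T4 : C' * D / sqr N%:R <= eps / 4.
 have sN : 0 < sqr N%:R :> R by rewrite sqrtr_gt0.
 rewrite ler_pdivrMr// -ler_pdivrMl ?divr_gt0// -/x.
 have x0 : 0 <= x by rewrite mulr_ge0 ?mulr_ge0// invr_ge0 divr_ge0// ltW.
 have xN : x ^+ 2 <= N%:R by near: N; exact: nbhs_infty_ger.
 apply: (@le_trans _ _ (sqr (x ^+ 2))); first by rewrite sqrtr_sqr ger0_norm.
 exact: ler_wsqrtr.
have aw : a <= eps / 4 by rewrite /a /w; move: et; lra.
have bK' : b * C + b * s2 <= eps / 4 by rewrite -mulrDr.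
exact: (dist_triangle3 T1 T2 T3 T4 bK' aw).
Unshelve. all: by end_near. Qed.
End SmoothCLT.

(** * Expectations of bounded random variables and rescaled normal laws *)

Section BoundedExpectation.
Context d (T : measurableType d) (R : realType) (mu : probability T R).
Implicit Types (f : T -> R).
Notation E f := (\int[mu]_w f w).

Lemma bounded_integrable f (M : R) : mfun f -> (forall w, `|f w| <= M) ->
 mu.-integrable setT (EFin \o f).
move=> mf fM; apply: measurable_bounded_integrable => //.
 exact: (le_lt_trans (probability_le1 mu measurableT) (ltry _)).
by exists M; split; [exact: num_real|move=> x Mx w _; exact: le_trans (fM w) (ltW Mx)].
Qed.

Lemma mean_cst (c : R) : E (fun=> c) = c.
have h : mu setT = 1%E := probability_setT mu.
by transitivity (c * fine (mu setT)); [exact: Rintegral_cst|rewrite h mulr1].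
Qed.
Lemma mean_indic (A : set T) : measurable A -> E (\1_A) = fine (mu A).
by move=> mA; rewrite /Rintegral integral_indic// setIT. Qed.
Lemma mean_sum (J : eqType) (s : seq J) (f : J -> T -> R) (M : J -> R) :
 (forall j, mfun (f j)) -> (forall j w, `|f j w| <= M j) ->
 E (fun w => \sum_(j <- s) f j w) = \sum_(j <- s) E (f j).
move=> mf fM; elim: s => [|j s IH].
 by under eq_Rintegral do rewrite big_nil; rewrite big_nil mean_cst.
under eq_Rintegral do rewrite big_cons; rewrite big_cons -IH.
apply: RintegralD => //; first exact: (bounded_integrable (mf j) (fM j)).
apply: (@bounded_integrable _ (\sum_(j <- s) M j)); first exact: measurable_sum.
by move=> w; apply: (le_trans (ler_norm_sum _ _ _)); apply: ler_sum.
Qed.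

Lemma mean_addr f (M c : R) : mfun f -> (forall w, `|f w| <= M) ->
 E (fun w => f w + c) = E f + c.
move=> mf fM; transitivity (E f + E (fun=> c)); last by rewrite mean_cst.
apply: RintegralD; [exact: measurableT|exact: bounded_integrable fM|].
by apply: (@bounded_integrable _ `|c|) => // w.
Qed.

Lemma mean_dct (fn : nat -> T -> R) f (M : R) : (forall n, mfun (fn n)) ->
 (forall n w, `|fn n w| <= M) -> (forall w, fn ^~ w @ \oo --> f w) ->
 (fun n => E (fn n)) @ \oo --> E f.
move=> mfn fnM fnf.
have mf : mfun f by apply: (measurable_fun_cvg mfn) => w _; exact: fnf.
have iM : mu.-integrable setT (EFin \o (fun _ : T => M)).
 by apply: (@bounded_integrable _ `|M|) => // w.
have cE : {ae mu, forall w, setT w -> (fun n => (fn n w)%:E) @ \oo --> (f w)%:E}.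
 by apply: aeW => w _; apply: cvg_EFin; [exact: nearW|exact: fnf].
have bE : {ae mu, forall w n, setT w -> (`|(fn n w)%:E| <= M%:E)%E}.
 by apply: aeW => w n _; rewrite lee_fin.
have mE n : mfun (fun w => (fn n w)%:E) by exact/measurable_EFinP.
have mE' : mfun (fun w => (f w)%:E) by exact/measurable_EFinP.
have [h1 _ h2] := @dominated_convergence _ _ _ mu setT measurableT (fun n w => (fn n w)%:E) (fun w => (f w)%:E) (fun w => M%:E)
 mE mE' cE iM bE.
apply: fine_cvg; rewrite fineK//; exact: integrable_fin_num h1.
Qed.
End BoundedExpectation.

Section NormalScale.
Context {R : realType}.
Notation mu := (@lebesgue_measure R).
Variable s : R.
Hypothesis s0 : 0 < s.

Let sn : s != 0. Proof. by rewrite gt_eqF. Qed.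
Let pdf_scale (x : R) : normal_pdf 0 s (s * x) * s = normal_pdf 0 1 x.
rewrite !normal_pdfE ?oner_neq0// /normal_peak /normal_fun !subr0 expr1n mul1r.
have -> : - (s * x) ^+ 2 / (s ^+ 2 *+ 2) = - x ^+ 2 / (1 *+ 2) by field.
rewrite mulrAC; congr (_ * _); rewrite -mulrnAr sqrtrM ?sqr_ge0// sqrtr_sqr gtr0_norm//.
by rewrite invfM mulrAC mulVf// mul1r.
Qed.
Let ge0_scale (f : R -> R) : continuous f -> (forall z, 0 <= f z) ->
 (\int[normal_prob (0:R) s]_x (f x)%:E = \int[normal_prob (0:R) 1]_x (f (s * x))%:E)%E.
move=> cf f0.
have cs : continuous (fun z : R => s * z) by move=> z; cvg_scale.
have cfs : continuous (fun z : R => f (s * z)).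
 by move=> z; apply: (@continuous_comp _ _ _ (fun z => s * z) f); [exact: cs|exact: cf].
rewrite (ge0_integral_normal 0 s f0 (cont_meas cf)).
rewrite (ge0_integral_gauss (fun z => f0 (s * z)) (cont_meas cfs)).
pose G (y : R) := f y * normal_pdf 0 s y.
have dF (x : R) : is_derive x 1 (fun x : R => s * x) s.
 by have := dZ s (is_derive_id x (1 : R)); apply: d_ext => //; rewrite mulr1.
have dFE : (fun x : R => s * x)^`()%classic = cst s.
 by apply/funext => x; rewrite derive1E; case: (dF x).
have h1 : {homo (fun x : R => s * x) : x y / x < y} by move=> x y xy; rewrite ltr_pM2l.
have h2 : continuous (fun x : R => s * x)^`()%classic by rewrite dFE => x; exact: cvg_cst.
have h3 : cvg ((fun x : R => s * x)^`()%classic x @[x --> -oo]) by rewrite dFE; exact: is_cvg_cst.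
have h4 : cvg ((fun x : R => s * x)^`()%classic x @[x --> +oo]) by rewrite dFE; exact: is_cvg_cst.
have h5 (x : R) : derivable (fun x : R => s * x) x 1 by case: (dF x).
have h6 : (fun x : R => s * x) x @[x --> -oo] --> -oo by exact: gt0_cvgMrNy s0 cvg_id.
have h7 : (fun x : R => s * x) x @[x --> +oo] --> +oo by exact: gt0_cvgMry s0 cvg_id.
have h8 : continuous G by move=> x; apply: cvgM; [exact: cf|exact: continuous_normal_pdf].
have h9 x : 0 <= G x by rewrite mulr_ge0// normal_pdf_ge0.
apply: (eq_trans (increasing_ge0_integration_by_substitutionT h1 h2 h3 h4 h5 h6 h7 h8 h9)).
by apply: eq_integral => x _; rewrite dFE /G /= !fctE /= -mulrA pdf_scale.
Qed.

(** Adding the bound [M] makes the integrand nonnegative, where the change of variables [ge0_scale]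
    applies. *)
Lemma normal_scale (f : R -> R) (M : R) : continuous f -> (forall x, `|f x| <= M) ->
 \int[normal_prob (0:R) s]_x f x = gm (fun z => f (s * z)).
move=> cf fM.
have cfs : continuous (fun z : R => f (s * z)).
 move=> z; apply: (@continuous_comp _ _ _ (fun z => s * z) f); last exact: cf.
 by cvg_scale.
have cD : continuous (fun x => f x + M) by move=> x; apply: cvgD; [exact: cf|exact: cvg_cst].
have D0 x : 0 <= f x + M by have := fM x; rewrite ler_norml => /andP[h _]; rewrite -lerBlDr sub0r.
have h := congr1 fine (ge0_scale cD D0).
have e1 := @mean_addr _ _ _ (normal_prob (0 : R) s) f M M (cont_meas cf) fM.
have e2 := @mean_addr _ _ _ (normal_prob (0 : R) 1) (fun x => f (s * x)) M M (cont_meas cfs) (fun x => fM (s * x)).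
apply: (addIr M); rewrite -[LHS]e1 -[RHS]e2; exact: h.
Qed.
End NormalScale.

Import HBSimple.

(** * Independent Gaussian variables as iterated Gaussian averages *)

Section Independence.
Context d (T : measurableType d) (R : realType) (mu : probability T R).
Variables (K I : finType) (g : K -> {RV mu >-> R}) (e : K -> I).
Hypothesis g_iid : iid_standard_normal g.
Notation V := (I + I -> R).
Notation E f := (\int[mu]_w f w).
Notation gamma := (normal_prob (0 : R) 1).

(** The environment after the listed coordinates have received their random values: the pointwise
    counterpart of the iterated average [P]. *)
Fixpoint pt (s : seq K) (w : T) (x : V) : V :=
 if s is k :: s' then pt s' w (push x (inl (e k)) (x (inr (e k)) * g k w)) else x.

Lemma cont_push (gam : R -> V) (c : R -> R) i : (forall k, continuous (gam ^~ k)) -> continuous c ->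
 forall k, continuous (fun t => push (gam t) i (c t) k).
move=> cg cc k t; rewrite /push; case: (k == i).
 by apply: cvgD; [exact: cg|exact: cc].
by apply: cvgD; [exact: cg|exact: cvg_cst].
Qed.

Lemma pt_cont s w (gam : R -> V) : (forall k, continuous (gam ^~ k)) ->
 forall k, continuous (fun t => pt s w (gam t) k).
elim: s gam => [//|k s IH] gam cg; apply: IH; apply: cont_push => // t.
by apply: cvgM; [exact: cg|exact: cvg_cst].
Qed.

(** Indicator of events on the coordinates of [J]. It carries through the induction the independence
    of the coordinates that have already been rounded. *)
Definition hit (J : {set K}) (B : K -> set R) (w : T) : R := \prod_(j in J) \1_(B j) (g j w).

Lemma hitE J B : hit J B = \1_(\bigcap_(i in [set i | i \in J]) (g i @^-1` B i)).
apply/funext => w; rewrite /hit indicE; case: (boolP (w \in _)) => [|].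
 by move=> /set_mem h; apply: big1 => j jJ; rewrite indicE mem_set//; exact: h.
move=> h; have : ~ (forall i, i \in J -> B i (g i w)) by move=> a; move/negP: h; apply; apply/mem_set => i; exact: a.
move=> /existsNP[j /not_implyP[jJ nB]]; rewrite (bigD1 j)//= indicE memNset//; exact: mul0r.
Qed.

Lemma measurable_hit J B : (forall k, measurable (B k)) -> mfun (hit J B).
move=> mB; rewrite hitE; apply: measurable_indic; apply: fin_bigcap_measurable.
 exact: finite_finset.
by move=> i _; rewrite -[X in measurable X]setTI; exact: measurable_funP.
Qed.
Lemma hit_le1 J B w : `|hit J B w| <= 1.
by rewrite hitE indicE; case: (_ \in _); rewrite ?normr1// normr0. Qed.
Lemma mean_hit J B : (forall k, measurable (B k)) -> E (hit J B) = \prod_(j in J) fine (gamma (B j)).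
move=> mB; have [hn hi] := g_iid; rewrite hitE mean_indic; last first.
 apply: fin_bigcap_measurable; first exact: finite_finset.
 by move=> i _; rewrite -[X in measurable X]setTI; exact: measurable_funP.
rewrite hi// (eq_bigr (fun j => (fine (gamma (B j)))%:E)) => [|j _]; last first.
 transitivity (gamma (B j)); first exact: (hn j (B j) (mB j)).
 apply/esym/fineK; rewrite fin_real//; apply/andP; split; first exact: (lt_le_trans (ltNyr 0) (measure_ge0 gamma _)).
 exact: (le_lt_trans (probability_le1 gamma (mB j)) (ltry _)).
by rewrite prodEFin.
Qed.

Lemma hit_add (J : {set K}) (B : K -> set R) (k : K) (A : set R) (w : T) : k \notin J ->
 hit (k |: J) (fun j => if j == k then A else B j) w = \1_A (g k w) * hit J B w.
move=> kJ; rewrite /hit big_setU1//= eqxx; congr (_ * _); apply: eq_bigr => j jJ.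
by rewrite (negbTE (memPn kJ j jJ)).
Qed.

Lemma sum_pick (s : seq R) (v : R) (F : R -> R) : uniq s -> v \in s ->
 F v = \sum_(y <- s) (v == y)%:R * F y.
move=> us vs; rewrite (bigD1_seq v)//= eqxx mul1r big1 ?addr0// => y yv.
by rewrite eq_sym (negbTE yv) mul0r.
Qed.

(* One coordinate at a time is rounded to finitely many values, which reduces
 its independence of the others to that of events. *)
Lemma mean_pt (F : V -> R) (M : R) : smooth F -> (forall x, `|F x| <= M) -> forall s, uniq s -> forall x,
 mfun (fun w => F (pt s w x)) /\
 forall (J : {set K}) (B : K -> set R), (forall k, measurable (B k)) -> (forall k, k \in s -> k \notin J) ->
 E (fun w => hit J B w * F (pt s w x)) = (\prod_(j in J) fine (gamma (B j))) * P [seq e k | k <- s] F x.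
move=> sF FM; elim => [_|k s IH /= /andP[ks us]] x.
 split=> [|J B mB _] /=; first exact: measurable_cst.
 under eq_Rintegral do rewrite mulrC.
 transitivity (F x * E (hit J B)); last by rewrite mean_hit// mulrC.
 apply: RintegralZl; first exact: measurableT.
 apply: (@bounded_integrable _ _ _ mu (hit J B) 1); first exact: measurable_hit.
 by move=> w; exact: hit_le1.
pose pu (y : R) := push x (inl (e k)) (x (inr (e k)) * y).
pose H (y : R) (w : T) := F (pt s w (pu y)).
have cpu (j : I + I) : continuous (fun y => pu y j).
 by apply: cont_push => [j' t|t]; [exact: cvg_cst|cvg_scale].
have cH w : continuous (H ^~ w).
 by move=> y; apply: (@smooth_continuous R I F _ (fun y => pt s w (pu y)) y sF) => j; exact: pt_cont.
have HM y w : `|H y w| <= M by exact: FM.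
have mH y : mfun (H y) by case: (IH us (pu y)).
pose h (y : R) := P [seq e k | k <- s] F (pu y).
have sP := smooth_P [seq e k | k <- s] sF.
have ch : continuous h.
 by move=> y; apply: (@smooth_continuous R I (P [seq e k | k <- s] F) _ pu y sP) => j; exact: cpu.
have hM y : `|h y| <= M.
 rewrite ler_norml /h; have Pc c := congr1 (fun f => f (pu y)) (P_cst (R := R) [seq e k | k <- s] c).
 rewrite -[X in X <= _ <= _]Pc -[X in _ <= _ <= X]Pc; apply/andP; split; apply: P_le; rewrite //; try exact: smooth_cst.
 by move=> z; have := FM z; rewrite ler_norml => /andP[].
 by move=> z; have := FM z; rewrite ler_norml => /andP[].
have mE : mfun (fun u : measurableTypeR R => u%:E) by exact/measurable_EFinP.
(* [rnd m] rounds a real number to one of finitely many values and tends pointwise to the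
   identity. *)
have [rnd hr] := approximation_sfun measurableT mE.
have cr u : rnd ^~ u @ \oo --> u by have := hr u Logic.I; exact: fine_cvg.
have hex (m : nat) : exists t : seq R, uniq t /\ forall u, rnd m u \in t.
 have /finite_seqP[t ht] := fimfunP (rnd m).
 exists (undup t); split; first exact: undup_uniq.
 by move=> u; rewrite mem_undup; have : range (rnd m) (rnd m u) by [exists u]; rewrite ht.
have [ys hy] := choice hex.
pose A m y : set R := rnd m @^-1` [set y].
have mr m : mfun (rnd m) by exact: measurable_funP.
have mA m y : measurable (A m y).
 by rewrite /A -[X in measurable X]setTI; exact: (mr m measurableT _ (measurable_set1 y)).
have iA m y u : \1_(A m y) u = (rnd m u == y)%:R :> R.
 rewrite indicE; congr (nat_of_bool _)%:R; apply/idP/eqP => [/set_mem//|hu]; exact: mem_set.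
have HE m w : H (rnd m (g k w)) w = \sum_(y <- ys m) \1_(A m y) (g k w) * H y w.
 have [u1 u2] := hy m; rewrite (sum_pick (fun y => H y w) u1 (u2 (g k w))).
 by apply: eq_bigr => y _; rewrite iA.
have mI m y : mfun (fun w => \1_(A m y) (g k w) : R).
 by apply: (measurableT_comp (measurable_indic (mA m y))); exact: measurable_funP.
have mHm m : mfun (fun w => H (rnd m (g k w)) w).
 under eq_fun do rewrite HE; apply: measurable_sum => y; exact: measurable_funM.
have cHm w : (fun m => H (rnd m (g k w)) w) @ \oo --> H (g k w) w.
 by apply: (@cvg_comp _ _ _ (fun m => rnd m (g k w)) (H ^~ w) _ _ _ (cr _)); exact: cH.
have mHg : mfun (fun w => H (g k w) w).
 by apply: (measurable_fun_cvg mHm) => w _; exact: cHm.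
split=> // J B mB hJ.
have kJ : k \notin J by apply: hJ; rewrite mem_head.
pose BB m y j := if j == k then A m y else B j.
have mBB m y j : measurable (BB m y j) by rewrite /BB; case: (j == k).
pose c := \prod_(j in J) fine (gamma (B j)).
(* Fixing the rounded value of coordinate [k] adds one event to those of [J], and the induction
   hypothesis applies to the enlarged set. *)
have EL m : E (fun w => hit J B w * H (rnd m (g k w)) w) = c * \int[gamma]_z h (rnd m z).
 have [u1 u2] := hy m.
 transitivity (\sum_(y <- ys m) E (fun w => hit (k |: J) (BB m y) w * H y w)).
 rewrite -(@mean_sum _ _ _ mu _ (ys m) (fun y w => hit (k |: J) (BB m y) w * H y w) (fun=> M)); first last.
 - by move=> y w; rewrite normrM -[M]mul1r; apply: ler_pM => //; exact: hit_le1.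
 - by move=> y; apply: measurable_funM => //; exact: measurable_hit.
 apply: eq_Rintegral => w _; rewrite HE mulr_sumr; apply: eq_bigr => y _.
 by rewrite hit_add// mulrA [hit J B w * _]mulrC.
 transitivity (\sum_(y <- ys m) c * (fine (gamma (A m y)) * h y)).
 apply: eq_bigr => y _; have [_ ->//] := IH us (pu y); last first.
 move=> j js; rewrite in_setU1 negb_or hJ ?in_cons ?js ?orbT// andbT.
 by apply: contraNneq ks => <-.
 rewrite big_setU1//= /BB eqxx -mulrA mulrCA; congr (_ * _).
 by apply: eq_bigr => j jJ; rewrite (negbTE (memPn kJ j jJ)).
 rewrite -mulr_sumr; congr (_ * _).
 transitivity (\int[gamma]_z (\sum_(y <- ys m) h y * \1_(A m y) z)); last first.
 apply: eq_Rintegral => z _; rewrite [RHS](sum_pick h u1 (u2 z)).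
 by apply: eq_bigr => y _; rewrite iA mulrC.
 have bI y (z : R) : `|\1_(A m y) z : R| <= 1 by rewrite iA; case: (_ == _); rewrite ?normr1 ?normr0.
 rewrite (@mean_sum _ _ _ gamma _ (ys m) (fun y z => h y * \1_(A m y) z) (fun y => `|h y|)).
 - apply: eq_bigr => y _; transitivity (h y * \int[gamma]_z \1_(A m y) z).
 by rewrite mulrC; congr (_ * _); apply/esym; exact: (@mean_indic _ _ _ gamma _ (mA m y)).
 apply/esym; apply: RintegralZl; first exact: measurableT.
 apply: (@bounded_integrable _ _ _ gamma (\1_(A m y)) 1); first exact: (measurable_indic (mA m y)).
 by move=> z; exact: bI.
 - by move=> y; apply: measurable_funM; [exact: measurable_cst|exact: (measurable_indic (mA m y))].
 by move=> y z; rewrite normrM ler_piMr.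
have L1 : (fun m => E (fun w => hit J B w * H (rnd m (g k w)) w)) @ \oo --> E (fun w => hit J B w * H (g k w) w).
 apply: (@mean_dct _ _ _ mu _ _ M).
 - by move=> m; apply: measurable_funM => //; exact: measurable_hit.
 - by move=> m w; rewrite normrM -[M]mul1r; apply: ler_pM => //; exact: hit_le1.
 by move=> w; apply: cvgM; [exact: cvg_cst|exact: cHm].
have L2 : (fun m => E (fun w => hit J B w * H (rnd m (g k w)) w)) @ \oo --> c * \int[gamma]_z h z.
 under eq_fun do rewrite EL; apply: cvgM; first exact: cvg_cst.
 apply: (@mean_dct _ _ _ gamma _ _ M) => //.
 - move=> m; apply: (measurableT_comp (cont_meas ch)); exact: measurable_funP.
 by move=> z; apply: (@cvg_comp _ _ _ (fun m => rnd m z) h _ _ _ (cr z)); exact: ch.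
exact: (cvg_unique _ L1 L2).
Qed.
End Independence.

(** * The averaged Gibbs measure of the statement as an iterated average *)

Section DisorderMean.
Context d (T : measurableType d) (R : realType) (mu : probability T R).
Variable N : nat.
Variable g : 'I_N * 'I_N -> {RV mu >-> R}.
Hypothesis g_iid : iid_standard_normal g.
Variables beta h q : R.
Hypothesis be0 : 0 < beta.

Lemma ptE (s : seq ('I_N * 'I_N)) w (x : Ix N + Ix N -> R) (j : Ix N) :
 pt g inl s w x (inl j) = x (inl j) + \sum_(k <- s) (x (inr (inl k)) * g k w) *+ (j == inl k).
elim: s x => [|k s IH] x; first by rewrite big_nil addr0.
rewrite /= IH big_cons addrA; congr (_ + _); apply: eq_bigr => k' _.
by rewrite pushNE.
Qed.
Let c := beta / sqr (2 * N%:R).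
Let x0 : Ix N + Ix N -> R := vec (At (beta ^+ 2) q 1).

Let x0_sk p : x0 (inr (inl p)) = c.
rewrite /x0 /vec /At /A1 /Av mul1r sqrtrM ?sqr_ge0// sqrtr_sqr gtr0_norm//.
by rewrite sqrtrV// mulr_ge0.
Qed.
Let x0_fld ik : x0 (inr (inr ik)) = 0.
by case: ik => i [[|[|[|k]]] hk]; rewrite /x0 /vec /At /A1 /Av/= ?subrr ?mul0r sqrtr0. Qed.
Let x0_inl k : x0 (inl k) = 0. Proof. by []. Qed.
Let ENr (w : T) (s : config N) : En (b1 h (N := N)) (@v1 R N) s (pt g inl (enum {: 'I_N * 'I_N}) w x0) =
 hamiltonian beta h (fun ij => g ij w) s.
rewrite /En /hamiltonian -/c addrC; congr (_ + _).
rewrite big_sumType/= [X in _ + X]big1 ?addr0 => [|ik _]; last first.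
 rewrite ptE x0_inl add0r big1 ?mulr0// => k _.
rewrite pair_big/= mulr_sumr; apply: eq_bigr => p _.
rewrite ptE x0_inl add0r (bigD1_seq p)/= ?mem_enum ?enum_uniq// eqxx mulr1n big1 => [|k kp]; last first.
 by rewrite (_ : (inl p == inl k :> Ix N) = (p == k))// eq_sym (negbTE kp).
by rewrite -[sqr _]/(x0 (inr (inl p))) x0_sk addr0; case: p => i j /=; move: (g _ _) (spin _ _ _) (spin _ _ _) (c) => a b b' c'; ring.
Qed.

Lemma gibbs_mean_pav (F : config N -> config N -> R) (w : T) :
 gibbs_mean beta h (fun ij => g ij w) (fun s : {ffun 'I_2 -> config N} => F (s ord0) (s ord_max)) =
 pav h F (pt g inl (enum {: 'I_N * 'I_N}) w x0).
set y := pt _ _ _ _ _.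
have wE s : gibbs_weight beta h (fun ij => g ij w) s = wt (@one1 R N) (b1 h (N := N)) (@v1 R N) s y.
 rewrite /gibbs_weight /wt /Zf /one1 mul1r ENr; congr (_ / _).
 by apply: eq_bigr => t _; rewrite mul1r ENr.
have ge1 := @one1_ge0 R N; have gt1 := @one1_gt0 R N.
transitivity (gibbs (@one1 R N) (b1 h (N := N)) (@v1 R N) (fun s : {ffun 'I_2 -> config N} => F (s ord0) (s ord_max)) y).
 by apply: eq_bigr => s _; congr (_ * _); apply: eq_bigr => l _; exact: wE.
rewrite /gibbs (gav_two (wt_sum _ _ ge1 gt1 y) F (m := ord0) (m' := ord_max))// /pav; apply: eq_bigr => s _; rewrite mulr_sumr.
by apply: eq_bigr => t _; rewrite mulrA.
Qed.

(** With no event imposed, [mean_pt] yields the iterated average over the couplings; the fields have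
    variance 0 at [t = 1], so averaging over them as well changes nothing. *)
Lemma nu1_mean2 (F : config N -> config N -> R) :
 nu1 beta h g (fun s : {ffun 'I_2 -> config N} => F (s ord0) (s ord_max)) = mean2 h (beta ^+ 2) q F.
pose M := \sum_s \sum_t `|F s t|.
have FM s t : `|F s t| <= M.
 rewrite /M (bigD1 s)//= (bigD1 t)//= -addrA lerDl addr_ge0// sumr_ge0// => s' _; exact: sumr_ge0.
have sP := smooth_pav h F.
have PM x : `|pav h F x| <= M.
 rewrite ler_norml -[in X in X <= _](pav_cst h (- M) x) -[in X in _ && X](pav_cst h M x).
 by apply/andP; split; apply: pav_le => s t; have := FM s t; rewrite ler_norml => /andP[].
have [_ hP] := @mean_pt _ _ _ mu _ (Ix N) g inl g_iid _ M sP PM (enum {: 'I_N * 'I_N}) (enum_uniq _) x0.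
have := hP finset.set0 (fun=> setT) (fun=> measurableT) (fun k _ => negbT (finset.in_set0 k)).
rewrite big_set0 mul1r => h1.
transitivity (\int[mu]_w (hit g finset.set0 (fun=> setT) w * pav h F (pt g inl (enum {: 'I_N * 'I_N}) w x0))).
 by apply: eq_Rintegral => w _; rewrite /hit big_set0 mul1r; exact: gibbs_mean_pav.
rewrite h1 /mean2 /so /si -catA -catA /P foldr_cat -/(P _ _).
pose Q (x : Ix N + Ix N -> R) := forall ik, x (inr (inr ik)) = 0.
apply: (@P_eq_on R _ (skL N) Q) => //.
- by move=> x i z _ hx ik; rewrite pushNE.
move=> x hx; apply/esym; apply: P_scale0 => k; rewrite !mem_cat => /or3P[] /mapP[i _ ->]; exact: hx.
Qed.
End DisorderMean.

Theorem theorem1p2 (R : realType) (K : set (R * R)) (K_compact : compact K)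
    (K_sub : K `<=` [set p : R * R |
       [/\ 0 < p.1, 0 < p.2 & alpha p.1 p.2 < 1]])
    (d : nat -> measure_display) (T : forall N, measurableType (d N))
    (P : forall N, probability (T N) R)
    (g : forall N, 'I_N * 'I_N -> {RV (P N) >-> R})
    (g_iid : forall N, iid_standard_normal (g N))
    (beta h : R) (K_beta_h : K (beta, h)) :
  0 < sigma2 beta h /\
  nu1_cvg_in_law beta h g
    (fun N s => Num.sqrt N%:R * (R12 R s - q beta h))
    (normal_prob 0 (Num.sqrt (sigma2 beta h))).
Proof.
have [/= be0 h0 al] := K_sub _ K_beta_h.
have s0 := sigma2_gt0 be0 h0 al; split=> // f cf [M [_ fM]].
(* Boundedness provides a bound by every number above [M]; [M + 1] is one of them. *)
have fM' x : `|f x| <= M + 1 by apply: fM => //; rewrite ltrDl.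
have [q0 q1] := q_range be0 h0; have [r01 rq _ _] := r_facts be0 h0.
have B0 : 0 < beta ^+ 2 by rewrite exprn_gt0.
have sg0 : 0 < Num.sqrt (sigma2 beta h) by rewrite sqrtr_gt0.
have H := @clt_bounded_continuous R h (beta ^+ 2) (q beta h) (r beta h) h0 B0 q0 q1
  (Eth2_q be0 h0) (Eth4_r be0 h0) (aT_q be0 h0 al) al r01 rq s0 f (M + 1) cf fM'.
rewrite (normal_scale sg0 cf fM').
have e N := nu1_mean2 (g_iid N) h (q beta h) be0 (fun a b => f (Num.sqrt N%:R * (overlap R a b - q beta h))).
by apply: cvg_trans H; apply: near_eq_cvg; apply: nearW => N; exact: (esym (e N)).
Qed.
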